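(* The $\mathbb{T}_{>0}$-algebra $\mathcal{M}$ has dimension $3$ and the $\mathbb{T}_{>0}$-algebra $\widetilde{\mathcal{M}}$ has dimension $5$. Moreover, $\widetilde{\mathcal{M}}=\mathcal{M}[E,\boldsymbol{E}]$.
   Context: Basic setting. Let $q=p^e$ be a power of a prime $p$, $A=\mathbb{F}_q[\theta]$, $K=\mathbb{F}_q(\theta)$, $|x|=q^{\deg_\theta x}$ on $K$, $K_\infty=\mathbb{F}_q((1/\theta))$, $C$ the completion of an algebraic closure of $K_\infty$. Let $\Omega=C\setminus K_\infty$ and $\Gamma=\mathbf{GL}_2(A)$ (determinant in $\mathbb{F}_q^*$), acting on $\Omega$ by $\gamma(z)=\frac{az+b}{cz+d}$. Let $e_{\mathrm{Car}}(z)=\sum_{i\ge0}z^{q^i}/d_i$ with $d_0=1$, $d_i=[i][i-1]^q\cdots[1]^{q^{i-1}}$, $[i]=\theta^{q^i}-\theta$ (Carlitz exponential); fix $\tilde\pi$ with $\ker e_{\mathrm{Car}}=\tilde\pi A$; put $u=u(z)=1/e_{\mathrm{Car}}(\tilde\pi z)$. A Drinfeld modular form of weight $w\ge 0$ and type $m\in\mathbb{Z}/(q-1)\mathbb{Z}$ is a rigid analytic $f:\Omega\to C$ with $f(\gamma(z))=(cz+d)^w(\det\gamma)^{-m}f(z)$ for all $\gamma=\begin{pmatrix}a&b\\c&d\end{pmatrix}\in\Gamma$, holomorphic at infinity (i.e. $A$-periodic and equal to a convergent series $\sum_{n\ge0}f_nu^n$ for $|u(z)|$ small). Classical forms. For $z\in\Omega$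 let $\Lambda_z=A+zA$ and $e_z=e_{\Lambda_z}$ its exponential function, $e_z(\zeta)=\zeta\prod_{0\ne\lambda\in\Lambda_z}(1-\zeta/\lambda)$. The associated Drinfeld module satisfies $\Phi_z(\theta)=\theta\tau^0+\tilde\pi^{q-1}g(z)\tau+\tilde\pi^{q^2-1}\Delta(z)\tau^2$ ($\tau:x\mapsto x^q$), which defines $g,\Delta$. The function $h$ is the unique Drinfeld modular form of weight $q+1$ and type $1$ with $u$-expansion $-u+\cdots$; one has $\Delta=-h^{q-1}$, and $h$ has no zeros on $\Omega$. The false Eisenstein series is $E(z)=\sum_{a\in A\text{ monic}}a\,u(az)$. Series. Let $t$ be an indeterminate; $\mathbb{T}_{>0}\subset C[[t]]$ is the $C$-algebra of series with positive convergence radius. For $f=\sum_i f_it^i\in C[[t]]$ and $k\in\mathbb{Z}$, $f^{(k)}=\sum_i f_i^{q^k}t^i$; for $\boldsymbol f:\Omega\to C[[t]]$, $\boldsymbol f^{(k)}(z)=\boldsymbol f(z)^{(k)}$, and $\boldsymbol f(z)$ is also written $\boldsymbol f(z,t)$. Put $$\boldsymbol s_{\mathrm{Car}}=\sum_{i\ge0}e_{\mathrm{Car}}(\tilde\pi/\theta^{i+1})t^i,\quad \boldsymbol s_1(z)=\sum_{i\ge0}e_z(z/\theta^{i+1})t^i,\quad \boldsymbol s_2(z)=\sum_{i\ge0}e_z(1/\theta^{i+1})t^i,$$ which are units in $\mathbb{T}_{>0}$. For $a=a(\theta)\in A$ write $\overline a=a(t)\in\mathbb{F}_q[t]$. For $\gamma=\begin{pmatrix}a&b\\c&d\end{pmatrix}\in\Gamma$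 and $z\in\Omega$ let $$J_\gamma=cz+d,\quad \boldsymbol J_\gamma=\overline c\,\frac{\boldsymbol s_1}{\boldsymbol s_2}+\overline d,\quad L_\gamma=\frac{c}{cz+d},\quad \boldsymbol L_\gamma=\frac{\overline c}{(\theta-t)(\overline c\,\boldsymbol s_1+\overline d\,\boldsymbol s_2)}.$$ Define $\boldsymbol h=\tilde\pi h\boldsymbol s_2/\boldsymbol s_{\mathrm{Car}}$ and $\boldsymbol E=\boldsymbol h^{(1)}/\Delta$. Regular functions. $\boldsymbol f:\Omega\to C[[t]]$ is regular if: (1) there is $r>0$ such that for all $z\in\Omega$ the series $\boldsymbol f(z,t)$ converges at all $t_0\in C$, $|t_0|<r$; (2) there is $\varepsilon>0$ such that for all $t_0\in C$ with $|t_0|<\varepsilon$, $z\mapsto\boldsymbol f(z,t_0)$ is holomorphic on $\Omega$; (3) $\boldsymbol f(z+a)=\boldsymbol f(z)$ for all $a\in A$, and there is $c>0$ such that for $|u(z)|<c$ and $|t|<c$ there is a convergent expansion $\boldsymbol f(z,t)=\sum_{n,m\ge0}c_{n,m}t^nu^m$, $c_{n,m}\in C$. The set $\boldsymbol{\mathcal O}$ of regular functions is a $\mathbb{T}_{>0}$-algebra. Almost-$A$-quasi-modular forms. A regular $\boldsymbol f$ is an almost-$A$-quasi-modular form of weight $(\mu,\nu)\in\mathbb{Z}^2$, type $m\in\mathbb{Z}/(q-1)\mathbb{Z}$ and depth $\le l$ ($l\geq 0$) if there are regular functions $\boldsymbol f_{i,j}$ ($i,j\ge 0$, $i+j\le l$)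 such that for all $\gamma\in\Gamma$, $z\in\Omega$, $$\boldsymbol f(\gamma(z),t)=\det(\gamma)^{-m}J_\gamma^\mu\boldsymbol J_\gamma^\nu\sum_{i+j\le l}\boldsymbol f_{i,j}L_\gamma^i\boldsymbol L_\gamma^j.$$ $\widetilde{\mathcal M}$ denotes the $\mathbb{T}_{>0}$-algebra generated by all almost-$A$-quasi-modular forms, and $\mathcal M$ its $\mathbb{T}_{>0}$-subalgebra generated by the almost-$A$-quasi-modular forms of depth $\le 0$. The dimension of such a $\mathbb{T}_{>0}$-algebra is the maximal number of elements algebraically independent over $\mathbb{T}_{>0}$. *)

(* Defs.v *)
From HB Require Import structures.
From mathcomp Require Import all_boot all_order all_algebra finmap ring lra.
From mathcomp Require Import all_classical all_reals all_analysis.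
From mathcomp.analysis.showcase Require Import summability.
From mathcomp Require Import (canonicals, coercions) multinomials.mpoly.

Set Implicit Arguments.
Unset Strict Implicit.
Unset Printing Implicit Defensive.

Import Order.TTheory GRing.Theory Num.Theory.
Local Open Scope classical_set_scope.
Local Open Scope ring_scope.

Record fps (K : Type) := Fps { fps_coef :> nat -> K }.

Lemma fpsP (K : Type) (f g : fps K) : (forall i, f i = g i) -> f = g.
Proof. by case: f g => f [g] /= fg; congr Fps; exact/funext. Qed.

HB.instance Definition _ (K : Type) := gen_eqMixin (fps K).
HB.instance Definition _ (K : Type) := gen_choiceMixin (fps K).

Section FpsRing.
Variable K : comNzRingType.
Implicit Types f g h : fps K.

Definition fps_const (c : K) : fps K := Fps (fun i => if i == 0%N then c else 0).
Definition fps_X : fps K := Fps (fun i => (i == 1%N)%:R).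

Definition fps_add f g : fps K := Fps (fun i => f i + g i).
Definition fps_opp f : fps K := Fps (fun i => - f i).
Definition fps_mul f g : fps K :=
  Fps (fun n => \sum_(i < n.+1) f i * g (n - i)%N).

Fact fps_addA : associative fps_add.
Proof. by move=> f g h; apply: fpsP => i /=; rewrite addrA. Qed.
Fact fps_addC : commutative fps_add.
Proof. by move=> f g; apply: fpsP => i /=; rewrite addrC. Qed.
Fact fps_add0 : left_id (fps_const 0) fps_add.
Proof. by move=> f; apply: fpsP => i /=; rewrite if_same add0r. Qed.
Fact fps_addN : left_inverse (fps_const 0) fps_opp fps_add.
Proof. by move=> f; apply: fpsP => i /=; rewrite if_same addNr. Qed.

HB.instance Definition _ :=
  GRing.isZmodule.Build (fps K) fps_addA fps_addC fps_add0 fps_addN.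

Let trunc n f : {poly K} := \poly_(i < n.+1) f i.

Let fps_mul_trunc n k f g : (k <= n)%N ->
  fps_mul f g k = (trunc n f * trunc n g)`_k.
Proof.
move=> kn; rewrite coefM /=; apply: eq_bigr => i _.
by rewrite !coef_poly !ltnS (leq_trans (leq_ord i) kn)
  (leq_trans (leq_subr _ _) kn).
Qed.

Fact fps_mulC : commutative fps_mul.
Proof.
by move=> f g; apply: fpsP => n; rewrite !(@fps_mul_trunc n n)// mulrC.
Qed.

Fact fps_mulA : associative fps_mul.
Proof.
move=> f g h; apply: fpsP => n; rewrite !(@fps_mul_trunc n n)//.
have trM p f1 f2 : (p * trunc n (fps_mul f1 f2))`_n =
    (p * (trunc n f1 * trunc n f2))`_n.
  rewrite !coefM; apply: eq_bigr => i _; congr (_ * _).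
  by rewrite coef_poly ltnS leq_subr (@fps_mul_trunc n)// leq_subr.
by rewrite trM [in RHS]mulrC trM [in RHS]mulrC mulrA.
Qed.

Fact fps_mul1 : left_id (fps_const 1) fps_mul.
Proof.
move=> f; apply: fpsP => n /=.
rewrite big_ord_recl /= mul1r subn0 big1 ?addr0// => i _.
by rewrite mul0r.
Qed.

Fact fps_mulDl : left_distributive fps_mul fps_add.
Proof.
move=> f g h; apply: fpsP => n /=; rewrite -big_split /=.
by apply: eq_bigr => i _; rewrite mulrDl.
Qed.

Fact fps_oner_neq0 : fps_const 1 != fps_const 0.
Proof. by apply/eqP => /(congr1 (fun f : fps K => f 0%N))/eqP; rewrite /= oner_eq0. Qed.

HB.instance Definition _ := GRing.Zmodule_isComNzRing.Build (fps K)
  fps_mulA fps_mulC fps_mul1 fps_mulDl fps_oner_neq0.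

Definition fps_unit : {pred fps K} := [pred f | `[< exists g, g * f = 1 >]].
Definition fps_inv f : fps K :=
  if f \in fps_unit then xget f [set g | g * f = 1] else f.

Fact fps_mulVf : {in fps_unit, left_inverse 1 fps_inv *%R}.
Proof.
move=> f uf; rewrite /fps_inv uf; case: xgetP => [g _ //|].
by move: uf; rewrite inE /= => -[g gf] /(_ g).
Qed.
Fact fps_unitPl f g : g * f = 1 -> f \in fps_unit.
Proof. by move=> gf; rewrite inE /=; exists g. Qed.
Fact fps_inv_out : {in [predC fps_unit], fps_inv =1 id}.
Proof. by move=> f /negbTE nuf; rewrite /fps_inv nuf. Qed.

HB.instance Definition _ := GRing.ComNzRing_hasMulInverse.Build (fps K)
  fps_mulVf fps_unitPl fps_inv_out.

End FpsRing.

(* The normed structures of the library require |x *+ n| = |x| *+ n, which fails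
   in positive characteristic; only the metric is taken from the library. *)
Record ultrametricField (R : realType) := UltrametricField {
  ufield : closedFieldType;
  ufield_abs : ufield -> R;
  ufield_abs_ge0 : forall x, 0 <= ufield_abs x;
  ufield_abs_eq0 : forall x, (ufield_abs x == 0) = (x == 0);
  ufield_absM : forall x y, ufield_abs (x * y) = ufield_abs x * ufield_abs y;
  ufield_abs_ultra : forall x y,
    ufield_abs (x + y) <= Num.max (ufield_abs x) (ufield_abs y)
}.

Definition ucar (R : realType) (C : ultrametricField R) : Type := ufield C.
Coercion ucar : ultrametricField >-> Sortclass.

HB.instance Definition _ (R : realType) (C : ultrametricField R) :=
  GRing.ClosedField.copy C (ufield C).

Section UltrametricTheory.
Variables (R : realType) (C : ultrametricField R).

Definition absv (x : C) : R := ufield_abs x.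

Lemma absv_ge0 (x : C) : 0 <= absv x.
Proof. exact: ufield_abs_ge0. Qed.
Lemma absv_eq0 (x : C) : (absv x == 0) = (x == 0).
Proof. exact: ufield_abs_eq0. Qed.
Lemma absvM (x y : C) : absv (x * y) = absv x * absv y.
Proof. exact: ufield_absM. Qed.
Lemma absv_ultra (x y : C) : absv (x + y) <= Num.max (absv x) (absv y).
Proof. exact: ufield_abs_ultra. Qed.

Lemma absv0 : absv 0 = 0.
Proof. by apply/eqP; rewrite absv_eq0. Qed.

Lemma absv1 : absv 1 = 1.
Proof.
have n0 : absv 1 != 0 by rewrite absv_eq0 oner_eq0.
by apply: (mulIf n0); rewrite -absvM !mul1r.
Qed.

Lemma absvN (x : C) : absv (- x) = absv x.
Proof.
have N1 : absv (-1) = 1.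
  apply/eqP; rewrite -(@eqrXn2 _ 2) ?absv_ge0// expr1n expr2 -absvM.
  by rewrite mulrNN mulr1 absv1.
by rewrite -mulN1r absvM N1 mul1r.
Qed.

Lemma absvV (x : C) : absv x^-1 = (absv x)^-1.
Proof.
have [->|x0] := eqVneq x 0; first by rewrite invr0 absv0 invr0.
have n0 : absv x != 0 by rewrite absv_eq0.
by apply: (mulIf n0); rewrite -absvM !mulVf// absv1.
Qed.

Definition udist (x y : C) : R := absv (x - y).

Fact udistxx (x : C) : udist x x = 0.
Proof. by rewrite /udist subrr absv0. Qed.
Fact udist_positivity (x y : C) : udist x y = 0 -> x = y.
Proof. by move=> /eqP; rewrite absv_eq0 subr_eq0 => /eqP. Qed.
Fact udist_sym (x y : C) : udist x y = udist y x.
Proof. by rewrite /udist -absvN opprB. Qed.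
Fact udist_triangle (y x z : C) : udist x z <= udist x y + udist y z.
Proof.
rewrite /udist -(subrKA y); apply: (le_trans (absv_ultra _ _)).
by rewrite ge_max lerDl lerDr !absv_ge0.
Qed.

HB.instance Definition _ := isMetric.Build R C
  udistxx udist_positivity udist_sym udist_triangle.
HB.instance Definition _ := isPointed.Build C 0.

End UltrametricTheory.

Section Subfields.
Variables (R : realType) (F : finFieldType) (C : ultrametricField R).
Variables (iota : {rmorphism F -> C}) (theta : C).

Definition polyev (a : {poly F}) : C := (map_poly iota a).[theta].

Definition ratfun : set C :=
  [set x | exists a b : {poly F}, polyev b != 0 /\ x = polyev a / polyev b].

(* F_q((1/theta)) as the completion of F_q(theta), taken inside the complete
   field C *)
Definition Kinfty : set C := closure ratfun.

Lemma polyevD : {morph polyev : a b / a + b}.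
Proof. by move=> a b; rewrite /polyev rmorphD hornerD. Qed.
Lemma polyevM : {morph polyev : a b / a * b}.
Proof. by move=> a b; rewrite /polyev rmorphM hornerM. Qed.
Lemma polyevN : {morph polyev : a / - a}.
Proof. by move=> a; rewrite /polyev rmorphN hornerN. Qed.
Lemma polyev1 : polyev 1 = 1.
Proof. by rewrite /polyev rmorph1 hornerE. Qed.

Lemma KinftyP (x : C) :
  Kinfty x <-> forall e : R, 0 < e -> exists2 k, ratfun k & absv (x - k) < e.
Proof.
split=> [xK e e0|xK V /nbhs_ballP[e /= e0 eV]].
  have [k [kr]] := xK _ (nbhsx_ballx x _ e0).
  by rewrite ballEmdist /= => xk; exists k.
by have [k kr xk] := xK e e0; exists k; split=> //; apply: eV; rewrite ballEmdist.
Qed.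

Lemma ratfun_Kinfty : ratfun `<=` Kinfty.
Proof. exact: subset_closure. Qed.

Lemma ratfun_frac (a b c d : {poly F}) (k : C) :
  ratfun k -> polyev c * k + polyev d != 0 ->
  ratfun ((polyev a * k + polyev b) / (polyev c * k + polyev d)).
Proof.
move=> [m [n [n0 ->]]] cd0; exists (a * m + b * n), (c * m + d * n).
have E x y : polyev (x * m + y * n) =
    (polyev x * (polyev m / polyev n) + polyev y) * polyev n.
  by rewrite polyevD !polyevM mulrDl -!mulrA mulVf// mulr1.
by rewrite !E mulf_neq0//; split=> //; rewrite -mulf_div divff// mulr1.
Qed.

Definition algebraic_over (k : set C) : set C :=
  [set x | exists p : {poly C}, [/\ p != 0, forall i, k p`_i & root p x]].

End Subfields.

(* The last field says that elements algebraic over F_q((1/theta)) are dense, so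
   that [Cinf] is the completion of an algebraic closure of F_q((1/theta)).  As
   the absolute value is ultrametric, hence trivial on F_q, [abs_theta] gives
   |a| = q ^ deg a on F_q[theta]. *)
Record setting (R : realType) (F : finFieldType) := Setting {
  Cinf : ultrametricField R;
  Cinf_complete : forall G : set_system Cinf,
    ProperFilter G -> cauchy G -> cvg G;
  iota : {rmorphism F -> Cinf};
  theta : Cinf;
  abs_theta : absv theta = #|F|%:R;
  dense_alg : dense (algebraic_over (Kinfty iota theta))
}.

Lemma det_mx22E (K : comNzRingType) (g : 'M[K]_2) :
  \det g = g 0 0 * g 1 1 - g 0 1 * g 1 0.
Proof.
rewrite (expand_det_row _ 0) !big_ord_recl big_ord0 /cofactor !det_mx11 !mxE.
have -> : lift 0 0 = 1 :> 'I_2 by exact: val_inj.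
have -> : lift 1 0 = 0 :> 'I_2 by exact: val_inj.
by rewrite /= !(expr0, expr1) addr0 mul1r mulN1r mulrN.
Qed.

Section Subfields2.
Variables (R : realType) (F : finFieldType) (C : ultrametricField R).
Variables (iota : {rmorphism F -> C}) (theta : C).
Local Notation ev := (polyev iota theta).
Local Notation Kinf := (Kinfty iota theta).

Lemma Kinfty_frac (a b c d : {poly F}) (z : C) :
  a * d - b * c \is a GRing.unit -> ~ Kinf z ->
  ~ Kinf ((ev a * z + ev b) / (ev c * z + ev d)).
Proof.
move=> detu zK wK; apply: zK.
have det0 : ev a * ev d - ev b * ev c != 0.
  have : ev ((a * d - b * c) * (a * d - b * c)^-1) != 0.
    by rewrite divrr// polyev1 oner_neq0.
  by rewrite polyevM mulf_eq0 negb_or polyevD polyevN !polyevM => /andP[].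
have [J0|J0] := eqVneq (ev c * z + ev d) 0.
  have c0 : ev c != 0.
    apply: contraNneq det0 => c0; move: J0; rewrite c0 mul0r add0r => ->.
    by rewrite !mulr0 subrr.
  apply: ratfun_Kinfty; exists (- d), c; split=> //.
  by apply: (mulIf c0); rewrite mulfVK// polyevN mulrC; apply/eqP;
    rewrite -addr_eq0 J0.
set w := _ / _ in wK; set m := ev a - ev c * w.
have mJ : m * (ev c * z + ev d) = ev a * ev d - ev b * ev c.
  by rewrite /m /w; field.
have m0 : m != 0 by apply: contraNneq det0 => m0; rewrite -mJ m0 mul0r.
have zE : z = (ev d * w - ev b) / m.
  by apply: (mulIf m0); rewrite mulfVK// /m /w; field.
have absm : 0 < absv m by rewrite lt_def absv_ge0 absv_eq0 m0.
have absd : 0 < absv (ev a * ev d - ev b * ev c).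
  by rewrite lt_def absv_ge0 absv_eq0 det0.
have absc : 0 < absv (ev c) + 1 by rewrite ltr_wpDl ?absv_ge0.
apply/KinftyP => e e0.
set D := absv (_ - _) in absd.
have /KinftyP/(_ (Num.min (absv m / (absv (ev c) + 1))
                          (e * absv m ^+ 2 / D)))[] := wK.
  by rewrite lt_min !divr_gt0// mulr_gt0// exprn_gt0.
move=> k kr; rewrite lt_min !ltr_pdivlMr// => /andP[wk1 wk2].
set n := ev a - ev c * k.
have cwk : absv (ev c * (w - k)) < absv m.
  rewrite absvM mulrC (le_lt_trans _ wk1)// ler_wpM2l ?absv_ge0//.
  by rewrite lerDl.
have mn : absv m <= absv n.
  rewrite leNgt; apply/negP => nm.
  have : absv m <= Num.max (absv n) (absv (- (ev c * (w - k)))).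
    by apply: le_trans (absv_ultra _ _); rewrite /m /n mulrBr opprB subrKA.
  by rewrite absvN leNgt gt_max nm cwk.
have n0 : n != 0 by rewrite -absv_eq0 gt_eqF// (lt_le_trans absm).
exists ((ev d * k - ev b) / n).
  have := @ratfun_frac _ _ _ iota theta d (- b) (- c) a k kr.
  by rewrite !polyevN mulNr [- _ + ev a]addrC; apply.
have -> : z - (ev d * k - ev b) / n =
    (ev a * ev d - ev b * ev c) * (w - k) / (m * n).
  rewrite zE -mulNr addf_div//; congr (_ / _); rewrite /n /m; ring.
rewrite absvM absvV !absvM -/D ltr_pdivrMr; last first.
  by rewrite mulr_gt0// (lt_le_trans absm).
rewrite mulrC (lt_le_trans wk2)// expr2 ler_wpM2l ?(ltW e0)//.
by rewrite ler_wpM2l// ltW.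
Qed.

End Subfields2.

Section DrinfeldForms.
Variables (R : realType) (F : finFieldType) (S : setting R F).

Notation q := #|F|.
Notation A := {poly F}.
Notation C := (Cinf S).
Notation th := (theta S).
Notation ev := (polyev (iota S) th).
Notation Kinf := (Kinfty (iota S) th).

Definition Omega : set C := ~` Kinf.

Definition unordered_prod (I : choiceType) (a : I -> C) : C :=
  lim ((fun X : {fset I} => \prod_(i : X) a (val i)) @ totally).

Definition unordered_sum (I : choiceType) (a : I -> C) : C :=
  lim (partial_sum a @ totally).

(* The standard admissible covering of Omega; K_infty is locally compact, so each
   [affinoid n] is P^1 minus finitely many open discs, and its analytic functions
   are the uniform limits of rational functions without poles on it. *)
Definition affinoid (n : nat) : set C :=
  [set z | absv z <= q%:R ^+ n /\
           forall x, Kinf x -> q%:R ^- n <= absv (z - x)].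

Definition rigid_analytic (f : Omega -> C) : Prop :=
  forall (n : nat) (e : R), 0 < e -> exists p d : {poly C},
    forall z : Omega, affinoid n (val z) ->
      d.[val z] != 0 /\ absv (f z - p.[val z] / d.[val z]) < e.

Definition carlitz_bracket (i : nat) : C := th ^+ (q ^ i) - th.

Definition carlitz_d (i : nat) : C :=
  \prod_(j < i) carlitz_bracket (i - j) ^+ (q ^ j).

Definition e_Car (z : C) : C :=
  limn (series (fun i => z ^+ (q ^ i) / carlitz_d i)).

Definition carlitz_period (pi : C) : Prop :=
  forall z, e_Car z = 0 <-> exists a : A, z = pi * ev a.

Definition e_lattice (z zeta : C) : C :=
  zeta * unordered_prod (fun l : {l : A * A | l != 0} =>
    1 - zeta / (ev (val l).1 + z * ev (val l).2)).

Notation GL2 := [set g : 'M[A]_2 | g \in unitmx].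

Definition J (g : 'M[A]_2) (z : C) : C := ev (g 1 0) * z + ev (g 1 1).

Definition mobius_C (g : 'M[A]_2) (z : C) : C :=
  (ev (g 0 0) * z + ev (g 0 1)) / J g z.

Definition mobius (g : 'M[A]_2) (z : Omega) : Omega :=
  insubd z (mobius_C g (val z)).

Definition translate (a : A) (z : Omega) : Omega := insubd z (val z + ev a).

Lemma val_mobius (g : 'M[A]_2) (z : Omega) :
  g \in unitmx -> val (mobius g z) = mobius_C g (val z).
Proof.
move=> gu; rewrite val_insubd; case: ifPn => // /negP[]; apply/mem_set.
apply: Kinfty_frac (set_valP z : ~ Kinf (val z)).
by rewrite -det_mx22E.
Qed.

Lemma val_translate (a : A) (z : Omega) : val (translate a z) = val z + ev a.
Proof.
rewrite val_insubd; case: ifPn => // /negP[]; apply/mem_set.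
have := @Kinfty_frac _ _ _ (iota S) th 1 a 0 1 (val z).
rewrite mulr0 subr0 mulr1 unitr1 => /(_ isT (set_valP z)).
have -> : ev 0 = 0 by rewrite /polyev rmorph0 horner0.
by rewrite polyev1 mul1r mul0r add0r divr1.
Qed.

Definition detC (g : 'M[A]_2) : C := ev (\det g).

Definition L (g : 'M[A]_2) (z : C) : C := ev (g 1 0) / J g z.

Definition twist (f : fps C) : fps C := Fps (fun i => f i ^+ q).

(* a(t) for a = a(theta) *)
Definition bar (a : A) : fps C := Fps (fun i => iota S a`_i).

Definition s_1 (z : C) : fps C := Fps (fun i => e_lattice z (z / th ^+ i.+1)).
Definition s_2 (z : C) : fps C := Fps (fun i => e_lattice z (1 / th ^+ i.+1)).

Definition bJ (g : 'M[A]_2) (z : C) : fps C :=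
  bar (g 1 0) * (s_1 z / s_2 z) + bar (g 1 1).

Definition bL (g : 'M[A]_2) (z : C) : fps C :=
  bar (g 1 0) / ((fps_const th - fps_X _) *
                 (bar (g 1 0) * s_1 z + bar (g 1 1) * s_2 z)).

Definition fps_terms (f : fps C) (t0 : C) : nat -> C := fun i => f i * t0 ^+ i.
Definition fps_cvg (f : fps C) (t0 : C) : Prop := cvgn (series (fps_terms f t0)).
Definition fps_eval (f : fps C) (t0 : C) : C := limn (series (fps_terms f t0)).

Definition Tpos : set (fps C) :=
  [set f | exists2 r : R, 0 < r & forall t0, absv t0 < r -> fps_cvg f t0].

Definition subTalg (B : set (Omega -> fps C)) : Prop :=
  [/\ forall c, Tpos c -> B (cst c),
      forall f g, B f -> B g -> B (f + g)
    & forall f g, B f -> B g -> B (f * g)].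

(* The T_{>0}-subalgebra of the ring of functions Omega -> C[[t]] generated
   by G *)
Definition Talg (G : set (Omega -> fps C)) : set (Omega -> fps C) :=
  smallest subTalg G.

Definition alg_indep (n : nat) (x : 'I_n -> (Omega -> fps C)) : Prop :=
  forall P : mpoly.mpoly n (fps C),
    (forall m, Tpos (mpoly.mcoeff m P)) ->
    (forall z, mpoly.meval (fun i => x i z) P = 0) -> P = 0.

Definition has_dim (B : set (Omega -> fps C)) (d : nat) : Prop :=
  (exists x : 'I_d -> (Omega -> fps C), (forall i, B (x i)) /\ alg_indep x) /\
  (forall (n : nat) (x : 'I_n -> (Omega -> fps C)),
     (forall i, B (x i)) -> alg_indep x -> (n <= d)%N).

Variable pi : C.

Definition u (z : C) : C := 1 / e_Car (pi * z).

Definition u_expansion (f : Omega -> C) (a : nat -> C) : Prop :=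
  exists2 c : R, 0 < c & forall z : Omega, absv (u (val z)) < c ->
    series (fun n => a n * u (val z) ^+ n) @ \oo --> f z.

(* The type m in Z/(q-1)Z is given by any integer representative, since
   det g is a nonzero element of F_q. *)
Definition modular_form (w : nat) (m : int) (f : Omega -> C) : Prop :=
  [/\ rigid_analytic f,
      forall g, GL2 g -> forall z : Omega,
        f (mobius g z) = J g (val z) ^+ w * detC g ^ (- m) * f z,
      forall (a : A) z, f (translate a z) = f z
    & exists a, u_expansion f a].

Definition is_h (h : Omega -> C) : Prop :=
  modular_form q.+1 1 h /\
  exists a, [/\ u_expansion h a, a 0%N = 0 & a 1%N = -1].

(* [e_lattice z] intertwines multiplication by theta with Phi_z(theta). *)
Definition drinfeld_coeffs (g Delta : Omega -> C) : Prop :=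
  forall (z : Omega) (zeta : C), let e := e_lattice (val z) in
    e (th * zeta) = th * e zeta + pi ^+ q.-1 * g z * e zeta ^+ q
                    + pi ^+ (q ^ 2).-1 * Delta z * e zeta ^+ (q ^ 2).

Definition s_Car : fps C := Fps (fun i => e_Car (pi / th ^+ i.+1)).

Definition false_eisenstein (z : Omega) : C :=
  unordered_sum (fun a : {a : A | a \is monic} =>
    ev (val a) * u (ev (val a) * val z)).

Definition bh (h : Omega -> C) (z : Omega) : fps C :=
  fps_const (pi * h z) * s_2 (val z) / s_Car.

Definition bE (h Delta : Omega -> C) (z : Omega) : fps C :=
  twist (bh h z) / fps_const (Delta z).

Definition regular (f : Omega -> fps C) : Prop :=
  [/\ exists2 r : R, 0 < r &
        forall (z : Omega) t0, absv t0 < r -> fps_cvg (f z) t0,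
      exists2 e : R, 0 < e &
        forall t0, absv t0 < e -> rigid_analytic (fun z => fps_eval (f z) t0),
      forall (a : A) z, f (translate a z) = f z
    & exists2 c : R, 0 < c & exists k : nat -> nat -> C,
        forall (z : Omega) t0, absv (u (val z)) < c -> absv t0 < c ->
          partial_sum (fun nm : nat * nat =>
              k nm.1 nm.2 * t0 ^+ nm.1 * u (val z) ^+ nm.2) @ totally
            --> fps_eval (f z) t0].

Definition almost_quasi_modular (mu nu m : int) (l : nat)
    (f : Omega -> fps C) : Prop :=
  regular f /\
  exists fij : nat -> nat -> (Omega -> fps C),
    (forall i j, (i + j <= l)%N -> regular (fij i j)) /\
    forall g, GL2 g -> forall z : Omega,
      f (mobius g z) =
        fps_const (detC g ^ (- m) * J g (val z) ^ mu) * bJ g (val z) ^ nu *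
        \sum_(i < l.+1) \sum_(j < l.+1 | (i + j <= l)%N)
          fij i j z * fps_const (L g (val z) ^+ i) * bL g (val z) ^+ j.

Definition Mtilde_alg : set (Omega -> fps C) :=
  Talg [set f | exists mu nu m l, almost_quasi_modular mu nu m l f].

Definition Malg : set (Omega -> fps C) :=
  Talg [set f | exists mu nu m, almost_quasi_modular mu nu m 0 f].

End DrinfeldForms.

Arguments Omega {R F} S.

(* Main.v *)
(** The values of E and bE at gamma z are affine
    in L_gamma and bL_gamma.  Comparing the two expansions of f(gamma delta z) as
    polynomials in L_gamma, bL_gamma (which take Zariski-dense values) shows that the
    top coefficients f_ij, i + j = l, of a form of depth l are themselves forms of depth 0;
    subtracting sum f_ij E^i bE^j lowers the depth, whence Mtilde = M[E, bE].

    The functions g, h, s_2, E, bE (weights (q-1,0), (q+1,0), (-1,1), (2,0), (1,1)) are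
    independent over T_{>0}: in a relation, evaluated at gamma z with J_gamma = z + theta^n,
    the extreme exponents of 1/J_gamma and bL_gamma isolate one weight, then one monomial
    in E and bE, and the powers of h are separated by their order of vanishing at the cusp.

    Conversely a form of weight (mu, nu) and depth 0 whose u-order exceeds |mu| + |nu| is
    zero.  So elements sum f_ij E^i bE^j with weights bounded by B and i, j <= D impose
    O(B^3 D^2) linear conditions over the domain T_{>0}, while n elements of an algebra
    have about T^n monomials of degree <= T, with B and D proportional to T: as soon as n > 5
    (n > 3 when D = 0) a linear dependence between monomials exists.

    The analytic input is a Liouville theorem: a rigid analytic function on Omega that is
    bounded is constant.  Applied to h times the Moore determinant
    s_1 s_2^(1) - s_2 s_1^(1) it shows that this product is constant in z, from which follow
    the non-vanishing of h, Delta = const * h^(q-1), the formula for bE and its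
    transformation law.  The law of E comes from Eisenstein's double sum, whose two
    orders of summation are exchanged by z -> 1/z, and the Euclidean algorithm in A. *)
From HB Require Import structures.
From Pilot Require Import Defs.
From mathcomp Require Import all_boot all_order all_algebra finmap ring lra zify.
From mathcomp Require Import all_classical all_reals all_analysis.
From mathcomp.analysis.showcase Require Import summability.
From mathcomp Require Import finfield.
From mathcomp Require Import (canonicals) mpoly.
Import Pilot.Defs.
Set Implicit Arguments.
Unset Strict Implicit.
Unset Printing Implicit Defensive.
Import Order.TTheory GRing.Theory Num.Theory numFieldNormedType.Exports.
Local Open Scope classical_set_scope.
Local Open Scope ring_scope.

(** * Ultrametric convergence *)

(** Values of forms are power series in [t], while rigid analysis and Liouville's theorem concern
    functions with values in C. So estimates are made for one coefficient, or at one small value of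
    [t], and an identity of series is recovered from its values at arbitrarily small [t]. The
    obstacle is bold J, which is not controlled over the whole group. What saves the estimates is
    that every point of Omega is equivalent under SL_2(A) to some w with |w| >= 1 lying at distance
    |w| from K_infty. There the coefficients of s_2 have known absolute values, those of s_1 are at
    most |e_A(w)|, and |e_A(w)| = 1/|pi u(w)|. Hence bold J costs a power of 1/|u| that does not
    depend on the group element, and a zero at the cusp of sufficient order pays for it; this is the
    origin of the bound |mu| + |nu|. Counting conditions in this way replaces a description of M by
    generators. Convergence is always uniform on affinoids, with geometric rate 1/q, so that limits
    of finite sums and products stay rigid analytic. *)

Section Ultrametric.
Variables (R : realType) (C : ultrametricField R).
Implicit Types (x y z : C) (a b : nat -> C) (e M B : R).

Lemma absv_gt0 x : (0 < absv x) = (x != 0).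
Proof. by rewrite lt_def absv_ge0 absv_eq0 andbT. Qed.

Lemma absvX x n : absv (x ^+ n) = absv x ^+ n.
Proof. by elim: n => [|n IH]; rewrite ?expr0 ?absv1// !exprS absvM IH. Qed.

Lemma absv_prod (I : Type) (r : seq I) (P : pred I) (f : I -> C) :
  absv (\prod_(i <- r | P i) f i) = \prod_(i <- r | P i) absv (f i).
Proof. exact: (big_morph _ (@absvM _ _) (@absv1 _ _)). Qed.

Lemma absv_div x y : absv (x / y) = absv x / absv y.
Proof. by rewrite absvM absvV. Qed.

Lemma absvD_le M x y : absv x <= M -> absv y <= M -> absv (x + y) <= M.
Proof. by move=> xM yM; rewrite (le_trans (absv_ultra _ _))// ge_max xM. Qed.

Lemma absvB_le M x y : absv x <= M -> absv y <= M -> absv (x - y) <= M.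
Proof. by move=> xM yM; rewrite absvD_le// absvN. Qed.

Lemma absvD_lt M x y : absv x < M -> absv y < M -> absv (x + y) < M.
Proof. by move=> xM yM; rewrite (le_lt_trans (absv_ultra _ _))// gt_max xM. Qed.

Lemma absvB_lt M x y : absv x < M -> absv y < M -> absv (x - y) < M.
Proof. by move=> xM yM; rewrite absvD_lt// absvN. Qed.

Lemma absv_subC x y : absv (x - y) = absv (y - x).
Proof. by rewrite -absvN opprB. Qed.

Lemma absvDr x y : absv x < absv y -> absv (x + y) = absv y.
Proof.
move=> xy; apply/eqP; rewrite eq_le absvD_le// ?(ltW xy)//= leNgt.
apply/negP => h; have := @absvB_lt (absv y) (x + y) x h xy.
by rewrite addrC addKr ltxx.
Qed.

Lemma absvDl x y : absv y < absv x -> absv (x + y) = absv x.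
Proof. by move=> xy; rewrite addrC absvDr. Qed.

Lemma absvBr x y : absv x < absv y -> absv (x - y) = absv y.
Proof. by move=> xy; rewrite absvDr absvN. Qed.

Lemma absvBl x y : absv y < absv x -> absv (x - y) = absv x.
Proof. by move=> xy; rewrite absvDl ?absvN. Qed.

Lemma absv_near x y : absv (x - y) < absv y -> absv x = absv y.
Proof. by move=> h; rewrite -[x in LHS](subrK y) absvDr. Qed.

Lemma absv_sum_le M (I : Type) (r : seq I) (P : pred I) (f : I -> C) :
  0 <= M -> (forall i, P i -> absv (f i) <= M) ->
  absv (\sum_(i <- r | P i) f i) <= M.
Proof.
move=> M0 H; elim/big_ind: _ => [|x y|//]; first by rewrite absv0.
exact: absvD_le.
Qed.

Lemma absv_sum_lt M (I : Type) (r : seq I) (P : pred I) (f : I -> C) :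
  0 < M -> (forall i, P i -> absv (f i) < M) ->
  absv (\sum_(i <- r | P i) f i) < M.
Proof.
move=> M0 H; elim/big_ind: _ => [|x y|//]; first by rewrite absv0.
exact: absvD_lt.
Qed.

Lemma absv_unity x n : (0 < n)%N -> x ^+ n = 1 -> absv x = 1.
Proof.
move=> n0 xn; apply/eqP; rewrite -(@eqrXn2 _ n) ?absv_ge0//.
by rewrite -absvX xn absv1 expr1n.
Qed.

(** Convergence in epsilon form, to which the ultrametric inequality applies directly; [lims_cvg] is
    the link with the filters used in the definitions. *)
Definition lims a (l : C) :=
  forall e, 0 < e -> exists N, forall n, (N <= n)%N -> absv (a n - l) < e.

Lemma lims_cvg a l : lims a l <-> a @ \oo --> l.
Proof.
rewrite cvg_ballP; split=> [al e e0|al e e0].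
  have [N NP] := al e e0; exists N => // n /= Nn.
  by rewrite ballEmdist/= /mdist/= /udist absv_subC; apply: NP.
have [N _ NP] := al e e0; exists N => n Nn.
by have := NP n Nn; rewrite /= ballEmdist/= /mdist/= /udist absv_subC.
Qed.

Lemma lims_limn a l : lims a l -> limn a = l.
Proof. by move=> /lims_cvg al; apply: cvg_lim => //; exact: metric_hausdorff. Qed.

Lemma lims_unique a l1 l2 : lims a l1 -> lims a l2 -> l1 = l2.
Proof. by move=> /lims_limn<- /lims_limn. Qed.

Lemma lims_cst l : lims (fun=> l) l.
Proof. by move=> e e0; exists 0%N => n _; rewrite subrr absv0. Qed.

Lemma lims_eq N b a l : (forall n, (N <= n)%N -> a n = b n) -> lims a l -> lims b l.
Proof.
move=> ab al e /al[N1 H]; exists (maxn N N1) => n; rewrite geq_max => /andP[h1 h2].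
by rewrite -ab//; apply: H.
Qed.

Lemma lims_ext b a l : a =1 b -> lims a l -> lims b l.
Proof. by move=> ab; apply: (@lims_eq 0) => n _. Qed.

Lemma lims_close b a l : lims a l ->
  (forall e, 0 < e -> exists N, forall n, (N <= n)%N -> absv (b n - a n) < e) -> lims b l.
Proof.
move=> al ba e e0; have [N1 H1] := al e e0; have [N2 H2] := ba e e0.
exists (maxn N1 N2) => n; rewrite geq_max => /andP[h1 h2].
by rewrite -(subrKA (a n)); apply: absvD_lt; [apply: H2|apply: H1].
Qed.

Lemma lims_sub (s : nat -> nat) a l : (forall n, (n <= s n)%N) -> lims a l ->
  lims (fun n => a (s n)) l.
Proof.
move=> hs al e /al[N H]; exists N => n Nn; apply: H; exact: leq_trans (hs n).
Qed.

Lemma limsS a l : lims (fun n => a n.+1) l -> lims a l.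
Proof.
by move=> al e /al[N H]; exists N.+1 => -[//|n] Nn; apply: H.
Qed.

Lemma lims_le N B a l : lims a l -> (forall n, (N <= n)%N -> absv (a n) <= B) -> absv l <= B.
Proof.
move=> al aB; rewrite leNgt; apply/negP => Bl.
have [N1 H] := al _ (le_lt_trans (le_trans (absv_ge0 _) (aB N (leqnn _))) Bl).
have := H (maxn N N1) (leq_maxr _ _); rewrite absv_subC => h1.
have := @absvD_lt (absv l) _ _ h1 (le_lt_trans (aB (maxn N N1) (leq_maxl _ _)) Bl).
by rewrite subrK ltxx.
Qed.

Lemma limsD a b l k : lims a l -> lims b k -> lims (fun n => a n + b n) (l + k).
Proof.
move=> al bk e e0; have [N1 H1] := al e e0; have [N2 H2] := bk e e0.
exists (maxn N1 N2) => n; rewrite geq_max => /andP[h1 h2].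
by rewrite opprD addrACA; apply: absvD_lt; [apply: H1|apply: H2].
Qed.

Lemma lims_bounded a l : lims a l -> exists2 M, 0 < M & forall n, absv (a n) <= M.
Proof.
move=> al; have [N H] := al 1 ltr01.
pose M := \big[Num.max/(absv l + 1)]_(i < N) absv (a i).
have lM : absv l + 1 <= M by exact: bigmax_ge_id.
exists M; first by rewrite (lt_le_trans _ lM)// ltr_wpDl// absv_ge0.
move=> n; have [nN|nN] := ltnP n N.
  by have := le_bigmax (absv l + 1) (fun i : 'I_N => absv (a i)) (Ordinal nN).
rewrite (le_trans _ lM)// -[a n](subrK l) absvD_le ?lerDl//.
by rewrite (le_trans (ltW (H _ nN)))// lerDr absv_ge0.
Qed.

Lemma limsM a b l k : lims a l -> lims b k -> lims (fun n => a n * b n) (l * k).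
Proof.
move=> al bk e e0; have [M M0 aM] := lims_bounded al.
have k1 : 0 < absv k + 1 by rewrite ltr_wpDl// absv_ge0.
have [N1 H1] := al (e / (absv k + 1)) (divr_gt0 e0 k1).
have [N2 H2] := bk (e / M) (divr_gt0 e0 M0).
exists (maxn N1 N2) => n; rewrite geq_max => /andP[h1 h2].
have -> : a n * b n - l * k = a n * (b n - k) + (a n - l) * k by ring.
apply: absvD_lt; rewrite absvM.
  rewrite (le_lt_trans (ler_wpM2r (absv_ge0 _) (aM n)))// mulrC -ltr_pdivlMr//.
  exact: H2.
rewrite (@le_lt_trans _ _ (absv (a n - l) * (absv k + 1)))//.
  by rewrite ler_wpM2l ?absv_ge0// lerDl.
by rewrite -ltr_pdivlMr//; apply: H1.
Qed.

Lemma limsZ c a l : lims a l -> lims (fun n => c * a n) (c * l).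
Proof. exact: limsM (lims_cst c). Qed.

Lemma limsN a l : lims a l -> lims (fun n => - a n) (- l).
Proof. by move=> /(limsZ (-1)); rewrite mulN1r; apply: lims_ext => n; rewrite mulN1r. Qed.

Lemma limsB a b l k : lims a l -> lims b k -> lims (fun n => a n - b n) (l - k).
Proof. by move=> al /limsN; apply: limsD. Qed.

Lemma limsX a l m : lims a l -> lims (fun n => a n ^+ m) (l ^+ m).
Proof.
move=> al; elim: m => [|m IH]; first exact: lims_cst.
by rewrite exprS; apply: lims_ext (limsM al IH) => n; rewrite exprS.
Qed.

Lemma lims_prod (I : Type) (r : seq I) (P : pred I) (f : I -> nat -> C) (g : I -> C) :
  (forall i, P i -> lims (f i) (g i)) ->
  lims (fun n => \prod_(i <- r | P i) f i n) (\prod_(i <- r | P i) g i).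
Proof.
move=> H; elim: r => [|i r IH].
  by rewrite big_nil; apply: lims_ext (lims_cst 1) => n; rewrite big_nil.
rewrite big_cons; case: ifPn => Pi.
  by apply: lims_ext (limsM (H i Pi) IH) => n; rewrite big_cons Pi.
by apply: lims_ext IH => n; rewrite big_cons (negPf Pi).
Qed.

(** The absolute value is locally constant away from 0, so exact absolute values pass from partial
    products to their limits. *)
Lemma lims_absv a l : lims a l -> l != 0 ->
  exists N, forall n, (N <= n)%N -> absv (a n) = absv l.
Proof.
move=> al l0; have [N H] := al (absv l) (eq_ind_r is_true l0 (absv_gt0 l)).
by exists N => n /H; apply: absv_near.
Qed.

Lemma limsV a l : lims a l -> l != 0 -> lims (fun n => (a n)^-1) l^-1.
Proof.
move=> al l0; have [N1 H1] := lims_absv al l0.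
have lp : 0 < absv l by rewrite absv_gt0.
move=> e e0; have [N2 H2] := al (e * absv l ^+ 2) (mulr_gt0 e0 (exprn_gt0 _ lp)).
exists (maxn N1 N2) => n; rewrite geq_max => /andP[h1 h2].
have an0 : a n != 0 by rewrite -absv_gt0 H1.
have -> : (a n)^-1 - l^-1 = (l - a n) / (a n * l) by field; rewrite l0.
by rewrite absv_div absvM H1// absv_subC -expr2 ltr_pdivrMr ?exprn_gt0// H2.
Qed.

Lemma geom_lt (r : R) e : 0 <= r < 1 -> 0 < e ->
  exists N, forall n, (N <= n)%N -> r ^+ n < e.
Proof.
move=> /andP[r0 r1] e0.
have : (r ^+ n @[n --> \oo] --> (0 : R))%classic.
  by apply: cvg_expr; rewrite ger0_norm.
move=> /cvgrPdist_lt /(_ e e0)[N _ NP]; exists N => n /NP.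
by rewrite sub0r normrN ger0_norm// exprn_ge0.
Qed.

Lemma lims_le0 a (g : nat -> R) : (forall n, absv (a n) <= g n) ->
  (forall e, 0 < e -> exists N, forall n, (N <= n)%N -> g n < e) -> lims a 0.
Proof.
move=> ag H e /H[N NP]; exists N => n Nn; rewrite subr0.
exact: le_lt_trans (NP _ Nn).
Qed.

Lemma lims_scale_geom M r a : 0 <= r < 1 -> (forall n, absv (a n) <= M * r ^+ n) -> lims a 0.
Proof.
move=> r01 H; apply: lims_le0 H _ => e e0.
have M1 : 0 < Num.max M 0 + 1 by rewrite ltr_wpDl// le_max lexx orbT.
have [N NP] := geom_lt r01 (divr_gt0 e0 M1); exists N => n /NP.
rewrite ltr_pdivlMr// mulrC; apply: le_lt_trans; rewrite ler_wpM2r//.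
  by rewrite exprn_ge0//; case/andP: r01.
by rewrite (@le_trans _ _ (Num.max M 0))// ?le_max ?lexx// lerDl.
Qed.

End Ultrametric.

Section Complete.
Variables (R : realType) (F : finFieldType) (S : setting R F).
Notation C := (Cinf S).

Lemma cauchy_net (T : Type) (G : set_system T) (f : T -> C) : ProperFilter G ->
  (forall e : R, 0 < e -> exists l, G [set x | absv (f x - l) < e]) ->
  exists l : C, f @ G --> l.
Proof.
move=> GF H; have cG : cauchy (f @ G).
  apply: cauchy_exP => e e0; have [l Gl] := H e e0; exists l.
  rewrite /fmap /=; apply: filterS Gl => x /=; rewrite ballEmdist /= => h.
  by rewrite /mdist/= /udist absv_subC.
by exists (lim (f @ G)); exact: (@Cinf_complete _ _ S _ _ cG).
Qed.

(** By the ultrametric inequality, small consecutive differences already make a sequence Cauchy;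
    hence a series converges as soon as its terms tend to 0. *)
Lemma lims_cauchy (a : nat -> C) :
  (forall e : R, 0 < e -> exists N, forall n, (N <= n)%N -> absv (a n.+1 - a n) < e) ->
  exists l, lims a l.
Proof.
move=> H; have [e e0|l al] := @cauchy_net _ \oo a _; last first.
  by exists l; apply/lims_cvg.
have [N NP] := H e e0; exists (a N); exists N => // n /= Nn.
rewrite -(subnKC Nn); elim: (n - N)%N => [|k IH]; first by rewrite addn0 subrr absv0.
rewrite -(subrKA (a (N + k)%N)); apply: absvD_lt => //.
by rewrite addnS; apply: NP; rewrite leq_addr.
Qed.

Lemma near_totally (I : choiceType) (f : {fset I} -> C) (l : C) :
  (forall e, 0 < e -> exists X0 : {fset I}, forall X : {fset I}, (X0 `<=` X)%fset -> absv (f X - l) < e) <->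
  f @ totally --> l.
Proof.
have FT := @totally_filter I; rewrite cvg_ballP; split=> H e e0.
  have [X0 XP] := H e e0; exists X0 => // X /= X0X.
  by rewrite ballEmdist/= /mdist/= /udist absv_subC XP.
have [X0 _ XP] := H e e0; exists X0 => X X0X.
by have := XP X X0X; rewrite /= ballEmdist/= /mdist/= /udist absv_subC.
Qed.

Lemma lims_series (a : nat -> C) : lims a 0 -> exists l, lims (series a) l.
Proof.
move=> a0; apply: lims_cauchy => e /a0[N NP]; exists N => n /NP.
by rewrite /series/= big_nat_recr//= addrAC subrr add0r subr0.
Qed.

Lemma series_null (a : nat -> C) l : lims (series a) l -> lims a 0.
Proof.
move=> al; have := limsB (lims_sub (s := succn) (fun=> leqnSn _) al) al.
rewrite subrr; apply: lims_ext => n.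
by rewrite /series/= big_nat_recr//= addrAC subrr add0r.
Qed.

Lemma lims_series_tail (a : nat -> C) l (B : R) n : lims (series a) l ->
  (forall k, (n <= k)%N -> absv (a k) <= B) -> absv (l - series a n) <= B.
Proof.
move=> al aB; have B0 : 0 <= B by apply: le_trans (aB n (leqnn _)); rewrite absv_ge0.
apply: (lims_le (N := n) (limsB al (lims_cst (series a n)))) => m nm.
rewrite /series/= (big_cat_nat (leq0n n) nm)//= addrAC subrr add0r big_nat_cond.
apply: absv_sum_le => // i; rewrite andbT => /andP[ni _]; exact: aB.
Qed.

End Complete.

Section NetSums.
Variables (R : realType) (F : finFieldType) (S : setting R F).
Notation C := (Cinf S).
Variables (I : choiceType).
Implicit Types (X Y : {fset I}).

Lemma big_fset_split (T : Type) (idx : T) (op : Monoid.com_law idx) X Y (f : I -> T) :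
  (X `<=` Y)%fset ->
  \big[op/idx]_(i <- Y) f i =
  op (\big[op/idx]_(i <- X) f i) (\big[op/idx]_(i <- Y | i \notin X) f i).
Proof.
move=> XY; rewrite (bigID (mem X))/=; congr (op _ _).
rewrite -big_filter; apply: perm_big; apply: uniq_perm; rewrite ?filter_uniq//.
move=> i; rewrite mem_filter; apply/andP/idP => [[]//|iX]; split=> //.
exact: (fsubsetP XY).
Qed.

Lemma partial_sumE (a : I -> C) X : partial_sum a X = \sum_(i <- X) a i.
Proof. by rewrite /partial_sum big_seq_fsetE. Qed.

Variables (N : I -> nat) (box : nat -> {fset I}) (r : R).
Hypotheses (boxP : forall i d, (i \in box d) = (N i < d)%N) (r01 : 0 < r < 1).

Let rX n : 0 < r ^+ n.
Proof. by rewrite exprn_gt0//; case/andP: r01. Qed.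

Let geomN K (e : R) : 0 <= K -> 0 < e -> exists n, K * r ^+ n < e.
Proof.
move=> K0 e0; have K1 : 0 < K + 1 by rewrite ltr_wpDl.
have [|n /(_ n (leqnn n))] := @geom_lt _ r (e / (K + 1)) _ (divr_gt0 e0 K1).
  by case/andP: r01 => /ltW -> ->.
rewrite ltr_pdivlMr// mulrC => h; exists n; apply: le_lt_trans h.
by rewrite ler_wpM2r ?(ltW (rX n))// lerDl.
Qed.

(** [box d] holds the indices of size [N] below [d]. Since larger finite sets change the value by at
    most B r^d, unordered limits are limits along boxes, with an explicit rate. *)
Lemma net_box (f : {fset I} -> C) (B : R) : 0 <= B ->
  (forall d Y, (box d `<=` Y)%fset -> absv (f Y - f (box d)) <= B * r ^+ d) ->
  exists2 l, f @ totally --> l &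
    forall d Y, (box d `<=` Y)%fset -> absv (l - f Y) <= B * r ^+ d.
Proof.
move=> B0 H; have [e e0|l fl] := @cauchy_net _ _ S _ totally f totally_filter.
  have [n nP] := geomN B0 e0; exists (f (box n)); exists (box n) => // Y /= /H h.
  exact: le_lt_trans nP.
exists l => // d Y dY; apply/ler_addgt0Pl => e e0.
have [X0 X0P] := (near_totally _ _).2 fl _ e0.
have := X0P (X0 `|` Y)%fset (fsubsetUl _ _); rewrite absv_subC => h.
rewrite -(subrKA (f (X0 `|` Y)%fset)) absvD_le//.
  by rewrite (le_trans (ltW h))// lerDl mulr_ge0// ltW.
rewrite -[f Y](subrK (f (box d))) opprD addrA addrAC; apply: absvB_le.
  rewrite (le_trans (H d _ _)) ?lerDr ?ltW//.
  exact: fsubset_trans dY (fsubsetUr _ _).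
by rewrite (le_trans (H d _ _)) ?lerDr ?ltW.
Qed.

Lemma psum_box (K : R) (a : I -> C) : 0 <= K -> (forall i, absv (a i) <= K * r ^+ N i) ->
  exists2 l, partial_sum a @ totally --> l &
    forall d Y, (box d `<=` Y)%fset -> absv (l - \sum_(i <- Y) a i) <= K * r ^+ d.
Proof.
move=> K0 aK; have [|l al lP] := @net_box (partial_sum a) K K0.
  move=> d Y dY; rewrite !partial_sumE (big_fset_split _ _ dY)/= addrAC subrr add0r.
  apply: absv_sum_le => [|i]; first by rewrite mulr_ge0// ltW.
  rewrite boxP -leqNgt => di; rewrite (le_trans (aK i))// ler_wpM2l//.
  by rewrite ler_wiXn2l// ltW//; case/andP: r01.
by exists l => // d Y dY; rewrite -partial_sumE lP.
Qed.

Lemma usum_box (K : R) (a : I -> C) d Y : 0 <= K -> (forall i, absv (a i) <= K * r ^+ N i) ->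
  (box d `<=` Y)%fset -> absv (unordered_sum a - \sum_(i <- Y) a i) <= K * r ^+ d.
Proof.
move=> K0 aK dY; have [l al lP] := psum_box K0 aK.
suff -> : unordered_sum a = l by exact: lP.
by apply: cvg_lim => //; [exact: metric_hausdorff|exact: totally_filter].
Qed.

Lemma absv_prodB1 (J : Type) (s : seq J) (P : pred J) (a : J -> C) (e : R) :
  0 <= e <= 1 -> (forall i, P i -> absv (a i - 1) <= e) ->
  absv (\prod_(i <- s | P i) a i - 1) <= e.
Proof.
move=> /andP[e0 e1] H.
elim/big_rec: _ => [|i x Pi xe]; first by rewrite subrr absv0.
have -> : a i * x - 1 = (a i - 1) * x + (x - 1) by ring.
apply: absvD_le => //; rewrite absvM (le_trans _ (H i Pi))// ler_piMr ?absv_ge0//.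
by rewrite -[x](subrK 1) absvD_le ?absv1// (le_trans xe).
Qed.

(** The constant [B] is chosen before the family [a]: the estimate is uniform when the factors
    depend on parameters, which later yields uniform convergence on affinoids. *)
Lemma uprod_box (K : R) : 0 <= K -> exists2 B, 0 <= B & forall a : I -> C,
  (forall i, absv (a i - 1) <= K * r ^+ N i) ->
  forall d Y, (box d `<=` Y)%fset ->
    absv (\prod_(i <- Y) a i) <= B /\
    absv (unordered_prod a - \prod_(i <- Y) a i) <= B * r ^+ d.
Proof.
move=> K0; have /andP[r0 r1] := r01.
(* From size [D] on every factor has absolute value at most 1, so a finite product is bounded by the
   contribution of the factors in [box D]. *)
have [D DP] := geomN K0 ltr01.
pose M := Num.max 1 K; have M1 : 1 <= M by rewrite le_max lexx.
pose B := M ^+ #|` box D|; have B1 : 1 <= B by rewrite exprn_ege1.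
have B0 : 0 <= B by rewrite (le_trans ler01).
have KB : B <= B * (K + 1) by rewrite ler_peMr// lerDr.
exists (B * (K + 1)); first by rewrite mulr_ge0// addr_ge0.
move=> a aK.
have abd Y : absv (\prod_(i <- Y) a i) <= B.
  rewrite absv_prod (@le_trans _ _ (\prod_(i <- Y) (if i \in box D then M else 1)))//.
    apply: ler_prod => i _; rewrite absv_ge0/= -[a i](subrK 1) absvD_le//.
      case: ifPn => [_|]; last first.
        rewrite boxP -leqNgt => Di; rewrite (le_trans (aK i))// (le_trans _ (ltW DP))//.
        by rewrite ler_wpM2l// ler_wiXn2l// ltW.
      rewrite (le_trans (aK i))// (@le_trans _ _ K) ?le_max ?lexx ?orbT//.
      by rewrite ler_piMr// exprn_ile1// ltW.
    by rewrite absv1; case: ifP.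
  rewrite -big_mkcond/= -big_filter big_const_seq iter_mulr_1 count_predT.
  apply: ler_weXn2l => //; apply: uniq_leq_size; first by rewrite filter_uniq.
  by move=> i; rewrite mem_filter => /andP[].
have tail d Y : (box d `<=` Y)%fset ->
    absv (\prod_(i <- Y) a i - \prod_(i <- box d) a i) <= B * (K + 1) * r ^+ d.
  (* If K r^d exceeds 1, the bound to be proved is at least [B] and the crude estimate of both
     products suffices. *)
  move=> dY; have [Kd|Kd] := leP (K * r ^+ d) 1.
    rewrite (big_fset_split _ _ dY)/= -[X in _ - X]mulr1 -mulrBr absvM -mulrA.
    apply: ler_pM; rewrite ?absv_ge0//.
    rewrite (@le_trans _ _ (K * r ^+ d))//; last first.
      by rewrite ler_wpM2r ?lerDl// ltW.
    apply: absv_prodB1; first by rewrite Kd mulr_ge0// ltW.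
    move=> i; rewrite boxP -leqNgt => di; rewrite (le_trans (aK i))// ler_wpM2l//.
    by rewrite ler_wiXn2l// ltW.
  rewrite (@le_trans _ _ B)// ?absvB_le// -mulrA ler_peMr// mulrDl mul1r.
  by rewrite (le_trans (ltW Kd))// lerDl ltW.
have [|l al lP] := net_box _ tail; first by rewrite mulr_ge0// addr_ge0.
move=> d Y dY; split; first exact: le_trans (abd Y) KB.
suff -> : unordered_prod a = l by exact: lP.
apply: cvg_lim; [exact: metric_hausdorff|exact: totally_filter|].
have -> : (fun X : {fset I} => \prod_(i : X) a (val i)) = (fun X : {fset I} => \prod_(i <- X) a i).
  by apply/funext => X; rewrite big_seq_fsetE.
exact: al.
Qed.

(** Outside [box d] the factors are closer to 1 than 1, hence have absolute value exactly 1 and do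
    not affect that of the product. *)
Lemma uprod_abs (K : R) (a : I -> C) d : 0 <= K ->
  (forall i, absv (a i - 1) <= K * r ^+ N i) -> K * r ^+ d < 1 ->
  absv (unordered_prod a) = absv (\prod_(i <- box d) a i).
Proof.
move=> K0 aK Kd; have [B B0 /(_ a aK) BP] := uprod_box K0; have /andP[r0 r1] := r01.
have stab D : (d <= D)%N -> absv (\prod_(i <- box D) a i) = absv (\prod_(i <- box d) a i).
  move=> dD; have sub : (box d `<=` box D)%fset.
    by apply/fsubsetP => i; rewrite !boxP => /leq_trans; apply.
  rewrite (big_fset_split _ _ sub)/= absvM [X in _ * X](_ : _ = 1) ?mulr1//.
  rewrite absv_prod big1// => i; rewrite boxP -leqNgt => di.
  rewrite -[a i](subrK 1) absvDr absv1// (le_lt_trans (aK i))// (le_lt_trans _ Kd)//.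
  by rewrite ler_wpM2l// ler_wiXn2l// ltW.
have lim e : 0 < e -> exists2 D, (d <= D)%N & absv (unordered_prod a - \prod_(i <- box D) a i) < e.
  move=> e0; have [n nP] := geomN B0 e0; exists (maxn n d); first exact: leq_maxr.
  have [_ h] := BP (maxn n d) _ (fsubset_refl _); rewrite (le_lt_trans h)// (le_lt_trans _ nP)//.
  by rewrite ler_wpM2l// ler_wiXn2l ?leq_maxl// ltW.
have [u0|u0] := eqVneq (unordered_prod a) 0; last first.
  have [|D dD] := lim (absv (unordered_prod a)); first by rewrite absv_gt0.
  by rewrite absv_subC => /absv_near <-; exact: stab.
apply/eqP; rewrite u0 absv0 eq_sym; apply/negPn/negP => p0.
have [|D dD] := lim (absv (\prod_(i <- box d) a i)); first by rewrite lt_def p0 absv_ge0.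
by rewrite u0 sub0r absvN stab// ltxx.
Qed.

End NetSums.

(** * Formal power series *)

Section FpsDomain.
Variable K : fieldType.
Implicit Types f g h : fps K.

Lemma fpsD f g n : (f + g) n = f n + g n. Proof. by []. Qed.
Lemma fpsN f n : (- f) n = - f n. Proof. by []. Qed.
Lemma fpsB f g n : (f - g) n = f n - g n. Proof. by []. Qed.
Lemma fpsM f g n : (f * g) n = \sum_(i < n.+1) f i * g (n - i)%N. Proof. by []. Qed.
Lemma fps0 n : (0 : fps K) n = 0. Proof. by rewrite /=; case: ifP. Qed.
Lemma fps1 n : (1 : fps K) n = (n == 0%N)%:R. Proof. by rewrite /=; case: ifP. Qed.

Lemma fps_sum (I : Type) (r : seq I) (P : pred I) (f : I -> fps K) n :
  (\sum_(i <- r | P i) f i) n = \sum_(i <- r | P i) f i n.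
Proof. by elim/big_rec2: _ => [|i x y _ <-//]; rewrite fps0. Qed.

Lemma fpsM0 f g : (f * g) 0%N = f 0%N * g 0%N.
Proof. by rewrite fpsM big_ord1. Qed.

Lemma fpsCM c f n : (fps_const c * f) n = c * f n.
Proof.
rewrite fpsM big_ord_recl /= subn0 big1 ?addr0// => i _; by rewrite mul0r.
Qed.

Lemma fpsMC c f n : (f * fps_const c) n = f n * c.
Proof. by rewrite mulrC fpsCM mulrC. Qed.

Lemma fpsXM f n : (fps_X K * f) n = if n is m.+1 then f m else 0.
Proof.
rewrite fpsM; case: n => [|n]; first by rewrite big_ord1 mul0r.
rewrite big_ord_recl /= mul0r add0r big_ord_recl /= mul1r subSS subn0.
by rewrite big1 ?addr0// => i _; rewrite mul0r.
Qed.

Lemma fps_constD a b : fps_const (a + b) = fps_const a + fps_const b :> fps K.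
Proof. by apply: fpsP => -[|n]//=; rewrite addr0. Qed.
Lemma fps_constM a b : fps_const (a * b) = fps_const a * fps_const b :> fps K.
Proof. by apply: fpsP => n; rewrite fpsCM; case: n => [|n]//=; rewrite mulr0. Qed.

Lemma fps_const0 : fps_const 0 = 0 :> fps K. Proof. by []. Qed.

Lemma fps_constX a n : fps_const (a ^+ n) = fps_const a ^+ n :> fps K.
Proof. by elim: n => [//|n IH]; rewrite !exprS fps_constM IH. Qed.

Lemma fpsX_val h k i : h 0%N = 0 -> (i < k)%N -> (h ^+ k) i = 0.
Proof.
move=> h0; elim: k i => [//|k IH] i ik; rewrite exprS fpsM big1// => j _.
have [->|j0] := posnP j; first by rewrite h0 mul0r.
by rewrite IH ?mulr0//; have := ltn_ord j; lia.
Qed.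

(** Geometric series in h = 1 - f / f(0): as h has no constant term, h^k starts in degree k, and
    each coefficient of the inverse is a finite sum. *)
Lemma fps_unitE f : (f \is a GRing.unit) = (f 0%N != 0).
Proof.
apply/idP/idP => [uf|f0].
  apply: contraTneq isT => f0; have := congr1 (fun f : fps K => f 0%N) (mulVr uf).
  by rewrite fpsM0 f0 mulr0 => /esym/eqP; rewrite oner_eq0.
pose h : fps K := 1 - fps_const (f 0%N)^-1 * f.
have h0 : h 0%N = 0 by rewrite fpsB fpsCM mulVf// subrr.
pose g : fps K := Fps (fun n => \sum_(k < n.+1) (h ^+ k) n).
have gE n i : (i <= n)%N -> g i = (\sum_(k < n.+1) h ^+ k) i.
  move=> ni; rewrite fps_sum /= (big_ord_widen n.+1 (fun k => (h ^+ k) i))// big_mkcond/=.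
  apply: eq_bigr => k _; case: ifPn => //; rewrite -leqNgt => ik.
  by rewrite fpsX_val.
have gh : g * (1 - h) = 1.
  apply: fpsP => n; rewrite fpsM.
  transitivity (((\sum_(k < n.+1) h ^+ k) * (1 - h)) n).
    by rewrite fpsM; apply: eq_bigr => i _; rewrite (gE n)// -ltnS.
  have := subrXX 1 h n.+1; rewrite mulrC => E.
  have -> : (\sum_(k < n.+1) h ^+ k) * (1 - h) = 1 - h ^+ n.+1.
    rewrite -[1 in RHS](expr1n _ n.+1) E; congr (_ * _).
    by apply: eq_bigr => i _; rewrite expr1n mul1r.
  by rewrite fpsB fpsX_val// subr0.
have : (g * fps_const (f 0%N)^-1) * f = 1 by rewrite -gh /h opprB addrC subrK mulrA.
by move=> H; apply/unitrP; eexists; split; [exact: H|rewrite mulrC].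
Qed.

Fact fps_idomain : GRing.integral_domain_axiom (fps K).
Proof.
move=> f g fg0; apply/contraT; rewrite negb_or => /andP[f0 g0].
have ex (k : fps K) : k != 0 -> exists n, k n != 0.
  move=> k0; apply: contrapT => H; case/eqP: k0; apply: fpsP => n.
  by rewrite fps0; apply/eqP/negPn/negP => h; apply: H; exists n.
have [n nf nmin] := ex_minnP (ex _ f0); have [m mg mmin] := ex_minnP (ex _ g0).
have := congr1 (fun f : fps K => f (n + m)%N) fg0; rewrite fps0 fpsM.
rewrite (bigD1 (Ordinal (leq_addr m n : (n < (n + m).+1)%N)))//= addKn big1 ?addr0.
  by move=> /eqP; rewrite mulf_eq0 (negPf nf) (negPf mg).
move=> i /negP ni; have [fi|fi] := eqVneq (f i) 0; first by rewrite fi mul0r.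
have := nmin _ fi; rewrite leq_eqVlt => /predU1P[E|lt]; first by case: ni; apply/eqP/val_inj.
have [gi|gi] := eqVneq (g (n + m - i)%N) 0; first by rewrite gi mulr0.
by have := mmin _ gi; have := ltn_ord i; lia.
Qed.

End FpsDomain.

HB.instance Definition _ (K : fieldType) :=
  GRing.ComUnitRing_isIntegral.Build (fps K) (@fps_idomain K).

Section BoundedCoefs.
Variables (R : realType) (C : ultrametricField R).
Implicit Types (f g : fps C) (M rho : R).

(** Quantitative form of membership in T_{>0} (see [TposP]). Because the absolute value is
    ultrametric, sums and products keep the same [rho]. *)
Definition bd M rho f := forall n, absv (f n) <= M * rho ^+ n.

Lemma bdW M rho M' rho' f : M <= M' -> 0 <= M -> 0 <= rho -> rho <= rho' ->
  bd M rho f -> bd M' rho' f.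
Proof.
move=> MM M0 r0 rr fM n; apply: le_trans (fM n) _; apply: ler_pM => //.
  exact: exprn_ge0.
by apply: lerXn2r; rewrite ?nnegrE// (le_trans r0).
Qed.

Lemma bd_ge0 M rho f : bd M rho f -> 0 <= M.
Proof. by move=> /(_ 0%N); rewrite mulr1; apply: le_trans; rewrite absv_ge0. Qed.

Lemma bdD M rho f g : bd M rho f -> bd M rho g -> bd M rho (f + g).
Proof. by move=> fM gM n; rewrite fpsD absvD_le. Qed.

Lemma bdN M rho f : bd M rho f -> bd M rho (- f).
Proof. by move=> fM n; rewrite fpsN absvN. Qed.

Lemma bd_sum M rho (I : Type) (r : seq I) (P : pred I) (f : I -> fps C) :
  0 <= M -> 0 <= rho ->
  (forall i, P i -> bd M rho (f i)) -> bd M rho (\sum_(i <- r | P i) f i).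
Proof.
move=> M0 r0 H n; rewrite fps_sum absv_sum_le ?mulr_ge0 ?exprn_ge0//.
by move=> i Pi; apply: H.
Qed.

Lemma bdM M M' rho f g : 0 <= rho -> bd M rho f -> bd M' rho g -> bd (M * M') rho (f * g).
Proof.
move=> r0 fM gM n; have M0 := bd_ge0 fM; have M'0 := bd_ge0 gM.
rewrite fpsM absv_sum_le ?mulr_ge0 ?exprn_ge0// => i _.
rewrite absvM -[in X in _ <= X](subnKC (leq_ord i)) exprD mulrACA.
by apply: ler_pM; rewrite ?absv_ge0.
Qed.

Lemma bdC c rho : 0 <= rho -> bd (absv c) rho (fps_const c).
Proof.
move=> r0 [|n] /=; first by rewrite mulr1.
by rewrite absv0 mulr_ge0 ?absv_ge0 ?exprn_ge0.
Qed.

Lemma bd1 rho : 0 <= rho -> bd 1 rho 1.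
Proof. by move=> r0; have := @bdC 1 rho r0; rewrite absv1. Qed.

Lemma bdX M rho f n : 0 <= rho -> bd M rho f -> bd (M ^+ n) rho (f ^+ n).
Proof.
move=> r0 fM; elim: n => [|n IH]; first exact: bd1.
by rewrite !exprS; apply: bdM.
Qed.

(** Induction on the recursion for the coefficients of the inverse; the normalisation to constant 1
    is what prevents the bound from growing, and [bd_normalize] reduces the general case to it. *)
Lemma bdV rho f : 0 <= rho -> absv (f 0%N) = 1 -> bd 1 rho f -> bd 1 rho f^-1.
Proof.
move=> r0 f1 fb; have f0 : f 0%N != 0 by rewrite -absv_gt0 f1.
have uf : f \is a GRing.unit by rewrite fps_unitE.
move=> n; elim/ltn_ind: n => n IH.
have := congr1 (fun k : fps C => k n) (mulrV uf); rewrite fps1 fpsM big_ord_recl subn0.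
move=> /(canRL (addrK _)) E; rewrite mul1r.
have -> : absv (f^-1 n) = absv (f 0%N * f^-1 n) by rewrite absvM f1 mul1r.
rewrite E absvB_le//.
  by case: n {E IH} => [|n] /=; rewrite ?absv1 ?absv0// exprn_ge0.
apply: absv_sum_le => [|i _]; first exact: exprn_ge0.
rewrite absvM lift0; have -> : rho ^+ n = rho ^+ i.+1 * rho ^+ (n - i.+1).
  by rewrite -exprD subnKC.
apply: ler_pM; rewrite ?absv_ge0//; first by have := fb i.+1; rewrite mul1r.
by have := IH (n - i.+1)%N; rewrite mul1r; apply; have := ltn_ord i; lia.
Qed.

End BoundedCoefs.

Section Eval.
Variables (R : realType) (F : finFieldType) (S : setting R F).
Notation C := (Cinf S).
Implicit Types (f g : fps C) (t : C) (M rho : R).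

Definition conv f t := lims (fps_terms f t) 0.

Lemma fps_cvgE f t : fps_cvg f t <-> conv f t.
Proof.
split=> [fc|/lims_series[l /lims_cvg]]; last by exact: cvgP.
by apply: (@series_null _ _ _ _ (fps_eval f t)); apply/lims_cvg.
Qed.

Lemma evalP f t : conv f t -> lims (series (fps_terms f t)) (fps_eval f t).
Proof. by move=> /lims_series[l fl]; rewrite /fps_eval (lims_limn fl). Qed.

Lemma evalE f t l : lims (series (fps_terms f t)) l -> fps_eval f t = l.
Proof. exact: lims_limn. Qed.

Lemma bd_terms M rho f t n : bd M rho f ->
  absv (fps_terms f t n) <= M * (rho * absv t) ^+ n.
Proof.
by move=> fM; rewrite absvM absvX exprMn mulrA ler_wpM2r ?exprn_ge0 ?absv_ge0.
Qed.

Lemma bd_conv M rho f t : 0 <= rho -> bd M rho f -> rho * absv t < 1 -> conv f t.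
Proof.
move=> r0 fM rt; apply: (@lims_scale_geom _ _ M (rho * absv t)) => [|n].
  by rewrite rt mulr_ge0 ?absv_ge0.
exact: bd_terms.
Qed.

Lemma convD f g t : conv f t -> conv g t -> conv (f + g) t.
Proof.
move=> ft gt; rewrite /conv -[0](addr0 0); apply: lims_ext (limsD ft gt) => n.
by rewrite /fps_terms mulrDl.
Qed.

Lemma evalD f g t : conv f t -> conv g t -> fps_eval (f + g) t = fps_eval f t + fps_eval g t.
Proof.
move=> ft gt; apply: evalE; apply: lims_ext (limsD (evalP ft) (evalP gt)) => n.
by rewrite /series/= -big_split /=; apply: eq_bigr => i _; rewrite /fps_terms mulrDl.
Qed.

Lemma convN f t : conv f t -> conv (- f) t.
Proof.
by move=> /limsN; rewrite oppr0; apply: lims_ext => n; rewrite /fps_terms fpsN mulNr.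
Qed.

Lemma evalN f t : conv f t -> fps_eval (- f) t = - fps_eval f t.
Proof.
move=> ft; apply: evalE; apply: lims_ext (limsN (evalP ft)) => n.
by rewrite /series/= -sumrN; apply: eq_bigr => i _; rewrite /fps_terms mulNr.
Qed.

Lemma convC c t : conv (fps_const c) t.
Proof.
by apply: (lims_eq (N := 1) _ (lims_cst 0)) => -[//|n] _; rewrite /fps_terms /= mul0r.
Qed.

Lemma evalC c t : fps_eval (fps_const c) t = c.
Proof.
apply: evalE; apply: (lims_eq (N := 1) _ (lims_cst c)) => -[//|n] _.
rewrite /series/= big_nat_recl//= [X in _ + X]big1 ?addr0.
  by rewrite /fps_terms /= mulr1.
by move=> i _; rewrite /fps_terms /= mul0r.
Qed.

Lemma fps_terms_mul f g t n :
  fps_terms (f * g) t n = \sum_(i < n.+1) fps_terms f t i * fps_terms g t (n - i)%N.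
Proof.
rewrite /fps_terms fpsM mulr_suml; apply: eq_bigr => i _.
by rewrite mulrACA -exprD subnKC// -ltnS.
Qed.

Let small f g t (e : R) : 0 < e -> conv f t -> conv g t -> exists N,
  forall i j, (N <= i + j)%N -> absv (fps_terms f t i * fps_terms g t j) < e.
Proof.
move=> e0 ft gt; have [M M0 fM] := lims_bounded ft; have [M' M'0 gM] := lims_bounded gt.
have [N1 H1] := ft _ (divr_gt0 e0 M'0); have [N2 H2] := gt _ (divr_gt0 e0 M0).
exists (N1 + N2)%N => i j ij; rewrite absvM.
have [Ni|iN] := leqP N1 i.
  rewrite (@le_lt_trans _ _ (absv (fps_terms f t i) * M'))//.
    by rewrite ler_wpM2l ?absv_ge0.
  by rewrite -ltr_pdivlMr//; have := H1 _ Ni; rewrite subr0.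
rewrite (@le_lt_trans _ _ (M * absv (fps_terms g t j)))//.
  by rewrite ler_wpM2r ?absv_ge0.
rewrite mulrC -ltr_pdivlMr//; have := H2 j; rewrite subr0; apply.
by lia.
Qed.

Lemma convM f g t : conv f t -> conv g t -> conv (f * g) t.
Proof.
move=> ft gt e e0; have [N H] := small e0 ft gt; exists N => n Nn.
rewrite subr0 fps_terms_mul absv_sum_lt// => i _; apply: H.
by rewrite subnKC// -ltnS.
Qed.

(** The partial sum of the Cauchy product and the product of partial sums differ only by terms of
    indices i + j >= n, which are uniformly small. *)
Lemma evalM f g t : conv f t -> conv g t -> fps_eval (f * g) t = fps_eval f t * fps_eval g t.
Proof.
move=> ft gt; apply: evalE; apply: lims_close (limsM (evalP ft) (evalP gt)) _ => e e0.
have [N H] := small e0 ft gt; exists N => n Nn; rewrite absv_subC.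
set a := fps_terms f t in H *; set b := fps_terms g t in H *.
have -> : series (fps_terms (f * g) t) n = \sum_(0 <= i < n) a i * \sum_(0 <= j < n - i) b j.
  rewrite /series/=; elim: n {Nn} => [|n IH]; first by rewrite !big_nil.
  rewrite big_nat_recr//= IH big_nat_recr//= fps_terms_mul subSnn big_nat1.
  rewrite big_ord_recr/= subnn addrA; congr (_ + _).
  rewrite big_mkord -big_split/= [RHS]big_mkord; apply: eq_bigr => i _.
  by rewrite -mulrDr -big_nat_recr//= subSn// ltnW.
rewrite /series/= mulr_suml -sumrB big_seq absv_sum_lt// => i.
rewrite mem_index_iota => /andP[_ ni]; rewrite -mulrBr (big_cat_nat (leq0n (n - i)) (leq_subr _ _))/=.
rewrite addrAC subrr add0r mulr_sumr big_seq absv_sum_lt// => j.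
by rewrite mem_index_iota => /andP[ij jn]; apply: H; lia.
Qed.

Lemma convX f t n : conv f t -> conv (f ^+ n) t.
Proof.
move=> ft; elim: n => [|n IH]; first exact: convC.
by rewrite exprS; apply: convM.
Qed.

Lemma evalX f t n : conv f t -> fps_eval (f ^+ n) t = fps_eval f t ^+ n.
Proof.
move=> ft; elim: n => [|n IH]; first exact: evalC.
by rewrite !exprS evalM ?IH//; apply: convX.
Qed.

Lemma eval_le (B : R) f t : conv f t -> (forall n, absv (fps_terms f t n) <= B) ->
  absv (fps_eval f t) <= B.
Proof.
move=> ft fB; have := lims_series_tail (n := 0) (evalP ft) (fun k _ => fB k).
by rewrite /series/= big_nil subr0.
Qed.

Lemma eval_dom (B : R) f t : conv f t -> B < absv (f 0%N) ->
  (forall n, absv (fps_terms f t n.+1) <= B) -> absv (fps_eval f t) = absv (f 0%N).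
Proof.
move=> ft Bf fB; apply: absv_near; apply: le_lt_trans Bf.
have := lims_series_tail (B := B) (n := 1) (evalP ft).
rewrite /series/= big_nat1 /fps_terms mulr1; apply => -[//|k] _; exact: fB.
Qed.

(** Zeros of a nonzero convergent series cannot accumulate at 0: for small t the first nonzero term
    strictly dominates the rest. *)
Lemma fps_identity M rho f : 0 < rho -> bd M rho f ->
  (forall e : R, 0 < e -> exists t : C, [/\ 0 < absv t, absv t < e & fps_eval f t = 0]) -> f = 0.
Proof.
move=> r0 fM H; apply: contrapT => /eqP f0.
have [n nf nmin] : exists2 n, f n != 0 & forall m, (m < n)%N -> f m = 0.
  have ex : exists n, f n != 0.
    apply: contrapT => H0; case/eqP: f0; apply: fpsP => n.
    by rewrite fps0; apply/eqP/negPn/negP => h; apply: H0; exists n.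
  have [n nf nmin] := ex_minnP ex; exists n => // m mn.
  by apply/eqP; apply: contraTT mn => /nmin; rewrite -leqNgt.
have fn0 : 0 < absv (f n) by rewrite absv_gt0.
have M0 := bd_ge0 fM.
have M1 : 0 < M * rho ^+ n.+1 + 1 by rewrite ltr_wpDl// mulr_ge0// exprn_ge0// ltW.
(* The second radius makes the tail bound M (rho |t|)^(n+1) smaller than |f_n t^n|; adding 1 to the
   denominator only keeps it nonzero. *)
have [] := H (Num.min rho^-1 (absv (f n) / (M * rho ^+ n.+1 + 1))).
  by rewrite lt_min invr_gt0 r0 divr_gt0.
move=> t [t0]; rewrite lt_min -[rho^-1]mul1r ltr_pdivlMr// mulrC ltr_pdivlMr// => /andP[t1 t2] ft0.
have := lims_series_tail (n := n.+1) (B := M * (rho * absv t) ^+ n.+1)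
  (evalP (bd_conv (ltW r0) fM t1)).
rewrite ft0 sub0r absvN /series/= big_nat_recr//= big1_seq ?add0r.
  move=> /(_ _); rewrite /fps_terms absvM absvX => h.
  have : absv (f n) * absv t ^+ n <= M * (rho * absv t) ^+ n.+1.
    apply: h => k nk; apply: le_trans (bd_terms _ _ fM) _; rewrite ler_wpM2l//.
    by rewrite ler_wiXn2l ?mulr_ge0 ?absv_ge0 ?(ltW r0)// ltW.
  rewrite exprMn [absv t ^+ n.+1]exprSr !mulrA [X in _ <= X]mulrAC ler_pM2r ?exprn_gt0// leNgt.
  rewrite (le_lt_trans _ t2)// mulrC ler_wpM2l ?absv_ge0// lerDl ler01//.
by move=> i; rewrite mem_index_iota => /andP[_ /nmin fi]; rewrite /fps_terms fi mul0r.
Qed.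

End Eval.

(** * Frobenius, polynomials in theta, K_infty and the affinoids *)

Section Constants.
Variables (R : realType) (F : finFieldType) (S : setting R F).
Notation C := (Cinf S).
Notation q := #|F|.
Notation A := {poly F}.
Notation th := (theta S).
Notation ev := (polyev (iota S) th).
Notation Kinf := (Kinfty (iota S) th).

Lemma q_gt1 : (1 < q)%N. Proof. exact: finNzRing_gt1. Qed.
Lemma q_gt0 : (0 < q)%N. Proof. exact: ltnW q_gt1. Qed.
Lemma qS : q.-1.+1 = q. Proof. exact: prednK q_gt0. Qed.
Lemma q1_gt0 : (0 < q.-1)%N. Proof. by rewrite -ltnS qS q_gt1. Qed.
Lemma qR_gt1 : 1 < q%:R :> R. Proof. by rewrite ltr1n q_gt1. Qed.
Lemma qR_ge1 : 1 <= q%:R :> R. Proof. exact: ltW qR_gt1. Qed.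
Lemma qR_gt0 : 0 < q%:R :> R. Proof. exact: lt_trans ltr01 qR_gt1. Qed.
Lemma qRX_gt0 n : 0 < q%:R ^+ n :> R. Proof. exact: exprn_gt0 qR_gt0. Qed.
Lemma qRX_ge1 n : 1 <= q%:R ^+ n :> R. Proof. exact: exprn_ege1 qR_ge1. Qed.
Lemma qV01 : 0 < (q%:R^-1 : R) < 1.
Proof. by rewrite invr_gt0 qR_gt0 invf_lt1 ?qR_gt0 ?qR_gt1. Qed.

Lemma th_neq0 : th != 0.
Proof. by rewrite -absv_gt0 abs_theta qR_gt0. Qed.
Lemma thX_neq0 n : th ^+ n != 0.
Proof. exact: expf_neq0 th_neq0. Qed.
Lemma absv_thX n : absv (th ^+ n) = q%:R ^+ n.
Proof. by rewrite absvX abs_theta. Qed.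

Lemma q_pnat : [pchar C].-nat q.
Proof.
have [p pp pF] := finPcharP F.
have pC : p \in [pchar C] by rewrite (fmorph_pchar (iota S : {rmorphism F -> C})).
by rewrite (eq_pnat _ (pcharf_eq pC)) (card_pprimeChar pF) pnatX pnat_id.
Qed.

Lemma frobD (x y : C) : (x + y) ^+ q = x ^+ q + y ^+ q.
Proof. exact: exprDn_pchar q_pnat. Qed.

Lemma frobN (x : C) : (- x) ^+ q = - x ^+ q.
Proof.
apply: (addrI (x ^+ q)); rewrite -frobD !subrr expr0n.
by rewrite eqn0Ngt q_gt0.
Qed.

Lemma frobB (x y : C) : (x - y) ^+ q = x ^+ q - y ^+ q.
Proof. by rewrite frobD frobN. Qed.

Lemma frob_sum (I : Type) (r : seq I) (P : pred I) (f : I -> C) :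
  (\sum_(i <- r | P i) f i) ^+ q = \sum_(i <- r | P i) f i ^+ q.
Proof.
apply: (big_morph (fun x : C => x ^+ q) frobD).
by rewrite expr0n eqn0Ngt q_gt0.
Qed.

Lemma natq0 : q%:R = 0 :> C.
Proof.
have [p pp pF] := finPcharP F.
have pC : p \in [pchar C] by rewrite (fmorph_pchar (iota S : {rmorphism F -> C})).
apply/eqP; rewrite -(dvdn_pcharf pC); have := q_gt1.
have := card_pprimeChar pF; set n := logn _ _; clearbody n => ->.
by case: n => // n _; rewrite expnS dvdn_mulr.
Qed.

Lemma frob_iota c : iota S c ^+ q = iota S c.
Proof. by rewrite -rmorphXn /= expf_card. Qed.

Lemma absv_iota c : c != 0 -> absv (iota S c) = 1.
Proof.
move=> c0; apply: (@absv_unity _ _ _ q.-1); first exact: q1_gt0.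
have ic0 : iota S c != 0 by rewrite fmorph_eq0.
by apply: (mulfI ic0); rewrite -exprS qS frob_iota mulr1.
Qed.

Lemma absv_iota_le c : absv (iota S c) <= 1.
Proof. by have [->|/absv_iota->//] := eqVneq c 0; rewrite rmorph0 absv0. Qed.

(** X^q - X splits over F as the product of all X - c, so it has no further roots in C. *)
Lemma frob_fixed (x : C) : x ^+ q = x -> exists c, x = iota S c.
Proof.
move=> xq; have := congr1 (fun p => (map_poly (iota S) p).[x]) (finField_genPoly F).
rewrite /= rmorphB /= map_polyXn map_polyX rmorph_prod /= !hornerE xq subrr => /esym/eqP.
rewrite horner_prod prodf_seq_eq0 => /hasP[c _ /=].
by rewrite rmorphB/= map_polyX map_polyC/= !hornerE subr_eq0 => /eqP ->; exists c.
Qed.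

Lemma ev0 : ev 0 = 0. Proof. by rewrite /polyev rmorph0 horner0. Qed.
Lemma evD a b : ev (a + b) = ev a + ev b. Proof. exact: polyevD. Qed.
Lemma evM a b : ev (a * b) = ev a * ev b. Proof. exact: polyevM. Qed.
Lemma evN a : ev (- a) = - ev a. Proof. exact: polyevN. Qed.
Lemma evB a b : ev (a - b) = ev a - ev b. Proof. by rewrite evD evN. Qed.
Lemma ev1 : ev 1 = 1. Proof. exact: polyev1. Qed.
Lemma evC c : ev c%:P = iota S c. Proof. by rewrite /polyev map_polyC hornerC. Qed.
Lemma evX : ev 'X = th. Proof. by rewrite /polyev map_polyX hornerX. Qed.
Lemma evXn n : ev 'X^n = th ^+ n. Proof. by rewrite /polyev map_polyXn hornerXn. Qed.
Lemma evE (a : A) n : (size a <= n)%N -> ev a = \sum_(i < n) iota S a`_i * th ^+ i.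
Proof.
move=> an; rewrite /polyev (@horner_coef_wide _ n) ?size_map_poly//.
by apply: eq_bigr => i _; rewrite coef_map.
Qed.

Lemma absv_ev a : a != 0 -> absv (ev a) = q%:R ^+ (size a).-1.
Proof.
elim/poly_ind: a => [|a c IH]; first by rewrite eqxx.
move=> ac0; rewrite evD evM evX evC size_MXaddC.
have [a0|a0] := eqVneq a 0.
  move: ac0; rewrite a0 mul0r add0r polyC_eq0 ev0 mul0r add0r => c0.
  by rewrite (negPf c0) absv_iota//= size_poly0.
rewrite absvDl absvM IH// abs_theta /= -exprSr; first by rewrite prednK// size_poly_gt0.
apply: le_lt_trans (absv_iota_le c) _.
by rewrite exprn_egt1 ?qR_gt1.
Qed.

Lemma absv_ev_ge1 a : a != 0 -> 1 <= absv (ev a).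
Proof. by move=> /absv_ev ->; exact: qRX_ge1. Qed.

Lemma ev_eq0 a : (ev a == 0) = (a == 0).
Proof.
apply/idP/idP => [|/eqP->]; last by rewrite ev0.
by apply: contraTT => /absv_ev_ge1; rewrite -absv_gt0; apply: lt_le_trans.
Qed.

Lemma ev_inj : injective ev.
Proof. by move=> a b /eqP; rewrite -subr_eq0 -evB ev_eq0 subr_eq0 => /eqP. Qed.

Lemma small_elt (e : R) : 0 < e -> exists t : C, 0 < absv t < e.
Proof.
move=> e0; have [|N /(_ N (leqnn N)) NP] := @geom_lt _ (q%:R^-1) e _ e0.
  by case/andP: qV01 => /ltW -> ->.
by exists (th ^- N); rewrite absvV absv_thX -exprVn NP exprn_gt0 ?invr_gt0 ?qR_gt0.
Qed.

(** Approximate by a fraction and take its polynomial part by Euclidean division; the remainder over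
    the denominator has absolute value below 1. *)
Lemma Kinf_near x : Kinf x -> exists a, absv (x - ev a) < 1.
Proof.
move=> /KinftyP /(_ 1 ltr01)[k [a [b [b0 ->]]] xk].
have b0' : b != 0 by rewrite -ev_eq0.
exists (a %/ b); rewrite -(subrKA (ev a / ev b)) absvD_lt//.
rewrite [in ev a](divp_eq a b) evD evM mulrDl mulfK// addrAC subrr add0r absv_div.
rewrite ltr_pdivrMr ?absv_gt0// mul1r (absv_ev b0').
have [->|m0] := eqVneq (a %% b) 0; first by rewrite ev0 absv0 qRX_gt0.
rewrite absv_ev// ltr_eXn2l ?qR_gt1//.
have := ltn_modp a b; rewrite b0'; move: m0; rewrite -size_poly_gt0.
by move: (size (a %% b)) (size b) => m n; lia.
Qed.

(** A sufficiently close fraction has the same absolute value. The gaps in this value group later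
    provide annuli that avoid K_infty. *)
Lemma Kinf_val x : Kinf x -> x != 0 -> exists n m, absv x = q%:R ^+ n / q%:R ^+ m.
Proof.
rewrite -absv_gt0 => /KinftyP xK x0; have [k [a [b [b0 ->]]] xk] := xK _ x0.
have E : absv x = absv (ev a / ev b) by apply/esym/absv_near; rewrite absv_subC.
have a0 : ev a != 0.
  by apply: contraTneq x0 => a0; rewrite E a0 mul0r absv0 ltxx.
exists (size a).-1, (size b).-1; rewrite E absv_div !absv_ev// -ev_eq0//.
Qed.

Lemma KinfB x y : Kinf x -> Kinf y -> Kinf (x - y).
Proof.
move=> /KinftyP xK /KinftyP yK; apply/KinftyP => e e0.
have [k [a [b [b0 ->]]] xk] := xK _ e0; have [l [c [d [d0 ->]]] yl] := yK _ e0.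
exists (ev a / ev b - ev c / ev d).
  exists (a * d - c * b), (b * d); rewrite evB !evM mulf_neq0//; split=> //.
  by field; rewrite b0 d0.
have -> : x - y - (ev a / ev b - ev c / ev d) = (x - ev a / ev b) - (y - ev c / ev d) by ring.
exact: absvB_lt.
Qed.

Lemma Omega_dist z : Omega S z -> exists2 d : R, 0 < d & forall x, Kinf x -> d <= absv (z - x).
Proof.
move=> zO; apply: contrapT => H; apply: zO; apply/KinftyP => e e0.
have [x xK xz] : exists2 x, Kinf x & absv (z - x) < e.
  apply: contrapT => H'; apply: H; exists e => // x xK.
  by rewrite leNgt; apply/negP => xz; apply: H'; exists x.
have /KinftyP/(_ e e0)[k kr xk] := xK; exists k => //.
by rewrite -(subrKA x) absvD_lt.
Qed.

Lemma expq_unbounded (M : R) : exists n, M <= q%:R ^+ n.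
Proof.
have [M0|M0] := leP M 0; first by exists 0%N; rewrite (le_trans M0).
have [|N /(_ N (leqnn N)) NP] := @geom_lt _ (q%:R^-1) M^-1 _ (eq_ind_r is_true M0 (invr_gt0 _)).
  by case/andP: qV01 => /ltW -> ->.
exists N; apply: ltW; move: NP; rewrite exprVn ltf_pV2 ?posrE ?qRX_gt0//.
Qed.

Lemma Omega_affinoid z : Omega S z -> exists n, affinoid n z.
Proof.
move=> /Omega_dist[d d0 dP].
have [n nP] := expq_unbounded (absv z); have [m mP] := expq_unbounded d^-1.
exists (maxn n m); split.
  by rewrite (le_trans nP)// ler_weXn2l ?leq_maxl ?qR_ge1.
move=> x /dP; apply: le_trans; rewrite -[d]invrK lef_pV2 ?posrE ?invr_gt0 ?qRX_gt0//.
by rewrite (le_trans mP)// ler_weXn2l ?leq_maxr ?qR_ge1.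
Qed.

Lemma Omega_affine a b z : Omega S z -> a != 0 -> ev a * z + ev b != 0.
Proof.
move=> zO a0; apply/eqP => E; apply: zO; apply: ratfun_Kinfty.
have ea0 : ev a != 0 by rewrite ev_eq0.
exists (- b), a; split=> //; apply: (mulIf ea0); rewrite mulfVK// evN mulrC.
by apply/eqP; rewrite -addr_eq0 E.
Qed.

Lemma affinoid_le n m z : (n <= m)%N -> affinoid (S := S) n z -> affinoid (S := S) m z.
Proof.
move=> nm [zn zK]; split; first by rewrite (le_trans zn)// ler_weXn2l ?qR_ge1.
move=> x /zK; apply: le_trans; rewrite lef_pV2 ?posrE ?qRX_gt0//.
by rewrite ler_weXn2l ?qR_ge1.
Qed.

Lemma affine_lb n z a b : affinoid (S := S) n z ->
  absv (ev a) * q%:R ^- n <= absv (ev a * z + ev b).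
Proof.
move=> [_ zK]; have [->|a0] := eqVneq a 0; first by rewrite ev0 absv0 mul0r absv_ge0.
have ea0 : ev a != 0 by rewrite ev_eq0.
have -> : ev a * z + ev b = ev a * (z - ev (- b) / ev a) by rewrite evN; field.
rewrite absvM ler_wpM2l ?absv_ge0//; apply: zK.
by apply: ratfun_Kinfty; exists (- b), a.
Qed.

(** If |b| > |a| q^n, then b dominates az + b; otherwise the distance from z to the rational point
    -b/a gives the bound. Either way a lattice vector is comparable with its larger coordinate,
    uniformly on the affinoid. *)
Lemma affine_lb2 n z a b : affinoid (S := S) n z ->
  Num.max (absv (ev a)) (absv (ev b)) * q%:R ^- (n + n) <= absv (ev a * z + ev b).
Proof.
move=> zn; have := affine_lb a b zn => h.
have qn : 0 < (q%:R ^+ n : R) by exact: qRX_gt0.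
have [ab|ab] := leP (absv (ev b)) (absv (ev a) * q%:R ^+ n).
  rewrite exprD invfM mulrA; apply: le_trans h; rewrite ler_wpM2r ?invr_ge0 ?(ltW qn)//.
  rewrite ler_pdivrMr// ge_max ab andbT ler_peMr ?absv_ge0//; exact: qRX_ge1.
have zb : absv (ev a * z) < absv (ev b).
  by rewrite absvM (le_lt_trans _ ab)// ler_wpM2l ?absv_ge0//; case: zn.
rewrite absvDr// ler_pdivrMr ?qRX_gt0// ge_max; apply/andP; split.
  rewrite (le_trans _ (ltW (lt_le_trans ab _)))//.
    by rewrite ler_peMr ?absv_ge0// qRX_ge1.
  by rewrite ler_peMr ?absv_ge0// qRX_ge1.
by rewrite ler_peMr ?absv_ge0// qRX_ge1.
Qed.

Lemma TposP (f : fps C) : Tpos f <-> exists M rho, [/\ 0 < M, 0 < rho & bd M rho f].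
Proof.
split=> [[r r0 fc]|[M [rho [M0 r0 fM]]]].
  have [t /andP[t0 tr]] := small_elt r0.
  have /fps_cvgE/lims_bounded[M M0 fM] := fc t tr.
  exists M, (absv t)^-1; rewrite invr_gt0; split=> // n.
  by rewrite exprVn ler_pdivlMr ?exprn_gt0// -absvX -absvM; apply: fM.
exists rho^-1; first by rewrite invr_gt0.
move=> t; rewrite -[rho^-1]mul1r ltr_pdivlMr// mulrC => tr.
by apply/fps_cvgE; apply: (bd_conv (ltW r0) fM).
Qed.

Lemma bd_unify M1 r1 M2 r2 (f g : fps C) : 0 < M1 -> 0 < r1 -> 0 < M2 -> 0 < r2 ->
  bd M1 r1 f -> bd M2 r2 g ->
  exists M rho, [/\ 0 < M, 0 < rho, bd M rho f & bd M rho g].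
Proof.
move=> M10 r10 M20 r20 fM gM; exists (Num.max M1 M2), (Num.max r1 r2).
rewrite !lt_max M10 r10; split=> //.
  by apply: bdW fM; rewrite ?le_max ?lexx// ?ltW.
by apply: bdW gM; rewrite ?le_max ?lexx ?orbT// ?ltW.
Qed.

Lemma TposD (f g : fps C) : Tpos f -> Tpos g -> Tpos (f + g).
Proof.
move=> /TposP[M1 [r1 [M10 r10 fM]]] /TposP[M2 [r2 [M20 r20 gM]]]; apply/TposP.
have [M [r [M0 r0 f' g']]] := bd_unify M10 r10 M20 r20 fM gM.
by exists M, r; split=> //; apply: bdD.
Qed.

Lemma TposM (f g : fps C) : Tpos f -> Tpos g -> Tpos (f * g).
Proof.
move=> /TposP[M1 [r1 [M10 r10 fM]]] /TposP[M2 [r2 [M20 r20 gM]]]; apply/TposP.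
have [M [r [M0 r0 f' g']]] := bd_unify M10 r10 M20 r20 fM gM.
by exists (M * M), r; split=> //; [exact: mulr_gt0|apply: bdM => //; exact: ltW].
Qed.

Lemma TposN (f : fps C) : Tpos f -> Tpos (- f).
Proof.
move=> /TposP[M [r [M0 r0 fM]]]; apply/TposP; exists M, r; split=> //; exact: bdN.
Qed.

Lemma TposC (c : C) : Tpos (fps_const c).
Proof.
apply/TposP; exists (absv c + 1), 1; split=> //; first by rewrite ltr_wpDl ?absv_ge0.
by apply: bdW (bdC c ler01) => //; rewrite ?lerDl ?absv_ge0.
Qed.

Lemma Tpos0 : Tpos (0 : fps C). Proof. exact: TposC 0. Qed.
Lemma Tpos1 : Tpos (1 : fps C). Proof. exact: TposC 1. Qed.

Lemma Tpos_sum (I : Type) (r : seq I) (P : pred I) (f : I -> fps C) :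
  (forall i, P i -> Tpos (f i)) -> Tpos (\sum_(i <- r | P i) f i).
Proof. by move=> H; elim/big_ind: _ => //; [exact: Tpos0|exact: TposD]. Qed.

(** The coefficient of index 0 is bounded by itself, so the excess of M over |f(0)| can be absorbed
    into the rate in all positive degrees. *)
Lemma bd_normalize M r (f : fps C) : 0 < M -> 0 < r -> f 0%N != 0 -> bd M r f ->
  exists2 r', 0 < r' & bd (absv (f 0%N)) r' f.
Proof.
move=> M0 r0; rewrite -absv_gt0 => f0 fM.
pose N := Num.max 1 (M / absv (f 0%N)).
have N1 : 1 <= N by rewrite le_max lexx.
have N0 : 0 < N by exact: lt_le_trans N1.
exists (N * r); first exact: mulr_gt0.
case=> [|n]; first by rewrite mulr1.
apply: le_trans (fM _) _; rewrite exprMn mulrA ler_wpM2r ?exprn_ge0 ?(ltW r0)//.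
apply: (@le_trans _ _ (absv (f 0%N) * N)).
  by rewrite mulrC -ler_pdivrMr// le_max lexx orbT.
by rewrite ler_wpM2l ?(ltW f0)// exprS ler_peMr ?(ltW N0)// exprn_ege1.
Qed.

Lemma TposV (f : fps C) : f 0%N != 0 -> Tpos f -> Tpos f^-1.
Proof.
move=> f0 /TposP[M [r [M0 r0 fM]]].
have [r' r'0 fM'] := bd_normalize M0 r0 f0 fM.
pose c := f 0%N; have c0 : c != 0 by [].
have E : f = fps_const c * (fps_const c^-1 * f).
  by rewrite mulrA -fps_constM divff// mul1r.
have ug : fps_const c^-1 * f \is a GRing.unit.
  by rewrite fps_unitE fpsCM mulf_neq0 ?invr_neq0.
have uc : fps_const c \is a GRing.unit by rewrite fps_unitE.
rewrite E invrM//; apply: TposM.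
  apply/TposP; exists 1, r'; split=> //; apply: bdV (ltW r'0) _ _.
    by rewrite fpsCM absvM absvV mulVf// absv_eq0.
  by have := bdM (ltW r'0) (bdC c^-1 (ltW r'0)) fM'; rewrite absvV mulVf// absv_eq0.
suff -> : (fps_const c)^-1 = fps_const c^-1 by exact: TposC.
by apply: (mulrI uc); rewrite divrr// -fps_constM divff.
Qed.

Lemma twistD (f g : fps C) : twist (F := F) (f + g) = twist f + twist g.
Proof. by apply: fpsP => n; rewrite /= frobD. Qed.

Lemma twistM (f g : fps C) : twist (F := F) (f * g) = twist f * twist g.
Proof.
apply: fpsP => n; rewrite /= frob_sum; apply: eq_bigr => i _.
by rewrite exprMn.
Qed.

Lemma twistC (c : C) : twist (F := F) (fps_const c) = fps_const (c ^+ q) :> fps C.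
Proof. by apply: fpsP => -[|n] //=; rewrite expr0n eqn0Ngt q_gt0. Qed.

End Constants.

(** * Exponentials of F_q-lattices *)

Section PolysUpTo.
Variable F : finFieldType.
Notation A := {poly F}.

Definition polys d : seq A := [seq rVpoly v | v <- enum 'rV[F]_d].

Lemma mem_polys d (a : A) : (a \in polys d) = (size a <= d)%N.
Proof.
apply/mapP/idP => [[v _ ->]|ad]; first exact: size_poly.
by exists (poly_rV a); rewrite ?mem_enum// poly_rV_K.
Qed.

Lemma uniq_polys d : uniq (polys d).
Proof.
rewrite map_inj_uniq ?enum_uniq//.
exact: can_inj rVpolyK.
Qed.

Lemma size_polys d : size (polys d) = (#|F| ^ d)%N.
Proof. by rewrite size_map -cardE card_mx mul1n. Qed.

End PolysUpTo.

Section LinearPolys.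
Variables (R : realType) (F : finFieldType) (S : setting R F).
Notation C := (Cinf S).
Notation q := #|F|.
Notation A := {poly F}.
Notation th := (theta S).
Notation ev := (polyev (iota S) th).

Lemma sum_inv_roots (r : seq C) (x : C) : (forall a, a \in r -> x != a) ->
  (\prod_(a <- r) ('X - a%:P))^`().[x] =
  \prod_(a <- r) (x - a) * \sum_(a <- r) (x - a)^-1.
Proof.
elim: r => [|a r IH] H; first by rewrite !big_nil mulr0 derivC horner0.
rewrite !big_cons derivM derivXsubC mul1r hornerD hornerM IH; last first.
  by move=> b br; apply: H; rewrite inE br orbT.
have xa : x - a != 0 by rewrite subr_eq0 H ?inE ?eqxx.
rewrite horner_prod hornerXsubC.
under eq_bigr do rewrite hornerXsubC.
by field.
Qed.

Variable beta : nat -> C.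

(* Moore's recursion for the F_q-linear polynomial with linear term X whose kernel is
   spanned by beta 0, ..., beta (d - 1). *)
Fixpoint lpoly d : {poly C} :=
  if d is e.+1 then lpoly e - ((lpoly e).[beta e] ^+ q.-1)^-1 *: lpoly e ^+ q else 'X.

Definition lcomb (a : A) : C := \sum_(i < size a) iota S a`_i * beta i.

Lemma lcombE (a : A) d : (size a <= d)%N -> lcomb a = \sum_(i < d) iota S a`_i * beta i.
Proof.
move=> ad; rewrite /lcomb (big_ord_widen d (fun i => iota S a`_i * beta i))// big_mkcond/=.
apply: eq_bigr => i _; case: ltnP => // h.
by rewrite nth_default// rmorph0 mul0r.
Qed.

Lemma lcombB (a b : A) : lcomb (a - b) = lcomb a - lcomb b.
Proof.
pose d := maxn (size a) (size b).
have sd : (size (a - b)%R <= d)%N by rewrite (leq_trans (size_polyD _ _))// size_polyN.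
rewrite (lcombE sd) (@lcombE a d) ?leq_maxl// (@lcombE b d) ?leq_maxr// -sumrB.
by apply: eq_bigr => i _; rewrite coefB rmorphB mulrBl.
Qed.

Lemma lcomb0 : lcomb 0 = 0.
Proof. by rewrite /lcomb size_poly0 big_ord0. Qed.

Lemma lpolyS d x : (lpoly d.+1).[x] =
  (lpoly d).[x] - (lpoly d).[x] ^+ q / (lpoly d).[beta d] ^+ q.-1.
Proof. by rewrite /= !hornerE mulrC. Qed.

Lemma lpolyD d x y : (lpoly d).[x + y] = (lpoly d).[x] + (lpoly d).[y].
Proof.
elim: d => [|d IH]; first by rewrite !hornerE.
by rewrite !lpolyS IH frobD; ring.
Qed.

Lemma lpoly_at0 d : (lpoly d).[0] = 0.
Proof. by apply: (addrI (lpoly d).[0]); rewrite -lpolyD !addr0. Qed.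

Lemma lpolyN d x : (lpoly d).[- x] = - (lpoly d).[x].
Proof. by apply/eqP; rewrite -addr_eq0 -lpolyD addNr lpoly_at0. Qed.

Lemma lpolyB d x y : (lpoly d).[x - y] = (lpoly d).[x] - (lpoly d).[y].
Proof. by rewrite lpolyD lpolyN. Qed.

Lemma lpolyZ d c x : (lpoly d).[iota S c * x] = iota S c * (lpoly d).[x].
Proof.
elim: d => [|d IH]; first by rewrite !hornerE.
by rewrite !lpolyS IH exprMn frob_iota; ring.
Qed.

(** The correction in each step of the recursion is a q-th power, whose derivative vanishes since q
    = 0 in C. *)
Lemma deriv_lpoly d : (lpoly d)^`() = 1.
Proof.
elim: d => [|d IH] /=; first exact: derivX.
rewrite derivB derivZ deriv_exp IH -mulr_natr.
have -> : (q%:R : {poly C}) = 0 by rewrite -polyC_natr natq0.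
by rewrite mulr0 scaler0 subr0.
Qed.

Hypothesis indep : forall a : A, lcomb a = 0 -> a = 0.

Lemma lcomb_inj : injective lcomb.
Proof.
by move=> a b ab; apply/eqP; rewrite -subr_eq0; apply/eqP/indep; rewrite lcombB ab subrr.
Qed.

Lemma lcomb_eq0 a : (lcomb a == 0) = (a == 0).
Proof. by apply/eqP/eqP => [/indep//|->]; exact: lcomb0. Qed.

(** The three facts are proved together: nonvanishing at [beta d] makes the next step of the
    recursion meaningful and fixes its degree, and degree and roots in turn give the next
    nonvanishing. *)
Lemma lpoly_props d :
  [/\ size (lpoly d) = (q ^ d).+1, forall a : A, (size a <= d)%N -> (lpoly d).[lcomb a] = 0
    & (lpoly d).[beta d] != 0].
Proof.
elim: d => [|d [sd rd bd]].
  split=> /=; first by rewrite size_polyX.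
    by move=> a; rewrite leqn0 size_poly_eq0 => /eqP ->; rewrite lcomb0 hornerX.
  rewrite hornerX; have : lcomb 1 != 0 by rewrite lcomb_eq0 oner_eq0.
  by rewrite /lcomb size_poly1 big_ord1 coef1 rmorph1 mul1r.
have sz : size (lpoly d.+1) = (q ^ d.+1).+1.
  have l0 : lpoly d != 0 by rewrite -size_poly_eq0 sd.
  have sE : size (lpoly d ^+ q) = (q ^ d.+1).+1.
    by rewrite -[LHS]prednK ?size_poly_gt0 ?expf_neq0// size_exp sd /= expnSr.
  have sZ : size (- (((lpoly d).[beta d] ^+ q.-1)^-1 *: lpoly d ^+ q)) = (q ^ d.+1).+1.
    by rewrite size_polyN size_scale// invr_eq0 expf_neq0.
  rewrite /= addrC size_polyDl sZ// sd ltnS expnS ltn_Pmull ?q_gt1// expn_gt0 q_gt0//.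
have rt (a : A) : (size a <= d.+1)%N -> (lpoly d.+1).[lcomb a] = 0.
  move=> ad; rewrite lpolyS (lcombE ad) big_ord_recr/=.
  pose b : A := \poly_(i < d) a`_i.
  have -> : \sum_(i < d) iota S a`_i * beta i = lcomb b.
    rewrite (@lcombE b d) ?size_poly//; apply: eq_bigr => i _.
    by rewrite coef_poly ltn_ord.
  rewrite lpolyD rd ?size_poly// add0r lpolyZ exprMn frob_iota -mulrA.
  by rewrite -[in (lpoly d).[_] ^+ q](qS F) exprS mulfK ?expf_neq0// subrr.
(* Otherwise the polynomial of degree q^(d+1) would have the q^(d+1) combinations as roots and, in
   addition, [beta d.+1], which independence keeps apart from them. *)
split=> //; apply/eqP => b0.
have uq : uniq (beta d.+1 :: map lcomb (polys F d.+1)).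
  rewrite /= map_inj_uniq ?uniq_polys ?andbT; last exact: lcomb_inj.
  apply/mapP => -[/= a]; rewrite mem_polys => ad E.
  have : lcomb ('X^(d.+1) - a : A) = 0.
    rewrite lcombB -E (@lcombE 'X^(d.+1) d.+2) ?size_polyXn// (bigD1 ord_max)//= coefXn eqxx.
    rewrite rmorph1 mul1r big1 ?addr0 ?subrr// => i ni; rewrite coefXn.
    by rewrite [_ == _](_ : _ = false) ?rmorph0 ?mul0r//; apply/negbTE.
  move=> /indep/eqP; rewrite subr_eq0 => /eqP E'.
  by move: ad; rewrite -E' size_polyXn ltnn.
have lN0 : lpoly d.+1 != 0 by rewrite -size_poly_eq0 sz.
have /max_poly_roots := lN0 => /(_ _ _ uq); rewrite sz /= size_map size_polys ltnS ltnn.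
move=> H; suff : false by []; apply: H; rewrite /root b0 eqxx /=.
apply/allP => b /mapP[a]; rewrite mem_polys => ad ->.
by rewrite /root rt.
Qed.

Lemma lpoly_beta_neq0 d : (lpoly d).[beta d] != 0.
Proof. by case: (lpoly_props d). Qed.

Lemma lpoly_roots d : lpoly d =
  lead_coef (lpoly d) *: \prod_(b <- map lcomb (polys F d)) ('X - b%:P).
Proof.
have [sd rd _] := lpoly_props d; apply: all_roots_prod_XsubC.
- by rewrite size_map size_polys sd.
- by apply/allP => b /mapP[a]; rewrite mem_polys => ad ->; rewrite /root rd.
- by rewrite uniq_rootsE map_inj_uniq ?uniq_polys//; exact: lcomb_inj.
Qed.

Lemma lead_lpoly_neq0 d : lead_coef (lpoly d) != 0.
Proof. by rewrite lead_coef_eq0 -size_poly_eq0; case: (lpoly_props d) => ->. Qed.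

Lemma lpoly_prod d x : (lpoly d).[x] =
  lead_coef (lpoly d) * \prod_(a <- polys F d) (x - lcomb a).
Proof.
rewrite [in LHS]lpoly_roots hornerZ horner_prod big_map; congr (_ * _).
by apply: eq_bigr => a _; rewrite hornerXsubC.
Qed.

Lemma lpoly_eq0 d x : (lpoly d).[x] = 0 -> exists2 a : A, (size a <= d)%N & x = lcomb a.
Proof.
move/eqP; rewrite lpoly_prod mulf_eq0 (negPf (lead_lpoly_neq0 _))/= prodf_seq_eq0.
case/hasP => a; rewrite mem_polys => ad /=; rewrite subr_eq0 => /eqP ->.
by exists a.
Qed.

(** The left side is the logarithmic derivative of [lpoly d], whose derivative is 1. *)
Lemma lpoly_sum_inv d x : (lpoly d).[x] != 0 ->
  \sum_(a <- polys F d) (x - lcomb a)^-1 = ((lpoly d).[x])^-1.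
Proof.
move=> x0; have l0 := lead_lpoly_neq0 d.
have := congr1 (fun p : {poly C} => p^`().[x]) (lpoly_roots d); rewrite deriv_lpoly hornerC.
rewrite derivZ hornerZ sum_inv_roots => [|_ /mapP[a ad ->]]; last first.
  apply: contraNneq x0 => ->; have [_ -> //] := lpoly_props d; by rewrite -mem_polys.
move=> E; apply: (mulfI x0); rewrite divff// lpoly_prod -mulrA [RHS]E.
by rewrite !big_map.
Qed.

Lemma lpoly_prod1 d x : (lpoly d).[x] =
  x * \prod_(a <- polys F d | a != 0) (1 - x / lcomb a).
Proof.
have l0 := lead_lpoly_neq0 d.
have in0 : 0 \in polys F d by rewrite mem_polys size_poly0.
have nz a : a != 0 -> lcomb a != 0 by rewrite lcomb_eq0.
pose Q := lead_coef (lpoly d) *: \prod_(a <- polys F d | a != 0) ('X - (lcomb a)%:P).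
have QE : lpoly d = 'X * Q.
  rewrite /Q -scalerAr [in LHS]lpoly_roots big_map (bigD1_seq 0)//= ?uniq_polys//.
  by rewrite lcomb0 subr0.
have Q0 : Q.[0] = 1.
  have := congr1 (fun p : {poly C} => p.[0]) (deriv_lpoly d).
  by rewrite QE derivM derivX !hornerE.
rewrite QE hornerM hornerX; congr (x * _).
rewrite -[LHS]mulr1 -[X in _ * X]invr1 -[X in X^-1]Q0 /Q !hornerZ !horner_prod invfM mulrACA divff// mul1r.
rewrite -prodfV -big_split/=; apply: eq_bigr => a a0.
by rewrite !hornerXsubC sub0r invrN mulrN -mulNr opprB mulrBl divff ?nz.
Qed.

(** Additivity turns the product over a translate of the root space into a single factor; this is
    how a product over A + zA collapses to a product over multiples of z. *)
Lemma lpoly_translate d x y : (lpoly d).[y] != 0 ->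
  \prod_(a <- polys F d) (1 - x / (y - lcomb a)) = 1 - (lpoly d).[x] / (lpoly d).[y].
Proof.
move=> y0; have -> : 1 - (lpoly d).[x] / (lpoly d).[y] = (lpoly d).[y - x] / (lpoly d).[y].
  by rewrite lpolyB; field.
rewrite !lpoly_prod -mulf_div divff ?lead_lpoly_neq0// mul1r -prodfV -big_split/=.
rewrite !big_seq; apply: eq_bigr => a; rewrite mem_polys => ad.
suff ya : y - lcomb a != 0 by field.
apply: contraNneq y0 => /eqP; rewrite subr_eq0 => /eqP ->.
by have [_ ->] := lpoly_props d.
Qed.

End LinearPolys.

Section SubBox.
Variables (T : choiceType) (P : pred T).

Definition subbox (s : seq T) : {fset {x | P x}} :=
  [fset x | x in pmap (insub : T -> option {x | P x}) s]%fset.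

Lemma mem_subbox s (i : {x | P x}) : (i \in subbox s) = (val i \in s).
Proof. by rewrite !inE /= mem_pmap_sub. Qed.

Lemma big_subbox (U : Type) (idx : U) (op : Monoid.com_law idx) s (f : T -> U) : uniq s ->
  \big[op/idx]_(i <- subbox s) f (val i) = \big[op/idx]_(x <- s | P x) f x.
Proof.
move=> us; transitivity (\big[op/idx]_(i <- pmap (insub : T -> option {x | P x}) s) f (val i)).
  apply: perm_big; apply: uniq_perm; rewrite ?fset_uniq ?pmap_sub_uniq//.
  by move=> i; rewrite mem_subbox mem_pmap_sub.
elim: s {us} => [|x s IH]; first by rewrite !big_nil.
rewrite big_cons -IH /=; case: ifPn => Px; first by rewrite insubT big_cons.
by rewrite insubN.
Qed.

End SubBox.

Section ExpA.
Variables (R : realType) (F : finFieldType) (S : setting R F).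
Notation C := (Cinf S).
Notation q := #|F|.
Notation A := {poly F}.
Notation th := (theta S).
Notation ev := (polyev (iota S) th).
Notation r := (q%:R^-1 : R).

Lemma lcomb_th a : lcomb (fun i => th ^+ i) a = ev a.
Proof. by rewrite /lcomb (evE S (leqnn _)). Qed.

Lemma indep_th a : lcomb (fun i => th ^+ i) a = 0 -> a = 0.
Proof. by rewrite lcomb_th => /eqP; rewrite ev_eq0 => /eqP. Qed.

Definition nA d (x : C) := (lpoly (fun i => th ^+ i) d).[x].

Lemma nA_prod d x : nA d x = x * \prod_(a <- polys F d | a != 0) (1 - x / ev a).
Proof.
rewrite /nA (lpoly_prod1 indep_th); congr (x * _).
by apply: eq_bigr => a _; rewrite lcomb_th.
Qed.

(* The exponential of the lattice A, so that e_Car (pi * x) = pi * eA x. *)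
Definition eA (x : C) : C := x * unordered_prod (fun a : {a : A | a != 0} => 1 - x / ev (val a)).

Lemma eA_box (K : R) : 0 <= K -> exists2 B, 0 <= B & forall x, absv x <= K ->
  forall d, absv (nA d x) <= B /\ absv (eA x - nA d x) <= B * r ^+ d.
Proof.
move=> K0; pose N (a : {a : A | a != 0}) := (size (val a)).-1.
pose box d := subbox (fun a : A => a != 0) (polys F d).
have boxP i d : (i \in box d) = (N i < d)%N.
  rewrite mem_subbox mem_polys /N -ltnS prednK// size_poly_gt0.
  exact: (valP i).
have [B B0 BP] := uprod_box S boxP (qV01 R F) K0.
exists (K * B); first exact: mulr_ge0.
move=> x xK d; have [||h1 h2] := BP (fun a => 1 - x / ev (val a)) _ d (box d).
- move=> a; rewrite addrAC subrr add0r absvN absv_div (absv_ev S (valP a)) -exprVn.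
  by rewrite ler_wpM2r// exprn_ge0// invr_ge0 ltW// qR_gt0.
- exact: fsubset_refl.
have E : nA d x = x * \prod_(i <- box d) (1 - x / ev (val i)).
  by rewrite nA_prod (@big_subbox _ _ _ _ _ (polys F d) (fun a : A => 1 - x / ev a)) ?uniq_polys.
split; first by rewrite E absvM ler_pM ?absv_ge0.
by rewrite E /eA -mulrBr absvM -mulrA ler_pM ?absv_ge0.
Qed.

Lemma lims_nA x : lims (fun d => nA d x) (eA x).
Proof.
have [B B0 /(_ x (lexx _)) BP] := eA_box (absv_ge0 x).
have r01 : 0 <= r < 1 by case/andP: (@qV01 R F) => /ltW -> ->.
rewrite -[eA x]add0r; apply: (@lims_ext _ _ _ (fun d => (nA d x - eA x) + eA x)).
  by move=> d; rewrite subrK.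
apply: limsD (lims_cst _); apply: (lims_scale_geom (M := B) r01) => d.
by rewrite absv_subC; case: (BP d).
Qed.

Lemma eAD x y : eA (x + y) = eA x + eA y.
Proof.
apply: lims_unique (lims_nA _) _; apply: lims_ext (limsD (lims_nA x) (lims_nA y)) => d.
by rewrite /nA lpolyD.
Qed.

Lemma eAZ c x : eA (iota S c * x) = iota S c * eA x.
Proof.
apply: lims_unique (lims_nA _) _; apply: lims_ext (limsZ (iota S c) (lims_nA x)) => d.
by rewrite /nA lpolyZ.
Qed.

Lemma eA0 : eA 0 = 0. Proof. by rewrite /eA mul0r. Qed.

Lemma nA_ev d (a : A) : (size a <= d)%N -> nA d (ev a) = 0.
Proof. by move=> ad; rewrite /nA -lcomb_th; have [_ ->] := lpoly_props indep_th d. Qed.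

Lemma eA_ev (a : A) : eA (ev a) = 0.
Proof.
apply: lims_unique (lims_nA _) _; apply: (lims_eq (N := size a) _ (lims_cst 0)) => d ad.
by rewrite nA_ev.
Qed.

(** The additional factors 1 - x/a have |x| < |a|, hence absolute value 1. *)
Lemma nA_stable d D x : (d <= D)%N -> absv x < q%:R ^+ d -> absv (nA D x) = absv (nA d x).
Proof.
move=> dD xd; rewrite !nA_prod !absvM; congr (_ * _).
rewrite (bigID (fun a : A => size a <= d)%N) /= absvM [X in _ * X](_ : _ = 1) ?mulr1; last first.
  rewrite absv_prod big1// => a /andP[a0]; rewrite -ltnNge => da.
  rewrite absvBl absv1// absv_div ltr_pdivrMr ?absv_gt0 ?ev_eq0// mul1r absv_ev//.
  by rewrite (lt_le_trans xd)// ler_weXn2l ?qR_ge1// -ltnS prednK// size_poly_gt0.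
congr absv; rewrite -[LHS]big_filter -[RHS]big_filter; apply: perm_big; apply: uniq_perm.
- by rewrite filter_uniq// uniq_polys.
- by rewrite filter_uniq// uniq_polys.
move=> a; rewrite !mem_filter !mem_polys -andbA; congr (_ && _).
by apply/andP/idP => [[]//|ad]; split=> //; exact: leq_trans dD.
Qed.

Lemma eA_abs d x : absv x < q%:R ^+ d -> absv (eA x) = absv (nA d x).
Proof.
move=> xd; have [e0|e0] := eqVneq (eA x) 0.
  have [n0|] := eqVneq (nA d x) 0; first by rewrite e0 n0.
  rewrite -absv_gt0 => n0; have [N NP] := lims_nA x n0.
  have := NP (maxn N d) (leq_maxl _ _); rewrite e0 subr0 (nA_stable _ xd) ?leq_maxr//.
  by rewrite ltxx.
have [N NP] := lims_absv (lims_nA x) e0.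
by rewrite -(NP (maxn N d)) ?leq_maxl// (nA_stable _ xd)// leq_maxr.
Qed.

Lemma expq_gt (M : R) : exists n, M < q%:R ^+ n.
Proof.
have [n nP] := expq_unbounded F M; exists n.+1; rewrite (le_lt_trans nP)//.
by rewrite ltr_eXn2l ?qR_gt1.
Qed.

Lemma eA_eq0 x : eA x = 0 -> exists a, x = ev a.
Proof.
move=> e0; have [d xd] := expq_gt (absv x).
have /eqP : absv (nA d x) = 0 by rewrite -(eA_abs xd) e0 absv0.
rewrite absv_eq0 => /eqP /(lpoly_eq0 indep_th)[a _ ->].
by exists a; rewrite lcomb_th.
Qed.

Lemma eA_small x : absv x < 1 -> absv (eA x) = absv x.
Proof.
by move=> x1; rewrite (@eA_abs 0)// /nA /= hornerX.
Qed.

Lemma eA_tangent x : absv x < 1 -> absv (eA x - x) <= absv x ^+ 2.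
Proof.
move=> x1; apply: (lims_le (N := 0) (limsB (lims_nA x) (lims_cst x))) => d _.
rewrite nA_prod -[X in _ - X]mulr1 -mulrBr absvM expr2 ler_wpM2l ?absv_ge0//.
apply: absv_prodB1; first by rewrite absv_ge0 ltW.
move=> a a0; rewrite addrAC subrr add0r absvN absv_div ler_pdivrMr.
  by rewrite ler_peMr ?absv_ge0 ?absv_ev_ge1.
by rewrite absv_gt0 ev_eq0.
Qed.

Let delta d := (nA d (th ^+ d) ^+ q.-1)^-1.

Let nAS d x : nA d.+1 x = nA d x - delta d * nA d x ^+ q.
Proof. by rewrite /nA lpolyS mulrC. Qed.

Let nAth d : nA d (th ^+ d) != 0.
Proof. exact: lpoly_beta_neq0 indep_th d. Qed.

Let kap := fix kap d := if d is e.+1 then kap e - delta e.+1 * (th ^+ q - th) else th - th ^+ q.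

(** Finite-level version of the functional equation of the Carlitz module; [eA_rec] is its limit. *)
Let nA_rec d x : nA d.+1 (th * x) = th * nA d.+1 x + kap d * nA d x ^+ q.
Proof.
elim: d x => [|d IH] x.
  rewrite !nAS /nA /= !hornerX /delta /nA /= hornerX expr0 expr1n invr1 exprMn; ring.
(* The induction hypothesis at theta^d, a zero of [nA d.+1], expresses nA_(d+1)(theta^(d+1)) through
   nA_d(theta^d), and so relates the two consecutive [delta]. *)
have dE : delta d.+1 * kap d ^+ q = kap d * delta d ^+ q.
  have := IH (th ^+ d); rewrite -exprS.
  have -> : nA d.+1 (th ^+ d) = 0 by rewrite -evXn nA_ev// size_polyXn.
  rewrite mulr0 add0r => E; have := nAth d.+1; rewrite E mulf_eq0 negb_or => /andP[k0 _].
  have kq : kap d ^+ q = kap d * kap d ^+ q.-1 by rewrite -exprS qS.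
  rewrite /delta E exprMn kq exprVn -!exprM [(q * _)%N]mulnC; field.
  by rewrite !expf_neq0.
rewrite nAS IH frobD exprMn [nA d.+2 x]nAS.
have -> : (kap d * nA d x ^+ q) ^+ q = kap d ^+ q * (nA d x ^+ q) ^+ q by rewrite exprMn.
rewrite !mulrDr [delta d.+1 * (kap d ^+ q * _)]mulrA dE /=.
have -> : nA d.+1 x ^+ q = nA d x ^+ q - delta d ^+ q * (nA d x ^+ q) ^+ q.
  by rewrite nAS frobB exprMn.
ring.
Qed.

(** The limit of [kap]; its value is forced by the functional equation at 1/theta, because e_A
    vanishes at 1. *)
Definition kapA : C := - (th / eA th^-1 ^+ q.-1).

Lemma absv_thV : absv th^-1 < 1.
Proof. by rewrite absvV abs_theta; case/andP: (@qV01 R F). Qed.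

Lemma eA_thV : absv (eA th^-1) = r.
Proof. by rewrite eA_small ?absv_thV// absvV abs_theta. Qed.

Lemma eA_thV_neq0 : eA th^-1 != 0.
Proof. by rewrite -absv_gt0 eA_thV; case/andP: (@qV01 R F). Qed.

Lemma eA_rec x : eA (th * x) = th * eA x + kapA * eA x ^+ q.
Proof.
have e0 := eA_thV_neq0.
have kl : lims kap kapA.
  have eq0 : eA th^-1 ^+ q != 0 by rewrite expf_neq0.
  have -> : kapA = (eA (th * th^-1) - th * eA th^-1) / eA th^-1 ^+ q.
    rewrite divff ?th_neq0// -ev1 eA_ev sub0r /kapA -{2}(qS F) exprS mulNr.
    by congr (- _); field; rewrite e0 expf_neq0.
  have [N NP] := lims_absv (lims_nA th^-1) e0.
  have H1 := limsV (limsX q (lims_nA th^-1)) eq0.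
  have H2 := lims_sub (s := succn) (fun=> leqnSn _) (limsB (lims_nA (th * th^-1)) (limsZ th (lims_nA th^-1))).
  apply: (lims_eq (N := N) _ (limsM H2 H1)) => d Nd /=.
  rewrite nA_rec addrAC subrr add0r mulfK// expf_neq0// -absv_gt0 NP//.
  by rewrite absv_gt0.
apply: lims_unique (lims_sub (s := succn) (fun=> leqnSn _) (lims_nA _)) _.
have H := lims_sub (s := succn) (fun=> leqnSn _) (limsZ th (lims_nA x)).
apply: lims_ext (limsD H (limsM kl (limsX q (lims_nA x)))) => d /=.
by rewrite nA_rec.
Qed.

Lemma absv_kapA : absv kapA = q%:R ^+ q.
Proof.
by rewrite absvN absv_div absvX eA_thV exprVn invrK abs_theta -exprS qS.
Qed.

Lemma kapA_neq0 : kapA != 0.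
Proof. by rewrite -absv_gt0 absv_kapA qRX_gt0. Qed.

End ExpA.

(** * The Carlitz exponential and its period *)

Section Carlitz.
Variables (R : realType) (F : finFieldType) (S : setting R F).
Notation C := (Cinf S).
Notation q := #|F|.
Notation A := {poly F}.
Notation th := (theta S).
Notation ev := (polyev (iota S) th).
Notation r := (q%:R^-1 : R).
Notation eA := (@eA R F S).
Notation e_Car := (@e_Car R F S).

(** Near 0 the difference is multiplied in absolute value by exactly q when its argument is
    multiplied by theta, while tangency makes it quadratically small. Hence |dl(x)| = q^n
    |dl(x/theta^n)| tends to 0, and vanishing near 0 spreads to all x by the functional equation. *)
Lemma carlitz_uniq (f1 f2 : C -> C) (c e : R) : 0 < e ->
  (forall x, f1 (th * x) = th * f1 x + f1 x ^+ q) ->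
  (forall x, f2 (th * x) = th * f2 x + f2 x ^+ q) ->
  (forall x, absv x < e -> absv (f1 x - x) <= c * absv x ^+ 2) ->
  (forall x, absv x < e -> absv (f2 x - x) <= c * absv x ^+ 2) ->
  f1 =1 f2.
Proof.
move=> e0 H1 H2 T1 T2; pose dl x := f1 x - f2 x.
have dlR x : dl (th * x) = th * dl x + dl x ^+ q.
  by rewrite /dl H1 H2 frobB; ring.
have dlT x : absv x < e -> absv (dl x) <= c * absv x ^+ 2.
  move=> xe; have -> : dl x = (f1 x - x) - (f2 x - x) by rewrite /dl; ring.
  by rewrite absvB_le ?T1 ?T2.
have c0 : 0 <= c.
  have [t /andP[t0 te]] := small_elt S e0.
  have := le_trans (absv_ge0 _) (dlT t te); rewrite pmulr_lge0// exprn_gt0//.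
have grow x : absv (dl x) <= 1 -> absv (dl (th * x)) = q%:R * absv (dl x).
  move=> h; rewrite dlR; have [->|d0] := eqVneq (dl x) 0.
    by rewrite mulr0 expr0n eqn0Ngt q_gt0 addr0 absv0 mulr0.
  have Eq : absv (dl x) ^+ q = absv (dl x) ^+ q.-1 * absv (dl x) by rewrite -exprSr qS.
  rewrite absvDl absvM abs_theta// absvX Eq ltr_pM2r ?absv_gt0//.
  by rewrite (le_lt_trans _ (qR_gt1 R F))// exprn_ile1// absv_ge0.
pose e1 := Num.min (Num.min e 1) (c + 1)^-1.
have e10 : 0 < e1 by rewrite !lt_min e0 ltr01 invr_gt0 ltr_wpDl.
have shrink x : absv (x / th) < e1 -> absv x < e1 -> absv (dl x) = q%:R * absv (dl (x / th)).
  move=> h _; rewrite -grow ?[th * _]mulrC ?mulfVK ?th_neq0//.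
  move: h; rewrite !lt_min => /andP[/andP[h1 h2] h3].
  rewrite (le_trans (dlT _ h1))// (@le_trans _ _ ((c + 1) * absv (x / th)))//.
    rewrite expr2 mulrA ler_wpM2r ?absv_ge0// (@le_trans _ _ c)// ?lerDl//.
    by rewrite ler_piMr// ltW.
  by rewrite mulrC -ler_pdivlMr ?ltr_wpDl// mul1r ltW.
have zsmall x : absv x < e1 -> dl x = 0.
  move=> xe; have xn n : absv (x / th ^+ n) < e1.
    rewrite absv_div absv_thX (le_lt_trans _ xe)// ler_pdivrMr ?qRX_gt0//.
    by rewrite ler_peMr ?absv_ge0// qRX_ge1.
  have En n : absv (dl x) = q%:R ^+ n * absv (dl (x / th ^+ n)).
    elim: n => [|n IH]; first by rewrite expr0 divr1 mul1r.
    have E : x / th ^+ n / th = x / th ^+ n.+1.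
      by rewrite exprSr; field; rewrite th_neq0 thX_neq0.
    by rewrite IH shrink ?E// [in RHS]exprSr mulrA.
  apply/eqP; rewrite -absv_eq0; apply/eqP/le_anti; rewrite absv_ge0 andbT.
  apply/ler_addgt0Pl => d d0; rewrite addr0.
  have [|N /(_ N (leqnn N)) NP] := @geom_lt _ r (d / (c + 1)) _ (divr_gt0 d0 (ltr_wpDl c0 ltr01)).
    by case/andP: (@qV01 R F) => /ltW -> ->.
  have xN : absv (x / th ^+ N) <= r ^+ N.
    rewrite absv_div absv_thX exprVn ler_piMl ?invr_ge0 ?exprn_ge0 ?ler0n//.
    by move: xe; rewrite !lt_min => /andP[/andP[_ /ltW]].
  have h : absv (dl (x / th ^+ N)) <= c * (r ^+ N) ^+ 2.
    have := dlT (x / th ^+ N); have := xn N; rewrite !lt_min => /andP[/andP[-> _] _] /(_ isT).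
    move=> /le_trans; apply; rewrite ler_wpM2l//.
    by apply: lerXn2r => //; rewrite nnegrE ?absv_ge0 ?exprn_ge0 ?invr_ge0 ?ler0n.
  rewrite (En N) (le_trans (ler_wpM2l (ltW (qRX_gt0 R F N)) h))//.
  have -> : q%:R ^+ N * (c * (r ^+ N) ^+ 2) = c * r ^+ N.
    by rewrite exprVn; field; rewrite gt_eqF ?qRX_gt0.
  have r0 : 0 <= r ^+ N by rewrite exprn_ge0 ?invr_ge0 ?ler0n.
  rewrite (@le_trans _ _ ((c + 1) * r ^+ N))//; first by rewrite ler_wpM2r// lerDl.
  by rewrite mulrC -ler_pdivlMr ?ltr_wpDl// ltW.
have step x : dl x = 0 -> dl (th * x) = 0.
  by move=> h; rewrite dlR h mulr0 expr0n eqn0Ngt q_gt0 addr0.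
move=> x; apply/eqP; rewrite -subr_eq0; apply/eqP; rewrite -/(dl x).
have [n nP] := expq_gt F (absv x / e1).
have xn : absv (x / th ^+ n) < e1.
  by rewrite absv_div absv_thX ltr_pdivrMr ?qRX_gt0// mulrC -ltr_pdivrMr.
have -> : x = th ^+ n * (x / th ^+ n) by field; exact: thX_neq0.
elim: n {nP xn} (x / th ^+ n) (zsmall _ xn) => [|n IH] y y0; first by rewrite mul1r.
by rewrite exprS -mulrA; apply/step/IH.
Qed.

Lemma carlitz_d0 : carlitz_d S 0 = 1.
Proof. by rewrite /carlitz_d big_ord0. Qed.

Lemma carlitz_dS i : carlitz_d S i.+1 = carlitz_bracket S i.+1 * carlitz_d S i ^+ q.
Proof.
rewrite /carlitz_d big_ord_recl subn0 expr1; congr (_ * _).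
rewrite (big_morph (fun x : C => x ^+ q) (id1 := 1) (op1 := *%R)); last 2 first.
- by move=> x y; rewrite exprMn.
- by rewrite expr1n.
by apply: eq_bigr => j _; rewrite /= /bump/= add1n subSS expnSr exprM.
Qed.

Lemma absv_bracket i : absv (carlitz_bracket S i.+1) = q%:R ^+ (q ^ i.+1).
Proof.
rewrite /carlitz_bracket absvBl absv_thX// abs_theta -{1}[q%:R]expr1.
by rewrite ltr_eXn2l ?qR_gt1// (leq_trans (q_gt1 F))// -{1}[q]expn1 leq_exp2l ?q_gt1.
Qed.

Lemma absv_carlitz_d i : absv (carlitz_d S i) = q%:R ^+ (i * q ^ i).
Proof.
elim: i => [|i IH]; first by rewrite carlitz_d0 absv1.
rewrite carlitz_dS absvM absv_bracket absvX IH -exprM -exprD; congr (_ ^+ _).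
by rewrite -mulnA -expnSr mulSn.
Qed.

Lemma carlitz_d_neq0 i : carlitz_d S i != 0.
Proof. by rewrite -absv_gt0 absv_carlitz_d qRX_gt0. Qed.

Let tm (z : C) i := z ^+ (q ^ i) / carlitz_d S i.

Let tm_abs z i : absv (tm z i) = (absv z / q%:R ^+ i) ^+ (q ^ i).
Proof. by rewrite /tm absv_div absvX absv_carlitz_d expr_div_n -exprM. Qed.

Lemma e_CarP z : lims (series (tm z)) (e_Car z).
Proof.
have [|l ll] := @lims_series _ _ S (tm z); last by rewrite /e_Car (lims_limn ll).
have [n nP] := expq_gt F (absv z).
apply: (lims_le0 (g := fun i => (absv z / q%:R ^+ i) ^+ (q ^ i))) => [i|e e0].
  by rewrite tm_abs.
have [|N NP] := @geom_lt _ r e _ e0; first by case/andP: (@qV01 R F) => /ltW -> ->.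
exists (maxn n.+1 N) => m; rewrite geq_max => /andP[nm Nm].
have h : absv z / q%:R ^+ m <= r.
  case: m nm {Nm} => // m; rewrite ltnS => nm.
  rewrite ler_pdivrMr ?qRX_gt0// exprS mulKf ?gt_eqF ?qR_gt0// (le_trans (ltW nP))//.
  by rewrite ler_weXn2l ?qR_ge1.
apply: le_lt_trans (NP _ Nm).
rewrite (@le_trans _ _ (r ^+ (q ^ m)))//.
  by apply: lerXn2r => //; rewrite nnegrE ?divr_ge0 ?absv_ge0 ?exprn_ge0 ?invr_ge0 ?ler0n.
by rewrite ler_wiXn2l ?invr_ge0 ?ler0n ?invf_le1 ?qR_ge1 ?qR_gt0// ltnW// ltn_expl ?q_gt1.
Qed.

Lemma e_Car_rec z : e_Car (th * z) = th * e_Car z + e_Car z ^+ q.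
Proof.
apply: (lims_unique (e_CarP (th * z))); apply: limsS.
have H1 := limsZ th (lims_sub (s := succn) (fun=> leqnSn _) (e_CarP z)).
apply: lims_ext (limsD H1 (limsX q (e_CarP z))) => n.
rewrite /series/= frob_sum big_nat_recl//= [in RHS]big_nat_recl//= mulrDr -addrA; congr (_ + _).
  by rewrite /tm !expr1 carlitz_d0 !divr1.
rewrite mulr_sumr -big_split/=; apply: eq_bigr => i _.
rewrite /tm !exprMn carlitz_dS exprVn -exprM -expnSr; have d0 := carlitz_d_neq0 i.
have b0 : carlitz_bracket S i.+1 != 0 by rewrite -absv_gt0 absv_bracket qRX_gt0.
have -> : th ^+ (q ^ i.+1) = carlitz_bracket S i.+1 + th by rewrite /carlitz_bracket subrK.
by field; rewrite b0 expf_neq0.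
Qed.

Lemma e_Car_tangent z : absv z < 1 -> absv (e_Car z - z) <= absv z ^+ 2.
Proof.
move=> z1; have := lims_series_tail (n := 1) (B := absv z ^+ 2) (e_CarP z).
rewrite /series/= big_nat1 /tm expr1 carlitz_d0 divr1; apply => -[//|i] _.
rewrite tm_abs (@le_trans _ _ (absv z ^+ (q ^ i.+1)))//.
  apply: lerXn2r; rewrite ?nnegrE ?divr_ge0 ?absv_ge0 ?exprn_ge0 ?ler0n//.
  by rewrite ler_pdivrMr ?qRX_gt0// ler_peMr ?absv_ge0 ?qRX_ge1.
rewrite ler_wiXn2l ?absv_ge0 ?(ltW z1)// (leq_trans (q_gt1 F))//.
by rewrite -{1}[q]expn1 leq_exp2l ?q_gt1.
Qed.

(** With w^(q-1) = [kapA], the rescaled function w e_A(z/w) satisfies the functional equation of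
    [e_Car], and uniqueness applies. *)
Lemma carlitz_root : exists2 w : C, w != 0 & forall z, e_Car (w * z) = w * eA z.
Proof.
have q1 := q1_gt0 F.
have /closed_rootP[w] : size ('X^(q.-1) - (kapA S)%:P : {poly C}) != 1%N by rewrite size_XnsubC// eqSS -lt0n.
rewrite /root !hornerE subr_eq0 => /eqP wk.
have w0 : w != 0.
  apply: contraNneq (kapA_neq0 S) => E; rewrite -wk E expr0n.
  by rewrite eqn0Ngt q1.
have wp : 0 < absv w by rewrite absv_gt0.
exists w => //.
have H : e_Car =1 (fun z => w * eA (z / w)).
  apply: (@carlitz_uniq _ _ (Num.max 1 (absv w)^-1) (Num.min 1 (absv w))).
  - by rewrite lt_min ltr01.
  - exact: e_Car_rec.
  - have wq : w ^+ q = w * kapA S by rewrite -wk -exprS qS.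
    move=> x; have -> : (w * eA (x / w)) ^+ q = w * kapA S * eA (x / w) ^+ q.
      by rewrite -wq -exprMn.
    by rewrite -mulrA eA_rec; ring.
  - move=> x; rewrite lt_min => /andP[x1 _]; rewrite (le_trans (e_Car_tangent x1))//.
    by rewrite ler_peMl ?exprn_ge0 ?absv_ge0// le_max lexx.
  - move=> x; rewrite lt_min => /andP[_ xw].
    have h : absv (x / w) < 1 by rewrite absv_div ltr_pdivrMr// mul1r.
    have -> : w * eA (x / w) - x = w * (eA (x / w) - x / w) by field.
    rewrite absvM (le_trans (ler_wpM2l (ltW wp) (eA_tangent h)))//.
    have -> : absv w * absv (x / w) ^+ 2 = (absv w)^-1 * absv x ^+ 2.
      by rewrite absv_div; field; rewrite gt_eqF.
    by rewrite ler_wpM2r ?exprn_ge0 ?absv_ge0// le_max lexx orbT.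
by move=> z; rewrite H [w * z]mulrC mulfK.
Qed.

Variable pi : C.
Hypothesis pi_period : carlitz_period pi.

(** [pi] and the constructed period generate the same A-module, so they differ by a unit of A, that
    is a nonzero constant of F_q, for which e_A is linear. *)
Lemma e_Car_pi z : e_Car (pi * z) = pi * eA z.
Proof.
have [w w0 wP] := carlitz_root.
have [a aE] : exists a, pi = w * ev a.
  have : e_Car pi = 0 by apply/pi_period; exists 1; rewrite ev1 mulr1.
  have -> : pi = w * (pi / w) by field.
  rewrite wP => /eqP; rewrite mulf_eq0 (negPf w0)/= => /eqP /eA_eq0[a ->].
  by exists a.
have [b bE] : exists b, w = pi * ev b.
  by apply/pi_period; rewrite -[w]mulr1 wP -ev1 eA_ev mulr0.
have ab1 : ev (a * b) = ev 1.
  by apply: (mulfI w0); rewrite ev1 mulr1 evM mulrA -aE -bE.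
move: aE; have [c ->] : exists c, a = c%:P.
  have : a \is a GRing.unit by apply/unitrPr; exists b; exact: (ev_inj ab1).
  by rewrite poly_unitE => /andP[/eqP a1 _]; exists a`_0; rewrite -size1_polyC// a1.
by rewrite evC => aE; rewrite aE -mulrA wP eAZ mulrA.
Qed.

Lemma pi_neq0 : pi != 0.
Proof.
have [w w0 wP] := carlitz_root.
have [b bE] : exists b, w = pi * ev b.
  by apply/pi_period; rewrite -[w]mulr1 wP -ev1 eA_ev mulr0.
by apply: contraNneq w0 => p0; rewrite bE p0 mul0r.
Qed.

Lemma uE z : u pi z = (pi * eA z)^-1.
Proof. by rewrite /u e_Car_pi mul1r. Qed.

End Carlitz.

(** * Exponentials of the lattices A + zA *)

Section Lattice.
Variables (R : realType) (F : finFieldType) (S : setting R F).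
Notation C := (Cinf S).
Notation q := #|F|.
Notation A := {poly F}.
Notation th := (theta S).
Notation ev := (polyev (iota S) th).
Notation r := (q%:R^-1 : R).
Notation eA := (@eA R F S).
Notation I := {l : A * A | l != 0}.

Definition lat (z : C) (l : A * A) : C := ev l.1 + z * ev l.2.

Definition prs d e : seq (A * A) := [seq (b, a) | b <- polys F e, a <- polys F d].

Lemma uniq_prs d e : uniq (prs d e).
Proof. by apply: allpairs_uniq; rewrite ?uniq_polys// => -[? ?] [? ?]. Qed.

Lemma mem_prs d e l : (l \in prs d e) = (size l.1 <= e)%N && (size l.2 <= d)%N.
Proof.
case: l => b a; apply/allpairsP/andP => [[[b' a'] /= [hb ha [-> ->]]]|/= [hb ha]].
  by rewrite !mem_polys in hb ha *.
by exists (b, a); rewrite !mem_polys.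
Qed.

Let N (i : I) := (maxn (size (val i).1) (size (val i).2)).-1.
Let bx d := subbox (fun l : A * A => l != 0) (prs d d).

Let Npos (i : I) : (0 < maxn (size (val i).1) (size (val i).2))%N.
Proof.
rewrite leq_max !size_poly_gt0 -negb_and; apply: contra (valP i).
by case: (val i) => a b /= /andP[/eqP -> /eqP ->].
Qed.

Let boxP i d : (i \in bx d) = (N i < d)%N.
Proof. by rewrite mem_subbox mem_prs -geq_max -ltnS prednK. Qed.

Let termP K n z zeta (i : I) : affinoid (S := S) n z -> absv zeta <= K ->
  absv (1 - zeta / lat z (val i) - 1) <= K * q%:R ^+ (n + n) * r ^+ N i.
Proof.
move=> zn zK; rewrite addrAC subrr add0r absvN absv_div.
have := affine_lb2 (val i).2 (val i).1 zn; rewrite [_ * z]mulrC addrC -/(lat z (val i)) => h.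
have q2 : 0 < q%:R ^+ (n + n) :> R by exact: qRX_gt0.
have m0 : q%:R ^+ N i <= Num.max (absv (ev (val i).2)) (absv (ev (val i).1)).
  rewrite /N; have := Npos i; rewrite maxnE; case: (leqP (size (val i).1) (size (val i).2)) => h1.
    rewrite subnKC// => p; rewrite le_max -(absv_ev S) ?lexx//.
    by rewrite -size_poly_gt0.
  rewrite -maxnE (maxn_idPl (ltnW h1)) => p; rewrite le_max -[X in _ || (X <= _)](absv_ev S) ?lexx ?orbT//.
  by rewrite -size_poly_gt0.
have l0 : 0 < absv (lat z (val i)).
  rewrite (lt_le_trans _ h)// mulr_gt0 ?invr_gt0// (lt_le_trans _ m0)// qRX_gt0//.
rewrite ler_pdivrMr// (le_trans zK)// -mulrA -mulrA ler_peMr//.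
  exact: le_trans (absv_ge0 _) zK.
rewrite exprVn mulrAC ler_pdivlMr ?qRX_gt0// mul1r mulrC -ler_pdivrMr//.
by rewrite (le_trans _ h)// ler_wpM2r// invr_ge0 ltW.
Qed.

Definition eL d e (z zeta : C) : C := zeta * \prod_(l <- prs d e | l != 0) (1 - zeta / lat z l).

Let eL_bx d z zeta : eL d d z zeta = zeta * \prod_(i <- bx d) (1 - zeta / lat z (val i)).
Proof.
by rewrite /eL (@big_subbox _ _ _ _ _ (prs d d) (fun l => 1 - zeta / lat z l)) ?uniq_prs.
Qed.

Lemma e_lattice_abs n z zeta d : affinoid (S := S) n z ->
  absv zeta * q%:R ^+ (n + n) < q%:R ^+ d ->
  absv (e_lattice z zeta) = absv (eL d d z zeta).
Proof.
move=> zn zd; rewrite eL_bx !absvM; congr (_ * _).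
apply: (@uprod_abs _ _ S _ _ _ r boxP (qV01 R F) (absv zeta * q%:R ^+ (n + n))
  (fun i : I => 1 - zeta / lat z (val i))) => [|i|]; last 2 first.
- exact: termP.
- by rewrite exprVn ltr_pdivrMr ?qRX_gt0// mul1r.
by rewrite mulr_ge0 ?absv_ge0 ?exprn_ge0 ?ler0n.
Qed.

(** Arbitrary finite sets containing a box are allowed because a change of basis of the lattice does
    not map boxes to boxes. *)
Lemma e_lattice_net K n : 0 <= K -> exists2 B, 0 <= B & forall z zeta,
  affinoid (S := S) n z -> absv zeta <= K -> forall d (s : seq (A * A)), uniq s ->
  (forall l : A * A, (size l.1 <= d)%N -> (size l.2 <= d)%N -> l \in s) ->
  absv (zeta * \prod_(l <- s | l != 0) (1 - zeta / lat z l)) <= B /\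
  absv (e_lattice z zeta - zeta * \prod_(l <- s | l != 0) (1 - zeta / lat z l)) <= B * r ^+ d.
Proof.
move=> K0; have K1 : 0 <= K * q%:R ^+ (n + n) by rewrite mulr_ge0 ?exprn_ge0 ?ler0n.
have [B B0 BP] := uprod_box S boxP (qV01 R F) K1.
exists (K * B); first exact: mulr_ge0.
move=> z zeta zn zK d s us sP.
have [||h1 h2] := BP (fun i => 1 - zeta / lat z (val i)) _ d (subbox (fun l : A * A => l != 0) s).
- by move=> i; exact: termP.
- apply/fsubsetP => i; rewrite boxP mem_subbox -ltnS prednK ?Npos// ltnS geq_max => /andP[? ?].
  exact: sP.
rewrite -(@big_subbox _ _ _ _ _ s (fun l => 1 - zeta / lat z l))//.
split; first by rewrite absvM ler_pM ?absv_ge0.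
by rewrite /e_lattice -mulrBr absvM -mulrA ler_pM ?absv_ge0.
Qed.

Lemma e_lattice_box K n : 0 <= K -> exists2 B, 0 <= B & forall z zeta,
  affinoid (S := S) n z -> absv zeta <= K -> forall d e, (d <= e)%N ->
  absv (eL d e z zeta) <= B /\ absv (e_lattice z zeta - eL d e z zeta) <= B * r ^+ d.
Proof.
move=> /(e_lattice_net n)[B B0 BP]; exists B => // z zeta zn zK d e de.
apply: BP => //; first exact: uniq_prs.
by move=> l h1 h2; rewrite mem_prs h2 (leq_trans h1).
Qed.

(** Right multiplication of the row vector (l.2, l.1) by g. It describes, up to the scalar J, the
    vector of the lattice at gamma(z) with coordinates [l] in the basis at z. *)
Definition actl (g : 'M[A]_2) (l : A * A) : A * A :=
  (l.2 * g 0 1 + l.1 * g 1 1, l.2 * g 0 0 + l.1 * g 1 0).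

Lemma sum2 (K : comNzRingType) (f : 'I_2 -> K) : \sum_i f i = f 0 + f 1.
Proof.
rewrite big_ord_recl big_ord1; congr (_ + f _); exact: val_inj.
Qed.

Lemma actlM g g' l : actl g (actl g' l) = actl (g' *m g) l.
Proof. by rewrite /actl /= !mxE !sum2; congr (_, _); ring. Qed.

Lemma actl1 l : actl 1%:M l = l.
Proof. by case: l => b a; rewrite /actl !mxE /=; congr (_, _); rewrite !mulr1 !mulr0 ?addr0 ?add0r. Qed.

Lemma actl0 g : actl g 0 = 0.
Proof. by rewrite /actl /= !mul0r addr0. Qed.

Lemma J_neq0 g z : g \in unitmx -> Omega S z -> J g z != 0.
Proof.
move=> gu zO; rewrite /J; have [c0|c0] := eqVneq (g 1 0) 0; last exact: Omega_affine.
rewrite c0 ev0 mul0r add0r ev_eq0; apply: contraTneq gu => d0.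
by rewrite unitmxE det_mx22E c0 d0 !mulr0 subr0 unitr0.
Qed.

Lemma lat_mobius g z l : J g z != 0 -> lat (mobius_C g z) l = lat z (actl g l) / J g z.
Proof.
move=> J0; rewrite /lat /mobius_C /actl/= !evD !evM; apply: (mulIf J0).
rewrite mulfVK// mulrDl [X in _ + X]mulrAC mulfVK// /J; ring.
Qed.

Lemma lims0_eq (x y : C) (B : R) : 0 <= B -> (forall d, absv (x - y) <= B * r ^+ d) -> x = y.
Proof.
move=> B0 H; apply/eqP; rewrite -subr_eq0; apply/eqP.
have r01 : 0 <= r < 1 by case/andP: (@qV01 R F) => /ltW -> ->.
exact: lims_unique (lims_cst _) (@lims_scale_geom _ _ _ _ (fun=> x - y) r01 H).
Qed.

Lemma Omega_mobius g z : g \in unitmx -> Omega S z -> Omega S (mobius_C g z).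
Proof. by move=> gu zO; apply: Kinfty_frac => //; rewrite -det_mx22E -unitmxE. Qed.

(** The lattice at gamma(z) is the lattice at z divided by J, and lattice exponentials scale
    accordingly; the reindexing is done on finite products and passed to the limit. *)
Lemma e_lattice_mobius g z zeta : g \in unitmx -> Omega S z ->
  e_lattice (mobius_C g z) zeta = (J g z)^-1 * e_lattice z (J g z * zeta).
Proof.
move=> gu zO; have J0 := J_neq0 gu zO; set j := J g z in J0 *.
have [n zn] := Omega_affinoid zO; have [m wm] := Omega_affinoid (Omega_mobius gu zO).
have [B B0 BP] := e_lattice_net n (absv_ge0 (j * zeta)).
have [B' B'0 BP'] := e_lattice_net m (absv_ge0 zeta).
apply: (mulfI J0); rewrite mulVKf//.
apply: (@lims0_eq _ _ (Num.max (absv j * B') B)) => [|e].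
  by rewrite le_max B0 orbT.
(* Large enough for the image under [actl g] of the box of size [D] to contain the box of size
   [e]. *)
pose D := \max_(l <- prs e e) maxn e (maxn (size (actl (invmx g) l).1) (size (actl (invmx g) l).2)).
pose s := map (actl g) (prs (maxn e D) (maxn e D)).
have injg : injective (actl g).
  by apply: (can_inj (g := actl (invmx g))) => l; rewrite actlM mulmxV// actl1.
have us : uniq s by rewrite map_inj_uniq// uniq_prs.
have sP (l : A * A) : (size l.1 <= e)%N -> (size l.2 <= e)%N -> l \in s.
  move=> h1 h2; apply/mapP; exists (actl (invmx g) l); last by rewrite actlM mulVmx// actl1.
  have lp : l \in prs e e by rewrite mem_prs h1.
  have h : (maxn e (maxn (size (actl (invmx g) l).1) (size (actl (invmx g) l).2)) <= D)%N.
    by rewrite /D (big_rem l lp) /= leq_maxl.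
  rewrite mem_prs !leq_max; move: h; rewrite !geq_max => /andP[_ /andP[-> ->]].
  by rewrite !orbT.
have [_ h1] := BP z _ zn (lexx _) e s us sP.
have [|_ h2] := BP' (mobius_C g z) zeta wm (lexx _) e (prs (maxn e D) (maxn e D)) (uniq_prs _ _).
  by move=> l a1 a2; rewrite mem_prs !leq_max a1 a2.
have E : j * (zeta * \prod_(l <- prs (maxn e D) (maxn e D) | l != 0) (1 - zeta / lat (mobius_C g z) l)) =
    j * zeta * \prod_(l <- s | l != 0) (1 - j * zeta / lat z l).
  rewrite mulrA; congr (_ * _); rewrite big_map; apply: eq_big => [l|l _].
    by rewrite -(inj_eq injg) actl0.
  by rewrite lat_mobius// -/j invfM invrK; congr (1 - _); ring.
rewrite -(subrKA (j * zeta * \prod_(l <- s | l != 0) (1 - j * zeta / lat z l))).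
have re : 0 <= r ^+ e by rewrite exprn_ge0 ?invr_ge0 ?ler0n.
apply: absvD_le.
  rewrite -E -mulrBr absvM (le_trans (ler_wpM2l (absv_ge0 _) h2))// mulrA ler_wpM2r//.
  by rewrite le_max lexx.
by rewrite absv_subC (le_trans h1)// ler_wpM2r// le_max lexx orbT.
Qed.

Section FixedZ.
Variable z : C.
Hypothesis zO : Omega S z.

Let beta i := eA (th ^+ i * z).

Lemma lcomb_eA a : lcomb beta a = eA (ev a * z).
Proof.
rewrite /lcomb (evE S (leqnn _)) mulr_suml.
have -> : eA (\sum_(i < size a) iota S a`_i * th ^+ i * z) = \sum_(i < size a) eA (iota S a`_i * th ^+ i * z).
  by apply: (big_morph eA (@eAD _ _ S)); exact: eA0.
by apply: eq_bigr => i _; rewrite -mulrA eAZ.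
Qed.

Lemma eA_mulz_eq0 a : eA (ev a * z) = 0 -> a = 0.
Proof.
move=> /eA_eq0[b E]; apply/eqP/negPn/negP => a0.
by have := Omega_affine (- b) zO a0; rewrite evN E subrr eqxx.
Qed.

Let indep a : lcomb beta a = 0 -> a = 0.
Proof. by rewrite lcomb_eA; exact: eA_mulz_eq0. Qed.

(* Dividing C by A before dividing by z A: e_z is the limit of nL d \o eA. *)
Definition nL d (X : C) := (lpoly beta d).[X].

Lemma nL_prod d X : nL d X = X * \prod_(a <- polys F d | a != 0) (1 - X / eA (ev a * z)).
Proof.
rewrite /nL (lpoly_prod1 indep); congr (X * _).
by apply: eq_bigr => a _; rewrite lcomb_eA.
Qed.

Lemma nA_mulz_neq0 e a : a != 0 -> nA e (ev a * z) != 0.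
Proof.
move=> a0; apply/eqP => /(lpoly_eq0 (@indep_th _ _ S))[b _]; rewrite lcomb_th => E.
by have := Omega_affine (- b) zO a0; rewrite evN E subrr eqxx.
Qed.

(** For a fixed coordinate a along z, the factors over all b of size at most e form one translate of
    the root space, and [lpoly_translate] evaluates their product. *)
Lemma eL_nA d e zeta : eL d e z zeta =
  nA e zeta * \prod_(a <- polys F d | a != 0) (1 - nA e zeta / nA e (ev a * z)).
Proof.
rewrite /eL nA_prod -mulrA; congr (_ * _).
rewrite big_mkcond /= big_allpairs_dep /= exchange_big /= (bigD1_seq 0) ?uniq_polys ?mem_polys ?size_poly0//=.
congr (_ * _).
  rewrite [RHS]big_mkcond; apply: eq_bigr => b _.
  by rewrite xpair_eqE eqxx andbT /lat/= ev0 mulr0 addr0.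
rewrite -nA_prod; apply: eq_bigr => a a0.
have -> : nA e zeta / nA e (ev a * z) = nA e (- zeta) / nA e (- (ev a * z)).
  by rewrite /nA !lpolyN invrN mulrNN.
have y0 : nA e (- (ev a * z)) != 0 by rewrite /nA lpolyN oppr_eq0 nA_mulz_neq0.
rewrite -(lpoly_translate (@indep_th _ _ S) _ y0); apply: eq_bigr => b _.
rewrite xpair_eqE (negPf a0) andbF lcomb_th /lat /= -opprD invrN mulrNN [z * _]mulrC.
by rewrite [ev b + _]addrC.
Qed.

(** Iterated limit, e first and then d; the bound of [e_lattice_box], valid for all e >= d, is what
    makes it agree with the unordered product. *)
Lemma lims_nL zeta : lims (fun d => nL d (eA zeta)) (e_lattice z zeta).
Proof.
have [n zn] := Omega_affinoid zO.
have [B B0 /(_ z zeta zn (lexx _)) BP] := e_lattice_box n (absv_ge0 zeta).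
have r01 : 0 <= r < 1 by case/andP: (@qV01 R F) => /ltW -> ->.
rewrite -[e_lattice _ _]add0r; apply: (@lims_ext _ _ _ (fun d => (nL d (eA zeta) - e_lattice z zeta) + e_lattice z zeta)).
  by move=> d; rewrite subrK.
apply: limsD (lims_cst _); apply: (lims_scale_geom (M := B) r01) => d; rewrite absv_subC.
have le : lims (fun e => eL d e z zeta) (nL d (eA zeta)).
  rewrite nL_prod; apply: (@lims_ext _ _ _ _ _ (fun e => esym (eL_nA d e zeta))).
  apply: limsM (lims_nA _) _; apply: lims_prod => a a0; apply: limsB (lims_cst _) _.
  apply: limsM (lims_nA _) _; apply: limsV (lims_nA _) _.
  by apply: contraNneq a0 => /eA_mulz_eq0 ->.
apply: (lims_le (N := d) (limsB (lims_cst (e_lattice z zeta)) le)) => e de.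
by case: (BP _ _ de).
Qed.

Lemma eLD x y : e_lattice z (x + y) = e_lattice z x + e_lattice z y.
Proof.
apply: lims_unique (lims_nL _) _; apply: lims_ext (limsD (lims_nL x) (lims_nL y)) => d.
by rewrite /nL eAD lpolyD.
Qed.

Lemma eLZ c x : e_lattice z (iota S c * x) = iota S c * e_lattice z x.
Proof.
apply: lims_unique (lims_nL _) _; apply: lims_ext (limsZ (iota S c) (lims_nL x)) => d.
by rewrite /nL eAZ lpolyZ.
Qed.

Lemma eL_0 : e_lattice z 0 = 0. Proof. by rewrite /e_lattice mul0r. Qed.

Lemma eLB x y : e_lattice z (x - y) = e_lattice z x - e_lattice z y.
Proof. by apply: (addIr (e_lattice z y)); rewrite -eLD !subrK. Qed.

Lemma eL_lat a b : e_lattice z (ev a * z + ev b) = 0.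
Proof.
apply: lims_unique (lims_nL _) _; apply: (lims_eq (N := size a) _ (lims_cst 0)) => d ad.
rewrite eAD eA_ev addr0 -lcomb_eA /nL.
by have [_ ->] := lpoly_props indep d.
Qed.

Lemma eL_eq0 x : e_lattice z x = 0 -> exists a b, x = ev a * z + ev b.
Proof.
have [n zn] := Omega_affinoid zO.
have [d dP] := expq_gt F (absv x * q%:R ^+ (n + n)).
move=> /eqP; rewrite -absv_eq0 (e_lattice_abs zn dP) absv_eq0 mulf_eq0 => /orP[/eqP ->|].
  by exists 0, 0; rewrite ev0 mul0r addr0.
rewrite prodf_seq_eq0 => /hasP[l _ /andP[l0]]; rewrite subr_eq0 eq_sym => /eqP E.
have la0 : lat z l != 0.
  by apply: contraTneq isT => h; move/eqP: E; rewrite h invr0 mulr0 eq_sym oner_eq0.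
exists l.2, l.1; apply: (mulIf (invr_neq0 la0)).
by rewrite E (_ : ev l.2 * z + ev l.1 = lat z l) ?divff// /lat addrC [z * _]mulrC.
Qed.

End FixedZ.

End Lattice.

Opaque eA e_lattice.

(** * Reduction theory *)

Section Reduction.
Variables (R : realType) (F : finFieldType) (S : setting R F).
Notation C := (Cinf S).
Notation q := #|F|.
Notation A := {poly F}.
Notation th := (theta S).
Notation ev := (polyev (iota S) th).
Notation r := (q%:R^-1 : R).
Notation eA := (@eA R F S).
Notation Kinf := (Kinfty (iota S) th).

Definition mat2 (K : pzRingType) (a b c d : K) : 'M[K]_2 :=
  \matrix_(i, j) (if i == 0 then if j == 0 then a else b else if j == 0 then c else d).

Lemma mat2E (K : pzRingType) (a b c d : K) :
  (mat2 a b c d 0 0 = a) * (mat2 a b c d 0 1 = b) * (mat2 a b c d 1 0 = c) * (mat2 a b c d 1 1 = d).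
Proof. by rewrite !mxE. Qed.

Lemma mulmx2E (K : comNzRingType) (g h : 'M[K]_2) i j :
  (g *m h) i j = g i 0 * h 0 j + g i 1 * h 1 j.
Proof. by rewrite mxE sum2. Qed.

Lemma J_mul (g g' : 'M[A]_2) (z : C) : J g' z != 0 ->
  J (g *m g') z = J g (mobius_C g' z) * J g' z.
Proof.
move=> J0; set w := mobius_C g' z.
have wJ : w * J g' z = ev (g' 0 0) * z + ev (g' 0 1) by rewrite mulfVK.
transitivity (ev (g 1 0) * (w * J g' z) + ev (g 1 1) * J g' z); last by rewrite {3}/J; ring.
by rewrite wJ /J !mulmx2E !evD !evM; ring.
Qed.

Lemma mobius_mul (g g' : 'M[A]_2) (z : C) : g \in unitmx -> g' \in unitmx -> Omega S z ->
  mobius_C (g *m g') z = mobius_C g (mobius_C g' z).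
Proof.
move=> gu g'u zO; have J0 := J_neq0 g'u zO; have w := Omega_mobius g'u zO.
have J1 := J_neq0 gu w.
have J2 : J (g *m g') z != 0 by rewrite J_mul// mulf_neq0.
apply: (mulIf J2); rewrite [LHS]mulfVK// J_mul// mulrA {1}/mobius_C mulfVK//.
set x := mobius_C g' z.
have xJ : x * J g' z = ev (g' 0 0) * z + ev (g' 0 1) by rewrite mulfVK.
by rewrite mulrDl -mulrA xJ /J !mulmx2E !evD !evM; ring.
Qed.

Lemma mobius1 z : mobius_C 1%:M z = z :> C.
Proof. by rewrite /mobius_C /J !mxE /= ev1 ev0 !mul1r mul0r !add0r addr0 divr1. Qed.

Lemma J1 z : J 1%:M z = 1 :> C.
Proof. by rewrite /J !mxE /= ev1 ev0 mul0r add0r. Qed.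

Lemma seq_argmin (T : eqType) (s : seq T) (f : T -> R) x0 : x0 \in s ->
  exists2 x, x \in s & forall y, y \in s -> f x <= f y.
Proof.
elim: s x0 => // a s IH x0 _; case: s IH => [_|b s IH].
  by exists a; rewrite ?mem_head// => y; rewrite inE => /eqP ->.
have [x xs xm] := IH b (mem_head _ _).
have [ax|xa] := leP (f a) (f x).
  exists a; first exact: mem_head.
  by move=> y; rewrite inE => /predU1P[->//|/xm]; apply: le_trans.
exists x; first by rewrite inE xs orbT.
by move=> y; rewrite inE => /predU1P[->|/xm//]; exact: ltW.
Qed.

(* Fundamental domain: |w| >= 1 is the distance from w to K_infty. *)
Definition Fd (w : C) := 1 <= absv w /\ forall x, Kinf x -> absv w <= absv (w - x).

Lemma Fd_Omega w : Fd w -> Omega S w.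
Proof.
by move=> [w1 wK] /wK; rewrite subrr absv0 => /(le_trans w1); rewrite leNgt ltr01.
Qed.

Lemma latE z b a : lat z (b, a) = ev a * z + ev b :> C.
Proof. by rewrite /lat /= addrC mulrC. Qed.

(** The vector 1 has absolute value 1, while [affine_lb2] shows that vectors with a large coordinate
    have absolute value at least 1; so the search is finite. *)
Lemma min_vector z : Omega S z -> exists2 l : A * A, l != 0 &
  forall l' : A * A, l' != 0 -> absv (lat z l) <= absv (lat z l').
Proof.
move=> zO; have [n zn] := Omega_affinoid zO; pose D := (n + n).+1.
have l10 : ((1, 0) : A * A) != 0 by rewrite xpair_eqE oner_eq0.
have l1 : absv (lat z ((1, 0) : A * A)) = 1.
  by rewrite latE ev0 mul0r add0r ev1 absv1.
have [|l] := @seq_argmin _ [seq l <- prs F D D | l != 0] (fun l => absv (lat z l)) (1, 0).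
  by rewrite mem_filter l10 mem_prs /= size_poly1 size_poly0.
rewrite mem_filter => /andP[l0 lD] lm; exists l => // l' l'0.
have [l'D|l'D] := boolP (l' \in prs F D D); first by apply: lm; rewrite mem_filter l'0.
apply: le_trans (_ : 1 <= _).
  by rewrite -l1; apply: lm; rewrite mem_filter l10 mem_prs /= size_poly1 size_poly0.
case: l' l'0 l'D => b a l'0; rewrite mem_prs /= latE => h.
apply: le_trans (affine_lb2 a b zn); rewrite ler_pdivlMr ?qRX_gt0// mul1r le_max.
move: h; rewrite negb_and -!ltnNge => /orP[h|h].
  by rewrite orbC absv_ev -?size_poly_gt0 ?(leq_ltn_trans _ h)// ler_weXn2l ?qR_ge1// -ltnS prednK// (leq_ltn_trans _ h).
by rewrite absv_ev -?size_poly_gt0 ?(leq_ltn_trans _ h)// ler_weXn2l ?qR_ge1// -ltnS prednK// (leq_ltn_trans _ h).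
Qed.

(** A shortest vector is primitive, since dividing by a common factor would shorten it, so it is the
    bottom row of a matrix of determinant 1. After that move all lattice vectors have absolute value
    at least 1, and a translation makes |w| minimal. *)
Lemma reduction z : Omega S z ->
  exists g w, [/\ \det g = 1 :> A, Fd w & z = mobius_C g w].
Proof.
move=> zO; have [[d c] l0 lm] := min_vector zO.
have cop : coprimep c d.
  have p0 : gcdp c d != 0.
    by rewrite gcdp_eq0; apply: contra l0 => /andP[/eqP -> /eqP ->].
  have := dvdp_gcdl c d; have := dvdp_gcdr c d; rewrite /coprimep.
  move: (gcdp c d) p0 => p p0 /dvdpP[d' dE] /dvdpP[c' cE].
  have l'0 : (d', c') != 0 :> A * A.
    by apply: contra l0; rewrite cE dE !xpair_eqE => /andP[/eqP -> /eqP ->]; rewrite !mul0r eqxx.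
  have := lm _ l'0; rewrite !latE cE dE !evM.
  have -> : ev c' * ev p * z + ev d' * ev p = (ev c' * z + ev d') * ev p by ring.
  rewrite absvM ger_pMr; last first.
    rewrite absv_gt0; have [c0|c0] := eqVneq c' 0; last exact: Omega_affine.
    rewrite c0 ev0 mul0r add0r ev_eq0; apply: contra l'0 => /eqP ->.
    by rewrite c0 xpair_eqE eqxx.
  rewrite absv_ev// -[1](expr0 (q%:R : R)) ler_eXn2l ?qR_gt1// leqn0 => /eqP s1.
  by rewrite -[size p]prednK ?size_poly_gt0// s1.
have /Bezout_eq1_coprimepP[[u v] /= uv] := cop.
pose g1 := mat2 v (- u) c d.
have dg1 : \det g1 = 1 by rewrite det_mx22E !mat2E -uv; ring.
have ug1 : g1 \in unitmx by rewrite unitmxE dg1 unitr1.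
pose w1 := mobius_C g1 z; have w1O := Omega_mobius ug1 zO; have J10 := J_neq0 ug1 zO.
have lat1 l : l != 0 -> 1 <= absv (lat w1 l).
  move=> ll; rewrite /w1 lat_mobius// absv_div ler_pdivlMr ?absv_gt0// mul1r.
  have -> : J g1 z = lat z (d, c) by rewrite latE /J !mat2E.
  apply: lm; apply: contra ll => /eqP E.
  by rewrite -(actl1 l) -(mulmxV ug1) -actlM E actl0.
have [D w1D] := expq_gt F (absv w1).
have [|b bD bm] := @seq_argmin _ (polys F D.+1) (fun b => absv (w1 + ev b)) 0.
  by rewrite mem_polys size_poly0.
have bm' b' : absv (w1 + ev b) <= absv (w1 + ev b').
  have [|h] := boolP (b' \in polys F D.+1); first exact: bm.
  apply: le_trans (bm 0 _) _; first by rewrite mem_polys size_poly0.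
  move: h; rewrite mem_polys -ltnNge => h; rewrite ev0 addr0.
  have wb : absv w1 < absv (ev b').
    rewrite absv_ev -?size_poly_gt0 ?(leq_ltn_trans _ h)//.
    rewrite (lt_le_trans w1D)// ler_weXn2l ?qR_ge1// -ltnS prednK ?(leq_ltn_trans _ h)// ltnW//.
  by rewrite absvDr// ltW.
pose T := mat2 1 b 0 1 : 'M[A]_2.
have dT : \det T = 1 by rewrite det_mx22E !mat2E; ring.
have uT : T \in unitmx by rewrite unitmxE dT unitr1.
have TE : mobius_C T w1 = w1 + ev b.
  by rewrite /mobius_C /J !mat2E ev1 ev0 mul0r add0r divr1 mul1r.
pose g := T *m g1.
have ug : g \in unitmx by rewrite unitmx_mul uT.
exists (invmx g), (w1 + ev b); split.
- by rewrite det_inv det_mulmx dT dg1 mul1r invr1.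
- have w1' : 1 <= absv (w1 + ev b).
    by have := lat1 (b, 1); rewrite latE ev1 mul1r; apply; rewrite xpair_eqE oner_eq0 andbF.
  split=> // x xK; rewrite leNgt; apply/negP => h.
  (* A point x of K_infty too close to w could be replaced by a polynomial a, at distance below 1 <=
     |w| from x, against minimality under translations. *)
  have [a xa] := Kinf_near xK.
  have := bm' (b - a); rewrite leNgt evB addrA => /negP; apply.
  rewrite -(subrKA x); apply: absvD_lt => //; exact: lt_le_trans xa w1'.
rewrite -TE -(mobius_mul uT ug1 zO) -/g -mobius_mul ?unitmx_inv// mulVmx//.
by rewrite mobius1.
Qed.

(** x is orthogonal to A in the non-archimedean sense: then every |x - a| equals max(|x|, |a|), and
    |e_A(x)| depends only on |x|, monotonically. *)
Definition orth (x : C) := forall a, absv x <= absv (x - ev a).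

Lemma nA_orth d x : orth x ->
  absv (nA d x) = absv x * \prod_(a <- polys F d | a != 0) Num.max 1 (absv x / absv (ev a)).
Proof.
move=> ox; rewrite nA_prod absvM absv_prod; congr (_ * _); apply: eq_bigr => a a0.
have ea : 0 < absv (ev a) by rewrite absv_gt0 ev_eq0.
have -> : 1 - x / ev a = (ev a - x) / ev a by field; rewrite ev_eq0.
rewrite absv_div; have := ox a; case: (ltgtP (absv x) (absv (ev a))) => h ha.
- rewrite absvBl// divff ?gt_eqF//; apply/esym/max_idPl.
  by rewrite ler_pdivrMr// mul1r ltW.
- rewrite absvBr//; apply/esym/max_idPr.
  by rewrite ler_pdivlMr// mul1r ltW.
- have -> : absv (ev a - x) = absv x.
    apply/le_anti/andP; split; first by rewrite absvB_le ?h.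
    by rewrite absv_subC.
  by rewrite h divff ?gt_eqF// maxxx.
Qed.

Lemma eA_ge x : orth x -> absv x <= absv (eA x).
Proof.
move=> ox; have [d xd] := expq_gt F (absv x); rewrite (eA_abs xd) nA_orth//.
rewrite ler_peMr ?absv_ge0//; elim/big_rec: _ => // a y _ y1.
by rewrite mulr_ege1// le_max lexx.
Qed.

Lemma eA_mono x y : orth x -> orth y -> absv x <= absv y -> absv (eA x) <= absv (eA y).
Proof.
move=> ox oy xy; have [d yd] := expq_gt F (absv y).
rewrite (eA_abs yd) (eA_abs (le_lt_trans xy yd)) !nA_orth//.
apply: ler_pM; rewrite ?absv_ge0//.
  by elim/big_rec: _ => // a z _ z0; rewrite mulr_ge0// le_max ler01.
apply: ler_prod => a _; rewrite le_max ler01 /= ge_max le_max lexx /= le_max.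
by rewrite ler_wpM2r ?orbT ?invr_ge0 ?absv_ge0.
Qed.

Lemma Fd_scale w (a : A) n : Fd w -> a != 0 -> orth (ev a * w / th ^+ n).
Proof.
move=> [_ wK] a0 b; have ea0 : ev a != 0 by rewrite ev_eq0.
have -> : ev a * w / th ^+ n - ev b = ev a / th ^+ n * (w - ev (b * 'X^n) / ev a).
  by rewrite evM evXn; field; rewrite ea0 thX_neq0.
rewrite mulrAC !absvM ler_wpM2l//; first by rewrite mulr_ge0 ?absv_ge0.
by apply: wK; apply: ratfun_Kinfty; exists (b * 'X^n), a.
Qed.

Lemma Fd_mul w a : Fd w -> a != 0 -> orth (ev a * w).
Proof. by move=> wF a0; have := Fd_scale 0 wF a0; rewrite expr0 divr1. Qed.

Lemma Fd_div w n : Fd w -> orth (w / th ^+ n).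
Proof. by move=> wF; have := Fd_scale n wF (oner_neq0 _); rewrite ev1 mul1r. Qed.

Lemma Fd_orth w : Fd w -> orth w.
Proof. by move=> wF; have := Fd_div 0 wF; rewrite expr0 divr1. Qed.

Lemma Fd_lat w l : Fd w -> l != 0 -> 1 <= absv (lat w l).
Proof.
case: l => b a wF l0; rewrite latE; have [a0|a0] := eqVneq a 0.
  rewrite a0 ev0 mul0r add0r absv_ev_ge1//.
  by apply: contra l0 => /eqP ->; rewrite a0.
have := Fd_mul wF a0 (- b); rewrite evN opprK; apply: le_trans; rewrite absvM.
by rewrite mulr_ege1 ?absv_ev_ge1//; case: wF.
Qed.

Lemma eA_Fd_ge1 w : Fd w -> 1 <= absv (eA w).
Proof. by move=> wF; rewrite (le_trans _ (eA_ge (Fd_orth wF)))//; case: wF. Qed.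

Lemma eL_Fd_small w zeta : Fd w -> absv zeta < 1 -> absv (e_lattice w zeta) = absv zeta.
Proof.
move=> wF z1; have [n wn] := Omega_affinoid (Fd_Omega wF).
have [d dP] := expq_gt F (absv zeta * q%:R ^+ (n + n)).
rewrite (e_lattice_abs wn dP) /eL absvM absv_prod big1 ?mulr1// => l l0.
rewrite absvBl absv1// absv_div ltr_pdivrMr ?mul1r; last first.
  by rewrite (lt_le_trans ltr01)// Fd_lat.
by rewrite (lt_le_trans z1)// Fd_lat.
Qed.

(** In e_A(w) = theta X + [kapA] X^q with X = e_A(w/theta), the second term dominates once |X| > 1.
    This controls the twisted series s_1^(1) by the same bound as s_1. *)
Lemma eA_Fd_pow w : Fd w -> absv (eA (w / th)) ^+ q <= absv (eA w).
Proof.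
move=> wF; have := eA_rec (w / th); rewrite mulrC mulfVK ?th_neq0//.
move: (eA (w / th)) => X E; set Y := absv X.
have [Y1|Y1] := leP Y 1.
  by rewrite (le_trans _ (eA_Fd_ge1 wF))// exprn_ile1// absv_ge0.
have Y0 : 0 < Y by rewrite (lt_trans ltr01).
have dom : absv (th * X) < absv (kapA S * X ^+ q).
  rewrite !absvM absvX absv_kapA abs_theta -/Y -exprMn -[q%:R * Y]expr1.
  by rewrite ltr_eXn2l ?q_gt1// mulr_egt1// qR_gt1.
rewrite E absvDr// absvM absvX absv_kapA -/Y ler_peMl ?exprn_ge0 ?(ltW Y0)//.
exact: qRX_ge1.
Qed.

(** In the product [nL] every factor 1 - e_A(w/theta^(i+1)) / e_A(aw) has absolute value at most 1,
    by monotonicity of |e_A| on orthogonal elements. *)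
Lemma absv_s1_Fd w i : Fd w -> absv (s_1 w i) <= absv (eA (w / th)).
Proof.
move=> wF; have wO := Fd_Omega wF; rewrite /=.
have w1 : 1 <= absv w by case: wF.
have th1 n : 1 <= absv (th ^+ n) by rewrite absv_thX qRX_ge1.
have E1 : absv (eA (w / th ^+ i.+1)) <= absv (eA (w / th)).
  apply: eA_mono; [exact: Fd_div|by have := Fd_div 1 wF; rewrite expr1|].
  rewrite !absv_div absv_thX abs_theta ler_wpM2l ?absv_ge0// lef_pV2 ?posrE ?qRX_gt0 ?qR_gt0//.
  by rewrite -{1}[q%:R]expr1 ler_weXn2l ?qR_ge1.
apply: le_trans E1; apply: (lims_le (N := 0) (lims_nL wO _)) => d _.
rewrite nL_prod// absvM ler_piMr ?absv_ge0// absv_prod.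
rewrite -absv_prod; elim/big_rec: _ => [|a y a0 y1]; first by rewrite absv1.
rewrite absvM mulr_ile1 ?absv_ge0//.
rewrite absvB_le ?absv1// absv_div ler_pdivrMr; last first.
  by rewrite absv_gt0; apply: contraNneq a0 => /(eA_mulz_eq0 wO) ->.
rewrite mul1r; apply: eA_mono; [exact: Fd_div|exact: Fd_mul|].
rewrite absv_div absvM ler_pdivrMr ?(lt_le_trans ltr01)// mulrAC -[X in X <= _]mul1r.
by rewrite ler_wpM2r ?absv_ge0// mulr_ege1 ?absv_ev_ge1.
Qed.

Lemma absv_s2_Fd w i : Fd w -> absv (s_2 w i) = r ^+ i.+1.
Proof.
move=> wF; have E : absv (1 / th ^+ i.+1 : C) = r ^+ i.+1.
  by rewrite mul1r absvV absv_thX exprVn.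
rewrite -E [LHS](eL_Fd_small wF)// E exprVn.
by rewrite invf_lt1 ?qRX_gt0// exprn_egt1 ?qR_gt1.
Qed.

Lemma affinoid_Fd w n : Fd w -> absv w <= q%:R ^+ n -> affinoid n w.
Proof.
move=> [w1 wK] wn; split=> // x /wK; apply: le_trans; apply: le_trans w1.
by rewrite invf_le1 ?qRX_gt0// qRX_ge1.
Qed.

(** Multiplication by t shifts the generating series as multiplication of x by theta does. Terms
    shifted beyond the start vanish, since e_z kills theta^n x. *)
Lemma bar_mul (z x : C) a i : Omega S z -> (forall n, e_lattice z (th ^+ n * x) = 0) ->
  (bar S a * Fps (fun i => e_lattice z (x / th ^+ i.+1))) i = e_lattice z (ev a * x / th ^+ i.+1).
Proof.
move=> zO H; rewrite fpsM /=.
pose n := maxn (size a) i.+1.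
rewrite (evE S (leq_maxl (size a) i.+1)) -/n !mulr_suml.
have -> : e_lattice z (\sum_(k < n) iota S a`_k * th ^+ k * x / th ^+ i.+1) =
   \sum_(k < n) e_lattice z (iota S a`_k * th ^+ k * x / th ^+ i.+1).
  by apply: (big_morph (e_lattice z) (eLD zO)); exact: eL_0.
rewrite (big_ord_widen n (fun k => iota S a`_k * e_lattice z (x / th ^+ (i - k).+1))) ?leq_maxr//.
rewrite big_mkcond/=; apply: eq_bigr => k _.
have -> : iota S a`_k * th ^+ k * x / th ^+ i.+1 = iota S a`_k * (th ^+ k * x / th ^+ i.+1).
  by rewrite !mulrA.
rewrite (eLZ zO); case: ltnP => h.
  congr (_ * e_lattice z _); rewrite -[in RHS](subnK (h : (k <= i)%N)) -addSn exprD; field.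
  by rewrite !thX_neq0.
have -> : th ^+ k * x / th ^+ i.+1 = th ^+ (k - i.+1) * x.
  by rewrite -[in LHS](subnK h) exprD; field; rewrite thX_neq0.
by rewrite H mulr0.
Qed.

Lemma eL_thz z n : Omega S z -> e_lattice z (th ^+ n * z) = 0.
Proof. by move=> zO; have := eL_lat zO 'X^n 0; rewrite ev0 addr0 evXn. Qed.

Lemma eL_th1 z n : Omega S z -> e_lattice z (th ^+ n * 1) = 0.
Proof. by move=> zO; have := eL_lat zO 0 'X^n; rewrite ev0 mul0r add0r evXn mulr1. Qed.

Lemma bar_s z a b i : Omega S z ->
  (bar S a * s_1 z + bar S b * s_2 z) i = e_lattice z ((ev a * z + ev b) / th ^+ i.+1).
Proof.
move=> zO; rewrite fpsD bar_mul//; last by move=> n; exact: eL_thz.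
by rewrite bar_mul// ?mulr1 -?eLD// ?mulrDl// => n; exact: eL_th1.
Qed.

Lemma s_2_mobius g z : g \in unitmx -> Omega S z ->
  s_2 (mobius_C g z) = fps_const (J g z)^-1 * (bar S (g 1 0) * s_1 z + bar S (g 1 1) * s_2 z).
Proof.
move=> gu zO; apply: fpsP => i; rewrite fpsCM bar_s//= e_lattice_mobius//.
by congr (_ * e_lattice z _); rewrite mul1r.
Qed.

Lemma s_1_mobius g z : g \in unitmx -> Omega S z ->
  s_1 (mobius_C g z) = fps_const (J g z)^-1 * (bar S (g 0 0) * s_1 z + bar S (g 0 1) * s_2 z).
Proof.
move=> gu zO; apply: fpsP => i; rewrite fpsCM bar_s//= e_lattice_mobius//.
congr (_ * e_lattice z _); rewrite /mobius_C; field; rewrite ?thX_neq0 ?J_neq0//.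
Qed.

End Reduction.

(** * A Liouville theorem on Omega *)

Section GenericPoints.
Variables (R : realType) (C : ultrametricField R).

Lemma prod_eq_max (s : seq R) (M : R) : 0 < M -> (forall x, x \in s -> 0 <= x <= M) ->
  \prod_(x <- s) x = M ^+ size s -> forall x, x \in s -> x = M.
Proof.
move=> M0; elim: s => // a s IH H.
rewrite big_cons /= exprS => E.
have /andP[a0 aM] := H a (mem_head _ _).
have sM : \prod_(x <- s) x <= M ^+ size s.
  have -> : M ^+ size s = \prod_(x <- s) M by rewrite big_const_seq count_predT iter_mulr_1.
  by rewrite !big_seq; apply: ler_prod => x xs; apply: H; rewrite inE xs orbT.
have Mn : 0 < M ^+ size s by exact: exprn_gt0.
have aE : a = M.
  apply/le_anti; rewrite aM /= -(ler_pM2r Mn) -E; exact: ler_wpM2l.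
move=> x; rewrite inE => /predU1P[->//|]; apply: IH.
  by move=> y ys; apply: H; rewrite inE ys orbT.
by move: E; rewrite aE => /(mulfI (lt0r_neq0 M0)).
Qed.

(** Solve z times the product of all z - a with |a| <= |z0| equal to a power of z0. Every factor has
    absolute value at most |z0|, and the product attains the maximum, so each factor does. *)
Lemma generic_point (s : seq C) (z0 : C) : z0 != 0 -> exists2 z, absv z = absv z0 &
  forall a, a \in s -> absv (z - a) = Num.max (absv z0) (absv a).
Proof.
move=> z00; set M := absv z0; have M0 : 0 < M by rewrite absv_gt0.
pose t := [seq a <- s | absv a <= M].
pose P := \prod_(a <- 0 :: t) ('X - a%:P) - (z0 ^+ (size t).+1)%:P.
have szP : size P = (size t).+2.
  rewrite /P size_polyDl size_prod_XsubC ?size_polyN//=.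
  by rewrite (leq_ltn_trans (size_polyC_leq1 _)).
have /closed_rootP[z] : size P != 1%N by rewrite szP.
rewrite /root hornerD hornerN hornerC subr_eq0 horner_prod => /eqP E.
have {}E : \prod_(a <- 0 :: t) absv (z - a) = M ^+ (size t).+1.
  by rewrite -absvX -E absv_prod; apply: eq_bigr => a _; rewrite hornerXsubC.
have tM a : a \in 0 :: t -> absv a <= M.
  by rewrite inE mem_filter => /predU1P[->|/andP[]//]; rewrite absv0 ltW.
have zM : absv z <= M.
  rewrite leNgt; apply/negP => Mz; move/eqP: E.
  rewrite (@eq_big_seq _ _ _ _ _ _ (fun=> absv z)) => [|a /tM aM]; last first.
    by rewrite absvBl// (le_lt_trans aM).
  rewrite big_const_seq count_predT iter_mulr_1 /= gt_eqF//.
  by rewrite ltrXn2r// ltW.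
have H a : a \in 0 :: t -> absv (z - a) = M.
  move=> at_; apply: (prod_eq_max (s := [seq absv (z - a) | a <- 0 :: t])) => //.
  - by move=> _ /mapP[b /tM bM ->]; rewrite absv_ge0 absvB_le.
  - by rewrite big_map size_map E.
  - by apply/mapP; exists a.
exists z; first by have := H 0 (mem_head _ _); rewrite subr0.
move=> a as_; have [aM|Ma] := leP (absv a) M.
  by rewrite H// inE mem_filter aM as_ orbT.
by rewrite absvBr ?(le_lt_trans zM).
Qed.

Definition proots (P : {poly C}) : seq C := sval (closed_field_poly_normal P).

Lemma prootsE (P : {poly C}) z : P.[z] = lead_coef P * \prod_(a <- proots P) (z - a).
Proof.
rewrite {1}(svalP (closed_field_poly_normal P)) hornerZ horner_prod; congr (_ * _).
by apply: eq_bigr => a _; rewrite hornerXsubC.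
Qed.

Lemma mem_proots (P : {poly C}) a : P != 0 -> (a \in proots P) = root P a.
Proof.
move=> P0; rewrite /root prootsE mulf_eq0 lead_coef_eq0 (negPf P0) /= prodf_seq_eq0.
apply/idP/hasP => [aP|[b bP /=]]; first by exists a => //=; rewrite subrr.
by rewrite subr_eq0 => /eqP ->.
Qed.

Lemma size_proots (P : {poly C}) : P != 0 -> size P = (size (proots P)).+1.
Proof.
move=> P0; rewrite {1}(svalP (closed_field_poly_normal P)) size_scale ?lead_coef_eq0//.
by rewrite size_prod_XsubC.
Qed.

(* Gauss norm on the disc of radius M: the value of |P| at generic points of its boundary. *)
Definition gauss (P : {poly C}) (M : R) : R :=
  absv (lead_coef P) * \prod_(a <- proots P) Num.max M (absv a).

Lemma gauss_ge (P : {poly C}) w M : absv w <= M -> absv P.[w] <= gauss P M.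
Proof.
move=> wM; rewrite prootsE absvM absv_prod ler_wpM2l ?absv_ge0//.
apply: ler_prod => a _; rewrite absv_ge0 /=.
by rewrite absvB_le// le_max ?wM ?lexx ?orbT.
Qed.

Lemma gauss_mono (P : {poly C}) M M' : 0 <= M -> M <= M' -> gauss P M <= gauss P M'.
Proof.
move=> M0 MM; rewrite ler_wpM2l ?absv_ge0//; apply: ler_prod => a _.
by rewrite le_max M0/= ge_max !le_max MM lexx orbT.
Qed.

Lemma gauss_grow (P : {poly C}) M M' : 0 < M -> M <= M' ->
  gauss P M' <= gauss P M * (M' / M) ^+ (size (proots P)).
Proof.
move=> M0 MM; rewrite -mulrA ler_wpM2l ?absv_ge0//.
have h1 : 1 <= M' / M by rewrite ler_pdivlMr// mul1r.
elim: (proots P) => [|a s IH]; first by rewrite !big_nil mulr1.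
rewrite !big_cons /= exprS mulrACA; apply: ler_pM => //.
- by rewrite le_max (le_trans (ltW M0) MM).
- by elim/big_rec: _ => // b y _ y0; rewrite mulr_ge0// le_max (le_trans (ltW M0) MM).
rewrite ge_max; apply/andP; split.
  have {1}-> : M' = M * (M' / M) by field; rewrite gt_eqF.
  by rewrite ler_wpM2r ?le_max ?lexx// (le_trans ler01).
apply: (@le_trans _ _ (Num.max M (absv a))); first by rewrite le_max lexx orbT.
by rewrite ler_peMr// le_max absv_ge0 orbT.
Qed.

Lemma gauss_inner (P : {poly C}) w : (forall a, a \in proots P -> absv a < absv w) ->
  absv P.[w] = gauss P (absv w) /\ gauss P (absv w) = absv (lead_coef P) * absv w ^+ size (proots P).
Proof.
move=> H; rewrite prootsE absvM absv_prod /gauss.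
have E : \prod_(a <- proots P) Num.max (absv w) (absv a) = absv w ^+ size (proots P).
  rewrite (@eq_big_seq _ _ _ _ _ _ (fun=> absv w)) ?big_const_seq ?count_predT ?iter_mulr_1//.
  by move=> a /H/ltW aw; apply/max_idPl.
rewrite E; split=> //; congr (_ * _); rewrite -E; apply: eq_big_seq => a /H aw.
by rewrite absvBl//; apply/esym/max_idPl/ltW.
Qed.

Lemma gauss_outer (P : {poly C}) M : (forall a, a \in proots P -> M <= absv a) ->
  gauss P M = absv (lead_coef P) * \prod_(a <- proots P) absv a.
Proof.
by move=> H; congr (_ * _); apply: eq_big_seq => a /H aM; apply/max_idPr.
Qed.

Lemma gauss_generic (Ps : seq {poly C}) (z0 : C) : z0 != 0 -> exists2 z, absv z = absv z0 &
  forall P, P \in Ps -> absv P.[z] = gauss P (absv z0).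
Proof.
move=> z00; have [z zE H] := generic_point (flatten [seq proots P | P <- Ps]) z00.
exists z => // P PP; rewrite prootsE absvM absv_prod; congr (_ * _).
by apply: eq_big_seq => a aP; apply: H; apply/flattenP; exists (proots P) => //; apply: map_f.
Qed.

Lemma gauss_gt0 (P : {poly C}) M : P != 0 -> 0 < M -> 0 < gauss P M.
Proof.
move=> P0 M0; rewrite mulr_gt0 ?absv_gt0 ?lead_coef_eq0//.
by elim/big_rec: _ => // a y _ y0; rewrite mulr_gt0// lt_max M0.
Qed.

(* The growth rates of the two summands on the annulus have opposite signs, so they
   cannot cancel on two circles at once. *)
Lemma annulus_split (P1 D1 P2 D2 : {poly C}) (r0 r1 M : R) (z1 z2 w : C) :
  D1 != 0 -> D2 != 0 -> (size P1 < size D1)%N ->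
  (forall a, root D1 a -> absv a <= r0) -> (forall a, root D2 a -> r1 <= absv a) ->
  (forall z, r0 < absv z < r1 -> absv (P1.[z] / D1.[z] + P2.[z] / D2.[z]) <= M) ->
  0 < absv z1 -> r0 < absv z1 -> absv z1 < absv z2 -> absv z2 < r1 -> absv z1 <= absv w ->
  absv (P1.[w] / D1.[w]) <= M * (absv z1 / absv w).
Proof.
move=> D10 D20 sz rD1 rD2 H z1p r0z1 z12 z2r1 z1w.
have [P10|P10] := eqVneq P1 0.
  have M0 : 0 <= M by apply: le_trans (H z1 _); rewrite ?absv_ge0// r0z1 (lt_trans z12).
  by rewrite P10 horner0 mul0r absv0 mulr_ge0// divr_ge0 ?absv_ge0.
have rD1' (v : C) : absv z1 <= absv v -> forall a, a \in proots D1 -> absv a < absv v.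
  by move=> zv a; rewrite mem_proots// => /rD1 h; rewrite (le_lt_trans h)// (lt_le_trans r0z1).
have sPD : (size (proots P1) < size (proots D1))%N.
  by move: sz; rewrite (size_proots P10) (size_proots D10).
pose g (v : C) := gauss P1 (absv v) / gauss D1 (absv v).
have decay (v : C) : absv z1 <= absv v -> g v <= g z1 * (absv z1 / absv v).
  move=> zv; have v0 : 0 < absv v by exact: lt_le_trans zv.
  have [_ E1] := gauss_inner (rD1' _ (lexx _)); have [_ E2] := gauss_inner (rD1' _ zv).
  have l0 : 0 < absv (lead_coef D1) by rewrite absv_gt0 lead_coef_eq0.
  rewrite /g ler_pdivrMr ?gauss_gt0// (le_trans (gauss_grow _ z1p zv))//.
  rewrite E1 E2; move: (gauss_gt0 P10 z1p); move: (gauss P1 _) => G G0.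
  have -> : G / (absv (lead_coef D1) * absv z1 ^+ size (proots D1)) * (absv z1 / absv v) *
     (absv (lead_coef D1) * absv v ^+ size (proots D1)) =
     G * (absv z1 / absv v * (absv v / absv z1) ^+ size (proots D1)).
    by rewrite expr_div_n; field; rewrite !gt_eqF ?exprn_gt0.
  rewrite ler_pM2l//.
  rewrite -(subnKC sPD) exprD exprS -[size (proots P1)]addn0 mulrA mulrA.
  rewrite [absv z1 / absv v * _](_ : _ = 1) ?mul1r; last by field; rewrite !gt_eqF.
  by rewrite addn0 ler_peMr ?exprn_ge0 ?divr_ge0 ?absv_ge0// exprn_ege1// ler_pdivlMr// mul1r.
(* If g(z1) > M, the second summand has the same size on the first circle, by cancellation. On the
   second circle g has decreased and the size [b] of the other summand has not, so there they cannot
   cancel. *)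
have gM : g z1 <= M.
  rewrite leNgt; apply/negP => Mg.
  have z20 : 0 < absv z2 by exact: lt_trans z12.
  pose b (v : C) := gauss P2 (absv v) / gauss D2 (absv v).
  have gen (v : C) : 0 < absv v -> r0 < absv v < r1 -> exists A B : C,
      [/\ absv A = g v, absv B = b v & absv (A + B) <= M].
    move=> v0 vr; have [|x xE X] := @gauss_generic [:: P1; D1; P2; D2] v; first by rewrite -absv_gt0.
    exists (P1.[x] / D1.[x]), (P2.[x] / D2.[x]); rewrite !absv_div !X ?inE ?eqxx ?orbT//.
    by split=> //; apply: H; rewrite xE.
  have rD2' (v : C) : absv v <= absv z2 -> forall a, a \in proots D2 -> absv v <= absv a.
    by move=> vz a; rewrite mem_proots// => /rD2/(lt_le_trans z2r1)/ltW; apply: le_trans.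
  have [A1 [B1 [A1E B1E AB1]]] := gen z1 z1p (introT andP (conj r0z1 (lt_trans z12 z2r1))).
  have [A2 [B2 [A2E B2E AB2]]] := gen z2 z20 (introT andP (conj (lt_trans r0z1 z12) z2r1)).
  have b1 : b z1 = g z1.
    by rewrite -B1E -A1E -(addKr A1 B1) addrC absvBr// A1E (le_lt_trans AB1).
  have b12 : g z1 <= b z2.
    rewrite -b1 /b (gauss_outer (rD2' z1 (ltW z12))) (gauss_outer (rD2' z2 (lexx _))).
    by rewrite ler_wpM2r ?invr_ge0 ?mulr_ge0 ?absv_ge0// -?absv_prod ?absv_ge0// gauss_mono// ltW.
  have g12 : g z2 < g z1.
    rewrite (le_lt_trans (decay z2 (ltW z12)))// gtr_pMr ?ltr_pdivrMr ?mul1r//.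
    by rewrite (le_lt_trans _ Mg)// (le_trans (absv_ge0 _) AB1).
  have := AB2; rewrite absvDr ?A2E ?B2E ?(lt_le_trans g12)// leNgt.
  by rewrite (lt_le_trans Mg b12).
have [E1 _] := gauss_inner (rD1' _ z1w).
have w0 : 0 < absv w by exact: lt_le_trans z1w.
rewrite absv_div E1 (le_trans (y := g w))//.
  by rewrite ler_wpM2r ?invr_ge0 ?(ltW (gauss_gt0 _ _))// gauss_ge.
rewrite (le_trans (decay _ z1w))// ler_wpM2r// divr_ge0 ?absv_ge0//.
Qed.

End GenericPoints.

Section Liouville.
Variables (R : realType) (F : finFieldType) (S : setting R F).
Notation C := (Cinf S).
Notation q := #|F|.
Notation A := {poly F}.
Notation th := (theta S).
Notation ev := (polyev (iota S) th).
Notation Kinf := (Kinfty (iota S) th).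
Implicit Types (f g : Omega S -> C).

Lemma affinoid_Omega n z : affinoid (S := S) n z -> Omega S z.
Proof.
move=> [_ zK] /zK; rewrite subrr absv0 leNgt invr_gt0 qRX_gt0//.
Qed.

Lemma OmegaP (z : C) : Omega S z -> exists w : Omega S, val w = z.
Proof. by move=> zO; exists (SigSub (mem_set zO)). Qed.

Lemma valO (z : Omega S) : Omega S (val z).
Proof. exact: set_valP. Qed.
Arguments valO : clear implicits.

Lemma poly_bounded (p : {poly C}) (M : R) : exists2 B, 0 <= B & forall z, absv z <= M -> absv p.[z] <= B.
Proof.
exists (gauss p M + Num.max 0 (gauss p M) - gauss p M); first by rewrite addrAC subrr add0r le_max lexx.
move=> z zM; rewrite addrAC subrr add0r le_max; apply/orP; right; exact: gauss_ge.
Qed.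

(** An affinoid contains every point closer than q^-n to one of its points, so a root of d stays at
    distance at least q^-n from it. *)
Lemma den_lb n (d : {poly C}) : (forall z, affinoid (S := S) n z -> d.[z] != 0) ->
  exists2 B, 0 < B & forall z, affinoid (S := S) n z -> B <= absv d.[z].
Proof.
move=> H; have [d0|d0] := eqVneq d 0.
  exists 1 => // z /H; by rewrite d0 horner0 eqxx.
have qn : 0 < q%:R ^- n :> R by rewrite invr_gt0 qRX_gt0.
exists (absv (lead_coef d) * (q%:R ^- n) ^+ size (proots d)).
  by rewrite mulr_gt0 ?exprn_gt0// absv_gt0 lead_coef_eq0.
move=> z zn; rewrite prootsE absvM absv_prod ler_wpM2l ?absv_ge0//.
have -> : (q%:R ^- n) ^+ size (proots d) = \prod_(a <- proots d) (q%:R ^- n : R).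
  by rewrite big_const_seq count_predT iter_mulr_1.
rewrite !big_seq; apply: ler_prod => a; rewrite mem_proots// => ra; rewrite (ltW qn) /=.
rewrite leNgt; apply/negP => za; suff : affinoid (S := S) n a by move=> /H; rewrite (eqP ra) eqxx.
have [zn1 zn2] := zn; split.
  rewrite -[a](subrK z) absvD_le// absv_subC (le_trans (ltW za))//.
  by rewrite (@le_trans _ _ 1) ?qRX_ge1// invf_le1 ?qRX_gt0// qRX_ge1.
move=> x /zn2 zx; rewrite leNgt; apply/negP => ax.
by have := absvD_lt za ax; rewrite subrKA ltNge zx.
Qed.

Lemma rigid_bounded f n : rigid_analytic f ->
  exists2 B, 0 <= B & forall z : Omega S, affinoid n (val z) -> absv (f z) <= B.
Proof.
move=> /(_ n 1 ltr01)[p [d H]].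
have [B B0 BP] := poly_bounded p (q%:R ^+ n).
have [|D D0 DP] := @den_lb n d.
  by move=> z zn; have [w wE] := OmegaP (affinoid_Omega zn); have := H w; rewrite wE => /(_ zn)[].
exists (Num.max 1 (B / D)); first by rewrite le_max ler01.
move=> z zn; have [d0 /ltW h] := H z zn.
rewrite -[f z](subrK (p.[val z] / d.[val z])) absvD_le ?le_max ?h//.
rewrite absv_div ler_pM ?orbT ?absv_ge0 ?invr_ge0 ?absv_ge0 ?BP//.
- by case: zn.
- by rewrite lef_pV2 ?posrE ?DP ?absv_gt0.
Qed.

Lemma rigid_lim f : (forall n (e : R), 0 < e -> exists2 g, rigid_analytic g &
    forall z : Omega S, affinoid n (val z) -> absv (f z - g z) < e) -> rigid_analytic f.
Proof.
move=> H n e e0; have [g /(_ n e e0)[p [d pd]] fg] := H n e e0.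
exists p, d => z zn; have [d0 h] := pd z zn; split=> //.
by rewrite -(subrKA (g z)) absvD_lt// fg.
Qed.

Lemma rigid_ext f g : f =1 g -> rigid_analytic f -> rigid_analytic g.
Proof. by move=> /funext ->. Qed.

Lemma rigid_ratio (p d : {poly C}) : (forall z, Omega S z -> d.[z] != 0) ->
  rigid_analytic (fun z : Omega S => p.[val z] / d.[val z]).
Proof. by move=> H n e e0; exists p, d => z zn; rewrite subrr absv0 H//; exact: valO. Qed.

Lemma rigid_poly (p : {poly C}) : rigid_analytic (fun z : Omega S => p.[val z]).
Proof.
apply: (rigid_ext (f := fun z : Omega S => p.[val z] / (1 : {poly C}).[val z])).
  by move=> z; rewrite hornerC divr1.
by apply: rigid_ratio => z _; rewrite hornerC oner_neq0.
Qed.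

Lemma rigidC (c : C) : rigid_analytic (fun _ : Omega S => c).
Proof. by apply: rigid_ext (rigid_poly c%:P) => z; rewrite hornerC. Qed.

Lemma rigidD f g : rigid_analytic f -> rigid_analytic g -> rigid_analytic (fun z => f z + g z).
Proof.
move=> fr gr n e e0; have [p [d pd]] := fr n e e0; have [p' [d' pd']] := gr n e e0.
exists (p * d' + p' * d), (d * d') => z zn; have [d0 h] := pd z zn; have [d'0 h'] := pd' z zn.
rewrite !hornerE mulf_neq0//; split=> //.
have -> : f z + g z - (p.[val z] * d'.[val z] + p'.[val z] * d.[val z]) / (d.[val z] * d'.[val z]) =
  (f z - p.[val z] / d.[val z]) + (g z - p'.[val z] / d'.[val z]) by field; rewrite d0 d'0.
exact: absvD_lt.
Qed.

Lemma rigidM f g : rigid_analytic f -> rigid_analytic g -> rigid_analytic (fun z => f z * g z).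
Proof.
move=> fr gr n e e0; have [B B0 fB] := rigid_bounded n fr; have [B' B'0 gB] := rigid_bounded n gr.
have M0 : 0 < B + B' + 1 by rewrite ltr_wpDl ?addr_ge0.
pose e1 := Num.min 1 (e / (B + B' + 1)).
have e10 : 0 < e1 by rewrite lt_min ltr01 divr_gt0.
have [p [d pd]] := fr n e1 e10; have [p' [d' pd']] := gr n e1 e10.
exists (p * p'), (d * d') => z zn; have [d0 h] := pd z zn; have [d'0 h'] := pd' z zn.
rewrite !hornerE mulf_neq0//; split=> //.
set x := f z in h *; set y := g z in h' *; set x' := p.[_] / _ in h; set y' := p'.[_] / _ in h'.
have -> : x * y - p.[val z] * p'.[val z] / (d.[val z] * d'.[val z]) = (x - x') * y + x' * (y - y').
  by rewrite /x' /y'; field; rewrite d0 d'0.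
have h1 : e1 * (B + B' + 1) <= e by rewrite -ler_pdivlMr// ge_min lexx orbT.
apply: absvD_lt; rewrite absvM.
  rewrite (le_lt_trans (ler_wpM2l (absv_ge0 _) (gB z zn)))// (lt_le_trans _ h1)//.
  rewrite (@le_lt_trans _ _ (e1 * B')) ?ler_wpM2r ?(ltW h)// ltr_pM2l// ltr_pwDr// lerDr.
  by [].
have x'B : absv x' < B + B' + 1.
  have -> : x' = x - (x - x') by rewrite opprB addrC subrK.
  apply: absvB_lt; first by rewrite (le_lt_trans (fB z zn))// -addrA ltrDl ltr_wpDl.
  by rewrite (lt_le_trans h)// (@le_trans _ _ 1) ?ge_min ?lexx// lerDr addr_ge0.
rewrite mulrC (lt_le_trans _ h1)// (@le_lt_trans _ _ (e1 * absv x'))//.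
  by rewrite ler_wpM2r ?absv_ge0// ltW.
by rewrite ltr_pM2l.
Qed.

Lemma rigidZ c f : rigid_analytic f -> rigid_analytic (fun z => c * f z).
Proof. exact: rigidM (rigidC c). Qed.

Lemma rigidN f : rigid_analytic f -> rigid_analytic (fun z => - f z).
Proof. by move=> /(rigidZ (-1)); apply: rigid_ext => z; rewrite mulN1r. Qed.

Lemma rigidB f g : rigid_analytic f -> rigid_analytic g -> rigid_analytic (fun z => f z - g z).
Proof. by move=> fr /rigidN; apply: rigidD. Qed.

Lemma rigidX f n : rigid_analytic f -> rigid_analytic (fun z => f z ^+ n).
Proof.
move=> fr; elim: n => [|n IH]; first exact: rigidC.
by apply: rigid_ext (rigidM fr IH) => z; rewrite exprS.
Qed.

Lemma rigid_sum (I : Type) (s : seq I) (P : pred I) (f : I -> Omega S -> C) :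
  (forall i, P i -> rigid_analytic (f i)) -> rigid_analytic (fun z => \sum_(i <- s | P i) f i z).
Proof.
move=> H; elim: s => [|i s IH].
  by apply: rigid_ext (rigidC 0) => z; rewrite big_nil.
case Pi : (P i); last by apply: rigid_ext IH => z; rewrite big_cons Pi.
by apply: rigid_ext (rigidD (H i Pi) IH) => z; rewrite big_cons Pi.
Qed.

Lemma rigid_prod (I : Type) (s : seq I) (P : pred I) (f : I -> Omega S -> C) :
  (forall i, P i -> rigid_analytic (f i)) -> rigid_analytic (fun z => \prod_(i <- s | P i) f i z).
Proof.
move=> H; elim: s => [|i s IH].
  by apply: rigid_ext (rigidC 1) => z; rewrite big_nil.
case Pi : (P i); last by apply: rigid_ext IH => z; rewrite big_cons Pi.
by apply: rigid_ext (rigidM (H i Pi) IH) => z; rewrite big_cons Pi.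
Qed.

(** A root of X^(n+1) - theta has absolute value q^(1/(n+1)); values outside q^Z are those that
    K_infty never takes. *)
Lemma dense_val (M : R) : 1 < M -> exists y : C, 1 < absv y < M.
Proof.
move=> M1; have M0 : 0 < M by exact: lt_trans M1.
have qi : 0 < (q%:R^-1 : R) by rewrite invr_gt0 qR_gt0.
have [|n /(_ n.+1 (leqnSn n)) nP] := @geom_lt _ (M^-1) (q%:R^-1) _ qi.
  by rewrite invr_ge0 (ltW M0) invf_lt1.
have /closed_rootP[y] : size ('X^(n.+1) - th%:P : {poly C}) != 1%N by rewrite size_XnsubC.
rewrite /root !hornerE subr_eq0 => /eqP yE.
have yq : absv y ^+ n.+1 = q%:R by rewrite -absvX yE abs_theta.
exists y; apply/andP; split.
  rewrite ltNge; apply/negP => y1; have := exprn_ile1 n.+1 (absv_ge0 y) y1.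
  by rewrite yq leNgt qR_gt1.
rewrite ltNge; apply/negP => My; move: nP; rewrite exprVn ltf_pV2 ?posrE ?exprn_gt0 ?qR_gt0//.
by rewrite -yq ltNge lerXn2r ?nnegrE ?(ltW M0) ?absv_ge0.
Qed.

Lemma two_radii n : exists z1 z2 : C,
  [/\ q%:R ^- n.+1 < absv z1 :> R, absv z1 < absv z2 & absv z2 < q%:R ^- n].
Proof.
have [y1 /andP[h1 h2]] := dense_val (qR_gt1 R F).
have y10 : 0 < absv y1 by exact: lt_trans h1.
have [|y2 /andP[h3 h4]] := @dense_val (q%:R / absv y1); first by rewrite ltr_pdivlMr// mul1r.
exists (y1 / th ^+ n.+1), (y1 * y2 / th ^+ n.+1); rewrite !absv_div absvM absv_thX.
split.
- by rewrite ltr_pMl ?invr_gt0 ?qRX_gt0.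
- by rewrite ltr_pM2r ?invr_gt0 ?qRX_gt0// ltr_pMr.
have -> : q%:R ^- n = q%:R / q%:R ^+ n.+1 :> R.
  by rewrite exprS; field; rewrite !gt_eqF ?qR_gt0 ?qRX_gt0.
by rewrite ltr_pM2r ?invr_gt0 ?qRX_gt0// mulrC -ltr_pdivlMr.
Qed.

(** Strict version of [affinoid]: a pole outside it and of small absolute value lies within the
    closed radius q^-n of a point of K_infty, and the annulus just outside that disc lies in it. *)
Definition Udom n (z : C) := absv z < q%:R ^+ n /\ forall y, Kinf y -> q%:R ^- n < absv (z - y).

Lemma Kinf_gap n x : Kinf x -> q%:R ^- n.+1 < absv x -> q%:R ^- n <= absv x.
Proof.
move=> xK xn; have x0 : x != 0 by rewrite -absv_gt0 (lt_trans _ xn)// invr_gt0 qRX_gt0.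
have [a [b E]] := Kinf_val xK x0; move: xn; rewrite E ltr_pdivlMr ?qRX_gt0// mulrC.
rewrite ltr_pdivrMr ?qRX_gt0// -exprD ltr_eXn2l ?qR_gt1// => h.
rewrite ler_pdivlMr ?qRX_gt0// mulrC ler_pdivrMr ?qRX_gt0// -exprD ler_weXn2l ?qR_ge1//.
by move: h; rewrite addnS ltnS.
Qed.

Lemma Kinf_noval n x : Kinf x -> q%:R ^+ n < absv x -> absv x < q%:R ^+ n.+1 -> False.
Proof.
move=> xK xn; have x0 : x != 0 by rewrite -absv_gt0 (lt_trans _ xn)// qRX_gt0.
have [a [b E]] := Kinf_val xK x0; move: xn; rewrite E ltr_pdivlMr ?qRX_gt0//.
rewrite ltr_pdivrMr ?qRX_gt0// -!exprD !ltr_eXn2l ?qR_gt1//.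
by move=> h1; rewrite addSn ltnS leqNgt h1.
Qed.

Lemma annulus_Udom n x a z : Kinf x -> absv (a - x) <= q%:R ^- n.+1 -> absv a < q%:R ^+ n.+1 ->
  q%:R ^- n.+1 < absv (z - x) < q%:R ^- n -> Udom n.+1 z.
Proof.
move=> xK ax an /andP[z1 z2]; have q1 : q%:R ^- n <= 1 :> R by rewrite invf_le1 ?qRX_gt0 ?qRX_ge1.
have q2 : 1 < q%:R ^+ n.+1 :> R by rewrite exprn_egt1 ?qR_gt1.
split.
  rewrite -(subrK x z) absvD_lt//; first by rewrite (lt_trans z2)// (le_lt_trans q1).
  have -> : x = a - (a - x) by rewrite opprB addrC subrK.
  rewrite absvB_lt// (le_lt_trans ax)// (lt_trans _ q2)// invf_lt1 ?qRX_gt0//.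
move=> y yK; have [xy|xy] := leP (absv (x - y)) (q%:R ^- n.+1).
  by rewrite -(subrKA x) absvDl// (le_lt_trans xy).
have := Kinf_gap (KinfB xK yK) xy => h.
by rewrite -(subrKA x) absvDr// (lt_le_trans z2).
Qed.

Lemma outer_root n x a b : Kinf x -> absv (a - x) <= q%:R ^- n.+1 -> absv a < q%:R ^+ n.+1 ->
  ~ Udom n.+1 b -> q%:R ^- n.+1 < absv (b - x) -> q%:R ^- n <= absv (b - x).
Proof.
move=> xK ax an bU bx; rewrite leNgt; apply/negP => h; apply: bU.
by apply: annulus_Udom xK ax an _; rewrite bx.
Qed.

(** Schwarz lemma for rational functions: bounded by M on a large domain, they vary by at most M
    q^(m-n) on a small one. Poles are removed one disc around a point of K_infty at a time; the
    ultrametric inequality keeps the bound M unchanged through the induction. *)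
Lemma rational_osc m n (M : R) : (m <= n)%N -> forall (P D : {poly C}), D != 0 ->
  (forall a, root D a -> ~ Udom n.+1 a) ->
  (forall z, Udom n.+1 z -> absv (P.[z] / D.[z]) <= M) ->
  forall z1 z2, affinoid (S := S) m z1 -> affinoid m z2 ->
  absv (P.[z1] / D.[z1] - P.[z2] / D.[z2]) <= M * (q%:R ^+ m / q%:R ^+ n).
Proof.
move=> mn P D; have [k] := ubnP (size D); elim: k => // k IH in P D *.
rewrite ltnS => Dk D0 rD PM z1 z2 z1m z2m.
have qm : 0 < q%:R ^+ m :> R by exact: qRX_gt0.
have qn : 0 < q%:R ^+ n :> R by exact: qRX_gt0.
have [w1 [w2 [w1a w12 w2b]]] := two_radii n.
have w10 : 0 < absv w1 by rewrite (lt_trans _ w1a)// invr_gt0 qRX_gt0.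
have mU z : affinoid (S := S) m z -> Udom n.+1 z.
  move=> [za zb]; split; first by rewrite (le_lt_trans za)// ltr_eXn2l ?qR_gt1.
  move=> y /zb; apply: lt_le_trans; rewrite ltf_pV2 ?posrE ?qRX_gt0//.
  by rewrite ltr_eXn2l ?qR_gt1.
have M0 : 0 <= M by exact: le_trans (absv_ge0 _) (PM z1 (mU _ z1m)).
(* Without poles in the disc of radius q^(n+1), |D| is constant there and the classical Schwarz
   argument applies on a circle whose radius lies strictly between q^n and q^(n+1). *)
have [[a aD an]|noa] := pselect (exists2 a, root D a & absv a < q%:R ^+ n.+1); last first.
  have {noa}H a : a \in proots D -> q%:R ^+ n.+1 <= absv a.
    by rewrite mem_proots// => aD; rewrite leNgt; apply/negP => an; apply: noa; exists a.
  pose w : C := w1 * th ^+ n.+1 * th ^+ n.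
  have wE : absv w = absv w1 * q%:R ^+ n.+1 * q%:R ^+ n by rewrite !absvM !absv_thX.
  have wn : q%:R ^+ n < absv w.
    by rewrite wE ltr_pMl// -ltr_pdivrMr ?qRX_gt0// div1r.
  have wn1 : absv w < q%:R ^+ n.+1.
    rewrite wE mulrAC gtr_pMl ?qRX_gt0// -ltr_pdivlMr// div1r.
    exact: lt_trans w2b.
  have w0 : 0 < absv w by exact: lt_trans wn.
  have qn1 : 1 <= q%:R ^+ n :> R by exact: qRX_ge1.
  pose G := absv (lead_coef D) * \prod_(a <- proots D) absv a.
  have DE v : absv v < q%:R ^+ n.+1 -> absv D.[v] = G.
    move=> vn; rewrite prootsE absvM absv_prod; congr (_ * _).
    by apply: eq_big_seq => a /H aq; rewrite absvBr// (lt_le_trans vn).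
  have zn v : affinoid (S := S) m v -> absv v <= q%:R ^+ m /\ absv v < q%:R ^+ n.+1.
    by move=> vm; have [? _] := mU _ vm; split=> //; case: vm.
  have [z1q z1n] := zn _ z1m; have [z2q z2n] := zn _ z2m.
  have G0 : 0 < G.
    rewrite -(DE z1)// absv_gt0; apply/eqP => /eqP h; exact: rD h (mU _ z1m).
  (* Numerator of the difference of values at a point and at [z2]; it is divisible by X - z2, and
     the quotient is bounded through its Gauss norm. *)
  pose N := P * (D.[z2])%:P - (P.[z2])%:P * D.
  have /factor_theorem[Q NQ] : root N z2 by rewrite /root /N !hornerE subrr.
  have [|x xE X] := @gauss_generic _ _ [:: Q] w; first by rewrite -absv_gt0.
  have xn : absv x < q%:R ^+ n.+1 by rewrite xE.
  have xU : Udom n.+1 x.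
    split=> // y yK; have x1 : q%:R ^- n.+1 < absv x.
      by rewrite xE (lt_trans _ wn)// (lt_le_trans _ qn1)// invf_lt1 ?qRX_gt0// exprn_egt1 ?qR_gt1.
    case: (ltgtP (absv x) (absv y)) => xy.
    - by rewrite absvBr// (lt_trans x1).
    - by rewrite absvBl.
    - have [] := Kinf_noval (n := n) yK; by rewrite -xy xE.
  have nz v : absv v < q%:R ^+ n.+1 -> D.[v] != 0 by move=> vn; rewrite -absv_gt0 DE.
  have NE v : absv v < q%:R ^+ n.+1 ->
      absv N.[v] = absv (P.[v] / D.[v] - P.[z2] / D.[z2]) * G ^+ 2.
    move=> vn; rewrite expr2 -{1}(DE v vn) -(DE z2 z2n) -!absvM; congr absv.
    rewrite /N hornerD hornerN !hornerM !hornerC; move: (nz v vn) (nz z2 z2n).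
    by move: (D.[v]) (D.[z2]) (P.[v]) (P.[z2]) => a b c e a0 b0; field; rewrite a0 b0.
  have Qx : absv w * gauss Q (absv w) <= M * G ^+ 2.
    rewrite -X ?inE// -xE -[in X in X * _](_ : absv (x - z2) = absv x); last first.
      by rewrite absvBl// (le_lt_trans z2q)// xE (le_lt_trans _ wn)// ler_weXn2l ?qR_ge1.
    have -> : absv (x - z2) * absv Q.[x] = absv N.[x].
      by rewrite NQ hornerM hornerXsubC absvM mulrC.
    rewrite NE// ler_wpM2r ?exprn_ge0 ?(ltW G0)// absvB_le ?PM//; exact: mU.
  have := NE z1 z1n; rewrite NQ hornerM hornerXsubC absvM => E.
  rewrite -(ler_pM2r (exprn_gt0 2 G0)) -E.
  have h1 : absv Q.[z1] <= gauss Q (absv w).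
    by apply: gauss_ge; rewrite (le_trans z1q)// (le_trans _ (ltW wn))// ler_weXn2l ?qR_ge1.
  have h2 : absv (z1 - z2) <= q%:R ^+ m by rewrite absvB_le.
  apply: (@le_trans _ _ (gauss Q (absv w) * q%:R ^+ m)).
    by rewrite ler_pM ?absv_ge0.
  have -> : M * (q%:R ^+ m / q%:R ^+ n) * G ^+ 2 = M * G ^+ 2 / q%:R ^+ n * q%:R ^+ m by ring.
  rewrite ler_pM2r// ler_pdivlMr// (le_trans _ Qx)// mulrC ler_wpM2r ?(ltW wn)//.
  exact: le_trans (absv_ge0 _) h1.
have [x xK ax] : exists2 x, Kinf x & absv (a - x) <= q%:R ^- n.+1.
  apply: contrapT => Hx; apply: (rD a aD); split=> // y yK.
  by rewrite ltNge; apply/negP => h; apply: Hx; exists y.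
pose T := [pred b : C | absv (b - x) <= q%:R ^- n.+1].
pose D1 := \prod_(b <- [seq b <- proots D | T b]) ('X - b%:P).
pose D2 := lead_coef D *: \prod_(b <- [seq b <- proots D | ~~ T b]) ('X - b%:P).
have l0 : lead_coef D != 0 by rewrite lead_coef_eq0.
have DD : D = D1 * D2.
  rewrite {1}(svalP (closed_field_poly_normal D)) -/(proots D) (bigID T)/=.
  by rewrite /D1 /D2 -scalerAr !big_filter.
have D10 : D1 != 0 by apply: contraNneq D0; rewrite DD => ->; rewrite mul0r.
have D20 : D2 != 0 by apply: contraNneq D0; rewrite DD => ->; rewrite mulr0.
have r1P b : root D1 b -> b \in proots D /\ T b.
  by rewrite /D1 root_prod_XsubC mem_filter => /andP[].
have r2P b : root D2 b -> b \in proots D /\ ~~ T b.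
  by rewrite /D2 rootZ// root_prod_XsubC mem_filter => /andP[].
have cop : coprimep D1 D2.
  have [//|] := eqVneq (size (gcdp D1 D2)) 1%N; first by rewrite /coprimep => ->.
  move=> /closed_rootP[b]; rewrite root_gcd => /andP[/r1P[_ Tb] /r2P[_]].
  by rewrite Tb.
(* Partial fractions: P1/D1 carries the poles near x and vanishes at infinity, P2/D2 the others. The
   annulus around x bounds the first part, hence also the second, which has fewer poles. *)
have /Bezout_eq1_coprimepP[[uu vv] /= uv] := cop.
pose P1 := (P * vv) %% D1; pose Q := (P * vv) %/ D1; pose P2 := P * uu + Q * D2.
have split_ z : Udom n.+1 z -> [/\ D1.[z] != 0, D2.[z] != 0 &
    P.[z] / D.[z] = P1.[z] / D1.[z] + P2.[z] / D2.[z]].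
  move=> zU; have : D.[z] != 0 by apply/eqP => /eqP h; exact: rD h zU.
  rewrite DD hornerM mulf_eq0 negb_or => /andP[h1 h2]; split=> //.
  have E1 := congr1 (fun p : {poly C} => p.[z]) (divp_eq (P * vv) D1).
  have E2 := congr1 (fun p : {poly C} => p.[z]) uv.
  rewrite /= -/P1 -/Q hornerM hornerD hornerM in E1; rewrite /= hornerD !hornerM hornerC in E2.
  rewrite [P2.[z]]hornerD !hornerM addf_div//; congr (_ / _).
  transitivity (P.[z] * (uu.[z] * D1.[z] + vv.[z] * D2.[z])); first by rewrite E2 mulr1.
  by rewrite mulrDr [P.[z] * (vv.[z] * _)]mulrA E1; ring.
pose sh (p : {poly C}) := p \Po ('X + x%:P).
have shE p v : (sh p).[v] = p.[v + x] by rewrite /sh horner_comp !hornerE.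
have shroot p v : root (sh p) v = root p (v + x) by rewrite /root shE.
have shsize p : size (sh p) = size p by rewrite size_comp_poly2// size_XaddC.
have shn0 p : p != 0 -> sh p != 0 by rewrite -!size_poly_eq0 shsize.
have ann (v1 v2 v : C) : 0 < absv v1 -> q%:R ^- n.+1 < absv v1 -> absv v1 < absv v2 ->
    absv v2 < q%:R ^- n -> absv v1 <= absv v -> absv (P1.[v + x] / D1.[v + x]) <= M * (absv v1 / absv v).
  move=> h1 h2 h3 h4 h5; rewrite -!shE.
  apply: (@annulus_split _ _ _ _ (sh P2) (sh D2) (q%:R ^- n.+1) (q%:R ^- n) M v1 v2 v) => //.
  - exact: shn0.
  - exact: shn0.
  - by rewrite !shsize ltn_modp.
  - by move=> b; rewrite shroot => /r1P[_]; rewrite /T/= addrK.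
  - move=> b; rewrite shroot => /r2P[bD]; rewrite /T/= addrK -ltNge => h.
    have := outer_root (b := b + x) xK ax an; rewrite addrK; apply=> //.
    by apply: rD; rewrite -mem_proots.
  - move=> z hz; have zU : Udom n.+1 (z + x).
      by apply: annulus_Udom xK ax an _; rewrite addrK.
    by have [_ _ E] := split_ _ zU; rewrite !shE -E PM.
have bU z : Udom n.+1 z -> absv (P1.[z] / D1.[z]) <= M.
  move=> [_ /(_ x xK) zx]; have z0 : 0 < absv (z - x) by rewrite (lt_trans _ zx)// invr_gt0 qRX_gt0.
  have [h|h] := leP (absv w1) (absv (z - x)).
    have := ann w1 w2 (z - x) w10 w1a w12 w2b h; rewrite subrK => /le_trans; apply.
    by rewrite ler_piMr// ler_pdivrMr// mul1r.
  have := ann (z - x) w1 (z - x) z0 zx h (lt_trans w12 w2b) (lexx _); rewrite subrK => /le_trans; apply.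
  by rewrite divff ?gt_eqF// mulr1.
have bm z : affinoid (S := S) m z -> absv (P1.[z] / D1.[z]) <= M * (q%:R ^+ m / q%:R ^+ n).
  move=> [_ /(_ x xK) zx]; have z0 : 0 < absv (z - x) by rewrite (lt_le_trans _ zx)// invr_gt0 qRX_gt0.
  have h1 : absv w1 <= q%:R ^- n by exact: ltW (lt_trans w12 w2b).
  have h : absv w1 <= absv (z - x).
    rewrite (le_trans h1)// (le_trans _ zx)// lef_pV2 ?posrE ?qRX_gt0// ler_weXn2l ?qR_ge1//.
  have := ann w1 w2 (z - x) w10 w1a w12 w2b h; rewrite subrK => /le_trans; apply.
  rewrite ler_wpM2l// mulrC ler_pM ?invr_ge0 ?absv_ge0//.
  by rewrite -[q%:R ^+ m]invrK lef_pV2 ?posrE// invr_gt0.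
have [_ _ E1] := split_ _ (mU _ z1m); have [_ _ E2] := split_ _ (mU _ z2m).
have -> : P.[z1] / D.[z1] - P.[z2] / D.[z2] = (P1.[z1] / D1.[z1] - P1.[z2] / D1.[z2]) +
   (P2.[z1] / D2.[z1] - P2.[z2] / D2.[z2]) by rewrite E1 E2; ring.
apply: absvD_le; first by rewrite absvB_le ?bm.
apply: IH => //.
- have aD1 : a \in [seq b <- proots D | T b] by rewrite mem_filter /= ax mem_proots.
  rewrite (leq_trans _ Dk)// /D2 size_scale// size_prod_XsubC (size_proots D0) ltnS.
  rewrite !size_filter -(count_predC T (proots D)) -[X in (X < _)%N]add0n ltn_add2r.
  by rewrite -has_count; apply/hasP; exists a; move: aD1; rewrite mem_filter => /andP[].
- by move=> b /r2P[]; rewrite mem_proots// => /rD.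
move=> z zU; have [_ _ E] := split_ _ zU.
have -> : P2.[z] / D2.[z] = P.[z] / D.[z] - P1.[z] / D1.[z] by rewrite E addrC addKr.
by rewrite absvB_le ?PM ?bU.
Qed.

(** Approximate f within e by a rational function on a very large affinoid; it is bounded there by
    max(M, e), and its oscillation at two fixed points falls below e when n is large. *)
Theorem rigid_liouville f (M : R) : rigid_analytic f -> (forall z, absv (f z) <= M) ->
  forall z1 z2, f z1 = f z2.
Proof.
move=> fr fM z1 z2; apply/eqP; rewrite -subr_eq0 -absv_eq0; apply/eqP/le_anti.
rewrite absv_ge0 andbT; apply/ler_addgt0Pl => e e0; rewrite addr0.
have [m1 h1] := Omega_affinoid (valO z1); have [m2 h2] := Omega_affinoid (valO z2).
pose m := maxn m1 m2; have M0 : 0 <= M by exact: le_trans (absv_ge0 _) (fM z1).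
have [n0 n0P] := expq_unbounded F ((Num.max M e) * q%:R ^+ m / e).
pose n := maxn m n0.
have [p [d pd]] := fr n.+1 e e0.
have UA z : Udom n.+1 z -> affinoid n.+1 z.
  by move=> [za zb]; split; [exact: ltW|move=> y /zb/ltW].
have pdO z : Udom n.+1 z -> exists2 w : Omega S, val w = z & d.[z] != 0 /\ absv (f w - p.[z] / d.[z]) < e.
  move=> zU; have [w wE] := OmegaP (affinoid_Omega (UA z zU)); exists w => //.
  by rewrite -wE; apply: pd; rewrite wE; exact: UA.
have d0 : d != 0.
  have [|d0 _] := pd z1 (affinoid_le _ h1); first by rewrite leqW// (leq_trans _ (leq_maxl _ _))// leq_maxl.
  by apply: contraNneq d0 => ->; rewrite horner0.
have H := @rational_osc m n (Num.max M e) (leq_maxl _ _) p d d0 _ _ (val z1) (val z2)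
  (affinoid_le (leq_maxl _ _) h1) (affinoid_le (leq_maxr _ _) h2).
have az1 : affinoid n.+1 (val z1) by apply: affinoid_le h1; rewrite leqW// (leq_trans _ (leq_maxl _ _))// leq_maxl.
have az2 : affinoid n.+1 (val z2) by apply: affinoid_le h2; rewrite leqW// (leq_trans _ (leq_maxl _ _))// leq_maxr.
have -> : f z1 - f z2 = (f z1 - p.[val z1] / d.[val z1]) - (f z2 - p.[val z2] / d.[val z2]) +
   (p.[val z1] / d.[val z1] - p.[val z2] / d.[val z2]) by ring.
apply: absvD_le; first by rewrite absvB_le// ltW//; [case: (pd z1 az1)|case: (pd z2 az2)].
apply: le_trans (H _ _) _.
- by move=> a /eqP da /pdO[w _ []]; rewrite da eqxx.
- move=> z /pdO[w _ [_ h]]; rewrite -[p.[z] / d.[z]](subrK (f w)) absvD_le//.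
    by rewrite absv_subC le_max (ltW h) orbT.
  by rewrite le_max fM.
rewrite mulrA ler_pdivrMr ?qRX_gt0// [e * _]mulrC -ler_pdivrMr// (le_trans n0P)//.
by rewrite ler_weXn2l ?qR_ge1// leq_maxr.
Qed.

End Liouville.

(** * The Moore determinant of s_1 and s_2 *)

Section BarMorphism.
Variables (R : realType) (F : finFieldType) (S : setting R F).
Notation C := (Cinf S).
Notation q := #|F|.
Notation A := {poly F}.
Notation th := (theta S).
Notation ev := (polyev (iota S) th).
Notation bar := (bar S).

Lemma barD a b : bar (a + b) = bar a + bar b.
Proof. by apply: fpsP => i /=; rewrite coefD rmorphD. Qed.
Lemma barN a : bar (- a) = - bar a.
Proof. by apply: fpsP => i /=; rewrite coefN rmorphN. Qed.
Lemma barM a b : bar (a * b) = bar a * bar b.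
Proof.
apply: fpsP => i /=; rewrite coefM rmorph_sum; apply: eq_bigr => j _.
by rewrite rmorphM.
Qed.
Lemma barC c : bar c%:P = fps_const (iota S c).
Proof. by apply: fpsP => -[|i] /=; rewrite coefC //= rmorph0. Qed.
Lemma bar1 : bar 1 = 1. Proof. by rewrite -[1 in LHS]/(1%:P) barC rmorph1. Qed.
Lemma bar0 : bar 0 = 0. Proof. by rewrite -[0 in LHS]/(0%:P) barC rmorph0. Qed.
Lemma barXn n : bar 'X^n = fps_X C ^+ n.
Proof.
have bX : bar 'X = fps_X C.
  by apply: fpsP => i; rewrite /= coefX; case: (i == 1%N); rewrite ?rmorph1 ?rmorph0.
elim: n => [|n IH]; first by rewrite expr0 bar1.
by rewrite exprS barM IH bX -exprS.
Qed.

Lemma twist_bar a : twist (F := F) (bar a) = bar a.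
Proof. by apply: fpsP => i /=; rewrite frob_iota. Qed.

Lemma unit_const (p : A) : p \is a GRing.unit -> exists2 c, c != 0 & p = c%:P.
Proof.
rewrite poly_unitE => /andP[/eqP p1 p0]; exists p`_0; last by rewrite -size1_polyC// p1.
by rewrite unitfE in p0.
Qed.

Lemma det_const (g : 'M[A]_2) : g \in unitmx -> exists c,
  [/\ c != 0, \det g = c%:P & detC S g = iota S c].
Proof.
rewrite unitmxE => /unit_const[c c0 E]; exists c; split=> //.
by rewrite /detC E evC.
Qed.

Lemma absv_detC (g : 'M[A]_2) : g \in unitmx -> absv (detC S g) = 1.
Proof. by move=> /det_const[c [c0 _ ->]]; exact: absv_iota. Qed.

Lemma detC_neq0 (g : 'M[A]_2) : g \in unitmx -> detC S g != 0.
Proof. by move=> gu; rewrite -absv_gt0 absv_detC. Qed.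

Lemma bar_det (g : 'M[A]_2) : g \in unitmx ->
  bar (g 0 0) * bar (g 1 1) - bar (g 0 1) * bar (g 1 0) = fps_const (detC S g).
Proof.
move=> gu; have [c [_ E ->]] := det_const gu.
by rewrite -barC -E det_mx22E barD barN !barM.
Qed.

Lemma detC_mul (g g' : 'M[A]_2) : detC S (g *m g') = detC S g * detC S g'.
Proof. by rewrite /detC det_mulmx evM. Qed.

Lemma frob_detC (g : 'M[A]_2) : g \in unitmx -> detC S g ^+ q = detC S g.
Proof. by move=> /det_const[c [_ _ ->]]; exact: frob_iota. Qed.

End BarMorphism.

Section Wronskian.
Variables (R : realType) (F : finFieldType) (S : setting R F).
Notation C := (Cinf S).
Notation q := #|F|.
Notation A := {poly F}.
Notation th := (theta S).
Notation ev := (polyev (iota S) th).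
Notation r := (q%:R^-1 : R).
Notation eA := (@eA R F S).
Notation Kinf := (Kinfty (iota S) th).

Lemma lat_neq0 z (l : A * A) : Omega S z -> l != 0 -> lat z l != 0.
Proof.
case: l => b a zO l0; rewrite latE; have [a0|a0] := eqVneq a 0; last exact: Omega_affine.
rewrite a0 ev0 mul0r add0r ev_eq0; apply: contra l0 => /eqP ->.
by rewrite a0.
Qed.

Lemma rigid_id : rigid_analytic (fun z : Omega S => val z).
Proof. by apply: rigid_ext (rigid_poly 'X) => z; rewrite hornerX. Qed.

Lemma rigid_latV (l : A * A) : l != 0 -> rigid_analytic (fun z : Omega S => (lat (val z) l)^-1).
Proof.
move=> l0; apply: rigid_ext (@rigid_ratio _ _ S 1 ((ev l.1)%:P + 'X * (ev l.2)%:P) _) => z.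
  by rewrite hornerD hornerM !hornerC hornerX div1r.
by rewrite hornerD hornerM !hornerC hornerX => zO; exact: lat_neq0.
Qed.

Lemma rigid_eL (c1 c0 : C) :
  rigid_analytic (fun z : Omega S => e_lattice (val z) (c1 * val z + c0)).
Proof.
apply: rigid_lim => n e e0.
have zr : rigid_analytic (fun z : Omega S => c1 * val z + c0).
  exact: rigidD (rigidZ _ rigid_id) (rigidC _).
pose K := absv c1 * q%:R ^+ n + absv c0.
have K0 : 0 <= K by rewrite addr_ge0 ?mulr_ge0 ?absv_ge0 ?exprn_ge0 ?ler0n.
have [B B0 BP] := e_lattice_box S n K0.
have B1 : 0 < B + 1 by rewrite ltr_wpDl.
have [|d /(_ d (leqnn d)) dP] := @geom_lt _ r (e / (B + 1)) _ (divr_gt0 e0 B1).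
  by case/andP: (@qV01 R F) => /ltW -> ->.
exists (fun z => eL d d (val z) (c1 * val z + c0)).
  apply: (rigidM zr); apply: rigid_prod => l l0; apply: rigidB (rigidC _) _.
  exact: (rigidM zr (rigid_latV l0)).
move=> z zn; have [|_ h] := BP (val z) (c1 * val z + c0) zn _ d d (leqnn d).
  apply: absvD_le; rewrite /K ?lerDr ?mulr_ge0 ?absv_ge0 ?exprn_ge0 ?ler0n//.
  rewrite absvM (@le_trans _ _ (absv c1 * q%:R ^+ n)) ?lerDl ?absv_ge0//.
  by rewrite ler_wpM2l ?absv_ge0//; case: zn.
rewrite (le_lt_trans h)//; move: dP; rewrite ltr_pdivlMr// mulrC; apply: le_lt_trans.
by rewrite ler_wpM2r ?exprn_ge0 ?invr_ge0 ?ler0n// lerDl.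
Qed.

Lemma rigid_s1 i : rigid_analytic (fun z : Omega S => s_1 (val z) i).
Proof.
by apply: rigid_ext (rigid_eL (th ^- i.+1) 0) => z; rewrite addr0 mulrC.
Qed.

Lemma rigid_s2 i : rigid_analytic (fun z : Omega S => s_2 (val z) i).
Proof.
by apply: rigid_ext (rigid_eL 0 (th ^- i.+1)) => z; rewrite mul0r add0r /= mul1r.
Qed.

(** If |w| is not in q^Z, no element of K_infty has the absolute value of w, so nothing cancels in w
    - x. *)
Lemma Fd_large (M : R) : exists2 w : C, Fd w & M <= absv w.
Proof.
have [n nP] := expq_unbounded F M; have [y /andP[y1 yq]] := dense_val S (qR_gt1 R F).
pose w : C := y * th ^+ n; have wE : absv w = absv y * q%:R ^+ n by rewrite absvM absv_thX.
have wn : q%:R ^+ n < absv w by rewrite wE ltr_pMl ?qRX_gt0.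
have wn1 : absv w < q%:R ^+ n.+1 by rewrite wE exprS ltr_pM2r ?qRX_gt0.
exists w; last exact: le_trans nP (ltW wn).
split; first by rewrite (le_trans _ (ltW wn))// qRX_ge1.
move=> x xK; case: (ltgtP (absv w) (absv x)) => h.
- by rewrite absvBr// ltW.
- by rewrite absvBl.
- by have [] := Kinf_noval (n := n) xK; rewrite -h.
Qed.

Lemma eA_Omega_neq0 z : Omega S z -> eA z != 0.
Proof.
move=> zO; apply/eqP => /eA_eq0[a E]; have := Omega_affine (- a) zO (oner_neq0 _).
by rewrite ev1 mul1r evN E subrr eqxx.
Qed.

(* Moore determinant of s_1 and s_2; it has weight -(q+1), so that its product with h is
   invariant. *)
Definition Wr (z : C) : fps C := s_1 z * twist (s_2 z) - s_2 z * twist (s_1 z).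

Lemma Wr_mobius g z : g \in unitmx -> Omega S z ->
  Wr (mobius_C g z) = fps_const ((J g z) ^- q.+1 * detC S g) * Wr z.
Proof.
move=> gu zO; rewrite /Wr s_1_mobius// s_2_mobius// !twistM !twistD !twistM !twistC !twist_bar.
rewrite fps_constM -bar_det// -exprVn exprS fps_constM; ring.
Qed.

Lemma rigid_Wr n : rigid_analytic (fun z : Omega S => Wr (val z) n).
Proof.
apply: rigid_ext (rigidB (f := fun z : Omega S => \sum_(i < n.+1) s_1 (val z) i * s_2 (val z) (n - i)%N ^+ q)
  (g := fun z : Omega S => \sum_(i < n.+1) s_2 (val z) i * s_1 (val z) (n - i)%N ^+ q) _ _) => //.
- by apply: rigid_sum => i _; apply: rigidM (rigid_s1 _) (rigidX _ (rigid_s2 _)).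
- by apply: rigid_sum => i _; apply: rigidM (rigid_s2 _) (rigidX _ (rigid_s1 _)).
Qed.

Lemma absv_s2_le w i : Fd w -> absv (s_2 w i : C) <= 1.
Proof.
by move=> wF; rewrite (absv_s2_Fd i wF) exprn_ile1 ?invr_ge0 ?ler0n// invf_le1 ?qR_ge1 ?qR_gt0.
Qed.

(** The bound matches |e_A(w)| = 1/|pi u(w)|, so that multiplying by h, which vanishes to order one
    in u, gives a bounded function. *)
Lemma Wr_Fd w n : Fd w -> absv (Wr w n) <= absv (eA w).
Proof.
move=> wF; have e1 := eA_Fd_ge1 wF; have e0 : 0 <= absv (eA w) by exact: absv_ge0.
have YE := eA_Fd_pow wF; set Y := absv (eA (w / th)) in YE.
have Y0 : 0 <= Y by exact: absv_ge0.
have Ye : Y <= absv (eA w).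
  have [Y1|Y1] := leP Y 1; first exact: le_trans e1.
  by rewrite (le_trans _ YE)// -{1}[Y]expr1 ler_weXn2l ?q_gt0// ltW.
have s2q i : absv (s_2 w i ^+ q : C) <= 1.
  by rewrite absvX exprn_ile1 ?absv_ge0 ?absv_s2_le.
rewrite fpsB; apply: absvB_le; rewrite fpsM absv_sum_le// => i _; rewrite absvM.
  rewrite (le_trans _ Ye)// -[Y]mulr1 ler_pM ?absv_ge0//; first exact: absv_s1_Fd.
  exact: s2q.
rewrite (le_trans _ YE)// -[Y ^+ q]mul1r ler_pM ?absv_ge0 ?absv_s2_le//.
by rewrite /= absvX lerXn2r ?nnegrE ?absv_ge0// absv_s1_Fd.
Qed.

Lemma eL_div_th z (c d : A) : Omega S z -> e_lattice z ((ev c * z + ev d) / th) = 0 ->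
  exists a b, c = a * 'X /\ d = b * 'X.
Proof.
move=> zO /(eL_eq0 zO)[a [b E]]; exists a, b.
have E2 : ev (c - a * 'X) * z + ev (d - b * 'X) = 0.
  rewrite !evB !evM evX -[ev c]/(ev c).
  have : ev c * z + ev d = (ev a * z + ev b) * th by rewrite -E mulfVK ?th_neq0.
  by move=> E3; transitivity (ev c * z + ev d - (ev a * z + ev b) * th); [ring|rewrite E3 subrr].
have c0 : c - a * 'X = 0.
  by apply/eqP/negPn/negP => h; have := Omega_affine (d - b * 'X) zO h; rewrite E2 eqxx.
move: E2; rewrite c0 ev0 mul0r add0r => /eqP; rewrite ev_eq0 => /eqP d0.
by split; apply/eqP; rewrite -subr_eq0 ?c0 ?d0.
Qed.

Lemma s2_0_neq0 z : Omega S z -> s_2 z 0%N != 0 :> C.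
Proof.
move=> zO; apply/eqP => /= E; have [|a [b [_ /eqP]]] := @eL_div_th z 0 1 zO.
  by rewrite ev0 mul0r add0r ev1 -[X in _ / X]expr1.
by move=> /eqP/(congr1 (fun p : A => p`_0)); rewrite coef1 coefMX/= => /eqP; rewrite oner_eq0.
Qed.

Lemma s2_unit z : Omega S z -> (s_2 z : fps C) \is a GRing.unit.
Proof. by move=> zO; rewrite fps_unitE s2_0_neq0. Qed.

(** Vanishing of x y^q - y x^q puts x/y in F_q, whereas e_z(z/theta) and e_z(1/theta) are
    F_q-independent theta-torsion points. *)
Lemma Wr0_neq0 z : Omega S z -> Wr z 0%N != 0.
Proof.
move=> zO; have y0 := s2_0_neq0 zO; apply/eqP; rewrite /Wr fpsB !fpsM0 /=.
rewrite expr1; move: y0; rewrite /= expr1.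
set x := e_lattice z (z / th); set y := e_lattice z (1 / th) => y0 E.
have [c cE] : exists c, x / y = iota S c.
  apply: frob_fixed; rewrite expr_div_n; apply/eqP; rewrite eqr_div ?expf_neq0//.
  by rewrite -subr_eq0 mulrC -opprB E oppr0.
have [|a [b [/eqP h _]]] := @eL_div_th z 1 (- c%:P) zO.
  rewrite evN evC ev1 mul1r mulrBl eLB// -[iota S c]mulr1 -mulrA eLZ// -cE.
  by rewrite -/x -/y mulfVK// subrr.
by have := congr1 (fun p : A => p`_0) (eqP h); rewrite coef1 coefMX/= => /eqP; rewrite oner_eq0.
Qed.

End Wronskian.

(** * Expansions at the cusp *)

Section UAdicLimit.
Variables (R : realType) (F : finFieldType) (S : setting R F).
Notation C := (Cinf S).
Implicit Types (M rho : R) (t : C).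

Lemma eval_tail M rho (f : fps C) t d : 0 <= rho -> bd M rho f -> rho * absv t < 1 ->
  (forall m, (m < d)%N -> f m = 0) -> absv (fps_eval f t) <= M * (rho * absv t) ^+ d.
Proof.
move=> r0 fM rt f0; have M0 := bd_ge0 fM; have rt0 : 0 <= rho * absv t by rewrite mulr_ge0 ?absv_ge0.
apply: eval_le => [|n]; first exact: bd_conv fM rt.
case: (ltnP n d) => nd.
  by rewrite /fps_terms f0// mul0r absv0 mulr_ge0 ?exprn_ge0.
apply: le_trans (bd_terms _ _ fM) _; rewrite ler_wpM2l//.
by rewrite ler_wiXn2l// ltW.
Qed.

Lemma eval_bd M rho (f : fps C) t : 0 <= rho -> bd M rho f -> rho * absv t < 1 ->
  absv (fps_eval f t) <= M.
Proof. by move=> r0 fM rt; have := eval_tail (d := 0) r0 fM rt; rewrite expr0 mulr1; apply. Qed.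

Lemma evalB (f g : fps C) t : conv f t -> conv g t ->
  fps_eval (f - g) t = fps_eval f t - fps_eval g t.
Proof. by move=> cf cg; rewrite evalD ?evalN//; exact: convN. Qed.

(** Limit of series whose coefficient of index m no longer changes from P_(m+1) on; with a common
    bound, evaluation commutes with it. *)
Definition diag (P : nat -> fps C) : fps C := Fps (fun m => P m.+1 m).

Lemma diagE (P : nat -> fps C) : (forall d m, (m < d)%N -> P d.+1 m = P d m) ->
  forall d m, (m < d)%N -> P d m = diag P m.
Proof.
move=> H d m; elim: d => // d IH; rewrite ltnS leq_eqVlt => /orP[/eqP -> //|md].
by rewrite H// IH.
Qed.

Lemma diag_bd M rho (P : nat -> fps C) : (forall d, bd M rho (P d)) -> bd M rho (diag P).
Proof. by move=> H m; apply: H. Qed.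

Lemma diag_eval M rho (P : nat -> fps C) t : 0 <= rho -> (forall d, bd M rho (P d)) ->
  (forall d m, (m < d)%N -> P d.+1 m = P d m) -> rho * absv t < 1 ->
  lims (fun d => fps_eval (P d) t) (fps_eval (diag P) t).
Proof.
move=> r0 PM PS rt e e0; have M0 := bd_ge0 (PM 0%N).
have rt0 : 0 <= rho * absv t by rewrite mulr_ge0 ?absv_ge0.
have M1 : 0 < M + 1 by rewrite ltr_wpDl.
have [|N HN] := @geom_lt _ (rho * absv t) (e / (M + 1)) _ (divr_gt0 e0 M1).
  by rewrite rt0.
have dM := diag_bd PM; exists N => d Nd.
rewrite -(evalB (bd_conv r0 (PM d) rt) (bd_conv r0 dM rt)).
apply: le_lt_trans (eval_tail (d := d) r0 (bdD (PM d) (bdN dM)) rt _) _.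
  by move=> m md; rewrite fpsB (diagE PS md) subrr.
have := HN d Nd; rewrite ltr_pdivlMr// mulrC; apply: le_lt_trans.
by rewrite ler_wpM2r ?exprn_ge0// lerDl.
Qed.

End UAdicLimit.

Section Cusp.
Variables (R : realType) (F : finFieldType) (S : setting R F) (pi : Cinf S).
Hypothesis pi_period : carlitz_period pi.
Notation C := (Cinf S).
Notation q := #|F|.
Notation A := {poly F}.
Notation th := (theta S).
Notation ev := (polyev (iota S) th).
Notation eA := (@eA R F S).
Notation u := (u pi).
Implicit Types (z : Omega S) (f : Omega S -> C) (M rho : R).

Lemma u_neq0 z : u (val z) != 0.
Proof.
by rewrite (uE pi_period) invr_neq0// mulf_neq0 ?(pi_neq0 pi_period)// eA_Omega_neq0//; exact: valO.
Qed.

Lemma absv_u_gt0 z : 0 < absv (u (val z)).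
Proof. by rewrite absv_gt0 u_neq0. Qed.

Lemma absv_eA z : absv (eA (val z)) = (absv pi * absv (u (val z)))^-1.
Proof.
have p0 := pi_neq0 pi_period; rewrite -absvM (uE pi_period) -absvV; congr absv.
by rewrite [in RHS]invfM invrK mulKf.
Qed.

Lemma absv_Fd_le z : Fd (val z) -> absv (val z) <= (absv pi * absv (u (val z)))^-1.
Proof. by move=> zF; rewrite -absv_eA eA_ge//; exact: Fd_orth. Qed.

Lemma cusp_small (e : R) : 0 < e -> exists z, Fd (val z) /\ absv (u (val z)) < e.
Proof.
move=> e0; have p0 : 0 < absv pi by rewrite absv_gt0 (pi_neq0 pi_period).
have [w wF wM] := Fd_large S ((absv pi * e)^-1 + 1).
have [z zE] := OmegaP (Fd_Omega wF); exists z; rewrite zE; split=> //.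
rewrite -zE in wF wM; have h : (absv pi * e)^-1 < (absv pi * absv (u (val z)))^-1.
  by apply: lt_le_trans (absv_Fd_le wF); apply: lt_le_trans wM; rewrite ltrDl.
have := absv_u_gt0 z; rewrite -zE; move=> u0.
by move: h; rewrite ltf_pV2 ?posrE ?mulr_gt0// ltr_pM2l.
Qed.

(** Away from the cusp the fundamental domain is contained in one affinoid, where rigid functions
    are bounded; only the neighbourhood of u = 0 needs an estimate. *)
Lemma Fd_affinoid (c : R) : 0 < c ->
  exists n, forall z, Fd (val z) -> c <= absv (u (val z)) -> affinoid n (val z).
Proof.
move=> c0; have p0 : 0 < absv pi by rewrite absv_gt0 (pi_neq0 pi_period).
have [n nP] := expq_unbounded F ((absv pi * c)^-1); exists n => z zF cu.
apply: (affinoid_Fd zF); apply: le_trans nP; apply: le_trans (absv_Fd_le zF) _.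
by rewrite lef_pV2 ?posrE ?mulr_gt0 ?absv_u_gt0// ler_pM2l.
Qed.

Lemma reduction_Omega z : exists g w, [/\ \det g = 1 :> A, g \in unitmx, Fd (val w) & z = mobius g w].
Proof.
have zO : Omega S (val z) by exact: valO.
have [g [w [dg wF E]]] := reduction zO; have [w' w'E] := OmegaP (Fd_Omega wF).
have gu : g \in unitmx by rewrite unitmxE dg unitr1.
exists g, w'; split=> //; first by rewrite w'E.
by apply: val_inj; rewrite val_mobius// w'E.
Qed.

Lemma rigid_const f M : rigid_analytic f ->
  (forall g w, \det g = 1 :> A -> g \in unitmx -> Fd (val w) -> absv (f (mobius g w)) <= M) ->
  forall z z', f z = f z'.
Proof.
move=> fr fM; apply: (@rigid_liouville _ _ _ f M) => // z.
by have [g [w [dg gu wF ->]]] := reduction_Omega z; exact: fM.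
Qed.

(** A u-expansion with explicit constants, so that expansions of infinitely many functions can share
    one radius. *)
Definition uexp M rho f (k : fps C) :=
  [/\ 0 < rho, bd M rho k & forall z, rho * absv (u (val z)) < 1 -> f z = fps_eval k (u (val z))].

Lemma uexpW M rho M' rho' f k : M <= M' -> rho <= rho' -> uexp M rho f k -> uexp M' rho' f k.
Proof.
move=> MM rr [r0 kM H]; split; first exact: lt_le_trans rr.
  exact: bdW MM (bd_ge0 kM) (ltW r0) rr kM.
by move=> z uz; apply: H; apply: le_lt_trans uz; rewrite ler_wpM2r ?absv_ge0.
Qed.

Lemma uexp_ext M rho f f' k : f =1 f' -> uexp M rho f k -> uexp M rho f' k.
Proof. by move=> E [r0 kM H]; split=> // z; rewrite -E; exact: H. Qed.

Lemma uexpC c rho : 0 < rho -> uexp (absv c) rho (fun=> c) (fps_const c).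
Proof. by move=> r0; split=> //; [exact/bdC/ltW|move=> z _; rewrite evalC]. Qed.

Lemma uexpD M rho f f' k k' : uexp M rho f k -> uexp M rho f' k' ->
  uexp M rho (fun z => f z + f' z) (k + k').
Proof.
move=> [r0 kM H] [_ kM' H']; split=> //; first exact: bdD.
move=> z uz; rewrite H// H'// evalD//.
  exact: bd_conv (ltW r0) kM uz.
exact: bd_conv (ltW r0) kM' uz.
Qed.

Lemma uexpM M M' rho f f' k k' : uexp M rho f k -> uexp M' rho f' k' ->
  uexp (M * M') rho (fun z => f z * f' z) (k * k').
Proof.
move=> [r0 kM H] [_ kM' H']; split=> //; first exact: bdM (ltW r0) kM kM'.
move=> z uz; rewrite H// H'// evalM//.
  exact: bd_conv (ltW r0) kM uz.
exact: bd_conv (ltW r0) kM' uz.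
Qed.

Lemma uexpX M rho f k n : uexp M rho f k -> uexp (M ^+ n) rho (fun z => f z ^+ n) (k ^+ n).
Proof.
move=> [r0 kM H]; split=> //; first exact: bdX (ltW r0) kM.
by move=> z uz; rewrite H// evalX//; exact: bd_conv (ltW r0) kM uz.
Qed.

Lemma uexpV M rho f k : uexp M rho f k -> k 0%N != 0 ->
  exists M' rho', uexp M' rho' (fun z => (f z)^-1) k^-1.
Proof.
move=> [r0 kM H] k0; have M1 : 0 < M + 1 by rewrite ltr_wpDl// (bd_ge0 kM).
have kM1 : bd (M + 1) rho k by apply: bdW (bd_ge0 kM) (ltW r0) (lexx _) kM; rewrite lerDl ler01.
have [r' r'0 kr] := bd_normalize M1 r0 k0 kM1.
pose c := k 0%N; have c0 : c != 0 by [].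
have kE : k = fps_const c * (fps_const c^-1 * k).
  by rewrite mulrA -fps_constM mulfV// mul1r.
have b1 : bd 1 r' (fps_const c^-1 * k).
  move=> n; rewrite fpsCM absvM absvV.
  by rewrite ler_pdivrMl ?absv_gt0// mul1r; exact: kr.
have a1 : absv ((fps_const c^-1 * k) 0%N) = 1 by rewrite fpsCM mulVf ?absv1.
have iE : k^-1 = fps_const c^-1 * (fps_const c^-1 * k)^-1.
  have ku : k \is a GRing.unit by rewrite fps_unitE.
  have mu : fps_const c^-1 * k \is a GRing.unit by rewrite fps_unitE -absv_gt0 a1.
  by apply: (mulrI ku); rewrite mulrV// mulrA [k * _]mulrC mulrV.
pose rho' := Num.max rho r'; have bi : bd (absv c^-1 * 1) rho' k^-1.
  rewrite iE; apply: bdM; first by rewrite le_max (ltW r0).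
    by apply: bdC; rewrite le_max (ltW r0).
  by apply: bdW (lexx _) ler01 (ltW r'0) _ (bdV (ltW r'0) a1 b1); rewrite le_max lexx orbT.
exists (absv c^-1 * 1), rho'; split=> //; first by rewrite lt_max r0.
move=> z uz; have uz1 : rho * absv (u (val z)) < 1.
  by apply: le_lt_trans uz; rewrite ler_wpM2r ?absv_ge0// le_max lexx.
have ck := bd_conv (ltW r0) kM uz1; have r''0 : 0 <= rho' by rewrite le_max (ltW r0).
have ci := bd_conv r''0 bi uz.
have E := evalM ck ci; rewrite mulrV ?fps_unitE// evalC -(H _ uz1) in E.
have f0 : f z != 0 by apply: contraTneq isT => f0; move: E; rewrite f0 mul0r => /eqP; rewrite oner_eq0.
by apply: (mulfI f0); rewrite mulfV// E.
Qed.

Lemma u_expansionP f a : u_expansion pi f a <-> exists M rho, uexp M rho f (Fps a).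
Proof.
split=> [[c c0 H]|[M [rho [r0 kM H]]]]; last first.
  exists rho^-1; first by rewrite invr_gt0.
  move=> z uz; have uz1 : rho * absv (u (val z)) < 1.
    by rewrite -ltr_pdivlMl// mulr1.
  by apply/lims_cvg; rewrite (H _ uz1); exact: evalP (bd_conv (ltW r0) kM uz1).
have [z0 [_ uz0]] := cusp_small c0; have u0 := absv_u_gt0 z0.
have /lims_cvg/series_null/lims_bounded[M M0 aM] := H _ uz0.
exists M, (absv (u (val z0)))^-1; split; first by rewrite invr_gt0.
  by move=> n; rewrite exprVn ler_pdivlMr ?exprn_gt0// -absvX -absvM; exact: aM.
move=> z; rewrite mulrC ltr_pdivrMr// mul1r => uz.
have /lims_cvg/lims_limn <- := H z (lt_trans uz uz0); by [].
Qed.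

Lemma uexp_lims M rho f k e : uexp M rho f k -> 0 < e ->
  exists2 c : R, 0 < c & forall z, absv (u (val z)) < c -> absv (f z - k 0%N) < e.
Proof.
move=> [r0 kM H] e0; have M0 := bd_ge0 kM.
have M1 : 0 < M + 1 by rewrite ltr_wpDl.
exists (Num.min rho^-1 (e / (M + 1) / rho)); first by rewrite lt_min invr_gt0 r0 !divr_gt0.
move=> z; rewrite lt_min => /andP[uz1 uz2].
have {uz1} uz1 : rho * absv (u (val z)) < 1 by rewrite -ltr_pdivlMl// mulr1.
have {uz2} uz2 : rho * absv (u (val z)) < e / (M + 1) by rewrite mulrC -ltr_pdivlMr.
have kc := bd_conv (ltW r0) kM uz1.
rewrite H// -[X in _ - X](evalC _ (u (val z))) -(evalB kc (convC _ _)).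
have kM' : bd M rho (k - fps_const (k 0%N)).
  move=> [|n]; rewrite fpsB /= ?subrr ?subr0; last exact: kM.
  by rewrite absv0 mulr1.
apply: le_lt_trans (eval_tail (d := 1) (ltW r0) kM' uz1 _) _.
  by case=> // _; rewrite fpsB /= subrr.
rewrite expr1; move: uz2; rewrite ltr_pdivlMr// mulrC; apply: le_lt_trans.
by rewrite ler_wpM2r ?mulr_ge0 ?absv_ge0 ?(ltW r0)// lerDl.
Qed.

End Cusp.

Section Expansions.
Variables (R : realType) (F : finFieldType) (S : setting R F) (pi : Cinf S).
Hypothesis pi_period : carlitz_period pi.
Notation C := (Cinf S).
Notation q := #|F|.
Notation A := {poly F}.
Notation th := (theta S).
Notation ev := (polyev (iota S) th).
Notation eA := (@eA R F S).
Notation nA := (@nA R F S).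
Notation u := (u pi).
Notation r := (q%:R^-1 : R).
Implicit Types (z : Omega S) (a b : A).

(** Replace x by its smallest translate y. The factor y and the factor for a = 1, available because
    the level is d + 1, contribute |y| max(1, |y|) >= e^2; the others are at least 1. *)
Lemma nA_lb (x : C) (e : R) d : 0 < e -> (forall b, e <= absv (x - ev b)) -> e ^+ 2 <= absv (nA d.+1 x).
Proof.
move=> e0 xe; have [|b bd bmin] := @seq_argmin R A (polys F d.+1) (fun b => absv (x - ev b)) 0.
  by rewrite mem_polys size_poly0.
have [y yE] : exists y, y = x - ev b by exists (x - ev b).
have ey : e <= absv y by rewrite yE.
have -> : nA d.+1 x = nA d.+1 y.
  by rewrite yE /nA lpolyB -/(nA d.+1 (ev b)) nA_ev ?subr0// -mem_polys.
have y0 : 0 < absv y by exact: lt_le_trans ey.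
have ym a : a \in polys F d.+1 -> absv y <= absv (y - ev a).
  move=> ad; rewrite yE -addrA -opprD -evD; apply: bmin; move: ad bd; rewrite !mem_polys => ad bd.
  by rewrite (leq_trans (size_polyD _ _))// geq_max bd.
rewrite nA_prod absvM absv_prod.
have fac a : a \in polys F d.+1 -> a != 0 -> Num.max 1 (absv y / absv (ev a)) <= absv (1 - y / ev a).
  move=> ad a0; have ea : ev a != 0 by rewrite ev_eq0.
  have ea0 : 0 < absv (ev a) by rewrite absv_gt0.
  have -> : 1 - y / ev a = - (y - ev a) / ev a by rewrite opprB mulrBl divff.
  rewrite absv_div absvN ge_max ler_pM2r ?invr_gt0// ym// andbT ler_pdivlMr// mul1r.
  have [h|h] := leP (absv (ev a)) (absv y); first exact: le_trans (ym _ ad).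
  by rewrite absvBr.
have in1 : (1 : A) \in polys F d.+1 by rewrite mem_polys size_poly1.
rewrite big_mkcond (bigD1_seq 1)//=; last exact: uniq_polys.
rewrite oner_neq0 -big_mkcondr /=.
have rest : 1 <= \prod_(a <- polys F d.+1 | (a != 1) && (a != 0)) absv (1 - y / ev a).
  rewrite big_seq_cond; elim/big_ind: _ => //; first by move=> *; exact: mulr_ege1.
  by move=> a /andP[ad /andP[_ a0]]; have := fac a ad a0; rewrite ge_max => /andP[].
have := fac 1 in1 (oner_neq0 _); rewrite ev1 absv1 divr1 => f1.
apply: le_trans (_ : absv y ^+ 2 <= _); first by rewrite lerXn2r// nnegrE (ltW e0, absv_ge0) ?absv_ge0.
rewrite expr2 ler_wpM2l ?absv_ge0// -[absv y]mulr1 ler_pM ?absv_ge0//.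
by rewrite (le_trans _ f1)// le_max lexx orbT.
Qed.

Lemma eA_lb (x : C) (e : R) : 0 < e -> (forall b, e <= absv (x - ev b)) -> e ^+ 2 <= absv (eA x).
Proof.
move=> e0 xe; have x0 : eA x != 0.
  by apply/eqP => /eA_eq0[a xa]; have := xe a; rewrite xa subrr absv0 leNgt e0.
have [N /(_ N.+1 (leqnSn N)) <-] := lims_absv (lims_nA x) x0.
exact: nA_lb.
Qed.

Lemma affine_dist n z a b : affinoid n (val z) -> absv (ev a) * q%:R ^- n <= absv (ev a * val z - ev b).
Proof. by move=> zn; rewrite -evN; exact: affine_lb. Qed.

Lemma inv_nA_le n z a d : affinoid n (val z) -> a != 0 ->
  absv (ev a / nA d.+1 (ev a * val z)) <= q%:R ^+ (n + n) / absv (ev a)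
  /\ absv (ev a / eA (ev a * val z)) <= q%:R ^+ (n + n) / absv (ev a).
Proof.
move=> zn a0; have a1 : 0 < absv (ev a) by rewrite absv_gt0 ev_eq0.
have e0 : 0 < absv (ev a) * q%:R ^- n by rewrite divr_gt0 ?qRX_gt0.
have H (x : C) : (absv (ev a) * q%:R ^- n) ^+ 2 <= absv x -> absv (ev a / x) <= q%:R ^+ (n + n) / absv (ev a).
  move=> h; have x0 : 0 < absv x by apply: lt_le_trans h; rewrite exprn_gt0.
  rewrite absv_div ler_pdivrMr//; apply: le_trans (_ : q%:R ^+ (n + n) / absv (ev a) * (absv (ev a) * q%:R ^- n) ^+ 2 <= _).
    have qn : q%:R ^+ n != 0 :> R by rewrite gt_eqF ?qRX_gt0.
    by rewrite exprD le_eqVlt; apply/orP; left; apply/eqP; field; rewrite ?qn ?gt_eqF.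
  by rewrite ler_wpM2l// divr_ge0 ?exprn_ge0 ?ler0n// ltW.
split; apply: H; [apply: nA_lb => // b|apply: eA_lb => // b]; exact: affine_dist.
Qed.

Lemma u_mulE z a : u (ev a * val z) = pi^-1 * (eA (ev a * val z))^-1.
Proof. by rewrite (uE pi_period) invfM. Qed.

Lemma eisenstein_term_le n z a : affinoid n (val z) -> a != 0 ->
  absv (ev a * u (ev a * val z)) <= (absv pi)^-1 * q%:R ^+ (n + n) * r ^+ (size a).-1.
Proof.
move=> zn a0; have [_ h] := inv_nA_le 0 zn a0.
have -> : ev a * u (ev a * val z) = pi^-1 * (ev a / eA (ev a * val z)) by rewrite u_mulE mulrCA.
rewrite absvM absvV -mulrA ler_wpM2l ?invr_ge0 ?absv_ge0//.
by rewrite exprVn -(absv_ev S).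
Qed.

Lemma bd_fpsX (rho : R) n : 0 < rho -> bd (rho ^- n) rho (fps_X C ^+ n).
Proof.
move=> r0; rewrite -exprVn; apply: bdX (ltW r0) _ => -[|[|m]] /=.
- by rewrite absv0 mulr1 invr_ge0 ltW.
- by rewrite absv1 expr1 mulVf// gt_eqF.
- by rewrite absv0 mulr_ge0 ?invr_ge0 ?exprn_ge0 ?(ltW r0).
Qed.

Lemma fpsXnM n (f : fps C) m : (fps_X C ^+ n * f) m = if (m < n)%N then 0 else f (m - n)%N.
Proof.
elim: n m => [|n IH] m; first by rewrite expr0 mul1r subn0.
by rewrite exprS -mulrA fpsXM; case: m => [//|m]; rewrite IH ltnS subSS.
Qed.

Lemma eval_fpsX (t : C) n : conv (fps_X C ^+ n) t /\ fps_eval (fps_X C ^+ n) t = t ^+ n.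
Proof.
have X : conv (fps_X C) t by apply: (lims_eq (N := 2) _ (lims_cst 0)) => -[|[|m]] // _; rewrite /fps_terms /= mul0r.
split; first exact: convX.
rewrite evalX//; congr (_ ^+ n); apply: evalE; apply: (lims_eq (N := 2) _ (lims_cst t)) => -[|[|m]] // _.
rewrite /series/= big_nat_recl//= big_nat_recl//= [X in _ + (_ + X)]big1 ?addr0.
  by rewrite /fps_terms /= mul0r mul1r add0r expr1.
by move=> i _; rewrite /fps_terms /= mul0r.
Qed.

Definition qdeg a := (q ^ (size a).-1)%N.

Lemma qdeg_gt0 a : (0 < qdeg a)%N.
Proof. by rewrite expn_gt0 q_gt0. Qed.

Lemma Carlitz_step (K : comNzRingType) (t X Y v c : K) Q n1 n2 p : n2.+1 = (Q * p)%N ->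
  (Q * p = Q + n1)%N -> Y * v = c ->
  (t * X + X ^+ p + Y) * v ^+ (Q * p) = t * v ^+ n1 * (X * v ^+ Q) + (X * v ^+ Q) ^+ p + c * v ^+ n2.
Proof.
move=> E2 E1 <-; rewrite !mulrDl; congr (_ + _ + _).
- by rewrite E1 exprD; ring.
- by rewrite exprMn -exprM.
- by rewrite -E2 exprS mulrA.
Qed.

(** k is the reciprocal of the Carlitz polynomial of a, written in u. Its constant term is the
    leading coefficient of a, which makes it a unit with a radius independent of a; Horner's scheme
    gives the induction. *)
Lemma Carlitz_poly a : a != 0 -> exists k : fps C, [/\ bd 1 (q%:R : R) k, absv (k 0%N) = 1
  & forall z, q%:R * absv (u (val z)) < 1 ->
     e_Car (pi * (ev a * val z)) * u (val z) ^+ qdeg a = fps_eval k (u (val z))].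
Proof.
have q0 := qR_gt0 R F; have p0 := pi_neq0 pi_period.
elim/poly_ind: a => [|p c IH]; first by rewrite eqxx.
have eC z : e_Car (pi * (iota S c * val z)) * u (val z) = iota S c.
  rewrite e_Car_pi// eAZ (uE pi_period) mulrCA mulfK// mulf_neq0// eA_Omega_neq0//; exact: valO.
have [-> |pn0] := eqVneq p 0.
  rewrite mul0r add0r polyC_eq0 => c0; exists (fps_const (iota S c)); split.
  - by have := @bdC R _ (iota S c) q%:R (ltW q0); rewrite absv_iota.
  - by rewrite /= absv_iota.
  - move=> z _; rewrite evalC evC -[in RHS](eC z) /qdeg size_polyC c0 expn0 expr1.
    by [].
have [k [kb k0 kE]] := IH pn0 => _.
have sz : (size (p * 'X + c%:P)).-1 = (size p).-1.+1.
  by rewrite size_MXaddC (negbTE pn0) /= prednK// size_poly_gt0.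
have QE : qdeg (p * 'X + c%:P) = (qdeg p * q)%N by rewrite /qdeg sz expnSr.
have Q0 := qdeg_gt0 p; have q1 := q_gt1 F.
(* [n1] and [n2] are the powers of u left over beside theta and beside the constant term c when C_p
   is replaced by theta C_p + C_p^q + C_c. *)
pose n1 := (q.-1 * qdeg p)%N; have n10 : (0 < n1)%N by rewrite muln_gt0 q1_gt0.
pose n2 := (qdeg p * q).-1; have n2E : n2.+1 = (qdeg p * q)%N by rewrite prednK// muln_gt0 Q0 ltnW.
have n20 : (0 < n2)%N by rewrite /n2 -ltnS n2E; nia.
have n1E : (qdeg p * q = qdeg p + n1)%N by rewrite /n1 -{1}(qS F); lia.
exists (fps_const th * fps_X C ^+ n1 * k + k ^+ q + fps_const (iota S c) * fps_X C ^+ n2); split.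
- have small n : (0 < n)%N -> q%:R ^- n <= q%:R^-1 :> R.
    case: n => // n _; rewrite exprS invfM ger_pMr ?invr_gt0//.
    by rewrite invf_le1 ?qRX_ge1 ?qRX_gt0.
  apply: bdD; first apply: bdD.
  + rewrite -[X in bd X](mulr1 1).
    apply: (bdM (ltW q0) _ kb).
    apply: bdW (_ : absv th * q%:R ^- n1 <= _) _ (ltW q0) (lexx _) (bdM (ltW q0) (bdC _ (ltW q0)) (bd_fpsX _ q0)).
      by rewrite abs_theta -[leRHS](mulfV (lt0r_neq0 q0)) ler_wpM2l ?(ltW q0) ?small.
    by rewrite mulr_ge0 ?absv_ge0 ?invr_ge0 ?exprn_ge0 ?(ltW q0).
  + by have := bdX q (ltW q0) kb; rewrite expr1n.
  + apply: bdW (_ : absv (iota S c) * q%:R ^- n2 <= _) _ (ltW q0) (lexx _) (bdM (ltW q0) (bdC _ (ltW q0)) (bd_fpsX _ q0)).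
      by rewrite mulr_ile1 ?absv_ge0 ?invr_ge0 ?exprn_ge0 ?(ltW q0) ?absv_iota_le// invf_le1 ?qRX_ge1 ?qRX_gt0.
    by rewrite mulr_ge0 ?absv_ge0 ?invr_ge0 ?exprn_ge0 ?(ltW q0).
- rewrite !fpsD -mulrA !fpsCM fpsXnM n10 -[fps_X C ^+ n2]mulr1 fpsXnM n20 !mulr0 add0r addr0.
  have -> : (k ^+ q) 0%N = k 0%N ^+ q :> C.
    by elim: (q) => [|n IHn]; rewrite ?expr0// !exprS fpsM0 IHn.
  by rewrite absvX k0 expr1n.
- move=> z uz; have ck := bd_conv (ltW q0) kb uz; have kz := kE z uz.
  have [cX eX] := eval_fpsX (u (val z)) n1; have [cX2 eX2] := eval_fpsX (u (val z)) n2.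
  have cc x := convC x (u (val z)).
  have c1 := convM (convM (cc th) cX) ck; have c2 := convX q ck; have c3 := convM (cc (iota S c)) cX2.
  rewrite (evalD (convD c1 c2) c3) (evalD c1 c2) (evalM (convM (cc th) cX) ck) (evalM (cc th) cX).
  rewrite (evalX _ ck) (evalM (cc (iota S c)) cX2) !evalC eX eX2 -kz QE.
  have -> : e_Car (pi * (ev (p * 'X + c%:P) * val z)) = th * e_Car (pi * (ev p * val z)) +
      e_Car (pi * (ev p * val z)) ^+ q + e_Car (pi * (iota S c * val z)).
    rewrite -e_Car_rec evD evM evX evC mulrDl.
    have -> : th * (pi * (ev p * val z)) = pi * (ev p * th * val z) by rewrite mulrCA -[ev p * th * _]mulrA [ev p * (th * _)]mulrCA.
    by rewrite !e_Car_pi// -mulrDr -eAD -!mulrDl.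
  exact: Carlitz_step n2E n1E (eC z).
Qed.

Lemma u_mul_exp a : a != 0 -> exists U : fps C, [/\ bd (q%:R ^- qdeg a : R) q%:R U,
   forall m, (m < qdeg a)%N -> U m = 0
  & forall z, q%:R * absv (u (val z)) < 1 -> u (ev a * val z) = fps_eval U (u (val z))].
Proof.
move=> a0; have q0 := qR_gt0 R F; have [k [kb k1 kE]] := Carlitz_poly a0.
have kb' := bdV (ltW q0) k1 kb.
have kn0 : k 0%N != 0 by rewrite -absv_gt0 k1.
exists (fps_X C ^+ qdeg a * k^-1); split.
- by rewrite -[X in bd X](mulr1 (q%:R ^- qdeg a)); apply: bdM (ltW q0) (bd_fpsX _ q0) kb'.
- by move=> m ma; rewrite fpsXnM ma.
- move=> z uz; have ck := bd_conv (ltW q0) kb uz; have ck' := bd_conv (ltW q0) kb' uz.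
  have [cX eX] := eval_fpsX (u (val z)) (qdeg a).
  have E := evalM ck ck'; rewrite mulrV ?fps_unitE// evalC -kE// in E.
  have un := u_neq0 pi_period z; rewrite evalM// eX {1}/Defs.u div1r.
  set X := e_Car _ in E *; have X0 : X != 0.
    by apply: contraTneq isT => X0; move: E; rewrite X0 !mul0r => /eqP; rewrite oner_eq0.
  by apply: (mulfI X0); rewrite mulfV// E mulrA.
Qed.

Definition Umul a : fps C := xget 0 [set U | [/\ bd (q%:R ^- qdeg a : R) q%:R U,
   forall m, (m < qdeg a)%N -> U m = 0
  & forall z, q%:R * absv (u (val z)) < 1 -> u (ev a * val z) = fps_eval U (u (val z))]].

Lemma UmulP a : a != 0 -> [/\ bd (q%:R ^- qdeg a : R) q%:R (Umul a),
   forall m, (m < qdeg a)%N -> Umul a m = 0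
  & forall z, q%:R * absv (u (val z)) < 1 -> u (ev a * val z) = fps_eval (Umul a) (u (val z))].
Proof. by move=> /u_mul_exp[U HU]; rewrite /Umul; case: xgetP => // /(_ U). Qed.

Lemma big_polys_split (T : Type) (idx : T) (op : Monoid.com_law idx) d D (P : pred A) (f : A -> T) :
  (d <= D)%N -> \big[op/idx]_(a <- polys F D | P a) f a =
  op (\big[op/idx]_(a <- polys F d | P a) f a)
     (\big[op/idx]_(a <- polys F D | P a && (d < size a)%N) f a).
Proof.
move=> dD; rewrite (bigID (fun a : A => (size a <= d)%N)) /=; congr (op _ _); last first.
  by apply: eq_bigl => a; rewrite ltnNge.
rewrite -big_filter -[RHS]big_filter; apply: perm_big; apply: uniq_perm => [||a].
- exact: filter_uniq (uniq_polys _ _).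
- exact: filter_uniq (uniq_polys _ _).
rewrite !mem_filter !mem_polys; case: (P a) => //=.
by case: (leqP (size a) d) => //= h; rewrite (leq_trans h dD).
Qed.

Lemma qdeg_ge d a : (d < size a)%N -> (d < qdeg a)%N.
Proof.
move=> da; apply: (leq_trans (ltn_expl d (q_gt1 F))); rewrite leq_exp2l ?q_gt1//; lia.
Qed.

Lemma Umul_high d a m : a != 0 -> (d < size a)%N -> (m < d)%N -> Umul a m = 0.
Proof.
by move=> a0 da md; have [_ -> //] := UmulP a0; exact: ltn_trans md (qdeg_ge da).
Qed.

Lemma prod_high (I : eqType) (s : seq I) (P : pred I) (f : I -> fps C) d :
  (forall i, P i -> forall m, (m < d)%N -> f i m = (1 : fps C) m) ->
  forall (g : fps C) m, (m < d)%N -> (g * \prod_(i <- s | P i) f i) m = g m.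
Proof.
move=> H; elim: s => [|i s IH] g m md; first by rewrite big_nil mulr1.
rewrite big_cons; case: ifP => Pi; last exact: IH.
rewrite mulrA IH// -[in RHS](mulr1 g) !fpsM; apply: eq_bigr => j _.
by rewrite H//; apply: leq_ltn_trans md; exact: leq_subr.
Qed.

Lemma eval_prod (I : Type) (s : seq I) (P : pred I) (f : I -> fps C) (g : I -> C) t :
  (forall i, P i -> conv (f i) t /\ fps_eval (f i) t = g i) ->
  conv (\prod_(i <- s | P i) f i) t /\
  fps_eval (\prod_(i <- s | P i) f i) t = \prod_(i <- s | P i) g i.
Proof.
move=> H; elim/big_rec2: _ => [|i x y Pi [cy ey]]; first by split; [exact: convC|rewrite evalC].
by have [cf ef] := H i Pi; split; [exact: convM|rewrite evalM// ey ef].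
Qed.

(** In the product [nL] each e_A(az) is 1/(pi u(az)), and u(az) has u-order q^deg a, so coefficients
    stabilise. The radius is common to all i, as regularity demands; the factor max(1, |pi|) in it
    absorbs pi. *)
Lemma uexp_s2 : exists2 rho : R, 0 < rho & forall i, exists k : fps C,
  uexp pi 1 rho (fun z => s_2 (val z) i) k /\ k 0%N = eA (th ^- i.+1).
Proof.
have q0 := qR_gt0 R F; have q1 := qR_ge1 R F.
pose rho : R := q%:R * Num.max 1 (absv pi).
have rq : q%:R <= rho by rewrite ler_peMr ?(ltW q0)// le_max lexx.
have rho0 : 0 < rho by exact: lt_le_trans rq.
exists rho => // i.
have zeta1 : absv (th ^- i.+1) < 1 :> R by rewrite absvV absv_thX invf_lt1 ?qRX_gt0// exprn_egt1 ?qR_gt1.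
have [X [XE X1]] : exists X, X = eA (th ^- i.+1) /\ absv X <= 1.
  by exists (eA (th ^- i.+1)); rewrite eA_small// ltW.
rewrite -XE; pose f a := 1 - fps_const (X * pi) * Umul a.
have fb a : a != 0 -> bd 1 rho (f a).
  move=> a0; have [ub um _] := UmulP a0 => -[|m]; rewrite fpsB fpsCM.
    by rewrite um ?qdeg_gt0// mulr0 subr0 /= absv1 mulr1.
  rewrite fps1 sub0r absvN mul1r !absvM; apply: le_trans (_ : 1 * absv pi * (1 * q%:R ^+ m.+1) <= _).
    rewrite ler_pM ?mulr_ge0 ?absv_ge0//; first by rewrite ler_wpM2r ?absv_ge0.
    apply: le_trans (ub _) _; rewrite ler_wpM2r ?exprn_ge0 ?(ltW q0)//.
    by rewrite invf_le1 ?qRX_ge1 ?qRX_gt0.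
  rewrite !mul1r exprMn mulrC ler_wpM2l ?exprn_ge0 ?(ltW q0)//.
  apply: le_trans (_ : Num.max 1 (absv pi) <= _); first by rewrite le_max lexx orbT.
  by rewrite -[leLHS]expr1 ler_weXn2l// le_max lexx.
pose P d : fps C := fps_const X * \prod_(a <- polys F d | a != 0) f a.
have Pb d : bd 1 rho (P d).
  have h : bd (absv X * 1) rho (P d).
    apply: bdM (ltW rho0) (bdC _ (ltW rho0)) _.
    elim/big_ind: _ => //; first exact: bd1 (ltW rho0).
    by move=> x y hx hy; rewrite -[1](mulr1 1); exact: bdM (ltW rho0) hx hy.
  by apply: bdW (bd_ge0 h) (ltW rho0) (lexx _) h; rewrite mulr1.
have Pst d m : (m < d)%N -> P d.+1 m = P d m.
  move=> md; rewrite /P (big_polys_split _ _ _ (leqnSn d)) mulrA (@prod_high _ _ _ _ d)// => a /andP[a0 da] j jd.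
  by rewrite /f fpsB fpsCM (Umul_high a0 da jd) mulr0 subr0.
exists (diag P); split; last first.
  rewrite -(diagE Pst (d := 1))// /P (@prod_high _ _ _ _ 1)// => a a0 m; rewrite ltnS leqn0 => /eqP ->.
  by have [_ um _] := UmulP a0; rewrite /f fpsB fpsCM um ?qdeg_gt0// mulr0 subr0.
split=> //; first exact: diag_bd.
move=> z uz; have zO := @valO _ _ S z; apply: lims_unique (diag_eval (ltW rho0) Pb Pst uz).
have := lims_nL zO (th ^- i.+1); rewrite /s_2 /= mul1r -XE; apply: lims_ext => d.
rewrite (nL_prod zO) /P.
have uq : q%:R * absv (u (val z)) < 1 by apply: le_lt_trans uz; rewrite ler_wpM2r ?absv_ge0.
have cf a : a != 0 -> conv (f a) (u (val z)) /\ fps_eval (f a) (u (val z)) = 1 - X / eA (ev a * val z).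
  move=> a0; have [ub um ue] := UmulP a0.
  have cU := bd_conv (ltW q0) ub uq; have cc x := convC x (u (val z)).
  split; first exact: bd_conv (ltW rho0) (fb _ a0) uz.
  rewrite evalB ?evalC ?evalM//; [|exact: cc|exact: convM].
  rewrite !evalC -ue// u_mulE mulrA; congr (_ - _).
  by rewrite mulfK// (pi_neq0 pi_period).
have [cP eP] := eval_prod (polys F d) cf.
by rewrite evalM ?evalC ?eP//; exact: convC.
Qed.

Notation monics := {a : A | a \is monic}.
Let Nm (a : monics) := (size (val a)).-1.
Let boxm d : {fset monics} := subbox (fun a : A => a \is monic) (polys F d).

Let boxmP (a : monics) d : (a \in boxm d) = (Nm a < d)%N.
Proof.
rewrite mem_subbox mem_polys /Nm prednK// size_poly_gt0; exact: monic_neq0 (valP a).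
Qed.

Lemma eisenstein_box n d z : affinoid n (val z) ->
  absv (false_eisenstein pi z - \sum_(a <- polys F d | a \is monic) ev a * u (ev a * val z)) <=
  (absv pi)^-1 * q%:R ^+ (n + n) * r ^+ d.
Proof.
move=> zn; rewrite -(@big_subbox _ (fun a : A => a \is monic) _ _ _ _ _ (uniq_polys F d)).
apply: (usum_box boxmP (qV01 R F)) => //; last by move=> a; exact: eisenstein_term_le zn (monic_neq0 (valP a)).
by rewrite mulr_ge0 ?invr_ge0 ?absv_ge0 ?exprn_ge0 ?ler0n.
Qed.

Lemma lims_eisenstein z :
  lims (fun d => \sum_(a <- polys F d | a \is monic) ev a * u (ev a * val z)) (false_eisenstein pi z).
Proof.
have [n zn] := Omega_affinoid (@valO _ _ S z); rewrite -[false_eisenstein _ _]add0r.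
have h : lims (fun d => \sum_(a <- polys F d | a \is monic) ev a * u (ev a * val z) - false_eisenstein pi z) 0.
  apply: (@lims_scale_geom _ _ _ r) => [|d]; last by rewrite absv_subC; exact: eisenstein_box zn.
  by case/andP: (qV01 R F) => /ltW -> ->.
by apply: lims_ext (limsD h (lims_cst (false_eisenstein pi z))) => d; rewrite subrK.
Qed.

Lemma uexp_eisenstein : exists k : fps C, uexp pi 1 q%:R (false_eisenstein pi) k.
Proof.
have q0 := qR_gt0 R F; have q1 := qR_ge1 R F.
pose P d : fps C := \sum_(a <- polys F d | a \is monic) fps_const (ev a) * Umul a.
have fb a : a \is monic -> bd 1 q%:R (fps_const (ev a) * Umul a).
  move=> am; have a0 := monic_neq0 am; have [ub _ _] := UmulP a0 => m.
  rewrite fpsCM absvM mul1r; apply: le_trans (_ : q%:R ^+ qdeg a * (q%:R ^- qdeg a * q%:R ^+ m) <= _).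
    rewrite ler_pM ?absv_ge0// absv_ev// ler_weXn2l//; exact: ltnW (ltn_expl _ (q_gt1 F)).
  by rewrite mulrA mulfV ?mul1r// gt_eqF ?qRX_gt0.
have Pb d : bd 1 q%:R (P d) by apply: bd_sum (ler01) (ltW q0) fb.
have Pst d m : (m < d)%N -> P d.+1 m = P d m.
  move=> md; rewrite /P (big_polys_split _ _ _ (leqnSn d)) fpsD [X in _ + X]fps_sum [X in _ + X]big1 ?addr0// => a /andP[am da].
  by rewrite fpsCM (Umul_high (monic_neq0 am) da md) mulr0.
exists (diag P); split=> //; first exact: diag_bd.
move=> z uz; apply: lims_unique (lims_eisenstein z) _.
apply: lims_ext (diag_eval (ltW q0) Pb Pst uz) => d.
suff [_ ->] : conv (P d) (u (val z)) /\ fps_eval (P d) (u (val z)) =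
  \sum_(a <- polys F d | a \is monic) ev a * u (ev a * val z) by [].
rewrite /P; elim/big_rec2: _ => [|a x y am [cy ey]]; first by split; [exact: convC|rewrite -(fps_const0 C) evalC].
have [ub _ ue] := UmulP (monic_neq0 am).
have cf : conv (fps_const (ev a) * Umul a) (u (val z)) by exact: bd_conv (ltW q0) (fb _ am) uz.
split; first exact: convD.
rewrite evalD// ey evalM ?evalC ?ue//; first exact: convC.
exact: bd_conv (ltW q0) ub uz.
Qed.

End Expansions.

(** * The false Eisenstein series *)

Section FalseEisenstein.
Variables (R : realType) (F : finFieldType) (S : setting R F) (pi : Cinf S).
Hypothesis pi_period : carlitz_period pi.
Notation C := (Cinf S).
Notation q := #|F|.
Notation A := {poly F}.
Notation th := (theta S).
Notation ev := (polyev (iota S) th).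
Notation eA := (@eA R F S).
Notation nA := (@nA R F S).
Notation u := (u pi).
Notation r := (q%:R^-1 : R).
Notation E := (false_eisenstein pi).
Implicit Types (z : Omega S) (a b : A).

(** Each nonzero polynomial is a constant times a monic one, there are q - 1 such constants, and q -
    1 = -1 in C. *)
Lemma sum_monic d (T : A -> C) : (forall c a, c != 0 -> T (c *: a) = T a) ->
  \sum_(a <- polys F d | a != 0) T a = - \sum_(a <- polys F d | a \is monic) T a.
Proof.
move=> TZ; rewrite (partition_big (fun a => lead_coef a) (fun c => c != 0)) /=; last first.
  by move=> a; rewrite lead_coef_eq0.
rewrite (eq_bigr (fun=> \sum_(a <- polys F d | a \is monic) T a)) => [|c c0].
  rewrite sumr_const; have -> : #|[pred c : F | c != 0]| = q.-1 by rewrite cardC1.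
  by apply/eqP; rewrite -addr_eq0 -mulrSr qS -mulr_natr natq0 mulr0.
rewrite -[RHS](eq_bigr _ (fun a _ => TZ c a c0)) -big_filter -[RHS]big_filter.
rewrite -(big_map (fun a => c *: a) xpredT T); apply: perm_big; apply: uniq_perm.
- exact: filter_uniq (uniq_polys _ _).
- rewrite map_inj_uniq; last exact: scalerI.
  exact: filter_uniq (uniq_polys _ _).
move=> a; apply/idP/mapP => [|[b]].
  rewrite mem_filter => /andP[/andP[a0 /eqP ac] ad]; exists (c^-1 *: a); last by rewrite scalerA divff// scale1r.
  rewrite mem_filter mem_polys size_scale ?invr_neq0// -mem_polys ad andbT.
  by rewrite monicE lead_coefZ ac mulVf.
rewrite mem_filter => /andP[bm bd] ->; rewrite mem_filter mem_polys size_scale// -mem_polys bd.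
by rewrite lead_coefZ (eqP bm) mulr1 eqxx !andbT scaler_eq0 (negbTE c0) (negbTE (monic_neq0 bm)).
Qed.

(* Partial sums of pi * E, written as a double sum over a and b. *)
Definition SE d e (z : C) : C := - \sum_(l <- prs F d e) ev l.2 / (ev l.2 * z - ev l.1).

Lemma SE_nA d e z : SE d e (val z) = - \sum_(a <- polys F d) ev a / nA e (ev a * val z).
Proof.
congr (- _); rewrite /prs big_allpairs_dep /= exchange_big /=; apply: eq_bigr => a _.
have [->|a0] := eqVneq a 0; first by rewrite ev0 [RHS]mul0r; apply: big1 => b _; rewrite mul0r.
rewrite -mulr_sumr /nA -lpoly_sum_inv ?nA_mulz_neq0//; last exact: valO.
  by congr (_ * _); apply: eq_bigr => b _; rewrite lcomb_th.
exact: indep_th.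
Qed.

Lemma Eisenstein_trunc n d z : affinoid n (val z) ->
  absv (pi * E z + \sum_(a <- polys F d) ev a / eA (ev a * val z)) <= q%:R ^+ (n + n) * r ^+ d.
Proof.
move=> zn; have p0 := pi_neq0 pi_period.
have p1 : 0 < absv pi by rewrite absv_gt0.
have -> : \sum_(a <- polys F d) ev a / eA (ev a * val z) =
    - (pi * \sum_(a <- polys F d | a \is monic) ev a * u (ev a * val z)).
  rewrite (bigID (fun a => a == 0)) /= big1 ?add0r => [|a /eqP ->]; last by rewrite ev0 mul0r.
  rewrite (@sum_monic d (fun a => ev a / eA (ev a * val z))).
    congr (- _); rewrite mulr_sumr; apply: eq_bigr => a _.
    by rewrite (u_mulE pi_period) mulrCA; congr (_ * _); rewrite mulVKf.
  move=> c a c0; rewrite -mul_polyC evM evC -(mulrA _ _ (val z)) eAZ -mulf_div divff ?mul1r//.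
  by rewrite -absv_gt0 absv_iota.
rewrite -mulrBr absvM -ler_pdivlMl// mulrA; exact: eisenstein_box.
Qed.

(** The rectangular sums converge with no relation required between the ranges d of a and m of b;
    this is what permits exchanging the order of summation in [EF_swap]. *)
Lemma SE_box n (e : R) : 0 < e -> exists N, forall d m z, (N <= d)%N -> (N <= m)%N ->
  affinoid n (val z) -> absv (pi * E z - SE d m (val z)) < e.
Proof.
move=> e0; set K : R := q%:R ^+ (n + n); have K0 : 0 < K by exact: qRX_gt0.
have r01 : 0 <= r < 1 by case/andP: (qV01 R F) => /ltW -> ->.
have r0 : 0 <= r by case/andP: r01.
have [|d1 /(_ d1 (leqnn _)) Kd1] := @geom_lt _ r (e / K) r01; first by rewrite divr_gt0.
have {Kd1} Kd1 : K * r ^+ d1 < e by rewrite mulrC -ltr_pdivlMr.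
have X0 : 0 <= (q%:R : R) ^+ (d1 + n) by rewrite exprn_ge0 ?ler0n.
have [B B0 BP] := eA_box S X0.
have KB : 0 < K ^+ 2 * B + 1 by rewrite ltr_wpDl ?mulr_ge0 ?exprn_ge0// ltW.
have [m1 Hm1] := @geom_lt _ r (e / (K ^+ 2 * B + 1)) r01 (divr_gt0 e0 KB).
exists (maxn d1 m1.+1) => d m z; rewrite !geq_max => /andP[d1d _] /andP[_ m1m] zn.
have [m' mE] : exists m', m = m'.+1 by exists m.-1; rewrite prednK// (leq_trans _ m1m).
rewrite SE_nA opprK.
set T := fun a => ev a / eA (ev a * val z); set Te := fun a => ev a / nA m (ev a * val z).
(* Three pieces: the truncated series itself, finitely many a where [nA m] replaces e_A, and a tail
   that is small uniformly in m. *)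
have -> : \sum_(a <- polys F d) ev a / nA m (ev a * val z) = \sum_(a <- polys F d1) T a +
    \sum_(a <- polys F d1) (Te a - T a) + \sum_(a <- polys F d | (d1 < size a)%N) Te a.
  by rewrite -big_split /= (big_polys_split _ _ _ d1d); congr (_ + _); apply: eq_bigr => a _; rewrite subrKC.
have bT a : a != 0 -> absv (T a) <= K / absv (ev a) /\ absv (Te a) <= K / absv (ev a).
  by move=> a0; have [h1 h2] := inv_nA_le m' zn a0; rewrite /Te mE; split.
rewrite !addrA; apply: absvD_lt; first apply: absvD_lt.
- exact: le_lt_trans (Eisenstein_trunc _ zn) Kd1.
- rewrite big_seq absv_sum_lt// => a; rewrite mem_polys => ad.
  have [->|a0] := eqVneq a 0; first by rewrite /Te /T ev0 !mul0r subrr absv0.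
  have ea : 1 <= absv (ev a) by exact: absv_ev_ge1.
  have ea0 : 0 < absv (ev a) by exact: lt_le_trans ea.
  have [h1 h2] := bT a a0; have zO := @valO _ _ S z.
  have [|b1 b2] := BP (ev a * val z) _ m.
    rewrite absvM exprD ler_pM ?absv_ge0//; last by case: zn.
    by rewrite absv_ev// ler_weXn2l ?qR_ge1// (leq_trans (leq_pred _) ad).
  have n0 : nA m (ev a * val z) != 0 by exact: nA_mulz_neq0.
  have l0 : eA (ev a * val z) != 0 by apply: contra a0 => /eqP /(eA_mulz_eq0 zO) ->.
  have -> : Te a - T a = T a * Te a * (eA (ev a * val z) - nA m (ev a * val z)) / ev a.
    rewrite /Te /T; move: (eA _) (nA _ _) n0 l0 => x y n0 l0.
    have ev0' : ev a != 0 by rewrite ev_eq0.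
    by field; rewrite ev0' n0 l0.
  have KP : K / absv (ev a) <= K by rewrite ler_pdivrMr// ler_peMr// ltW.
  apply: le_lt_trans (_ : K * K * (B * r ^+ m) < e).
    rewrite absv_div ler_pdivrMr// absvM (absvM (T a) (Te a)); apply: le_trans (_ : K * K * (B * r ^+ m) <= _).
      rewrite ler_pM ?mulr_ge0 ?absv_ge0// ler_pM ?absv_ge0//; [exact: le_trans h1 KP|exact: le_trans h2 KP].
    by rewrite ler_peMr// mulr_ge0 ?mulr_ge0 ?exprn_ge0// ltW.
  have := Hm1 m (ltnW m1m); rewrite ltr_pdivlMr// mulrC; apply: le_lt_trans.
  rewrite mulrA -expr2 ler_wpM2r ?exprn_ge0//; by rewrite lerDl ler01.
- apply: le_lt_trans Kd1; apply: absv_sum_le => [|a da]; first by rewrite mulr_ge0 ?exprn_ge0// ltW.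
  have a0 : a != 0 by rewrite -size_poly_gt0 (leq_ltn_trans _ da).
  have [_ h] := bT a a0; apply: le_trans h _; rewrite ler_wpM2l ?(ltW K0)// absv_ev// exprVn.
  by rewrite lef_pV2 ?posrE ?qRX_gt0// ler_weXn2l ?qR_ge1//; move: da; case: (size a).
Qed.

Lemma lims_SE z : lims (fun n => SE n n (val z)) (pi * E z).
Proof.
move=> e e0; have [n zn] := Omega_affinoid (@valO _ _ S z).
have [N H] := SE_box n e0; exists N => m Nm; rewrite absv_subC; exact: H.
Qed.

Lemma rigid_SE d e : rigid_analytic (fun z : Omega S => SE d e (val z)).
Proof.
apply: rigidN; apply: rigid_sum => l _; have [l0|l0] := eqVneq ((- l.1, l.2) : A * A) 0.
  case: l0 => _ ->; apply: rigid_ext (rigidC 0) => z; by rewrite ev0 mul0r.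
apply: (@rigidM _ _ S (fun=> ev l.2) (fun z => (ev l.2 * val z - ev l.1)^-1) (rigidC _)).
apply: rigid_ext (@rigid_latV R F S _ l0) => z.
by rewrite /lat /= evN addrC mulrC.
Qed.

Lemma rigid_E : rigid_analytic E.
Proof.
have p0 := pi_neq0 pi_period; have p1 : 0 < absv pi by rewrite absv_gt0.
apply: rigid_lim => n e e0; have [N H] := SE_box n (mulr_gt0 e0 p1).
exists (fun z => pi^-1 * SE N N (val z)); first exact: rigidZ (rigid_SE _ _).
move=> z zn; have := H N N z (leqnn _) (leqnn _) zn.
have -> : pi * E z - SE N N (val z) = pi * (E z - pi^-1 * SE N N (val z)).
  by rewrite mulrBr mulVKf.
by rewrite absvM mulrC ltr_pM2r.
Qed.

(** Every pair (a, b) other than (0, 0) contributes one extra z; there are q^(2n+2) - 1 of them,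
    which is -1 in C. This is the source of the non-modular term. *)
Lemma SE_swap n z : SE n.+1 n.+1 (val z)^-1 = val z - val z ^+ 2 * SE n.+1 n.+1 (val z).
Proof.
have zO := @valO _ _ S z; have z0 : val z != 0.
  by have := Omega_affine 0 zO (oner_neq0 _); rewrite ev1 ev0 addr0 mul1r.
move: (val z) zO z0 => x xO x0; rewrite /SE /prs !big_allpairs_dep /=.
rewrite mulrN opprK exchange_big /=.
have term b a : ev b / (ev b * x^-1 - ev a) =
    (if (a == 0) && (b == 0) then 0 else x) - x ^+ 2 * (ev a / (ev a * x - ev b)).
  have [->|a0] := eqVneq a 0.
    rewrite ev0 subr0 mul0r mulr0 subr0 /=; have [->|b0] := eqVneq b 0; first by rewrite ev0 mul0r.
    by rewrite invfM invrK mulVKf// ev_eq0.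
  have d0 : ev a * x - ev b != 0 by have := Omega_affine (- b) xO a0; rewrite evN.
  have d1 : ev b * x^-1 - ev a != 0.
    by apply: contra d0 => /eqP h; rewrite -oppr_eq0 opprB -[ev b](mulfVK x0) -mulrBl h mul0r.
  by rewrite /=; field; rewrite x0 d0 /=; apply: contra d0 => /eqP h; rewrite -oppr_eq0; apply/eqP; rewrite -h; ring.
under eq_bigr do under eq_bigr do rewrite term.
under eq_bigr do rewrite big_split /= sumrN -mulr_sumr.
rewrite big_split /= sumrN -mulr_sumr opprD opprK; congr (_ + _).
rewrite -[RHS]opprK; congr (- _).
have sumc : \sum_(b <- polys F n.+1) x = 0.
  rewrite big_const_seq count_predT size_polys iter_addr_0 expnS mulrnA -[x *+ _]mulr_natr.
  by rewrite natq0 mulr0 mul0rn.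
have in0 : (0 : A) \in polys F n.+1 by rewrite mem_polys size_poly0.
have up := uniq_polys F n.+1.
rewrite (bigD1_seq 0)//= [X in _ + X]big1 ?addr0 => [|b b0]; last first.
  by rewrite -[RHS]sumc; apply: eq_bigr => a _; rewrite (negbTE b0) andbF.
rewrite (bigD1_seq 0)//= eqxx add0r; move: sumc; rewrite (bigD1_seq 0)//= => /eqP.
rewrite addrC addr_eq0 => /eqP <-; by apply: eq_bigr => a /negbTE ->.
Qed.

(* The law is a cocycle condition, hence needs checking on generators of GL_2(A) only. *)
Definition EF (g : 'M[A]_2) := forall z,
  E (mobius g z) = (detC S g)^-1 * J g (val z) ^+ 2 * (E z - L g (val z) / pi).

Lemma EF_mul g g' : g \in unitmx -> g' \in unitmx -> EF g -> EF g' -> EF (g *m g').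
Proof.
move=> gu gu' Eg Eg' z; have zO := @valO _ _ S z.
have J' := J_neq0 gu' zO; have p0 := pi_neq0 pi_period.
have -> : mobius (g *m g') z = mobius g (mobius g' z).
  by apply: val_inj; rewrite !val_mobius ?unitmx_mul ?gu// mobius_mul.
have J0 : J g (mobius_C g' (val z)) != 0 by apply: J_neq0 gu _; exact: Omega_mobius.
rewrite Eg Eg' val_mobius// /L J_mul// detC_mul !mulmx2E evD !evM.
have d0 := detC_neq0 S gu; have d0' := detC_neq0 S gu'.
have dE : detC S g' = ev (g' 0 0) * ev (g' 1 1) - ev (g' 0 1) * ev (g' 1 0).
  by rewrite /detC det_mx22E evB !evM.
have JE : J g (mobius_C g' (val z)) = (ev (g 1 0) * (ev (g' 0 0) * val z + ev (g' 0 1))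
    + ev (g 1 1) * J g' (val z)) / J g' (val z).
  by rewrite /mobius_C {1}/J [in RHS]mulrDl mulfK// mulrA.
have key : J g (mobius_C g' (val z)) * J g' (val z) * ev (g' 1 0) + detC S g' * ev (g 1 0) =
   J g' (val z) * (ev (g 1 0) * ev (g' 0 0) + ev (g 1 1) * ev (g' 1 0)).
  by rewrite JE mulfVK// dE /J; ring.
move: (J g _) (J g' _) (detC S g) (detC S g') J0 J' d0 d0' key => {JE dE} X Y D D' X0 Y0 D0 D0' key.
move: (ev (g 1 0) * _ + _) key => c'' key.
have -> : ev (g' 1 0) = (Y * c'' - D' * ev (g 1 0)) / (X * Y) by rewrite -key addrK [X * Y * _]mulrC mulfK ?mulf_neq0.
by field; rewrite p0 X0 Y0 D0 D0'.
Qed.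

Lemma EF_upper g : g \in unitmx -> g 1 0 = 0 -> EF g.
Proof.
move=> gu c0 z; have dg := gu; rewrite unitmxE det_mx22E c0 mulr0 subr0 unitrM in dg.
case/andP: dg => /unit_const[a a0 aE] /unit_const[d d0 dE].
have ia : iota S a != 0 by rewrite -absv_gt0 absv_iota.
have id : iota S d != 0 by rewrite -absv_gt0 absv_iota.
rewrite /L /J /detC det_mx22E c0 mulr0 subr0 ev0 mul0r add0r aE dE evM !evC mul0r mul0r subr0.
apply: (lims_unique (lims_eisenstein pi_period (mobius g z))).
have -> : (iota S a * iota S d)^-1 * iota S d ^+ 2 * E z = (iota S d / iota S a) * E z by field; rewrite ia id.
apply: lims_ext (limsZ (iota S d / iota S a) (lims_eisenstein pi_period z)) => n.
rewrite mulr_sumr; apply: eq_bigr => b _; rewrite mulrCA; congr (_ * _).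
rewrite !(u_mulE pi_period) mulrCA; congr (_ * _).
have -> : ev b * val (mobius g z) = iota S (a / d) * (ev b * val z) + ev (b * g 0 1 * (d^-1)%:P).
  rewrite val_mobius// /mobius_C /J c0 ev0 mul0r add0r aE dE !evM !evC !rmorphM !fmorphV.
  by field; rewrite id.
by rewrite eAD eA_ev addr0 eAZ rmorphM fmorphV [RHS]invfM invf_div.
Qed.

Definition swapM : 'M[A]_2 := mat2 0 1 1 0.

Lemma swapM_unit : swapM \in unitmx.
Proof. by rewrite unitmxE det_mx22E !mat2E mul0r sub0r mulr1 unitrN unitr1. Qed.

Lemma EF_swap : EF swapM.
Proof.
move=> z; have p0 := pi_neq0 pi_period; have zO := @valO _ _ S z.
have z0 : val z != 0.
  by have := Omega_affine 0 zO (oner_neq0 _); rewrite ev1 ev0 addr0 mul1r.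
have JE : J swapM (val z) = val z by rewrite /J !mat2E ev1 ev0 mul1r addr0.
have wE : val (mobius swapM z) = (val z)^-1.
  by rewrite val_mobius ?swapM_unit// /mobius_C JE !mat2E ev1 ev0 mul0r add0r div1r.
have h := lims_sub (s := Datatypes.S) (fun n => leqnSn n) (lims_SE (mobius swapM z)); rewrite wE in h.
have {h} h : pi * E (mobius swapM z) = val z - val z ^+ 2 * (pi * E z).
  apply: lims_unique h _; apply: lims_ext (limsB (lims_cst (val z)) (limsZ (val z ^+ 2) (lims_sub (s := Datatypes.S) (fun n => leqnSn n) (lims_SE z)))) => n.
  by rewrite SE_swap.
apply: (mulfI p0); rewrite h /L JE /detC det_mx22E !mat2E mul0r sub0r mulr1 evN ev1 invrN invr1.
move: (val z) z0 (E z) => x x0 y; by field; rewrite p0 x0.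
Qed.

Lemma ord2 (i : 'I_2) : i = 0 \/ i = 1.
Proof. by case: i => -[|[|//]] i; [left|right]; exact: val_inj. Qed.

(** Euclidean division of the first column: a translation and the swap replace g_10 by a remainder
    of smaller size, until the matrix is upper triangular. *)
Lemma EF_all g : g \in unitmx -> EF g.
Proof.
have [n] := ubnP (size (g 1 0)); elim: n g => // n IH g; rewrite ltnS => gn gu.
have [c0|c0] := eqVneq (g 1 0) 0; first exact: EF_upper.
pose Q := g 0 0 %/ g 1 0; pose g' := mat2 (g 1 0) (g 1 1) (g 0 0 - Q * g 1 0) (g 0 1 - Q * g 1 1).
pose T : 'M[A]_2 := mat2 1 Q 0 1.
have Tu : T \in unitmx by rewrite unitmxE det_mx22E !mat2E mulr0 subr0 mulr1 unitr1.
have gE : g = (T *m swapM) *m g'.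
  apply/matrixP => i j; rewrite !mulmx2E; case: (ord2 i) => ->; case: (ord2 j) => ->; rewrite !mat2E; ring.
have gu' : g' \in unitmx by move: gu; rewrite {1}gE unitmx_mul => /andP[].
rewrite gE; apply: (EF_mul _ gu'); first by rewrite unitmx_mul Tu swapM_unit.
  apply: (EF_mul Tu swapM_unit _ EF_swap); apply: (EF_upper Tu); by rewrite mat2E.
apply: (IH _ _ gu'); rewrite mat2E; apply: leq_trans gn.
have -> : g 0 0 - Q * g 1 0 = g 0 0 %% g 1 0 by rewrite {1}(divp_eq (g 0 0) (g 1 0)) addrAC subrr add0r.
by rewrite ltn_modp.
Qed.

End FalseEisenstein.

Lemma Wr0E (R : realType) (F : finFieldType) (S : setting R F) (z : Cinf S) :
  Wr z 0%N = s_1 z 0%N * s_2 z 0%N ^+ #|F| - s_2 z 0%N * s_1 z 0%N ^+ #|F| :> Cinf S.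
Proof. by rewrite /Wr fpsB !fpsM0. Qed.

Lemma Wr_mobiusE (R : realType) (F : finFieldType) (S : setting R F) (m : 'M[{poly F}]_2) (z : Omega S) n :
  \det m = 1 -> m \in unitmx -> Wr (val (mobius m z)) n = J m (val z) ^- #|F|.+1 * Wr (val z) n.
Proof.
move=> dm mu; have zO := @valO _ _ S z; rewrite (val_mobius z mu) (Wr_mobius mu zO) fpsCM.
by rewrite /detC dm ev1 mulr1.
Qed.

Opaque Wr.

Section CuspExistential.
Variables (R : realType) (F : finFieldType) (S : setting R F) (pi : Cinf S).
Hypothesis pi_period : carlitz_period pi.
Notation C := (Cinf S).
Notation u := (u pi).
Implicit Types (z : Omega S) (f : Omega S -> C) (M rho : R).

Definition uex f (k : fps C) := exists M rho, uexp pi M rho f k.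

Lemma uexC c : uex (fun=> c) (fps_const c).
Proof. by exists (absv c), 1; exact: uexpC. Qed.

Lemma uex_ext f f' k : f =1 f' -> uex f k -> uex f' k.
Proof. by move=> E [M [rho H]]; exists M, rho; exact: uexp_ext H. Qed.

Lemma uexD f f' k k' : uex f k -> uex f' k' -> uex (fun z => f z + f' z) (k + k').
Proof.
move=> [M [rho H]] [M' [rho' H']]; exists (Num.max M M'), (Num.max rho rho'); apply: uexpD.
  by apply: uexpW H; rewrite le_max lexx.
by apply: uexpW H'; rewrite le_max lexx orbT.
Qed.

Lemma uexM f f' k k' : uex f k -> uex f' k' -> uex (fun z => f z * f' z) (k * k').
Proof.
move=> [M [rho H]] [M' [rho' H']]; exists (M * M'), (Num.max rho rho'); apply: uexpM.
  by apply: uexpW H; rewrite // le_max lexx.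
by apply: uexpW H'; rewrite // le_max lexx orbT.
Qed.

Lemma uexX f k n : uex f k -> uex (fun z => f z ^+ n) (k ^+ n).
Proof. by move=> [M [rho H]]; exists (M ^+ n), rho; exact: uexpX. Qed.

Lemma uexV f k : uex f k -> k 0%N != 0 -> uex (fun z => (f z)^-1) k^-1.
Proof. by move=> [M [rho H]] /(uexpV H). Qed.

End CuspExistential.

Lemma fpsX0 (K : fieldType) (f : fps K) n : (f ^+ n) 0%N = f 0%N ^+ n.
Proof. by elim: n => [|n IH]; rewrite ?expr0// !exprS fpsM0 IH. Qed.

Lemma fpsV0 (K : fieldType) (f : fps K) : f 0%N != 0 -> f^-1 0%N = (f 0%N)^-1.
Proof.
move=> f0; apply: (mulfI f0); rewrite -fpsM0 mulrV ?fps_unitE// mulfV//.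
Qed.

Lemma fps_constV (K : fieldType) (c : K) : c != 0 -> (fps_const c)^-1 = fps_const c^-1 :> fps K.
Proof.
move=> c0; have cu : (fps_const c : fps K) \is a GRing.unit by rewrite fps_unitE.
by apply: (mulrI cu); rewrite mulrV// -fps_constM mulfV.
Qed.

(** * Relations between h, Delta, g and the Moore determinant *)

Section Relations.
Variables (R : realType) (F : finFieldType) (S : setting R F) (pi : Cinf S).
Variables g Delta h : Omega S -> Cinf S.
Hypothesis pi_period : carlitz_period pi.
Hypothesis g_Delta : drinfeld_coeffs pi g Delta.
Hypothesis h_def : is_h pi h.
Notation C := (Cinf S).
Notation q := #|F|.
Notation A := {poly F}.
Notation th := (theta S).
Notation ev := (polyev (iota S) th).
Notation eA := (@eA R F S).
Notation u := (u pi).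
Notation bar := (bar S).
Implicit Types (z : Omega S).

Let zO z : Omega S (val z). Proof. exact: valO. Qed.

Lemma h_rigid : rigid_analytic h. Proof. by case: h_def => -[]. Qed.

Lemma h_mobius m z : m \in unitmx -> h (mobius m z) = J m (val z) ^+ q.+1 * (detC S m)^-1 * h z.
Proof. by case: h_def => -[_ H _ _] _ mu; rewrite H// exprN1. Qed.

Lemma h_uex : exists k, [/\ uex pi h k, k 0%N = 0 & k 1%N = -1].
Proof.
case: h_def => _ [a [ua a0 a1]]; exists (Fps a); split=> //.
by have [M [rho H]] := (u_expansionP pi_period h a).1 ua; exists M, rho.
Qed.

(** Adding u to h cancels the linear term of the expansion, and what remains is of order u^2. *)
Lemma h_cusp : exists2 c : R, 0 < c & forall z, absv (u (val z)) < c -> absv (h z) = absv (u (val z)).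
Proof.
have [k [[M [rho [r0 kM H]]] k0 k1]] := h_uex; have M0 := bd_ge0 kM.
have M1 : 0 < M + 1 by rewrite ltr_wpDl.
exists (Num.min rho^-1 ((M + 1) * rho ^+ 2)^-1).
  by rewrite lt_min !invr_gt0 r0 mulr_gt0 ?exprn_gt0.
move=> z; rewrite lt_min => /andP[uz1 uz2]; have u0 := absv_u_gt0 pi_period z.
have {}uz1 : rho * absv (u (val z)) < 1 by rewrite -ltr_pdivlMl// mulr1.
have kM' : bd (M + 1) rho (k + fps_X C).
  move=> [|[|n]]; rewrite fpsD /=.
  - by rewrite k0 addr0 absv0 mulr1 ltW.
  - by rewrite k1 addNr absv0 mulr_ge0 ?exprn_ge0 ?ltW.
  - by rewrite addr0 (le_trans (kM _))// ler_wpM2r ?exprn_ge0 ?lerDl ?ler01 ?ltW.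
have cu := bd_conv (ltW r0) kM uz1; have [cX eX] := eval_fpsX (u (val z)) 1.
rewrite expr1 in cX eX.
have := eval_tail (d := 2) (ltW r0) kM' uz1 _.
rewrite evalD// eX -H// expr1 => hle.
have {}hle : absv (h z + u (val z)) <= (M + 1) * (rho * absv (u (val z))) ^+ 2.
  by apply: hle => -[|[|//]] _; rewrite fpsD /= ?k0 ?k1 ?addr0 ?addNr.
rewrite -[RHS]absvN; apply: absv_near; rewrite opprK absvN; apply: le_lt_trans hle _.
have p : 0 < (M + 1) * rho ^+ 2 by rewrite mulr_gt0 ?exprn_gt0.
move: uz2; rewrite -[_^-1]mul1r ltr_pdivlMr// => uz2.
rewrite exprMn mulrA [absv _ ^+ 2]expr2 mulrA gtr_pMl// mulrC //.
Qed.

(** The product is SL_2(A)-invariant and, near the cusp, at most |u| |e_A| = 1/|pi|; away from it an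
    affinoid bound applies, and Liouville concludes. *)
Let hWc n z z' : h z * Wr (val z) n = h z' * Wr (val z') n.
Proof.
have [c c0 hc] := h_cusp; have [n0 aff] := Fd_affinoid pi_period c0.
have p0 : 0 < absv pi by rewrite absv_gt0 (pi_neq0 pi_period).
have fr : rigid_analytic (fun z => h z * Wr (val z) n) by apply: rigidM h_rigid (rigid_Wr _ _).
have [B B0 BP] := rigid_bounded n0 fr.
apply: (rigid_const (M := Num.max B (absv pi)^-1) fr) => m w dm mu wF.
have -> : h (mobius m w) * Wr (val (mobius m w)) n = h w * Wr (val w) n.
  have J0 : J m (val w) != 0 by exact: J_neq0.
  rewrite (Wr_mobiusE _ _ dm mu) h_mobius// /detC dm ev1 invr1 mulr1.
  by rewrite mulrACA mulfV ?mul1r// expf_neq0.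
have [uc|uc] := ltP (absv (u (val w))) c; last by rewrite le_max BP//; exact: aff.
rewrite le_max; apply/orP; right; rewrite absvM hc//.
apply: le_trans (_ : absv (u (val w)) * absv (eA (val w)) <= _).
  by rewrite ler_wpM2l ?absv_ge0 ?Wr_Fd.
by rewrite (absv_eA pi_period) invfM mulrCA mulfV ?mulr1// gt_eqF ?(absv_u_gt0 pi_period).
Qed.

Lemma bd_s12 n : exists2 B : R, 0 <= B & forall z, affinoid n (val z) ->
  bd B 1 (s_1 (val z)) /\ bd B 1 (s_2 (val z)).
Proof.
have K0 : 0 <= (q%:R : R) ^+ n by rewrite exprn_ge0 ?ler0n.
have [B B0 BP] := e_lattice_box S n K0.
have H z zeta : affinoid n (val z) -> absv zeta <= q%:R ^+ n -> absv (e_lattice (val z) zeta) <= B.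
  move=> zn zq; have [h1 h2] := BP _ _ zn zq 0%N 0%N (leqnn _).
  by rewrite -[e_lattice _ _](subrK (eL 0 0 (val z) zeta)) absvD_le// (le_trans h2)// mulr1.
exists B => // z zn; have [zq _] := zn; split=> i; rewrite expr1n mulr1; apply: H => //.
  rewrite absv_div absv_thX ler_pdivrMr ?qRX_gt0//; apply: le_trans zq _.
  by rewrite ler_peMr ?qRX_ge1// ltW// qRX_gt0.
rewrite absv_div absv1 absv_thX; apply: le_trans (qRX_ge1 R F n).
by rewrite div1r invf_le1 ?qRX_ge1 ?qRX_gt0.
Qed.

Lemma Tpos_bd (f : fps C) (B rho : R) : 0 <= B -> 0 < rho -> bd B rho f -> Tpos f.
Proof.
move=> B0 r0 fB; apply/TposP; exists (B + 1), rho; split=> //; first by rewrite ltr_wpDl.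
by apply: bdW (lexx rho) fB; rewrite ?(ltW r0) ?lerDl.
Qed.

Lemma bd_twist (f : fps C) (B : R) : bd B 1 f -> bd (B ^+ q) 1 (twist (F := F) f).
Proof.
move=> H i; have := H i; rewrite !expr1n !mulr1 /= absvX => fi.
by apply: lerXn2r fi; rewrite nnegrE ?absv_ge0 ?(bd_ge0 H).
Qed.

Lemma Tpos_Wr z : Tpos (Wr (val z)).
Proof.
have [n zn] := Omega_affinoid (@zO z); have [B B0 H] := bd_s12 n.
have [h1 h2] := H z zn; have Bq : 0 <= B ^+ q by rewrite exprn_ge0.
have T1 := Tpos_bd B0 ltr01 h1; have T2 := Tpos_bd B0 ltr01 h2.
have T3 := Tpos_bd Bq ltr01 (bd_twist h1); have T4 := Tpos_bd Bq ltr01 (bd_twist h2).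
exact: TposD (TposM T1 T4) (TposN (TposM T2 T3)).
Qed.

Let kW_sig : { k : fps C | [/\ forall z, fps_const (h z) * Wr (val z) = k, k 0%N != 0 & Tpos k] }.
Proof.
apply: cid; have [c c0 hc] := h_cusp; have [z0 [_ uz]] := cusp_small pi_period c0.
exists (fps_const (h z0) * Wr (val z0)); split.
- by move=> z; apply: fpsP => n; have := hWc n z z0; rewrite -!fpsCM.
- rewrite fpsCM mulf_neq0 ?(Wr0_neq0 (@zO z0))//.
  by rewrite -absv_gt0 hc// absv_u_gt0.
- exact: TposM (TposC _) (Tpos_Wr z0).
Qed.

Definition kW : fps C := sval kW_sig.

Lemma hWr z : fps_const (h z) * Wr (val z) = kW.
Proof. by rewrite /kW; case: kW_sig => k []. Qed.

Lemma kW0 : kW 0%N != 0.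
Proof. by rewrite /kW; case: kW_sig => k []. Qed.

Lemma Tpos_kW : Tpos kW.
Proof. by rewrite /kW; case: kW_sig => k []. Qed.

Lemma h_neq0 z : h z != 0.
Proof. by apply: contra kW0 => /eqP h0; rewrite -(hWr z) fpsCM h0 mul0r. Qed.

Lemma Wr0_h z : Wr (val z) 0%N = kW 0%N / h z.
Proof. by rewrite -(hWr z) fpsCM mulrC mulKf// h_neq0. Qed.

Let x z := s_1 (val z) 0%N : C.
Let y z := s_2 (val z) 0%N : C.
Let G z := pi ^+ q.-1 * g z.
Let D z := pi ^+ (q ^ 2).-1 * Delta z.

(** x and y are theta-torsion points, i.e. roots of Phi_z(theta). The two equations are linear in G
    and D, and Cramer's rule with determinant W_0^q determines both. *)
Let eqx z : th * x z + G z * x z ^+ q + D z * x z ^+ (q ^ 2) = 0.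
Proof.
have := g_Delta z (val z / th); rewrite /= mulrC divfK ?th_neq0//.
have := eL_thz 0 (@zO z); rewrite expr0 mul1r => ->.
by rewrite /x /s_1 /= expr1.
Qed.

Let eqy z : th * y z + G z * y z ^+ q + D z * y z ^+ (q ^ 2) = 0.
Proof.
have := g_Delta z (1 / th); rewrite /= mulrC divfK ?th_neq0//.
have := eL_th1 0 (@zO z); rewrite expr0 mul1r => ->.
by rewrite /y /s_2 /= expr1.
Qed.

Let W0E z : Wr (val z) 0%N = x z * y z ^+ q - y z * x z ^+ q.
Proof. exact: Wr0E. Qed.

Let W0q z : Wr (val z) 0%N ^+ q = x z ^+ q * y z ^+ (q ^ 2) - y z ^+ q * x z ^+ (q ^ 2).
Proof. by rewrite W0E frobB !exprMn -!exprM !mulnn. Qed.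

Definition cD : C := th / (pi ^+ (q ^ 2).-1 * kW 0%N ^+ q.-1).

Lemma cD_neq0 : cD != 0.
Proof. by rewrite mulf_neq0 ?th_neq0// invr_neq0// mulf_neq0 ?expf_neq0 ?kW0 ?(pi_neq0 pi_period). Qed.

(** Eliminating G from the two torsion equations gives theta W_0 = D W_0^q, where W_0 is constant
    over h. *)
Let DE z : D z = th * (h z / kW 0%N) ^+ q.-1.
Proof.
have W0 : Wr (val z) 0%N != 0 by exact: Wr0_neq0.
have E : th * Wr (val z) 0%N = D z * Wr (val z) 0%N ^+ q.
  apply/eqP; rewrite -subr_eq0 W0q W0E; apply/eqP.
  have -> : th * (x z * y z ^+ q - y z * x z ^+ q) -
    D z * (x z ^+ q * y z ^+ (q ^ 2) - y z ^+ q * x z ^+ (q ^ 2)) =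
    (th * x z + G z * x z ^+ q + D z * x z ^+ (q ^ 2)) * y z ^+ q -
    (th * y z + G z * y z ^+ q + D z * y z ^+ (q ^ 2)) * x z ^+ q by ring.
  by rewrite eqx eqy !mul0r subrr.
have -> : h z / kW 0%N = (Wr (val z) 0%N)^-1 by rewrite Wr0_h invf_div.
rewrite exprVn; apply: (mulIf (expf_neq0 q.-1 W0)); rewrite mulfVK ?expf_neq0//.
by apply: (mulIf W0); rewrite E -mulrA -exprSr qS.
Qed.

Lemma DeltaE z : Delta z = cD * h z ^+ q.-1.
Proof.
have p0 : pi ^+ (q ^ 2).-1 != 0 by rewrite expf_neq0 ?(pi_neq0 pi_period).
have k0 : kW 0%N ^+ q.-1 != 0 by rewrite expf_neq0 ?kW0.
apply: (mulfI p0); rewrite -/(D z) DE expr_div_n /cD.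
by field; rewrite p0 k0.
Qed.

Let GE z : G z = - th * (h z / kW 0%N) ^+ q * (x z * y z ^+ (q ^ 2) - y z * x z ^+ (q ^ 2)).
Proof.
have W0 : Wr (val z) 0%N != 0 by exact: Wr0_neq0.
have -> : h z / kW 0%N = (Wr (val z) 0%N)^-1 by rewrite Wr0_h invf_div.
rewrite exprVn; apply: (mulIf (expf_neq0 q W0)); rewrite [RHS]mulrAC mulfVK ?expf_neq0//.
apply/eqP; rewrite -subr_eq0 W0q; apply/eqP.
have -> : G z * (x z ^+ q * y z ^+ (q ^ 2) - y z ^+ q * x z ^+ (q ^ 2)) -
    - th * (x z * y z ^+ (q ^ 2) - y z * x z ^+ (q ^ 2)) =
    (th * x z + G z * x z ^+ q + D z * x z ^+ (q ^ 2)) * y z ^+ (q ^ 2) -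
    (th * y z + G z * y z ^+ q + D z * y z ^+ (q ^ 2)) * x z ^+ (q ^ 2) by ring.
by rewrite eqx eqy !mul0r subrr.
Qed.

Let piq : pi ^+ q.-1 != 0. Proof. by rewrite expf_neq0 ?(pi_neq0 pi_period). Qed.

Let gE z : g z = (pi ^+ q.-1)^-1 * (- th * (h z / kW 0%N) ^+ q * (x z * y z ^+ (q ^ 2) - y z * x z ^+ (q ^ 2))).
Proof. by rewrite -GE /G mulKf. Qed.

Lemma g_rigid : rigid_analytic g.
Proof.
apply: rigid_ext (fun z => esym (gE z)) _; apply: rigidZ; apply: rigidM.
  by apply: rigidZ; apply: rigidX; apply: rigidM h_rigid (rigidC _).
by apply: rigidB; apply: rigidM; rewrite ?/x ?/y; [exact: rigid_s1|apply: rigidX; exact: rigid_s2|exact: rigid_s2|apply: rigidX; exact: rigid_s1].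
Qed.

Let frob2 (a b : F) (v w : C) : (iota S a * v + iota S b * w) ^+ (q ^ 2) =
  iota S a * v ^+ (q ^ 2) + iota S b * w ^+ (q ^ 2).
Proof. by rewrite !expnSr expn0 mul1n !exprM !(frobD, exprMn) !frob_iota. Qed.

Lemma g_mobius m z : m \in unitmx -> g (mobius m z) = J m (val z) ^+ q.-1 * g z.
Proof.
move=> mu; have J0 : J m (val z) != 0 by apply: J_neq0.
have d0 := detC_neq0 S mu; rewrite !gE h_mobius// /x /y val_mobius// s_1_mobius// s_2_mobius//.
rewrite !fpsCM !fpsD !fpsM0 -/(x z) -/(y z) /=; move: (x z) (y z) => x' y'.
have dE : detC S m = iota S (m 0 0)`_0 * iota S (m 1 1)`_0 - iota S (m 0 1)`_0 * iota S (m 1 0)`_0.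
  by have := congr1 (fun f : fps C => f 0%N) (bar_det S mu); rewrite fpsB !fpsM0 /= => <-.
have fm (j v : C) : (j^-1 * v) ^+ (q ^ 2) = j ^- (q ^ 2) * v ^+ (q ^ 2) by rewrite exprMn exprVn.
rewrite !fm !frob2 !exprMn !exprVn (frob_detC S mu).
set a := iota S (m 0 0)`_0 in dE *; set b := iota S (m 0 1)`_0 in dE *.
set c := iota S (m 1 0)`_0 in dE *; set d := iota S (m 1 1)`_0 in dE *.
set j := J m (val z) in J0 *; move: (detC S m) dE d0 => dt dE d0.
have jq : (j ^+ q.+1) ^+ q = j ^+ q.-1 * (j * j ^+ (q ^ 2)).
  rewrite -exprM -!exprS -exprD; congr (_ ^+ _); have := qS F; nia.
have k0 : kW 0%N ^+ q != 0 by rewrite expf_neq0 ?kW0.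
have jQ : j ^+ (q ^ 2) != 0 by rewrite expf_neq0.
rewrite jq.
move: (x' ^+ (q ^ 2)) (y' ^+ (q ^ 2)) (h z ^+ q) (kW 0%N ^+ q) k0 => X Y H k k0.
move: (pi ^+ q.-1) piq (j ^+ q.-1) (j ^+ (q ^ 2)) jQ => p p0 j1 jQ jQ0.
transitivity (p^-1 * (- th * (j1 * (j * jQ) * dt^-1 * H / k) * (j^-1 * jQ^-1 * (a * d - b * c) * (x' * Y - y' * X)))).
  by congr (_ * (_ * _)); ring.
by rewrite -dE; field; rewrite p0 k0 jQ0 J0 d0.
Qed.

Let y_uex : exists k, uex pi y k /\ k 0%N != 0.
Proof.
have [rho r0 H] := uexp_s2 pi_period; have [k [ku k0]] := H 0%N; exists k.
split; first by exists 1, rho.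
by rewrite k0 expr1 eA_thV_neq0.
Qed.

(** Solve the torsion equation of y for G: y has a nonzero value at the cusp and D vanishes there
    with h, so G tends to -theta y^(1-q), which is not 0. *)
Lemma g_uex : exists k, uex pi g k /\ k 0%N != 0.
Proof.
have [ky [uy ky0]] := y_uex; have [kh [uh kh0 _]] := h_uex.
have y0 z : y z != 0 by rewrite s2_0_neq0.
have gy z : g z = (pi ^+ q.-1)^-1 * (- th * y z + - (th * (kW 0%N)^-1 ^+ q.-1) * h z ^+ q.-1 * y z ^+ (q ^ 2)) * (y z)^-1 ^+ q.
  have E := eqy z; have yq : y z ^+ q != 0 by rewrite expf_neq0.
  have : G z * y z ^+ q = - th * y z - D z * y z ^+ (q ^ 2).
    by apply/eqP; rewrite -subr_eq0 -[X in _ == X]E; apply/eqP; ring.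
  move=> /(canRL (mulfK yq)) GG; rewrite -[LHS](mulKf piq) -/(G z) GG DE exprMn mulNr [- (_ * _) * _]mulNr.
  rewrite !exprVn; move: ((y z ^+ q)^-1) (pi ^+ q.-1)^-1 (h z ^+ q.-1) ((kW 0%N ^+ q.-1)^-1) => a b c d.
  by move: (y z ^+ (q ^ 2)) (y z) => Y y'; ring.
have := uexM (uexM (uexC pi (pi ^+ q.-1)^-1) (uexD (uexM (uexC pi (- th)) uy)
  (uexM (uexM (uexC pi (- (th * (kW 0%N)^-1 ^+ q.-1))) (uexX q.-1 uh)) (uexX (q ^ 2) uy))))
  (uexX q (uexV uy ky0)).
set k := (X in uex _ _ X) => H; exists k; split; first exact: uex_ext (fun z => esym (gy z)) H.
rewrite /k !(fpsD, fpsM0) !fpsX0 fpsV0// kh0 /= expr0n gtn_eqF ?q1_gt0// mulr0 mul0r addr0.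
apply: mulf_neq0; last by rewrite expf_neq0 ?invr_neq0.
by apply: mulf_neq0; rewrite ?invr_neq0// mulf_neq0 ?oppr_eq0 ?th_neq0.
Qed.

Lemma twistV (f : fps C) : f 0%N != 0 -> twist (F := F) f^-1 = (twist f)^-1.
Proof.
move=> f0; have fu : f \is a GRing.unit by rewrite fps_unitE.
have tu : twist (F := F) f \is a GRing.unit by rewrite fps_unitE /= expf_neq0.
apply: (mulrI tu); rewrite mulrV// -twistM mulrV//.
by have := twistC (1 : C); rewrite expr1n.
Qed.

Lemma s_Car0 : s_Car pi 0%N != 0.
Proof. by rewrite /= expr1 (e_Car_pi pi_period) mulf_neq0 ?eA_thV_neq0 ?(pi_neq0 pi_period). Qed.

Lemma s_CarE i : s_Car pi i = pi * eA (th ^- i.+1).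
Proof. by rewrite /= (e_Car_pi pi_period). Qed.

Lemma bd_s_Car : bd (absv pi) 1 (s_Car pi).
Proof.
move=> i; rewrite s_CarE expr1n mulr1 absvM ler_piMr ?absv_ge0//.
have t1 : absv (th ^- i.+1) < 1 :> R by rewrite absvV absv_thX invf_lt1 ?qRX_gt0// exprn_egt1 ?qR_gt1.
by rewrite eA_small// ltW.
Qed.

Definition kE : fps C := fps_const (pi ^+ q / cD) / twist (F := F) (s_Car pi).

Definition H1 z : fps C := fps_const (h z) * twist (F := F) (s_2 (val z)).

Lemma tsC0 : twist (F := F) (s_Car pi) 0%N != 0.
Proof. by rewrite [twist _ _]/= expf_neq0// s_Car0. Qed.

Lemma kE0 : kE 0%N != 0.
Proof.
rewrite /kE fpsCM fpsV0 ?tsC0// mulf_neq0 ?invr_neq0 ?tsC0//.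
by rewrite mulf_neq0 ?invr_neq0 ?cD_neq0// expf_neq0 ?(pi_neq0 pi_period).
Qed.

Lemma Tpos_kE : Tpos kE.
Proof.
apply: TposM (TposC _) (TposV tsC0 _); apply: (Tpos_bd _ ltr01 (bd_twist bd_s_Car)).
by rewrite exprn_ge0 ?absv_ge0.
Qed.

(** h^q / Delta is a constant times h, so bold E is, up to a unit of T_{>0}, h times the twist of
    s_2 and has no denominators in z. *)
Lemma bE_H1 z : bE pi h Delta z = kE * H1 z.
Proof.
have h0 := h_neq0 z; have cd := cD_neq0.
rewrite /bE /bh !twistM twistV ?s_Car0// twistC DeltaE /kE /H1.
rewrite (fps_constV (mulf_neq0 cd (expf_neq0 _ h0))).
have E : fps_const ((pi * h z) ^+ q) * fps_const (cD * h z ^+ q.-1)^-1 =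
    fps_const (pi ^+ q / cD) * fps_const (h z) :> fps C.
  have hq : h z ^+ q = h z * h z ^+ q.-1 by rewrite -exprS qS.
  rewrite -!fps_constM exprMn hq; congr fps_const.
  by field; rewrite cd expf_neq0.
move: E; move: (fps_const _) (fps_const _) (fps_const _) (fps_const _) => a b c d E.
move: (twist _) (twist _)^-1 => s t; transitivity (d * c * (s * t)); first by ring.
by rewrite E; ring.
Qed.

End Relations.

(** * Regular functions *)

Section Nets.
Variables (R : realType) (F : finFieldType) (S : setting R F).
Notation C := (Cinf S).

Lemma net_unique (I : choiceType) (f : {fset I} -> C) (l1 l2 : C) :
  f @ totally --> l1 -> f @ totally --> l2 -> l1 = l2.
Proof.
move=> /near_totally f1 /near_totally f2; apply/eqP; rewrite -subr_eq0 -absv_eq0 eq_le absv_ge0 andbT.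
apply/ler_addgt0Pl => e e0; rewrite addr0; apply/ltW.
have [X1 H1] := f1 _ e0; have [X2 H2] := f2 _ e0.
rewrite -(subrKA (f (X1 `|` X2)%fset)) absvD_lt//; last by apply: H2; exact: fsubsetUr.
by rewrite absv_subC; apply: H1; exact: fsubsetUl.
Qed.

(** Outside a large finite set, a term is the difference of two partial sums that are both close to
    the limit. *)
Lemma net_terms_bounded (I : choiceType) (a : I -> C) (l : C) :
  partial_sum a @ totally --> l -> exists2 B : R, 0 <= B & forall i, absv (a i) <= B.
Proof.
move=> /near_totally/(_ _ (@ltr01 R))[X H].
pose B : R := \sum_(i <- X) absv (a i); have B0 : 0 <= B by apply: sumr_ge0 => i _; exact: absv_ge0.
exists (B + 1); first by rewrite addr_ge0.
move=> i; have [iX|iX] := boolP (i \in X).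
  rewrite (le_trans _ (_ : B <= B + 1)) ?lerDl// /B (bigD1_seq i) ?fset_uniq//= lerDl.
  by apply: sumr_ge0 => j _; exact: absv_ge0.
have := H X (fsubset_refl _); have := H (i |` X)%fset (fsubsetUr _ _).
rewrite !partial_sumE big_fsetU1//= => h1 h2; apply: (@le_trans _ _ 1); last by rewrite lerDr.
by have := absvB_lt h1 h2; rewrite opprB addrA subrK addrK => /ltW.
Qed.

Definition boxNN d : {fset nat * nat} := [fset x in [seq (n, m) | n <- seq.iota 0 d, m <- seq.iota 0 d]]%fset.

Lemma mem_boxNN (p : nat * nat) d : (p \in boxNN d) = (maxn p.1 p.2 < d)%N.
Proof.
case: p => n m; rewrite !inE /= gtn_max; apply/allpairsP/andP => [[[n' m'] [/=]]|[nd md]].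
  by rewrite !mem_iota !add0n /= => nd md [-> ->].
by exists (n, m); rewrite !mem_iota.
Qed.

Lemma big_boxNN (f : nat -> nat -> C) d :
  \sum_(p <- boxNN d) f p.1 p.2 = \sum_(0 <= n < d) \sum_(0 <= m < d) f n m.
Proof.
have -> : \sum_(0 <= n < d) \sum_(0 <= m < d) f n m =
    \sum_(p <- [seq (n, m) | n <- seq.iota 0 d, m <- seq.iota 0 d]) f p.1 p.2.
  by rewrite big_allpairs_dep /= /index_iota subn0.
apply: perm_big; apply: uniq_perm; rewrite ?fset_uniq//.
  by apply: allpairs_uniq; rewrite ?iota_uniq// => -[a b] [c d'] _ _ [-> ->].
by move=> p; rewrite !inE.
Qed.

Lemma series_poly (f : fps C) t n : series (fps_terms f t) n = \sum_(0 <= i < n) f i * t ^+ i.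
Proof. by []. Qed.

(** The unordered double sum exists by domination on square boxes; it equals the iterated sum
    because the square partial sums converge to that too. *)
Lemma double_sum_net (M rho : R) (k : nat -> fps C) (t v : C) : 0 <= M -> 0 < rho ->
  (forall n, bd (M * rho ^+ n) rho (k n)) -> rho * absv t < 1 -> rho * absv v < 1 ->
  partial_sum (fun nm : nat * nat => k nm.1 nm.2 * t ^+ nm.1 * v ^+ nm.2) @ totally
    --> fps_eval (Fps (fun n => fps_eval (k n) v)) t.
Proof.
move=> M0 r0 kM rt rv; set a := fun nm : nat * nat => _; set phi := Fps _.
(* The value 1/2 only keeps the common ratio strictly positive when t and v vanish. *)
pose x := Num.max (Num.max (rho * absv t) (rho * absv v)) (2%:R^-1).
have h20 : 0 < 2%:R^-1 :> R by lra.
have h21 : 2%:R^-1 < 1 :> R by lra.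
have x01 : 0 < x < 1 by rewrite /x lt_max !gt_max rt rv h20 h21 orbT.
have x0 : 0 <= x by case/andP: x01 => /ltW.
have xt : rho * absv t <= x by rewrite !le_max lexx.
have xv : rho * absv v <= x by rewrite !le_max lexx orbT.
have rt0 : 0 <= rho * absv t by rewrite mulr_ge0 ?absv_ge0 ?(ltW r0).
have rv0 : 0 <= rho * absv v by rewrite mulr_ge0 ?absv_ge0 ?(ltW r0).
have aM n m : absv (k n m * t ^+ n * v ^+ m) <= M * x ^+ maxn n m.
  apply: le_trans (_ : M * ((rho * absv t) ^+ n * (rho * absv v) ^+ m) <= _).
    rewrite !absvM !absvX !exprMn; have := kM n m => h.
    apply: le_trans (_ : M * rho ^+ n * rho ^+ m * absv t ^+ n * absv v ^+ m <= _).
      by rewrite !ler_wpM2r ?exprn_ge0 ?absv_ge0.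
    by rewrite le_eqVlt; apply/orP; left; apply/eqP; ring.
  rewrite ler_wpM2l//; apply: le_trans (_ : x ^+ n * x ^+ m <= _).
    by rewrite ler_pM ?exprn_ge0// lerXn2r ?nnegrE.
  by rewrite -exprD ler_wiXn2l//; [case/andP: x01 => _ /ltW|rewrite geq_max leq_addr leq_addl].
have [l al tl] := psum_box mem_boxNN x01 M0 (fun p : nat * nat => aM p.1 p.2).
suff -> : fps_eval phi t = l by [].
have phib : bd M rho phi by move=> n; exact: eval_bd (ltW r0) (kM n) rv.
have phic := bd_conv (ltW r0) phib rt.
have bxl : lims (fun d => \sum_(p <- boxNN d) k p.1 p.2 * t ^+ p.1 * v ^+ p.2) l.
  have h : lims (fun d => \sum_(p <- boxNN d) k p.1 p.2 * t ^+ p.1 * v ^+ p.2 - l) 0.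
    apply: (@lims_scale_geom _ _ M x) => [|d]; first by rewrite x0; case/andP: x01.
    by rewrite absv_subC; apply: tl; exact: fsubset_refl.
  by rewrite -[l]add0r; apply: lims_ext (limsD h (lims_cst l)) => d; rewrite subrK.
apply: lims_unique (evalP phic) _; apply: lims_close bxl _ => e e0.
have M1 : 0 < M + 1 by rewrite ltr_wpDl.
have [|N HN] := @geom_lt _ x (e / (M + 1)) _ (divr_gt0 e0 M1).
  by rewrite x0; case/andP: x01.
exists N => d Nd; rewrite (big_boxNN (fun n m => k n m * t ^+ n * v ^+ m)) series_poly -sumrB.
apply: absv_sum_lt => // n _.
have kc := bd_conv (ltW r0) (kM n) rv.
have -> : phi n * t ^+ n - \sum_(0 <= m < d) k n m * t ^+ n * v ^+ m =
    (fps_eval (k n) v - series (fps_terms (k n) v) d) * t ^+ n.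
  rewrite mulrBl; congr (_ - _); rewrite series_poly mulr_suml; apply: eq_bigr => m _; exact: mulrAC.
have tail := @lims_series_tail _ _ S _ _ (M * rho ^+ n * x ^+ d) d (evalP kc).
rewrite absvM absvX; apply: le_lt_trans (_ : M * rho ^+ n * x ^+ d * absv t ^+ n < e).
  rewrite ler_wpM2r ?exprn_ge0 ?absv_ge0//; apply: tail => j dj.
  apply: le_trans (bd_terms _ _ (kM n)) _; rewrite ler_wpM2l ?mulr_ge0 ?exprn_ge0 ?(ltW r0)//.
  apply: le_trans (_ : x ^+ j <= _); first by rewrite lerXn2r ?nnegrE.
  by rewrite ler_wiXn2l//; case/andP: x01 => _ /ltW.
have -> : M * rho ^+ n * x ^+ d * absv t ^+ n = M * x ^+ d * (rho * absv t) ^+ n.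
  by rewrite exprMn; ring.
apply: le_lt_trans (_ : (M + 1) * x ^+ d < e); last by rewrite mulrC -ltr_pdivlMr// HN.
rewrite -[leRHS]mulr1 ler_pM ?mulr_ge0 ?exprn_ge0//; first by rewrite ler_wpM2r ?exprn_ge0// lerDl.
by rewrite exprn_ile1// ltW.
Qed.

End Nets.

Section Regular.
Variables (R : realType) (F : finFieldType) (S : setting R F) (pi : Cinf S).
Hypothesis pi_period : carlitz_period pi.
Notation C := (Cinf S).
Notation A := {poly F}.
Notation u := (u pi).
Notation regular := (@regular R F S pi).
Implicit Types (z : Omega S) (f g : Omega S -> fps C) (M rho : R).

(* [k n m] is the coefficient of t^n u^m. *)
Definition gexp M rho f (k : nat -> fps C) :=
  forall n, uexp pi (M * rho ^+ n) rho (fun z => f z n) (k n).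

Lemma gexp_rho M rho f k : gexp M rho f k -> 0 < rho.
Proof. by move=> /(_ 0%N)[]. Qed.

Lemma gexp_M M rho f k : gexp M rho f k -> 0 <= M.
Proof. by move=> /(_ 0%N)[_ /bd_ge0 + _]; rewrite mulr1. Qed.

Lemma gexpW M rho M' rho' f k : M <= M' -> rho <= rho' -> gexp M rho f k -> gexp M' rho' f k.
Proof.
move=> MM rr H n; have r0 := gexp_rho H; have M0 := gexp_M H; apply: (uexpW _ rr (H n)).
have r'0 := le_trans (ltW r0) rr; apply: ler_pM MM _ => //; first exact: exprn_ge0 (ltW r0).
by apply: lerXn2r rr; rewrite nnegrE // ltW.
Qed.

Lemma gexp_unify M rho M' rho' f f' k k' : gexp M rho f k -> gexp M' rho' f' k' ->
  gexp (Num.max M M') (Num.max rho rho') f k /\ gexp (Num.max M M') (Num.max rho rho') f' k'.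
Proof.
by move=> H H'; split; [apply: gexpW H|apply: gexpW H']; rewrite le_max lexx ?orbT.
Qed.

Lemma gexpD M rho f f' k k' : gexp M rho f k -> gexp M rho f' k' ->
  gexp M rho (f + f') (fun n => k n + k' n).
Proof. by move=> H H' n; exact: uexpD (H n) (H' n). Qed.

Lemma uexp_sum M rho n (f : nat -> Omega S -> C) (k : nat -> fps C) : 0 < rho -> 0 <= M ->
  (forall i, (i < n)%N -> uexp pi M rho (f i) (k i)) ->
  uexp pi M rho (fun z => \sum_(i < n) f i z) (\sum_(i < n) k i).
Proof.
move=> r0 M0; elim: n => [|n IH] H.
  rewrite big_ord0; apply: (@uexp_ext _ _ _ _ _ _ (fun=> 0)); first by move=> z; rewrite big_ord0.
  by apply: uexpW (uexpC pi 0 r0); rewrite ?absv0.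
rewrite big_ord_recr /=; apply: (@uexp_ext _ _ _ _ _ _ (fun z => \sum_(i < n) f i z + f n z)).
  by move=> z; rewrite big_ord_recr.
by apply: uexpD; [apply: IH => i /ltnW|]; apply: H.
Qed.

Lemma gexpMul M M' rho f f' k k' : gexp M rho f k -> gexp M' rho f' k' ->
  gexp (M * M') rho (f * f') (fun n => \sum_(i < n.+1) k i * k' (n - i)%N).
Proof.
move=> H H' n; have r0 := gexp_rho H.
apply: (uexp_sum (n := n.+1) (f := fun i z => f z i * f' z (n - i)%N) (k := fun i => k i * k' (n - i)%N) r0).
  by rewrite !mulr_ge0 ?exprn_ge0 ?(gexp_M H) ?(gexp_M H') ?(ltW r0).
move=> i; rewrite ltnS => ni; have := uexpM (H i) (H' (n - i)%N).
have -> : M * rho ^+ i * (M' * rho ^+ (n - i)) = M * M' * rho ^+ n; last by [].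
by rewrite mulrACA -exprD subnKC.
Qed.

Definition good f := exists M rho k, gexp M rho f k.

Lemma goodD f f' : good f -> good f' -> good (f + f').
Proof.
move=> [M [rho [k H]]] [M' [rho' [k' H']]]; have [h h'] := gexp_unify H H'.
by exists (Num.max M M'), (Num.max rho rho'), (fun n => k n + k' n); exact: gexpD.
Qed.

Lemma goodM f f' : good f -> good f' -> good (f * f').
Proof.
move=> [M [rho [k H]]] [M' [rho' [k' H']]]; have [h h'] := gexp_unify H H'.
eexists; eexists; eexists; exact: gexpMul h h'.
Qed.

Lemma good_cst (c : fps C) : Tpos c -> good (cst c).
Proof.
move=> /TposP[M [rho [M0 r0 cM]]]; exists M, rho, (fun n => fps_const (c n)) => n.
by apply: uexpW (lexx rho) (uexpC pi (c n) r0); exact: cM.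
Qed.

Lemma good_const (f : Omega S -> C) k : uex pi f k -> good (fun z => fps_const (f z)).
Proof.
move=> [M [rho [r0 kM H]]]; have M0 := bd_ge0 kM.
exists M, rho, (fun n => if n is 0%N then k else 0) => -[|n]; first by rewrite mulr1.
have := uexpC pi 0 r0; rewrite absv0; apply: uexpW => //.
by rewrite mulr_ge0 ?exprn_ge0 ?(ltW r0).
Qed.

Lemma good_uniform M rho f (k : nat -> fps C) : (forall n, uexp pi M rho (fun z => f z n) (k n)) -> good f.
Proof.
move=> H; exists M, (Num.max rho 1), k => n; have [_ kM _] := H n; have M0 := bd_ge0 kM.
apply: uexpW (H n); last by rewrite le_max lexx.
by rewrite ler_peMr// exprn_ege1// le_max lexx orbT.
Qed.

Definition net_cond f := exists2 c : R, 0 < c & exists k : nat -> nat -> C,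
  forall z t0, absv (u (val z)) < c -> absv t0 < c ->
    partial_sum (fun nm : nat * nat => k nm.1 nm.2 * t0 ^+ nm.1 * u (val z) ^+ nm.2) @ totally
      --> fps_eval (f z) t0.

Lemma good_net f : good f -> net_cond f.
Proof.
move=> [M [rho [k H]]]; have r0 := gexp_rho H; have M0 := gexp_M H.
exists rho^-1; first by rewrite invr_gt0.
exists (fun n m => k n m) => z t0; rewrite -[rho^-1]mulr1 -!ltr_pdivrMl ?invr_gt0// invrK => uz tz.
have -> : f z = Fps (fun n => fps_eval (k n) (u (val z))).
  by apply: fpsP => n; have [_ _ E] := H n; exact: E.
by apply: (double_sum_net M0 r0) => // n; have [_ + _] := H n.
Qed.

Definition uconv f := exists2 r : R, 0 < r & forall z t0, absv t0 < r -> fps_cvg (f z) t0.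

(** Boundedness of the terms at a single point (t1, u1) bounds all coefficients. The series in t so
    obtained agrees with f(z) at all small t, hence coefficient by coefficient. *)
Lemma net_good f : uconv f -> net_cond f -> good f.
Proof.
move=> [r r0 fr] [c c0 [k H]].
have [z1 [_ uz1]] := cusp_small pi_period c0; have u1 := absv_u_gt0 pi_period z1.
have [t1 /andP[t10 t1c]] := small_elt S c0.
have [B B0 BP] := net_terms_bounded (H _ _ uz1 t1c).
pose rho := Num.max (absv t1)^-1 (absv (u (val z1)))^-1.
have rt : (absv t1)^-1 <= rho by rewrite le_max lexx.
have ru : (absv (u (val z1)))^-1 <= rho by rewrite le_max lexx orbT.
have rho0 : 0 < rho by apply: lt_le_trans rt; rewrite invr_gt0.
pose K n := Fps (k n); have KB n : bd (B * rho ^+ n) rho (K n).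
  move=> m; have := BP (n, m); rewrite /= !absvM !absvX => h.
  have t1n : 0 < absv t1 ^+ n by rewrite exprn_gt0.
  have u1m : 0 < absv (u (val z1)) ^+ m by rewrite exprn_gt0.
  apply: le_trans (_ : B * (absv t1)^-1 ^+ n * (absv (u (val z1)))^-1 ^+ m <= _).
    by rewrite !exprVn ler_pdivlMr// ler_pdivlMr// mulrAC.
  by rewrite !ler_pM ?mulr_ge0 ?exprn_ge0 ?invr_ge0 ?absv_ge0// lerXn2r ?nnegrE ?invr_ge0 ?absv_ge0 ?(ltW rho0).
exists B, rho, K => n; split=> // z uz.
have uzc : absv (u (val z)) < c.
  apply: lt_trans uz1; rewrite -[X in _ < X]invrK -[X in _ < X]mul1r ltr_pdivlMr ?invr_gt0//.
  by apply: le_lt_trans uz; rewrite mulrC ler_wpM2r ?absv_ge0.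
pose phi := Fps (fun n => fps_eval (K n) (u (val z))).
have phib : bd B rho phi by move=> j; exact: eval_bd (ltW rho0) (KB j) uz.
suff E : f z = phi by rewrite E.
have /TposP[M2 [r2 [M20 r20 fb]]] : Tpos (f z) by exists r => // t0; exact: fr.
pose rr := Num.max rho r2; pose MM := Num.max B M2.
have rr0 : 0 < rr by rewrite lt_max rho0.
have MM0 : 0 <= MM by rewrite le_max B0.
have b1 : bd MM rr phi by apply: (bdW _ B0 (ltW rho0) _ phib); rewrite le_max lexx.
have b2 : bd MM rr (f z) by apply: (bdW _ (ltW M20) (ltW r20) _ fb); rewrite le_max lexx orbT.
apply/eqP; rewrite -subr_eq0; apply/eqP.
apply: (fps_identity rr0 (bdD b2 (bdN b1))) => e e0.
have [|t /andP[t0 te]] := @small_elt R F S (Num.min e (Num.min c rr^-1)).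
  by rewrite !lt_min e0 c0 invr_gt0.
move: te; rewrite !lt_min => /and3P[te tc tr]; exists t; split=> //.
have {}tr : rr * absv t < 1 by rewrite -ltr_pdivlMl// mulr1.
rewrite (evalB (bd_conv (ltW rr0) b2 tr) (bd_conv (ltW rr0) b1 tr)).
apply/eqP; rewrite subr_eq0; apply/eqP; apply: net_unique (H _ _ uzc tc) _.
have trho : rho * absv t < 1 by apply: le_lt_trans tr; rewrite ler_wpM2r ?absv_ge0// le_max lexx.
exact: double_sum_net B0 rho0 KB trho uz.
Qed.

Definition urigid f := exists2 e : R, 0 < e &
  forall t0, absv t0 < e -> rigid_analytic (fun z => fps_eval (f z) t0).
Definition periodic f := forall (a : A) z, f (translate a z) = f z.

Lemma regularE f : regular f <-> [/\ uconv f, urigid f, periodic f & good f].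
Proof.
split=> [] [h1 h2 h3 h4]; split=> //; first exact: net_good.
exact: good_net.
Qed.

Lemma regularD f f' : regular f -> regular f' -> regular (f + f').
Proof.
move=> /regularE[[r r0 c] [e e0 a] p g] /regularE[[r' r'0 c'] [e' e'0 a'] p' g']; apply/regularE.
have cc z t0 : absv t0 < Num.min r r' -> conv (f z) t0 /\ conv (f' z) t0.
  by rewrite lt_min => /andP[t1 t2]; split; apply/fps_cvgE; [exact: c|exact: c'].
split; last exact: goodD.
- exists (Num.min r r'); first by rewrite lt_min r0.
  by move=> z t0 /(cc z)[h1 h2]; apply/fps_cvgE; exact: convD.
- exists (Num.min (Num.min r r') (Num.min e e')); first by rewrite !lt_min r0 r'0 e0.
  move=> t0; rewrite lt_min [X in _ && X]lt_min => /and3P[tr te te'].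
  by apply: rigid_ext (rigidD (a _ te) (a' _ te')) => z; have [h1 h2] := cc z _ tr; rewrite evalD.
- by move=> b z; rewrite /= -[LHS]/(f _ + f' _) p p'.
Qed.

Lemma regularM f f' : regular f -> regular f' -> regular (f * f').
Proof.
move=> /regularE[[r r0 c] [e e0 a] p g] /regularE[[r' r'0 c'] [e' e'0 a'] p' g']; apply/regularE.
have cc z t0 : absv t0 < Num.min r r' -> conv (f z) t0 /\ conv (f' z) t0.
  by rewrite lt_min => /andP[t1 t2]; split; apply/fps_cvgE; [exact: c|exact: c'].
split; last exact: goodM.
- exists (Num.min r r'); first by rewrite lt_min r0.
  by move=> z t0 /(cc z)[h1 h2]; apply/fps_cvgE; exact: convM.
- exists (Num.min (Num.min r r') (Num.min e e')); first by rewrite !lt_min r0 r'0 e0.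
  move=> t0; rewrite lt_min [X in _ && X]lt_min => /and3P[tr te te'].
  by apply: rigid_ext (rigidM (a _ te) (a' _ te')) => z; have [h1 h2] := cc z _ tr; rewrite evalM.
- by move=> b z; rewrite /= -[LHS]/(f _ * f' _) p p'.
Qed.

Lemma regular_cst (c : fps C) : Tpos c -> regular (cst c).
Proof.
move=> cT; apply/regularE; split; last exact: good_cst.
- by case: cT => r r0 H; exists r => // z; exact: H.
- exists 1 => // t0 _; exact: (@rigidC _ _ S (fps_eval c t0)).
- by [].
Qed.

Lemma regular_ext f f' : f =1 f' -> regular f -> regular f'.
Proof. by move=> E; have -> : f' = f by apply/funext => z; rewrite E. Qed.

Lemma regular_sum (I : Type) (s : seq I) (P : pred I) (f : I -> Omega S -> fps C) :
  (forall i, P i -> regular (f i)) -> regular (fun z => \sum_(i <- s | P i) f i z).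
Proof.
move=> H; elim: s => [|i s IH].
  by apply: regular_ext (regular_cst (Tpos0 S)) => z; rewrite big_nil.
case Pi: (P i); last by apply: regular_ext IH => z; rewrite big_cons Pi.
by apply: regular_ext (regularD (H i Pi) IH) => z; rewrite big_cons Pi.
Qed.

Lemma regularX f n : regular f -> regular (fun z => f z ^+ n).
Proof.
move=> fr; elim: n => [|n IH].
  by apply: regular_ext (regular_cst (Tpos1 S)) => z; rewrite expr0.
by apply: regular_ext (regularM fr IH) => z; rewrite exprS.
Qed.

(** The constant may depend on the affinoid but the rate [rho] may not: then truncations in t
    converge uniformly on each affinoid, for every t in one fixed disc. *)
Lemma tame_regular rho f : 0 < rho -> (forall i, rigid_analytic (fun z => f z i)) ->
  (forall n, exists2 B : R, 0 <= B & forall z, affinoid n (val z) -> bd B rho (f z)) ->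
  periodic f -> good f -> regular f.
Proof.
move=> r0 fr fb fp fg; apply/regularE; split=> //; exists rho^-1; rewrite ?invr_gt0//.
  move=> z t0 tr; have {}tr : rho * absv t0 < 1 by rewrite -ltr_pdivlMl// mulr1.
  have [n zn] := Omega_affinoid (@valO _ _ S z); have [B B0 H] := fb n.
  by apply/fps_cvgE; exact: bd_conv (ltW r0) (H z zn) tr.
move=> t0 tr; have {}tr : rho * absv t0 < 1 by rewrite -ltr_pdivlMl// mulr1.
have x0 : 0 <= rho * absv t0 by rewrite mulr_ge0 ?absv_ge0 ?(ltW r0).
apply: rigid_lim => n e e0; have [B B0 H] := fb n; have B1 : 0 < B + 1 by rewrite ltr_wpDl.
have [|N /(_ N (leqnn N)) HN] := @geom_lt _ (rho * absv t0) (e / (B + 1)) _ (divr_gt0 e0 B1).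
  by rewrite x0.
exists (fun z => \sum_(0 <= i < N) f z i * t0 ^+ i).
  by apply: rigid_sum => i _; apply: rigidM (fr i) (rigidC _).
move=> z zn; rewrite -series_poly.
have cz := bd_conv (ltW r0) (H z zn) tr.
apply: le_lt_trans (_ : B * (rho * absv t0) ^+ N < e).
  apply: lims_series_tail (evalP cz) _ => j Nj; apply: le_trans (bd_terms _ _ (H z zn)) _.
  by rewrite ler_wpM2l// ler_wiXn2l// ltW.
move: HN; rewrite ltr_pdivlMr// mulrC; apply: le_lt_trans.
by rewrite ler_wpM2r ?exprn_ge0// lerDl.
Qed.

Lemma regular_const (f : Omega S -> C) k : rigid_analytic f ->
  (forall (a : A) z, f (translate a z) = f z) -> uex pi f k -> regular (fun z => fps_const (f z)).
Proof.
move=> fr fp fu; apply: (tame_regular ltr01) (good_const fu).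
- by move=> [|i] /=; [exact: fr|exact: rigidC].
- move=> n; have [B B0 H] := rigid_bounded n fr; exists B => // z zn [|i] /=; rewrite expr1n mulr1 ?absv0//.
  exact: H.
- by move=> a z; rewrite fp.
Qed.

End Regular.

Lemma cancel_alg (K : comNzRingType) (a b c d x y w s : K) : a * c = 1 -> b * d = 1 ->
  a * x * (b * y * s) = a * b * w * s -> w * s = x * y * s.
Proof.
move=> j1 j2 E; transitivity (((a * c) * (b * d)) * (w * s)); first by rewrite j1 j2 !mul1r.
transitivity (((a * c) * (b * d)) * (x * y * s)); last by rewrite j1 j2 !mul1r.
transitivity (c * d * (a * b * w * s)); first by ring.
by rewrite -E; ring.
Qed.

Lemma bL_alg (K : comUnitRingType) (T N N2 N3 s j ji c c' c'' D : K) :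
  T \is a GRing.unit -> N \is a GRing.unit -> N2 \is a GRing.unit -> N3 \is a GRing.unit ->
  s \is a GRing.unit -> ji * j = 1 -> N = N3 * j -> c'' * N2 = D * c * s + c' * N ->
  c'' / (T * N) = D * ji / (N2 / s) * (c / (T * N3)) + c' / (T * N2).
Proof.
move=> Tu Nu N2u N3u su jj NE key.
have U1 : T * N * N2 \is a GRing.unit by rewrite !unitrM Tu Nu.
apply: (mulIr U1); rewrite !(invrM Tu)// (invrM N2u) ?unitrV// invrK.
have i1 := mulVr Nu; have i2 := mulVr N2u; have i3 := mulVr N3u; have i4 := mulVr Tu.
transitivity (c'' * N2 * ((N^-1 * N) * (T^-1 * T))); first by ring.
rewrite i1 i4 !mulr1 key mulrDl; congr (_ + _); last first.
  transitivity (c' * N * ((N2^-1 * N2) * (T^-1 * T))); last by ring.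
  by rewrite i2 i4 !mulr1.
rewrite [in RHS]NE.
transitivity (D * c * s * ((ji * j) * (N2^-1 * N2) * (N3^-1 * N3) * (T^-1 * T))); last by ring.
by rewrite jj i2 i3 i4 !mulr1.
Qed.

Lemma bE_alg (K : comUnitRingType) (a b c d k x y x' y' N T c' d' : K) :
  T \is a GRing.unit -> N \is a GRing.unit -> y \is a GRing.unit ->
  a * b = c * d -> N = c' * x + d' * y ->
  k * (a * (b * (c' * x' + d' * y'))) =
  c * (N / y) * (k * (d * y') + - (T * k * (d * (x * y' - y * x'))) * (c' / (T * N))).
Proof.
move=> Tu Nu yu ab NE; rewrite (invrM Tu Nu).
have i1 := mulVr Nu; have i2 := mulVr Tu; have i3 := mulVr yu.
transitivity (k * (c * d) * (c' * x' + d' * y')); first by rewrite -ab; ring.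
transitivity (k * (c * d) * (N * y' * y^-1 - (x * y' - y * x') * c' * y^-1 * ((N^-1 * N) * (T^-1 * T)))); last by ring.
rewrite i1 i2 !mulr1 [in RHS]NE.
transitivity (k * (c * d) * ((c' * x' + d' * y') * (y^-1 * y))); first by rewrite i3 mulr1.
by ring.
Qed.

(** * Automorphy factors and their cocycle relations *)

Section Cocycles.
Variables (R : realType) (F : finFieldType) (S : setting R F).
Notation C := (Cinf S).
Notation q := #|F|.
Notation A := {poly F}.
Notation th := (theta S).
Notation ev := (polyev (iota S) th).
Notation bar := (bar S).
Implicit Types (z : Omega S) (g : 'M[A]_2).

Definition tht : fps C := fps_const th - fps_X C.

Lemma tht_unit : tht \is a GRing.unit.
Proof. by rewrite fps_unitE fpsB /= subr0 th_neq0. Qed.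

Definition Nm g z : fps C := bar (g 1 0) * s_1 (val z) + bar (g 1 1) * s_2 (val z).

Lemma s2u z : (s_2 (val z) : fps C) \is a GRing.unit.
Proof. by apply: s2_unit; exact: valO. Qed.

Lemma s2_mobN g z : g \in unitmx -> s_2 (val (mobius g z)) = fps_const (J g (val z))^-1 * Nm g z.
Proof. by move=> gu; rewrite (val_mobius z gu) (s_2_mobius gu (@valO _ _ S z)). Qed.

Lemma Jn0 g z : g \in unitmx -> J g (val z) != 0.
Proof. by move=> gu; exact: (J_neq0 gu (@valO _ _ S z)). Qed.

Lemma N_unit g z : g \in unitmx -> Nm g z \is a GRing.unit.
Proof.
move=> gu; have := s2u (mobius g z); rewrite s2_mobN// unitrM => /andP[_ //].
Qed.

Lemma bJN g z : bJ g (val z) = Nm g z / s_2 (val z).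
Proof. by rewrite /bJ /Nm mulrDl mulrA mulrK ?s2u. Qed.

Lemma bJ_unit g z : g \in unitmx -> bJ g (val z) \is a GRing.unit.
Proof. by move=> gu; rewrite bJN unitrM N_unit// unitrV s2u. Qed.

Lemma s2_mob g z : g \in unitmx ->
  s_2 (val (mobius g z)) = fps_const (J g (val z))^-1 * bJ g (val z) * s_2 (val z).
Proof. by move=> gu; rewrite bJN -mulrA divrK ?s2u// s2_mobN. Qed.

Lemma mobius_mulE g g' z : g \in unitmx -> g' \in unitmx -> mobius (g *m g') z = mobius g (mobius g' z).
Proof.
move=> gu gu'; apply: val_inj; rewrite !val_mobius ?unitmx_mul ?gu//.
by apply: mobius_mul => //; exact: valO.
Qed.

Lemma mobius1E z : mobius 1%:M z = z.
Proof. by apply: val_inj; rewrite val_mobius ?unitmx1// mobius1. Qed.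

Lemma J_mulE g g' z : g \in unitmx -> g' \in unitmx ->
  J (g *m g') (val z) = J g (val (mobius g' z)) * J g' (val z).
Proof. by move=> gu gu'; rewrite J_mul ?Jn0// val_mobius. Qed.

(** By [s2_mob], bold J is J times the coboundary s_2(gamma z) / s_2(z); the cocycle relation
    follows from that of J. *)
Lemma bJ_mul g g' z : g \in unitmx -> g' \in unitmx ->
  bJ (g *m g') (val z) = bJ g (val (mobius g' z)) * bJ g' (val z).
Proof.
move=> gu gu'; have guu : g *m g' \in unitmx by rewrite unitmx_mul gu.
apply: (mulIr (s2u z)).
have jc x : x != 0 -> (fps_const x^-1 : fps C) * fps_const x = 1.
  by move=> x0; rewrite -fps_constM mulVf.
have E := s2_mob z guu; rewrite mobius_mulE// s2_mob// s2_mob// J_mulE// in E.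
have j1 := jc _ (Jn0 (mobius g' z) gu); have j2 := jc _ (Jn0 z gu').
rewrite invfM fps_constM in E.
exact: cancel_alg j1 j2 E.
Qed.

Lemma L_mul g g' z : g \in unitmx -> g' \in unitmx ->
  L (g *m g') (val z) = detC S g' * J g' (val z) ^- 2 * L g (val (mobius g' z)) + L g' (val z).
Proof.
move=> gu gu'; have J1 := Jn0 z gu'; have J2 := Jn0 (mobius g' z) gu.
rewrite /L J_mulE// mulmx2E evD !evM.
have JE : J g (val (mobius g' z)) = (ev (g 1 0) * (ev (g' 0 0) * val z + ev (g' 0 1))
    + ev (g 1 1) * J g' (val z)) / J g' (val z).
  by rewrite (val_mobius z gu') /mobius_C {1}/J [in RHS]mulrDl mulfK// mulrA.
have dE : detC S g' = ev (g' 0 0) * ev (g' 1 1) - ev (g' 0 1) * ev (g' 1 0).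
  by rewrite /detC det_mx22E evB !evM.
have key : J g (val (mobius g' z)) * J g' (val z) * ev (g' 1 0) + detC S g' * ev (g 1 0) =
   J g' (val z) * (ev (g 1 0) * ev (g' 0 0) + ev (g 1 1) * ev (g' 1 0)).
  by rewrite JE mulfVK// dE /J; ring.
move: (J g _) (J g' _) (detC S g') J2 J1 key => {JE dE} X Y D' X0 Y0 key.
move: (ev (g 1 0) * ev (g' 0 0) + _) key => c'' key.
have -> : c'' = (X * Y * ev (g' 1 0) + D' * ev (g 1 0)) / Y by rewrite key mulrC mulKf.
by field; rewrite X0 Y0.
Qed.

Lemma Nm_mul g g' z : g \in unitmx -> g' \in unitmx ->
  Nm (g *m g') z = Nm g (mobius g' z) * fps_const (J g' (val z)).
Proof.
move=> gu gu'; have guu : g *m g' \in unitmx by rewrite unitmx_mul gu.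
have E := s2_mobN z guu; rewrite mobius_mulE// s2_mobN// J_mulE// in E.
have J1 := Jn0 z gu'; have J2 := Jn0 (mobius g' z) gu.
have c1 : fps_const (J g (val (mobius g' z)) * J g' (val z)) * fps_const (J g (val (mobius g' z)) * J g' (val z))^-1 = 1 :> fps C.
  by rewrite -fps_constM mulfV ?mulf_neq0.
rewrite -[LHS]mul1r -c1 -mulrA -E mulrA -fps_constM mulrAC mulfV// mul1r mulrC.
by [].
Qed.

Lemma bL_N g z : bL g (val z) = bar (g 1 0) / (tht * Nm g z).
Proof. by []. Qed.

(** After clearing denominators this is the determinant identity [key]; it shows that bold L behaves
    like an additive cocycle twisted by the weight (1,1) factor, as L does with weight (2,0). *)
Lemma bL_mul g g' z : g \in unitmx -> g' \in unitmx ->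
  bL (g *m g') (val z) = fps_const (detC S g' / J g' (val z)) / bJ g' (val z) * bL g (val (mobius g' z))
    + bL g' (val z).
Proof.
move=> gu gu'; have guu : g *m g' \in unitmx by rewrite unitmx_mul gu.
have N1 := N_unit z guu; have N2 := N_unit z gu'; have N3 := N_unit (mobius g' z) gu.
have J1 := Jn0 z gu'; have sz := s2u z.
rewrite !bL_N bJN.
have jc : fps_const (J g' (val z))^-1 * fps_const (J g' (val z)) = 1 :> fps C by rewrite -fps_constM mulVf.
have NN := Nm_mul z gu gu'.
have dE := bar_det S gu'; have cE : bar ((g *m g') 1 0) = bar (g 1 0) * bar (g' 0 0) + bar (g 1 1) * bar (g' 1 0).
  by rewrite mulmx2E barD !barM.
have dE2 : bar ((g *m g') 1 1) = bar (g 1 0) * bar (g' 0 1) + bar (g 1 1) * bar (g' 1 1).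
  by rewrite mulmx2E barD !barM.
have key : bar ((g *m g') 1 0) * Nm g' z =
    fps_const (detC S g') * bar (g 1 0) * s_2 (val z) + bar (g' 1 0) * Nm (g *m g') z.
  by rewrite /Nm cE dE2 -dE; ring.
rewrite fps_constM; exact: bL_alg (tht_unit) N1 N2 N3 sz jc NN key.
Qed.

Definition Wt (mu nu m : int) g z : fps C :=
  fps_const (detC S g ^ (- m) * J g (val z) ^ mu) * bJ g (val z) ^ nu.

Lemma Wt_unit mu nu m g z : g \in unitmx -> Wt mu nu m g z \is a GRing.unit.
Proof.
move=> gu; rewrite /Wt unitrM; apply/andP; split.
  by rewrite fps_unitE /= mulf_neq0 ?expfz_neq0 ?detC_neq0 ?Jn0.
by rewrite unitrXz ?bJ_unit.
Qed.

Lemma Wt_mul mu nu m g g' z : g \in unitmx -> g' \in unitmx ->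
  Wt mu nu m (g *m g') z = Wt mu nu m g (mobius g' z) * Wt mu nu m g' z.
Proof.
move=> gu gu'; rewrite /Wt detC_mul J_mulE// bJ_mul//.
rewrite !expfzMl exprzMl ?bJ_unit// [in RHS]mulrACA -fps_constM.
congr (fps_const _ * _); ring.
Qed.

Lemma WtD mu nu m mu' nu' m' g z : g \in unitmx ->
  Wt (mu + mu') (nu + nu') (m + m') g z = Wt mu nu m g z * Wt mu' nu' m' g z.
Proof.
move=> gu; rewrite /Wt opprD !expfzDr ?detC_neq0 ?Jn0// exprzDr ?bJ_unit//.
rewrite [in RHS]mulrACA -fps_constM; congr (fps_const _ * _); ring.
Qed.

Lemma Wt0 g z : g \in unitmx -> Wt 0 0 0 g z = 1.
Proof. by move=> gu; rewrite /Wt !expr0z !mul1r. Qed.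

End Cocycles.

(** * The basic forms and their transformation laws *)

Section BasicForms.
Variables (R : realType) (F : finFieldType) (S : setting R F) (pi : Cinf S).
Variables g Delta h : Omega S -> Cinf S.
Hypothesis pi_period : carlitz_period pi.
Hypothesis g_Delta : drinfeld_coeffs pi g Delta.
Hypothesis h_def : is_h pi h.
Notation C := (Cinf S).
Notation q := #|F|.
Notation A := {poly F}.
Notation th := (theta S).
Notation ev := (polyev (iota S) th).
Notation u := (u pi).
Notation bar := (bar S).
Notation E := (false_eisenstein pi).
Notation regular := (@regular R F S pi).
Notation kW := (kW pi_period h_def).
Notation kE := (kE pi_period h_def).
Notation H1 := (@H1 R F S h).
Implicit Types (z : Omega S) (m : 'M[A]_2).

Definition transM (a : A) : 'M[A]_2 := mat2 1 a 0 1.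

Lemma transM_unit a : transM a \in unitmx.
Proof. by rewrite unitmxE det_mx22E !mat2E mulr0 subr0 mulr1 unitr1. Qed.

Lemma transM_J a z : J (transM a) (val z) = 1.
Proof. by rewrite /J !mat2E ev0 ev1 mul0r add0r. Qed.

Lemma transM_det a : detC S (transM a) = 1.
Proof. by rewrite /detC det_mx22E !mat2E mulr0 subr0 mulr1 ev1. Qed.

Lemma transM_bJ a z : bJ (transM a) (val z) = 1.
Proof. by rewrite /bJ !mat2E bar0 bar1 mul0r add0r. Qed.

Lemma transM_mobius a z : mobius (transM a) z = translate a z.
Proof.
apply: val_inj; rewrite val_mobius ?transM_unit// val_translate /mobius_C transM_J divr1.
by rewrite !mat2E ev1 mul1r.
Qed.

Lemma s2_periodic a z : s_2 (val (translate a z)) = s_2 (val z) :> fps C.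
Proof.
by rewrite -transM_mobius s2_mob ?transM_unit// transM_J transM_bJ invr1 !mul1r.
Qed.

Lemma regular_s2 : regular (fun z => s_2 (val z)).
Proof.
apply: (tame_regular pi_period ltr01) => [i|n|a z|]; first exact: rigid_s2.
- by have [B B0 H] := bd_s12 S n; exists B => // z /H[].
- exact: s2_periodic.
- have [rho r0 H] := uexp_s2 pi_period.
  have [k kP] := choice H; apply: (good_uniform (k := k)) => n.
  by have [+ _] := kP n; exact.
Qed.

Lemma regular_ts2 : regular (fun z => twist (F := F) (s_2 (val z))).
Proof.
apply: (tame_regular pi_period ltr01) => [i|n|a z|]; first exact: rigidX (rigid_s2 S i).
- have [B B0 H] := bd_s12 S n; exists (B ^+ q); first exact: exprn_ge0.
  by move=> z /H[_ h2]; exact: bd_twist.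
- by rewrite s2_periodic.
- have [rho r0 H] := uexp_s2 pi_period.
  have [k kP] := choice H; apply: (good_uniform (k := fun n => k n ^+ q)) => n.
  by have [h2 _] := kP n; have := uexpX q h2; exact.
Qed.

Lemma h_periodic (a : A) z : h (translate a z) = h z.
Proof. by case: h_def => -[_ _ H _] _; exact: H. Qed.

Lemma g_periodic (a : A) z : g (translate a z) = g z.
Proof.
rewrite -transM_mobius (g_mobius pi_period g_Delta h_def) ?transM_unit//.
by rewrite transM_J expr1n mul1r.
Qed.

Lemma E_periodic (a : A) z : E (translate a z) = E z.
Proof.
rewrite -transM_mobius (EF_all pi_period) ?transM_unit// transM_J transM_det.
by rewrite /L !mat2E ev0 mul0r mul0r subr0 invr1 expr1n !mul1r.
Qed.

Lemma regular_h : regular (fun z => fps_const (h z)).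
Proof.
have [k [ku _ _]] := h_uex pi_period h_def.
exact: (regular_const pi_period (h_rigid h_def) h_periodic ku).
Qed.

Lemma regular_g : regular (fun z => fps_const (g z)).
Proof.
have [k [ku _]] := g_uex pi_period g_Delta h_def.
exact: (regular_const pi_period (g_rigid pi_period g_Delta h_def) g_periodic ku).
Qed.

Lemma regular_E : regular (fun z => fps_const (E z)).
Proof.
have [k ku] := uexp_eisenstein pi_period.
apply: (regular_const pi_period (rigid_E pi_period) E_periodic (_ : uex pi E k)).
by exists 1, q%:R.
Qed.

Lemma regular_H1 : regular H1.
Proof. exact: regularM regular_h regular_ts2. Qed.

Lemma regular_bE : regular (bE pi h Delta).
Proof.
have -> : bE pi h Delta = cst kE * H1 by apply/funext => z; rewrite (bE_H1 pi_period g_Delta h_def).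
have h1 := regular_cst pi_period (Tpos_kE pi_period h_def).
exact: (regularM pi_period h1 regular_H1).
Qed.

Definition kL : fps C := - (tht S * kE * kW).

Lemma Tpos_tht : Tpos (tht S).
Proof.
apply: TposD (TposC _) (TposN _); exists 1 => // t0 _.
by apply/fps_cvgE; have [] := eval_fpsX t0 1; rewrite expr1.
Qed.

Lemma Tpos_kL : Tpos kL.
Proof.
by apply: TposN; apply: TposM; [apply: TposM Tpos_tht _; exact: Tpos_kE|exact: Tpos_kW].
Qed.

Lemma kL0 : kL 0%N != 0.
Proof.
rewrite /kL fpsN oppr_eq0 2!fpsM0; apply: mulf_neq0; last exact: kW0.
apply: mulf_neq0; last exact: kE0.
by rewrite -fps_unitE tht_unit.
Qed.

(** The twisted vector (s_1^(1), s_2^(1)) transforms like the untwisted one. The defect from a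
    multiple of s_2^(1) is the Moore determinant, and h times it is the constant [kW], which
    produces [kL]. *)
Lemma bE_mobius m z : m \in unitmx -> bE pi h Delta (mobius m z) =
  fps_const ((detC S m)^-1 * J m (val z)) * bJ m (val z) *
  (bE pi h Delta z + kL * bL m (val z)).
Proof.
move=> mu; rewrite !(bE_H1 pi_period g_Delta h_def) bJN bL_N.
have N1 := N_unit z mu; have tu := tht_unit S; have su := s2u z; have J0 := Jn0 z mu.
rewrite /kL -(hWr pi_period h_def z).
have WE : Wr (val z) = s_1 (val z) * twist (s_2 (val z)) - s_2 (val z) * twist (s_1 (val z)) :> fps C by [].
rewrite WE /H1 (h_mobius h_def z mu) s2_mobN// twistM twistC /Nm twistD !twistM !twist_bar -/(Nm m z).
have cE : fps_const (J m (val z) ^+ q.+1 / detC S m * h z) * fps_const ((J m (val z))^-1 ^+ q) =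
   fps_const ((detC S m)^-1 * J m (val z)) * fps_const (h z) :> fps C.
  rewrite -!fps_constM; congr fps_const; rewrite exprVn exprS.
  have jq : J m (val z) ^+ q != 0 by rewrite expf_neq0.
  by field; rewrite jq detC_neq0.
exact: bE_alg tu N1 su cE _.
Qed.

Lemma E_mobius m z : m \in unitmx -> E (mobius m z) =
  (detC S m)^-1 * J m (val z) ^+ 2 * (E z - L m (val z) / pi).
Proof. by move=> mu; exact: EF_all. Qed.

End BasicForms.

Lemma horner_mulXC (K : comNzRingType) (p : {poly K}) (v w : K) j : (p * v%:P ^+ j).[w] = p.[w] * v ^+ j.
Proof. by rewrite hornerM -polyC_exp hornerC. Qed.

(** * Uniqueness of expansions in L and bold L *)

Section Density.
Variable K : fieldType.
Implicit Types (Q : {poly {poly fps K}}) (f g : fps K).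

Definition eqm n f g := forall i, (i < n)%N -> f i = g i.

Lemma eqmM n f f' g g' : eqm n f f' -> eqm n g g' -> eqm n (f * g) (f' * g').
Proof.
move=> H H' i i_n; rewrite !fpsM; apply: eq_bigr => j _.
by rewrite H ?H'//; apply: leq_ltn_trans i_n; [exact: leq_subr|rewrite -ltnS].
Qed.

Lemma eqmX n f f' k : eqm n f f' -> eqm n (f ^+ k) (f' ^+ k).
Proof.
move=> H; elim: k => [|k IH]; first by [].
rewrite (exprS f) (exprS f'); exact: (eqmM H IH).
Qed.

Lemma eqm_sum n (I : Type) (s : seq I) (f g : I -> fps K) :
  (forall i, eqm n (f i) (g i)) -> eqm n (\sum_(i <- s) f i) (\sum_(i <- s) g i).
Proof. by move=> H i i_n; rewrite !fps_sum; apply: eq_bigr => j _; exact: H. Qed.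

Lemma eqm_eval2 n Q v v' w : eqm n v v' -> eqm n (Q.[v%:P]).[w] (Q.[v'%:P]).[w].
Proof.
move=> H; rewrite (horner_coef Q v%:P) (horner_coef Q v'%:P) !horner_sum; apply: eqm_sum => j.
rewrite !horner_mulXC.
exact: (eqmM (fun i _ => erefl ((Q`_j).[w] i)) (eqmX j H)).
Qed.

Lemma horner_const_coef (p : {poly fps K}) (c : K) k :
  p.[fps_const c] k = (\poly_(i < size p) (p`_i k)).[c].
Proof.
rewrite horner_coef fps_sum horner_poly; apply: eq_bigr => i _.
by rewrite -fps_constX fpsMC.
Qed.

(* The U n are infinitely many constants while V n tends t-adically to v0, so Q vanishes at
   V = v0; dividing by V - v0 lowers the degree. *)
Lemma density (U : nat -> K) (V : nat -> fps K) (v0 : fps K) Q : injective U ->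
  (forall n, eqm n (V n) v0) -> (forall n, V n != v0) ->
  (forall n, (Q.[(V n)%:P]).[fps_const (U n)] = 0) -> Q = 0.
Proof.
move=> Ui Vv Vn; have [m] := ubnP (size Q); elim: m Q => // m IH Q Qm H.
have Qv : Q.[v0%:P] = 0.
  set p := Q.[v0%:P]; apply/polyP => i; rewrite coef0; apply: fpsP => k; rewrite fps0.
  pose pk : {poly K} := \poly_(i < size p) (p`_i k).
  (* For n > k the series V_n and v0 agree through degree k, so this coefficient polynomial inherits
     the zero at U_n; there are infinitely many such zeros. *)
  have pkU n : (k < n)%N -> pk.[U n] = 0.
    move=> kn; rewrite -horner_const_coef -(fps0 K k) -(H n); symmetry.
    exact: (eqm_eval2 Q (fps_const (U n)) (Vv n)).
  have pk0 : pk = 0.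
    apply: (@roots_geq_poly_eq0 _ _ [seq U j | j <- seq.iota k.+1 (size pk)]).
    - by apply/allP => x /mapP[j]; rewrite mem_iota => /andP[kj _] ->; apply/eqP/pkU.
    - by rewrite map_inj_uniq// iota_uniq.
    - by rewrite size_map size_iota.
  have [ip|pi] := ltnP i (size p); last by rewrite nth_default// fps0.
  by have := coef_poly (size p) (fun i => p`_i k) i; rewrite ip -/pk pk0 coef0.
have [Q' QE] : exists Q', Q = Q' * ('X - (v0%:P)%:P) by apply/factor_theorem; apply/eqP.
have [Q0|Q0] := eqVneq Q' 0; first by rewrite QE Q0 mul0r.
rewrite QE (IH Q') ?mul0r//.
  have := Qm; rewrite ltnS; apply: leq_trans.
  by rewrite QE size_Mmonic ?monicXsubC// size_XsubC addn2.
move=> n; have := H n; rewrite QE hornerM hornerXsubC -polyCB hornerM hornerC => /eqP.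
by rewrite mulf_eq0 subr_eq0 (negbTE (Vn n)) orbF => /eqP.
Qed.

End Density.

Lemma coef_linX (K : comNzRingType) (a b : K) n j : (n <= j)%N ->
  ((a%:P * 'X + b%:P) ^+ n)`_j = if j == n then a ^+ n else 0.
Proof.
elim: n j => [|n IH] j nj; first by rewrite !expr0 coef1; case: (j == 0%N).
rewrite exprS mulrDl coefD -mulrA !coefCM coefXM.
case: j nj => // j; rewrite ltnS eqSS => nj; rewrite /= IH// IH ?leqW//.
rewrite (gtn_eqF (_ : n < j.+1)%N) ?mulr0 ?addr0 ?ltnS//.
by case: eqP => // _; rewrite ?mulr0// exprS.
Qed.

Lemma cancel_units (K : comUnitRingType) (w a b x : K) : a \is a GRing.unit -> b \is a GRing.unit ->
  w * (a * b) * x * (a^-1 * b^-1) = w * x.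
Proof.
move=> au bu; transitivity (w * x * ((a^-1 * a) * (b^-1 * b))); first by ring.
by rewrite !mulVr// !mulr1.
Qed.

Lemma inv_sub (K : comUnitRingType) (a b : K) : a \is a GRing.unit -> b \is a GRing.unit ->
  a^-1 - b^-1 = (b - a) * (a^-1 * b^-1).
Proof. by move=> au bu; rewrite mulrBl mulrCA mulrV// mulr1 mulrA mulrV ?mul1r. Qed.

Section QuasiModular.
Variables (R : realType) (F : finFieldType) (S : setting R F) (pi : Cinf S).
Hypothesis pi_period : carlitz_period pi.
Notation C := (Cinf S).
Notation A := {poly F}.
Notation th := (theta S).
Notation ev := (polyev (iota S) th).
Notation bar := (bar S).
Notation regular := (@regular R F S pi).
Implicit Types (z : Omega S) (g : 'M[A]_2) (f : Omega S -> fps C).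
Implicit Types (phi psi : 'M[A]_2 -> Omega S -> fps C).

(* Polynomials of total degree <= l in L_gamma and bL_gamma with regular coefficients. *)
Inductive cocyc : nat -> ('M[A]_2 -> Omega S -> fps C) -> Prop :=
| cocyc_mono l i j f : regular f -> (i + j <= l)%N ->
    cocyc l (fun g z => f z * fps_const (L g (val z) ^+ i) * bL g (val z) ^+ j)
| cocyc_add l phi psi : cocyc l phi -> cocyc l psi -> cocyc l (fun g z => phi g z + psi g z).

Lemma cocyc_ext l phi psi : (forall g z, phi g z = psi g z) -> cocyc l phi -> cocyc l psi.
Proof. by move=> E; have -> : psi = phi by apply/funext => g; apply/funext => z; rewrite E. Qed.

Lemma cocyc_reg f l : regular f -> cocyc l (fun _ z => f z).
Proof.
move=> fr; apply: cocyc_ext (@cocyc_mono l 0 0 f fr (leq0n _)) => g z.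
by rewrite !expr0 !mulr1.
Qed.

Lemma cocyc0 l : cocyc l (fun _ _ => 0).
Proof. by apply: (cocyc_reg l (regular_cst pi_period (Tpos0 S))). Qed.

Lemma cocycM a b phi psi : cocyc a phi -> cocyc b psi -> cocyc (a + b) (fun g z => phi g z * psi g z).
Proof.
move=> H; elim: H => {a phi} [a i j f fr ij|a phi phi' _ IH1 _ IH2] H'.
  elim: H' => {b psi} [b i' j' f' fr' ij'|b psi psi' _ IH1 _ IH2].
    have le : ((i + i') + (j + j') <= a + b)%N by lia.
    apply: cocyc_ext (cocyc_mono (regularM pi_period fr fr') le) => g z.
    rewrite -[(f * f') z]/(f z * f' z) !exprD fps_constM; ring.
  by apply: cocyc_ext (cocyc_add IH1 IH2) => g z; rewrite mulrDr.
by apply: cocyc_ext (cocyc_add (IH1 H') (IH2 H')) => g z; rewrite mulrDl.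
Qed.

Lemma regularN1 : regular (cst (-1)).
Proof. by apply: (regular_cst pi_period); exact: TposN (Tpos1 S). Qed.

Lemma cocycB l phi psi : cocyc l phi -> cocyc l psi -> cocyc l (fun g z => phi g z - psi g z).
Proof.
move=> H H'; have h := cocycM (cocyc_reg 0 regularN1) H'.
by apply: cocyc_ext (cocyc_add H h) => g z; rewrite mulN1r.
Qed.

Lemma cocyc_sum l (I : Type) (s : seq I) (P : pred I) (phi : I -> 'M[A]_2 -> Omega S -> fps C) :
  (forall i, P i -> cocyc l (phi i)) -> cocyc l (fun g z => \sum_(i <- s | P i) phi i g z).
Proof.
move=> H; elim: s => [|i s IH].
  by apply: cocyc_ext (cocyc0 l) => g z; rewrite big_nil.
case Pi: (P i); last by apply: cocyc_ext IH => g z; rewrite big_cons Pi.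
by apply: cocyc_ext (cocyc_add (H i Pi) IH) => g z; rewrite big_cons Pi.
Qed.

Definition qm_sum l (fij : nat -> nat -> Omega S -> fps C) g z :=
  \sum_(i < l.+1) \sum_(j < l.+1 | (i + j <= l)%N)
     fij i j z * fps_const (L g (val z) ^+ i) * bL g (val z) ^+ j.

Lemma qm_sum_cocyc l fij : (forall i j, (i + j <= l)%N -> regular (fij i j)) -> cocyc l (qm_sum l fij).
Proof.
by move=> H; apply: cocyc_sum => i _; apply: cocyc_sum => j ij; apply: cocyc_mono => //; exact: H.
Qed.

Lemma cocyc_qm_sum l phi : cocyc l phi -> exists fij,
  (forall i j, regular (fij i j)) /\ phi = qm_sum l fij.
Proof.
have r0 := regular_cst pi_period (Tpos0 S).
elim=> {l phi} [l i j f fr ij|l phi psi _ [f1 [r1 ->]] _ [f2 [r2 ->]]].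
  exists (fun i' j' => if (i' == i) && (j' == j) then f else cst 0); split.
    by move=> i' j'; case: ifP.
  apply/funext => g; apply/funext => z; rewrite /qm_sum.
  have il : (i < l.+1)%N by lia.
  have jl : (j < l.+1)%N by lia.
  rewrite (bigD1 (Ordinal il))//= (bigD1 (Ordinal jl))//= !eqxx /=.
  rewrite [X in _ + X + _]big1 ?addr0 => [|j' /andP[_ jj]]; last first.
    have -> : (nat_of_ord j' == j) = false by apply: contraNF jj => /eqP jj; apply/eqP/val_inj.
    by rewrite /= !mul0r.
  rewrite [X in _ + X]big1 ?addr0// => i' ii; apply: big1 => j' _.
  have -> : (nat_of_ord i' == i) = false by apply: contraNF ii => /eqP ii; apply/eqP/val_inj.
  by rewrite /= !mul0r.
exists (fun i j => f1 i j + f2 i j); split=> [i j|]; first exact: (regularD pi_period).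
apply/funext => g; apply/funext => z; rewrite /qm_sum -big_split; apply: eq_bigr => i _ /=.
by rewrite -big_split; apply: eq_bigr => j _ /=; rewrite !mulrDl.
Qed.

Lemma aqmP mu nu m l f : almost_quasi_modular pi mu nu m l f <->
  regular f /\ exists2 phi, cocyc l phi &
    forall g z, g \in unitmx -> f (mobius g z) = Wt mu nu m g z * phi g z.
Proof.
split=> [[fr [fij [fijr H]]]|[fr [phi /cocyc_qm_sum[fij [fijr ->]] H]]].
  by split=> //; exists (qm_sum l fij); [exact: qm_sum_cocyc|move=> g z gu; rewrite (H g gu)].
by split=> //; exists fij; split=> // g gu z; exact: H.
Qed.

Lemma aqm0P mu nu m f : almost_quasi_modular pi mu nu m 0 f <->
  regular f /\ forall g z, g \in unitmx -> f (mobius g z) = Wt mu nu m g z * f z.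
Proof.
split=> [[fr [fij [fijr H]]]|[fr H]].
  split=> // g z gu.
  have E g' z' : g' \in unitmx -> f (mobius g' z') = Wt mu nu m g' z' * fij 0%N 0%N z'.
    move=> g'u; rewrite (H g' g'u) /Wt; congr (_ * _).
    by rewrite big_ord1 big_mkcond big_ord1 /= !expr0 !mulr1.
  have -> : f z = fij 0%N 0%N z.
    have := E 1%:M z (unitmx1 _ _); rewrite mobius1E /Wt J1 => ->.
    have -> : detC S (1%:M : 'M[A]_2) = 1 by rewrite /detC det1 ev1.
    have -> : bJ (1%:M : 'M[A]_2) (val z) = 1 by rewrite /bJ !mxE /= bar0 bar1 mul0r add0r.
    by rewrite !exp1rz !mul1r.
  exact: E.
apply/aqmP; split=> //; exists (fun _ z => f z); first exact: cocyc_reg.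
exact: H.
Qed.

(** Test matrices of determinant 1: L takes pairwise distinct values in C, while bold L tends
    t-adically to 1/((theta - t) s_1) without reaching it, as [density] requires. *)
Definition gam n : 'M[A]_2 := mat2 0 (-1) 1 'X^n.

Lemma gam_unit n : gam n \in unitmx.
Proof. by rewrite unitmxE det_mx22E !mat2E mul0r mulN1r opprK add0r unitr1. Qed.

Lemma gam_J n z : J (gam n) (val z) = val z + th ^+ n.
Proof. by rewrite /J !mat2E ev1 mul1r evXn. Qed.

Lemma gam_L n z : L (gam n) (val z) = (val z + th ^+ n)^-1.
Proof. by rewrite /L gam_J mat2E ev1 div1r. Qed.

Lemma gam_N n z : Nm (gam n) z = s_1 (val z) + fps_X C ^+ n * s_2 (val z).
Proof. by rewrite /Nm !mat2E bar1 mul1r barXn. Qed.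

Lemma gam_bL n z : bL (gam n) (val z) = (tht S * Nm (gam n) z)^-1.
Proof. by rewrite bL_N mat2E bar1 div1r. Qed.

Lemma s1_unit z : (s_1 (val z) : fps C) \is a GRing.unit.
Proof.
have := N_unit z (swapM_unit F); rewrite /Nm !mat2E bar1 bar0 mul1r mul0r addr0.
by [].
Qed.

Lemma gam_density z (Q : {poly {poly fps C}}) :
  (forall n, (Q.[(bL (gam n) (val z))%:P]).[fps_const (L (gam n) (val z))] = 0) -> Q = 0.
Proof.
apply: (@density _ (fun n => L (gam n) (val z)) (fun n => bL (gam n) (val z)) (tht S * s_1 (val z))^-1).
- move=> n n'; rewrite !gam_L => /invr_inj/addrI E.
  have q1 := qR_gt1 R F; have := absv_thX S n; rewrite E absv_thX => h.
  have qn1 : #|F|%:R != 1 :> R by rewrite gt_eqF.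
  exact: (ieexprIn (qR_gt0 R F) qn1 (esym h)).
- move=> n i i_n; apply/eqP; rewrite -subr_eq0 -fpsB gam_bL.
  have u1 : tht S * Nm (gam n) z \is a GRing.unit by rewrite unitrM tht_unit N_unit// gam_unit.
  have u2 : tht S * s_1 (val z) \is a GRing.unit by rewrite unitrM tht_unit s1_unit.
  rewrite (inv_sub u1 u2).
  have -> : tht S * s_1 (val z) - tht S * Nm (gam n) z = fps_X C ^+ n * (- (tht S * s_2 (val z))).
    by rewrite gam_N; move: (tht S) (fps_X C ^+ n) (s_1 _) (s_2 _) => a b c d; ring.
  rewrite -mulrA.
  by rewrite fpsXnM i_n.
- move=> n; apply/eqP; rewrite gam_bL => /invr_inj.
  have tn : tht S != 0 by apply: contraTneq (tht_unit S) => ->; rewrite unitr0.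
  move=> /(mulfI tn)/eqP; rewrite gam_N -subr_eq0 addrAC subrr add0r mulf_eq0 expf_eq0.
  have -> : (fps_X C == 0) = false.
    by apply/eqP => /(congr1 (fun f : fps C => f 1%N))/eqP; rewrite fps0 /= oner_eq0.
  rewrite andbF /= => /eqP s0; have := s2u z; by rewrite s0 unitr0.
Qed.

Lemma WtX a b c n g z : g \in unitmx -> Wt (a *+ n) (b *+ n) (c *+ n) g z = Wt a b c g z ^+ n.
Proof.
move=> gu; elim: n => [|n IH]; first by rewrite !mulr0n Wt0.
by rewrite !mulrS WtD// IH exprS.
Qed.

Lemma Wt_shift mu nu m i j g z : g \in unitmx ->
  Wt (mu - 2 *+ i - 1 *+ j) (nu - 0 *+ i - 1 *+ j) (m - 1 *+ i - 1 *+ j) g z *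
  (Wt 2 0 1 g z ^+ i * Wt 1 1 1 g z ^+ j) = Wt mu nu m g z.
Proof.
move=> gu; rewrite -!WtX// mulrCA mulrA -!WtD//.
by congr (Wt _ _ _ g z); ring.
Qed.

Lemma L_mulW g g' z : g \in unitmx -> g' \in unitmx ->
  fps_const (L (g *m g') (val z)) =
  (Wt 2 0 1 g' z)^-1 * fps_const (L g (val (mobius g' z))) + fps_const (L g' (val z)).
Proof.
move=> gu gu'; rewrite L_mul// fps_constD fps_constM; congr (_ * _ + _).
have d0 := detC_neq0 S gu'; have J0 := Jn0 z gu'.
rewrite /Wt expr0z mulr1 fps_constV; last by rewrite mulf_neq0 ?expfz_neq0.
by congr fps_const; rewrite exprN1 [RHS]invfM invrK.
Qed.

Lemma bL_mulW g g' z : g \in unitmx -> g' \in unitmx ->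
  bL (g *m g') (val z) = (Wt 1 1 1 g' z)^-1 * bL g (val (mobius g' z)) + bL g' (val z).
Proof.
move=> gu gu'; rewrite bL_mul//; congr (_ * _ + _).
have d0 := detC_neq0 S gu'; have J0 := Jn0 z gu'.
rewrite /Wt !expr1z invrM ?bJ_unit//; last by rewrite fps_unitE /= mulf_neq0 ?expfz_neq0.
rewrite fps_constV; last by rewrite mulf_neq0 ?expfz_neq0.
by rewrite mulrC; congr (_ * fps_const _); rewrite exprN1 [RHS]invfM invrK.
Qed.

(** The inner variable stands for L and the outer one for bold L; the affine substitutions are those
    of the cocycle relations [L_mulW] and [bL_mulW]. *)
Let bipoly l (c : nat -> nat -> fps C) (a b a' b' : fps C) : {poly {poly fps C}} :=
  \sum_(i < l.+1) \sum_(j < l.+1 | (i + j <= l)%N)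
    ((c i j)%:P * (a%:P * 'X + b%:P) ^+ i)%:P * map_poly polyC ((a'%:P * 'X + b'%:P) ^+ j).

Let bipoly_eval l c a b a' b' u v : ((bipoly l c a b a' b').[v%:P]).[u] =
  \sum_(i < l.+1) \sum_(j < l.+1 | (i + j <= l)%N) c i j * (a * u + b) ^+ i * (a' * v + b') ^+ j.
Proof.
have lin (x y w : fps C) : (x%:P * 'X + y%:P).[w] = x * w + y.
  by rewrite hornerD hornerM !hornerC hornerX.
rewrite /bipoly !horner_sum; apply: eq_bigr => i _; rewrite !horner_sum; apply: eq_bigr => j _.
have -> (p : {poly fps C}) (r : {poly fps C}) : (p%:P * map_poly polyC r).[v%:P] = p * (r.[v])%:P.
  by rewrite hornerM hornerC horner_map.
by rewrite !hornerM !hornerC !horner_exp !lin.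
Qed.

Let bipoly_top l c a b a' b' i j : (i + j)%N = l -> (bipoly l c a b a' b')`_j`_i = c i j * (a ^+ i * a' ^+ j).
Proof.
move=> ij; have il : (i < l.+1)%N by lia.
have jl : (j < l.+1)%N by lia.
have term (i' j' : 'I_l.+1) : ((((c i' j')%:P * (a%:P * 'X + b%:P) ^+ i')%:P * map_poly polyC ((a'%:P * 'X + b'%:P) ^+ j'))`_j)`_i =
    c i' j' * (((a%:P * 'X + b%:P) ^+ i')`_i * ((a'%:P * 'X + b'%:P) ^+ j')`_j).
  by rewrite coefCM coef_map /= coefMC coefCM mulrA.
rewrite /bipoly coef_sum coef_sum (bigD1 (Ordinal il))//= coef_sum coef_sum.
rewrite (bigD1 (Ordinal jl)) /=; last by rewrite ij.
rewrite (term (Ordinal il) (Ordinal jl)) !coef_linX//= !eqxx.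
rewrite [X in _ + X + _]big1 ?addr0 => [|j' /andP[ijl jj]]; last first.
  have nj : nat_of_ord j' != j by apply: contraNneq jj => h; apply/eqP/val_inj.
  rewrite (term (Ordinal il) j') (coef_linX _ _ (_ : j' <= j)%N); last by lia.
  by rewrite eq_sym (negbTE nj) !mulr0.
rewrite [X in _ + X]big1 ?addr0// => i' ii; rewrite coef_sum coef_sum; apply: big1 => j' ijl.
have ni : nat_of_ord i' != i by apply: contraNneq ii => h; apply/eqP/val_inj.
rewrite term; case: (leqP i' i) => h.
  by rewrite coef_linX// eq_sym (negbTE ni) mul0r mulr0.
rewrite (coef_linX _ _ (_ : j' <= j)%N); last by lia.
have -> : (j == j') = false.
  apply/negbTE/eqP => jj; have h2 : (i' + j <= l)%N by rewrite jj.
  by move: ij h h2; lia.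
by rewrite !mulr0.
Qed.

(* Compare the two expansions of f (gamma delta z) as polynomials in L_gamma and bL_gamma. *)
Lemma top_coef mu nu m l f (fij : nat -> nat -> Omega S -> fps C) i j :
  (forall g z, g \in unitmx -> f (mobius g z) = Wt mu nu m g z * qm_sum l fij g z) ->
  (i + j)%N = l -> forall d z, d \in unitmx ->
  fij i j (mobius d z) =
  Wt (mu - 2 *+ i - 1 *+ j) (nu - 0 *+ i - 1 *+ j) (m - 1 *+ i - 1 *+ j) d z * fij i j z.
Proof.
move=> H ij d z du; have W2 := Wt_unit 2 0 1 z du; have W1 := Wt_unit 1 1 1 z du.
have Wd := Wt_shift mu nu m i j z du.
pose P1 := bipoly l (fun i j => fij i j (mobius d z)) 1 0 1 0.
pose P2 := bipoly l (fun i j => Wt mu nu m d z * fij i j z)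
  (Wt 2 0 1 d z)^-1 (fps_const (L d (val z))) (Wt 1 1 1 d z)^-1 (bL d (val z)).
(* Both polynomials represent f(gamma d z) divided by the weight factor of gamma at d z: one expands
   at the point d z, the other expands gamma d at z. *)
have PE : P1 - P2 = 0.
  apply: (gam_density (z := mobius d z)) => n; have gu := gam_unit n.
  rewrite hornerD hornerN hornerD hornerN !bipoly_eval; apply/eqP; rewrite subr_eq0; apply/eqP.
  have gdu : gam n *m d \in unitmx by rewrite unitmx_mul gu.
  have Wg := Wt_unit mu nu m (mobius d z) gu.
  have := H _ z gdu; rewrite (mobius_mulE z gu du) (H _ _ gu) (Wt_mul _ _ _ z gu du) -mulrA => /(mulrI Wg) E.
  transitivity (qm_sum l fij (gam n) (mobius d z)).
    apply: eq_bigr => i' _; apply: eq_bigr => j' _.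
    by rewrite !mul1r !addr0 fps_constX.
  rewrite E mulr_sumr; apply: eq_bigr => i' _; rewrite mulr_sumr; apply: eq_bigr => j' _.
  rewrite -(L_mulW z gu du) -(bL_mulW z gu du) fps_constX.
  move: (Wt mu nu m d z) (fij i' j' z) (fps_const _ ^+ i') (bL _ _ ^+ j') => a b c e.
  by rewrite !mulrA.
have : P1`_j`_i = P2`_j`_i.
  by apply/eqP; rewrite -subr_eq0 -!coefB PE !coef0.
rewrite !(bipoly_top _ _ _ _ _ ij) !expr1n !mulr1 => ->.
rewrite !exprVn -Wd; exact: cancel_units (unitrX _ W2) (unitrX _ W1).
Qed.

End QuasiModular.

(** * The structure of Mtilde *)

Section TalgTheory.
Variables (R : realType) (F : finFieldType) (S : setting R F).
Notation C := (Cinf S).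
Implicit Types G B : set (Omega S -> fps C).

Lemma Talg_gen G : G `<=` Talg G.
Proof. by move=> f Gf B [_ GB]; exact: GB. Qed.

Lemma Talg_min G B : subTalg B -> G `<=` B -> Talg G `<=` B.
Proof. by move=> sB GB f; apply; split. Qed.

Lemma Talg_sub G : subTalg (Talg G).
Proof.
split=> [c cT|f g Tf Tg|f g Tf Tg] B BG; have [[h1 h2 h3] GB] := BG.
- exact: h1.
- by apply: h2; [exact: Tf|exact: Tg].
- by apply: h3; [exact: Tf|exact: Tg].
Qed.

Lemma subTalg_sum B (I : Type) (s : seq I) (P : pred I) (f : I -> Omega S -> fps C) : subTalg B ->
  (forall i, P i -> B (f i)) -> B (fun z => \sum_(i <- s | P i) f i z).
Proof.
move=> [h1 h2 h3] H; elim: s => [|i s IH].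
  rewrite (_ : (fun z => _) = cst 0); first exact/h1/Tpos0.
  by apply/funext => z; rewrite big_nil.
case Pi: (P i).
  rewrite (_ : (fun z => _) = f i + (fun z => \sum_(i <- s | P i) f i z)).
    by apply: h2 IH; exact: H.
  by apply/funext => z; rewrite big_cons Pi.
rewrite (_ : (fun z => _) = (fun z => \sum_(i <- s | P i) f i z)) //.
by apply/funext => z; rewrite big_cons Pi.
Qed.

Lemma subTalgX B (f : Omega S -> fps C) n : subTalg B -> B f -> B (fun z => f z ^+ n).
Proof.
move=> sB Bf; have [h1 h2 h3] := sB; elim: n => [|n IH].
  rewrite (_ : (fun z => _) = cst 1); first exact/h1/Tpos1.
  by apply/funext => z; rewrite expr0.
rewrite (_ : (fun z => _) = f * (fun z => f z ^+ n)); first exact: h3.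
by apply/funext => z; rewrite exprS.
Qed.

End TalgTheory.

Lemma qm_term_alg (K : comUnitRingType) (w w' a b x y f : K) i j :
  w' * (a ^+ i * b ^+ j) = w -> w' * f * (a * x) ^+ i * (b * y) ^+ j = w * (f * x ^+ i * y ^+ j).
Proof. by move=> <-; rewrite !exprMn; ring. Qed.

Lemma pow_sub_step (K : comNzRingType) (x y : K) i :
  (x + y) * ((x + y) ^+ i - y ^+ i) + x * y ^+ i = (x + y) ^+ i.+1 - y ^+ i.+1.
Proof. by rewrite !exprS; ring. Qed.

Section Structure.
Variables (R : realType) (F : finFieldType) (S : setting R F) (pi : Cinf S).
Variables g Delta h : Omega S -> Cinf S.
Hypothesis pi_period : carlitz_period pi.
Hypothesis g_Delta : drinfeld_coeffs pi g Delta.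
Hypothesis h_def : is_h pi h.
Notation C := (Cinf S).
Notation A := {poly F}.
Notation regular := (@regular R F S pi).
Notation kL := (kL pi_period h_def).
Notation cocyc := (cocyc pi).
Implicit Types (z : Omega S) (d : 'M[A]_2).

Let E z : fps C := fps_const (false_eisenstein pi z).
Let b := bE pi h Delta.

Let pi0 : pi != 0. Proof. exact: pi_neq0. Qed.
Let kLu : kL \is a GRing.unit. Proof. by rewrite fps_unitE kL0. Qed.

Lemma aqm_E : almost_quasi_modular pi 2 0 1 1 E.
Proof.
apply/(aqmP pi_period); split; first exact: regular_E.
exists (fun d z => E z + cst (fps_const (- pi^-1)) z * fps_const (L d (val z) ^+ 1) * bL d (val z) ^+ 0).
  apply: cocyc_add; first exact: (cocyc_reg 1 (regular_E pi_period)).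
  by apply: cocyc_mono => //; apply: (regular_cst pi_period); exact: TposC.
move=> d z du; rewrite /E (E_mobius pi_period z du) /Wt expr0z mulr1 expr0 mulr1 expr1 /=.
by rewrite -fps_constM -fps_constD -fps_constM exprN1 mulNr [_ / pi]mulrC.
Qed.

Lemma aqm_bE : almost_quasi_modular pi 1 1 1 1 b.
Proof.
apply/(aqmP pi_period); split; first exact: (regular_bE pi_period g_Delta h_def).
exists (fun d z => b z + cst kL z * fps_const (L d (val z) ^+ 0) * bL d (val z) ^+ 1).
  apply: cocyc_add; first exact: (cocyc_reg 1 (regular_bE pi_period g_Delta h_def)).
  by apply: cocyc_mono => //; apply: (regular_cst pi_period); exact: Tpos_kL.
by move=> d z du; rewrite /b (bE_mobius pi_period g_Delta h_def z du) /Wt !expr1z exprN1 expr0 mulr1 expr1.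
Qed.

(** Normalised so that the transformation law adds exactly L; [b'] likewise adds exactly bold L. *)
Let E' z := fps_const (- pi) * E z.
Let b' z := kL^-1 * b z.

Let rE' : regular E'.
Proof. exact: (regularM pi_period (regular_cst pi_period (TposC (- pi))) (regular_E pi_period)). Qed.

Let rb' : regular b'.
Proof.
have kT : Tpos kL^-1 by apply: TposV (kL0 _ _) (Tpos_kL _ _).
exact: (regularM pi_period (regular_cst pi_period kT) (regular_bE pi_period g_Delta h_def)).
Qed.

Let E'_mob d z : d \in unitmx -> E' (mobius d z) = Wt 2 0 1 d z * (E' z + fps_const (L d (val z))).
Proof.
move=> du; rewrite /E' /E (E_mobius pi_period z du) /Wt expr0z mulr1 -!fps_constM -fps_constD -fps_constM.
by congr fps_const; rewrite exprN1 -[_ ^ 2]/(_ ^+ 2); move: (detC S d)^-1 (J d _ ^+ 2) => a c; field.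
Qed.

Let b'_mob d z : d \in unitmx -> b' (mobius d z) = Wt 1 1 1 d z * (b' z + bL d (val z)).
Proof.
move=> du; rewrite /b' /b (bE_mobius pi_period g_Delta h_def z du) /Wt !expr1z exprN1.
move: (fps_const _ * _) (bE _ _ _ _) (bL _ _) => w x y.
by rewrite mulrCA; congr (_ * _); rewrite mulrDr [kL^-1 * (kL * _)]mulrA mulVr ?mul1r.
Qed.

Let X d z := E' z + fps_const (L d (val z)).
Let Y d z := b' z + bL d (val z).

Let cX : cocyc 1 X.
Proof.
apply: cocyc_add; first exact: cocyc_reg.
apply: cocyc_ext (@cocyc_mono _ _ _ _ 1 1 0 _ (regular_cst pi_period (Tpos1 S)) (leqnn _)) => d z.
by rewrite /= mul1r mulr1 expr1.
Qed.

Let cY : cocyc 1 Y.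
Proof.
apply: cocyc_add; first exact: cocyc_reg.
apply: cocyc_ext (@cocyc_mono _ _ _ _ 1 0 1 _ (regular_cst pi_period (Tpos1 S)) (leqnn _)) => d z.
by rewrite /= !mul1r expr1.
Qed.

Let cXn i : cocyc i (fun d z => X d z ^+ i).
Proof.
elim: i => [|i IH]; first by apply: cocyc_ext (cocyc_reg 0 (regular_cst pi_period (Tpos1 S))) => d z; rewrite expr0.
by apply: cocyc_ext (cocycM pi_period cX IH) => d z; rewrite exprS.
Qed.

Let cL f i j l : regular f -> (i + j <= l)%N ->
  cocyc l (fun d z => f z * (fps_const (L d (val z)) ^+ i * bL d (val z) ^+ j)).
Proof.
move=> fr ij; apply: cocyc_ext (cocyc_mono fr ij) => d z.
by rewrite fps_constX mulrA.
Qed.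

Let r1 := regular_cst pi_period (Tpos1 S).

Let dX i : cocyc i (fun d z => X d z ^+ i.+1 - fps_const (L d (val z)) ^+ i.+1).
Proof.
elim: i => [|i IH].
  by apply: cocyc_ext (cocyc_reg 0 rE') => d z; rewrite !expr1 /X addrK.
apply: cocyc_ext (cocyc_add (cocycM pi_period cX IH) (@cL _ i.+1 0 i.+1 rE' _)) => [d z|]; last by rewrite addn0.
by rewrite expr0 mulr1; exact: pow_sub_step.
Qed.

Let dY i : cocyc i (fun d z => Y d z ^+ i.+1 - bL d (val z) ^+ i.+1).
Proof.
elim: i => [|i IH].
  by apply: cocyc_ext (cocyc_reg 0 rb') => d z; rewrite !expr1 /Y addrK.
apply: cocyc_ext (cocyc_add (cocycM pi_period cY IH) (@cL _ 0 i.+1 i.+1 rb' _)) => [d z|]; last by rewrite add0n.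
by rewrite expr0 mul1r; exact: pow_sub_step.
Qed.

(** X and Y are L and bold L shifted by regular functions, so the top-degree parts of the two
    monomials agree and the difference has smaller degree. *)
Let dXY i j l : (i + j)%N = l.+1 ->
  cocyc l (fun d z => fps_const (L d (val z)) ^+ i * bL d (val z) ^+ j - X d z ^+ i * Y d z ^+ j).
Proof.
move=> ij.
have h1 : cocyc l (fun d z => X d z ^+ i * (Y d z ^+ j - bL d (val z) ^+ j)).
  case: j ij => [|j] ij.
    by apply: cocyc_ext (cocyc0 pi_period l) => d z; rewrite !expr0 subrr mulr0.
  have -> : l = (i + j)%N by lia.
  exact: (cocycM pi_period (cXn i) (dY j)).
have h2 : cocyc l (fun d z => (X d z ^+ i - fps_const (L d (val z)) ^+ i) * bL d (val z) ^+ j).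
  case: i ij {h1} => [|i] ij.
    by apply: cocyc_ext (cocyc0 pi_period l) => d z; rewrite !expr0 subrr mul0r.
  have -> : l = (i + j)%N by lia.
  apply: (cocycM pi_period (dX i)); apply: cocyc_ext (@cL _ 0 j j r1 (leqnn _)) => d z.
  by rewrite /= mul1r expr0 mul1r.
apply: cocyc_ext (cocycB pi_period (cocyc0 pi_period l) (cocyc_add h1 h2)) => d z.
by move: (X d z ^+ i) (Y d z ^+ j) (fps_const _ ^+ i) (bL _ _ ^+ j) => x y v w; ring.
Qed.

Let B := Talg (Malg pi `|` [set E; b]).
Let sB : subTalg B. Proof. exact: Talg_sub. Qed.

Let BE' : B E'.
Proof.
have [h1 h2 h3] := sB; apply: (h3 (cst (fps_const (- pi))) E); first by apply: h1; exact: TposC.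
by apply: Talg_gen; right; left.
Qed.

Let Bb' : B b'.
Proof.
have [h1 h2 h3] := sB; apply: (h3 (cst kL^-1) b); first by apply: h1; apply: TposV (kL0 _ _) (Tpos_kL _ _).
by apply: Talg_gen; right; right.
Qed.

Let BM f : Malg pi f -> B f.
Proof. by move=> Mf; apply: Talg_gen; left. Qed.

(** Induction on the depth: the top coefficients are forms of depth 0, and subtracting the
    corresponding combination [SP] of powers of E' and b' cancels the terms of top degree. *)
Let Baqm l mu nu m f : almost_quasi_modular pi mu nu m l f -> B f.
Proof.
elim: l f => [|l IH] f fa.
  by apply: BM; apply: Talg_gen; exists mu, nu, m.
have [fr [phi /(cocyc_qm_sum pi_period)[fij [rij ->]] H]] := (aqmP pi_period mu nu m l.+1 f).1 fa.
have Bij i j : (i + j)%N = l.+1 -> B (fij i j).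
  move=> ij; apply: BM; apply: Talg_gen; do 3 eexists; apply/(aqm0P pi_period); split; first exact: rij.
  by move=> d z du; exact: (top_coef H ij z du).
pose P (i : 'I_l.+2) z := fij i (l.+1 - i)%N z * E' z ^+ i * b' z ^+ (l.+1 - i).
have ijl (i : 'I_l.+2) : (i + (l.+1 - i))%N = l.+1 by rewrite subnKC// -ltnS.
have [h1 h2 h3] := sB.
have BP i : B (P i).
  apply: (h3 (fun z => fij i (l.+1 - i)%N z * E' z ^+ i) (fun z => b' z ^+ (l.+1 - i))).
    apply: (h3 (fij i (l.+1 - i)%N) (fun z => E' z ^+ i)); first by apply: Bij; exact: ijl.
    exact: (subTalgX _ sB BE').
  exact: (subTalgX _ sB Bb').
have rP i : regular (P i).
  have h4 := regularM pi_period (rij i (l.+1 - i)%N) (regularX pi_period i rE').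
  exact: (regularM pi_period h4 (regularX pi_period (l.+1 - i) rb')).
pose SP z := \sum_i P i z.
have BSP : B SP by apply: subTalg_sum => // i _; exact: BP.
have rSP : regular SP by apply: regular_sum => // i _; exact: rP.
pose f' z := f z - SP z.
have fE : f = f' + SP by apply/funext => z; rewrite -[RHS]/(f' z + SP z) subrK.
rewrite fE; apply: (h2 _ _ _ BSP); apply: IH.
apply/(aqmP pi_period); split.
  have h4 := regularD pi_period fr (regularM pi_period (regularN1 pi_period) rSP).
  by apply: regular_ext h4 => z; rewrite -[LHS]/(f z + (-1) * SP z) mulN1r.
exists (fun d z => \sum_(i < l.+2) (fij i (l.+1 - i)%N z * (fps_const (L d (val z)) ^+ i * bL d (val z) ^+ (l.+1 - i) - X d z ^+ i * Y d z ^+ (l.+1 - i))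
  + \sum_(j < l.+2 | (i + j <= l)%N) fij i j z * fps_const (L d (val z) ^+ i) * bL d (val z) ^+ j)).
  apply: cocyc_sum => // i _; apply: cocyc_add.
    exact: (cocycM pi_period (cocyc_reg 0 (rij _ _)) (dXY (ijl i))).
  by apply: cocyc_sum => // j ij; apply: cocyc_mono => //; exact: rij.
move=> d z du; rewrite /f' (H _ _ du) /SP.
have -> : \sum_i P i (mobius d z) = Wt mu nu m d z * \sum_(i < l.+2) fij i (l.+1 - i)%N z * (X d z ^+ i * Y d z ^+ (l.+1 - i)).
  rewrite mulr_sumr; apply: eq_bigr => i _; rewrite /P (E'_mob z du) (b'_mob z du) (top_coef H (ijl i) z du).
  rewrite (qm_term_alg _ _ _ (Wt_shift mu nu m i (l.+1 - i) z du)) -mulrA.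
  by [].
rewrite -mulrBr; congr (_ * _); rewrite -sumrB; apply: eq_bigr => i _.
have il : (l.+1 - i < l.+2)%N by rewrite ltnS leq_subr.
rewrite (bigD1 (Ordinal il)) /=; last by rewrite ijl.
rewrite fps_constX mulrBr -!addrA; congr (_ + _); first by rewrite mulrA.
rewrite addrC; congr (_ + _); apply: eq_bigl => j.
apply/andP/idP => [[h5 h6]|h5]; last by split; [lia|apply/eqP => /(congr1 val) /=; lia].
have : nat_of_ord j != (l.+1 - i)%N by apply: contraNneq h6 => h7; apply/eqP/val_inj.
by move: (ijl i) h5; lia.
Qed.

Lemma Mtilde_structure : Mtilde_alg pi = Talg (Malg pi `|` [set E; b]).
Proof.
apply/seteqP; split.
  by apply: Talg_min sB _ => f [mu [nu [m [l fa]]]]; exact: Baqm fa.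
apply: Talg_min; first exact: Talg_sub.
move=> f [|[->|->]].
- apply: Talg_min; first exact: Talg_sub.
  by move=> f' [mu [nu [m fa]]]; apply: Talg_gen; exists mu, nu, m, 0%N.
- by apply: Talg_gen; do 4 eexists; exact: aqm_E.
- by apply: Talg_gen; do 4 eexists; exact: aqm_bE.
Qed.

End Structure.

(** * Vanishing of forms of large order at the cusp *)

Lemma exponent_gap a b N s : (a + b < N)%N -> exists D, (N * s.+1 = b * s.+1 + a + D.+1)%N.
Proof.
move=> abN; have [e ->] : exists e, N = (a + b + e).+1 by exists (N - (a + b).+1)%N; lia.
by exists (a * s + e * s.+1 + s)%N; nia.
Qed.

Section Vanishing.
Variables (R : realType) (F : finFieldType) (S : setting R F) (pi : Cinf S).
Variables h : Omega S -> Cinf S.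
Hypothesis pi_period : carlitz_period pi.
Hypothesis h_def : is_h pi h.
Notation C := (Cinf S).
Notation q := #|F|.
Notation A := {poly F}.
Notation u := (u pi).
Notation eA := (@eA R F S).
Notation bar := (bar S).
Notation regular := (@regular R F S pi).
Implicit Types (z w : Omega S) (d : 'M[A]_2) (f : Omega S -> fps C).

(** Only determinant 1 is imposed: forms of all types are then added and counted together, and the
    reduction to the fundamental domain stays inside SL_2(A). *)
Definition slform mu nu f := regular f /\
  forall d z, \det d = 1 -> f (mobius d z) = Wt mu nu 0 d z * f z.

Lemma det1_unit d : \det d = 1 -> d \in unitmx.
Proof. by move=> dd; rewrite unitmxE dd unitr1. Qed.

Lemma det1_C d : \det d = 1 -> detC S d = 1.
Proof. by move=> dd; rewrite /detC dd ev1. Qed.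

Lemma aqm0_slform mu nu m f : almost_quasi_modular pi mu nu m 0 f -> slform mu nu f.
Proof.
move=> /(aqm0P pi_period)[fr H]; split=> // d z dd; rewrite (H _ _ (det1_unit dd)).
by rewrite /Wt (det1_C dd) !exp1rz.
Qed.

Lemma slformM mu nu mu' nu' f f' : slform mu nu f -> slform mu' nu' f' ->
  slform (mu + mu') (nu + nu') (f * f').
Proof.
move=> [fr H] [fr' H']; split; first exact: regularM.
move=> d z dd; rewrite -[LHS]/(f _ * f' _) -[(f * f') z]/(f z * f' z) H// H'//.
by have := WtD mu nu 0 mu' nu' 0 z (det1_unit dd); rewrite addr0 => ->; rewrite mulrACA.
Qed.

Lemma slformD mu nu f f' : slform mu nu f -> slform mu nu f' -> slform mu nu (f + f').
Proof.
move=> [fr H] [fr' H']; split; first exact: regularD.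
by move=> d z dd; rewrite -[LHS]/(f _ + f' _) -[(f + f') z]/(f z + f' z) H// H'// mulrDr.
Qed.

Lemma slform_cst c : Tpos c -> slform 0 0 (cst c).
Proof.
move=> cT; split; first exact: regular_cst.
by move=> d z dd; rewrite Wt0 ?det1_unit// mul1r.
Qed.

Lemma slform_s2 : slform (-1) 1 (fun z => s_2 (val z)).
Proof.
split; first exact: regular_s2.
move=> d z dd; rewrite (s2_mob z (det1_unit dd)) /Wt (det1_C dd) exp1rz mul1r expr1z.
by rewrite exprN1.
Qed.

Lemma bar_eval (c : A) t : absv t < 1 -> conv (bar c) t /\ absv (fps_eval (bar c) t) <= 1.
Proof.
move=> t1; have b : bd 1 1 (bar c) by move=> n; rewrite expr1n mulr1; exact: absv_iota_le.
have t1' : 1 * absv t < 1 by rewrite mul1r.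
by split; [exact: bd_conv ler01 b t1'|exact: eval_bd ler01 b t1'].
Qed.

Lemma Y_le w : Fd (val w) -> absv (eA (val w / theta S)) <= absv (eA (val w)).
Proof.
move=> wF; have e1 := eA_Fd_ge1 wF; have YE := eA_Fd_pow wF.
have [Y1|Y1] := leP (absv (eA (val w / theta S))) 1; first exact: le_trans e1.
by rewrite (le_trans _ YE)// -{1}[absv (eA (val w / theta S))]expr1 ler_weXn2l ?q_gt0// ltW.
Qed.

Lemma s1_eval w t : Fd (val w) -> absv t < 1 ->
  conv (s_1 (val w)) t /\ absv (fps_eval (s_1 (val w)) t) <= absv (eA (val w)).
Proof.
move=> wF t1; have b : bd (absv (eA (val w))) 1 (s_1 (val w)).
  by move=> n; rewrite expr1n mulr1; apply: le_trans (absv_s1_Fd n wF) (Y_le wF).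
have t1' : 1 * absv t < 1 by rewrite mul1r.
by split; [exact: bd_conv ler01 b t1'|exact: eval_bd ler01 b t1'].
Qed.

Lemma s2_eval w t : Fd (val w) -> absv t < 1 ->
  conv (s_2 (val w)) t /\ absv (fps_eval (s_2 (val w)) t) = q%:R^-1.
Proof.
move=> wF t1; have q1 := qR_gt1 R F; have q0 := qR_gt0 R F.
have r0 : 0 <= (q%:R^-1 : R) by rewrite invr_ge0 ltW.
have r1 : (q%:R^-1 : R) < 1 by rewrite invf_lt1.
have b : bd 1 1 (s_2 (val w)).
  move=> n; rewrite expr1n mulr1 (absv_s2_Fd n wF); exact: exprn_ile1 r0 (ltW r1).
have t1' : 1 * absv t < 1 by rewrite mul1r.
have cs := bd_conv ler01 b t1'; split=> //.
have E0 := absv_s2_Fd 0 wF; rewrite expr1 in E0; rewrite -E0.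
apply: (@eval_dom _ _ _ (q%:R^-1 ^+ 2)) => //; first by rewrite E0 expr2 gtr_pMl ?invr_gt0.
move=> n; rewrite /fps_terms absvM absvX (absv_s2_Fd _ wF).
apply: le_trans (_ : q%:R^-1 ^+ n.+2 * 1 <= _).
  by rewrite ler_wpM2l ?exprn_ge0// exprn_ile1 ?absv_ge0// ltW.
by rewrite mulr1 ler_wiXn2l// ltW.
Qed.

Lemma rigid_hV : rigid_analytic (fun z => (h z)^-1).
Proof.
have k0 := kW0 pi_period h_def.
apply: rigid_ext (rigidZ ((kW pi_period h_def) 0%N)^-1 (rigid_Wr S 0)) => z.
rewrite (Wr0_h pi_period h_def z) mulKf//.
Qed.

Lemma rigid_hz (n : int) : rigid_analytic (fun z => h z ^ n).
Proof.
case: n => n; first exact: rigidX (h_rigid h_def).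
by apply: rigid_ext (rigidX n.+1 rigid_hV) => z; rewrite NegzE -exprnN exprVn.
Qed.

Lemma absv_exprz (x : C) (n : int) : absv (x ^ n) = absv x ^ n.
Proof. by case: n => n; rewrite ?NegzE -?exprnN ?absvV -?exprnP absvX. Qed.

Lemma absv_h_mobius d w (mu : int) : \det d = 1 ->
  absv (h (mobius d w) ^ (- mu)) = (absv (J d (val w)) ^ mu) ^- q.+1 * absv (h w ^ (- mu)).
Proof.
move=> dd; rewrite (h_mobius h_def w (det1_unit dd)) (det1_C dd) invr1 mulr1.
rewrite expfzMl absvM; congr (_ * _); rewrite absv_exprz absvX.
by rewrite !exprnP invr_expz !exprz_exp; congr (_ ^ _); ring.
Qed.

(** Liouville's theorem is applied, for each small t, to a function that is not invariant but
    bounded: f^(q+1) h^(-mu). It is constant and tends to 0 at the cusp. *)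
Let vanishing_nat (mu : int) (nu : nat) f (M rho : R) k N : slform mu nu f -> gexp pi M rho f k ->
  (forall n m, (m < N)%N -> k n m = 0) -> (`|mu| + nu < N)%N -> forall z, f z = 0.
Proof.
move=> [fr H] fk kN muN.
have r0 := gexp_rho fk; have M0 := gexp_M fk.
have [[r1 r10 fc] [e1 e10 frig] fp fg] := (regularE pi_period f).1 fr.
have p0 : 0 < absv pi by rewrite absv_gt0 (pi_neq0 pi_period).
have q0 := qR_gt0 R F.
have main t z : absv t < r1 -> absv t < e1 -> absv t < 1 -> rho * absv t <= 1 -> fps_eval (f z) t = 0.
  move=> tr te t1 trho.
  have cf w : conv (f w) t by apply/fps_cvgE; exact: fc.
  (* h has weight q + 1, so the (q+1)-st power of f is what lets h^(-mu) cancel the powers of J;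
     only bold J remains. *)
  pose Phi w := fps_eval (f w) t ^+ q.+1 * h w ^ (- mu).
  have Prig : rigid_analytic Phi by apply: rigidM (rigidX _ (frig _ te)) (rigid_hz _).
  have fbound w : rho * absv (u (val w)) < 1 -> absv (fps_eval (f w) t) <= M * (rho * absv (u (val w))) ^+ N.
    move=> uw; apply: eval_le => [|n]; first exact: cf.
    have [_ kb kE] := fk n; rewrite /fps_terms absvM absvX (kE _ uw).
    have tl := eval_tail (ltW r0) kb uw (kN n).
    apply: le_trans (_ : M * rho ^+ n * (rho * absv (u (val w))) ^+ N * absv t ^+ n <= _).
      by rewrite ler_wpM2r ?exprn_ge0 ?absv_ge0.
    have -> : M * rho ^+ n * (rho * absv (u (val w))) ^+ N * absv t ^+ n =
      M * (rho * absv (u (val w))) ^+ N * (rho * absv t) ^+ n by rewrite [(rho * absv t) ^+ n]exprMn; ring.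
    have x0 : 0 <= rho * absv (u (val w)) by rewrite mulr_ge0 ?absv_ge0// ltW.
    rewrite ler_piMr ?mulr_ge0 ?exprn_ge0//; apply: exprn_ile1 => //.
    by rewrite mulr_ge0 ?absv_ge0// ltW.
  (* Bold J is (c s_1 + d s_2)/s_2 with coefficients in F_q[t]. At |t| < 1 the numerator is at most
     |e_A(w)| and |s_2| = 1/q, for every matrix at once. *)
  have gbound d w : \det d = 1 -> Fd (val w) ->
      absv (Phi (mobius d w)) <= (q%:R * absv (eA (val w))) ^+ (nu * q.+1) * absv (Phi w).
    move=> dd wF; have du := det1_unit dd; have J0 : J d (val w) != 0 by exact: Jn0.
    have [cs2 es2] := s2_eval wF t1; have [cs1 es1] := s1_eval wF t1.
    have [cc ec] := bar_eval (d 1 0) t1; have [cd ed] := bar_eval (d 1 1) t1.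
    have cN : conv (Nm d w) t by apply: convD; apply: convM.
    have eN : absv (fps_eval (Nm d w) t) <= absv (eA (val w)).
      rewrite /Nm evalD ?evalM//; [|exact: convM|exact: convM].
      apply: absvD_le; rewrite absvM.
        by apply: le_trans (ler_pM (absv_ge0 _) (absv_ge0 _) ec es1) _; rewrite mul1r.
      rewrite es2; have qi : 0 <= (q%:R^-1 : R) by rewrite invr_ge0 ltW.
      have qe : q%:R^-1 <= absv (eA (val w)).
        by apply: le_trans (eA_Fd_ge1 wF); rewrite invf_le1 ?qR_ge1.
      by apply: le_trans (ler_pM (absv_ge0 _) qi ed qe) _; rewrite mul1r.
    have EQ : s_2 (val w) ^+ nu * f (mobius d w) = fps_const (J d (val w) ^ mu) * Nm d w ^+ nu * f w.
      rewrite (H d w dd) /Wt (det1_C dd) exp1rz mul1r bJN -exprnP exprMn mulrA; congr (_ * _).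
      have su : s_2 (val w) ^+ nu \is a GRing.unit by rewrite unitrX// s2u.
      by rewrite exprVn mulrCA [s_2 _ ^+ nu * _]mulrC mulrVK.
    have {}EQ := congr1 (fun x => absv (fps_eval x t)) EQ.
    have cN' := convX nu cN; have cJ := convC (J d (val w) ^ mu) t.
    rewrite (evalM (convX nu cs2) (cf _)) (evalM (convM cJ cN') (cf _)) (evalM cJ cN') in EQ.
    rewrite evalC !evalX// !absvM !absvX es2 in EQ.
    have Jg : 0 < absv (J d (val w) ^ mu) by rewrite absv_gt0 expfz_neq0.
    have fb : absv (fps_eval (f (mobius d w)) t) <=
        absv (J d (val w) ^ mu) * (q%:R * absv (eA (val w))) ^+ nu * absv (fps_eval (f w) t).
      have qn : 0 < (q%:R^-1 : R) ^+ nu by rewrite exprn_gt0 ?invr_gt0.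
      rewrite -(ler_pM2l qn) EQ exprMn.
      have -> : q%:R^-1 ^+ nu * (absv (J d (val w) ^ mu) * (q%:R ^+ nu * absv (eA (val w)) ^+ nu) * absv (fps_eval (f w) t))
        = (q%:R^-1 ^+ nu * q%:R ^+ nu) * (absv (J d (val w) ^ mu) * absv (eA (val w)) ^+ nu * absv (fps_eval (f w) t)) by ring.
      rewrite -exprMn mulVf ?gt_eqF// expr1n mul1r ler_wpM2r ?absv_ge0// ler_wpM2l ?absv_ge0//.
      by apply: lerXn2r eN; rewrite nnegrE absv_ge0.
    rewrite /Phi absvM absvX (absv_h_mobius w mu dd).
    rewrite absvM absvX exprM.
    have Jq : 0 < absv (J d (val w)) ^ mu by rewrite -absv_exprz.
    apply: le_trans (_ : (absv (J d (val w) ^ mu) * (q%:R * absv (eA (val w))) ^+ nu * absv (fps_eval (f w) t)) ^+ q.+1 *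
       ((absv (J d (val w)) ^ mu) ^- q.+1 * absv (h w ^ (- mu))) <= _).
      rewrite ler_wpM2r ?mulr_ge0 ?invr_ge0 ?exprn_ge0 ?absv_ge0 ?(ltW Jq)//.
      by apply: lerXn2r fb; rewrite nnegrE ?mulr_ge0 ?exprn_ge0 ?mulr_ge0 ?absv_ge0 ?(ltW q0).
    rewrite le_eqVlt; apply/orP; left; apply/eqP; rewrite absv_exprz !exprMn.
    have Jqq : (absv (J d (val w)) ^ mu) ^+ q.+1 != 0 by rewrite expf_neq0 ?gt_eqF.
    move: Jqq; move: (_ ^ mu) => j; move: (j ^+ q.+1) => jj j0.
    by field.
  (* near the cusp the zero of order N beats the growth of the automorphy factor *)
  have [c1 c10 hc] := h_cusp pi_period h_def.
  pose c := Num.min c1 (Num.min 1 rho^-1); have c0 : 0 < c by rewrite !lt_min c10 ltr01 invr_gt0.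
  pose K : R := (q%:R / absv pi) ^+ (nu * q.+1) * (M * rho ^+ N) ^+ q.+1.
  have K0 : 0 <= K by rewrite /K mulr_ge0 ?exprn_ge0 ?mulr_ge0 ?invr_ge0 ?exprn_ge0 ?absv_ge0 ?(ltW q0) ?(ltW r0).
  have cuspb w : Fd (val w) -> absv (u (val w)) < c ->
      (q%:R * absv (eA (val w))) ^+ (nu * q.+1) * absv (Phi w) <= K * absv (u (val w)).
    move=> wF; rewrite !lt_min => /and3P[uc1 u1 ur].
    have {}ur : rho * absv (u (val w)) < 1 by rewrite -ltr_pdivlMl// mulr1.
    have u0 := absv_u_gt0 pi_period w; have fb := fbound w ur.
    rewrite (absv_eA pi_period) /Phi absvM absvX absv_exprz (hc _ uc1).
    set v := absv (u (val w)) in u0 u1 ur fb *.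
    have v0 : v != 0 by rewrite gt_eqF.
    apply: le_trans (_ : (q%:R / (absv pi * v)) ^+ (nu * q.+1) * ((M * (rho * v) ^+ N) ^+ q.+1 * v ^ (- mu)) <= _).
      rewrite ler_wpM2l ?exprn_ge0 ?mulr_ge0 ?invr_ge0 ?mulr_ge0 ?absv_ge0 ?(ltW q0) ?(ltW u0)//.
      rewrite ler_wpM2r ?exprz_ge0 ?(ltW u0)//; apply: lerXn2r fb; rewrite nnegrE ?absv_ge0//.
      by rewrite mulr_ge0 ?exprn_ge0 ?mulr_ge0 ?(ltW r0) ?(ltW u0).
    have muv : v ^ (- mu) <= v ^- `|mu|.
      case: (mu) => n /=; first by rewrite -exprnN.
      rewrite NegzE opprK /= -exprnP; apply: le_trans (_ : 1 <= _).
        by rewrite exprn_ile1 ?ltW.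
      by rewrite invf_ge1 ?exprn_gt0// exprn_ile1 ?ltW.
    apply: le_trans (_ : (q%:R / (absv pi * v)) ^+ (nu * q.+1) * ((M * (rho * v) ^+ N) ^+ q.+1 * v ^- `|mu|) <= _).
      rewrite ler_wpM2l ?exprn_ge0 ?mulr_ge0 ?invr_ge0 ?mulr_ge0 ?absv_ge0 ?(ltW q0) ?(ltW u0)//.
      by rewrite ler_wpM2l// exprn_ge0// mulr_ge0 ?exprn_ge0 ?mulr_ge0 ?(ltW r0) ?(ltW u0).
    (* The order N (q+1) of f^(q+1) exceeds the loss nu (q+1) from bold J plus |mu| from h, so a
       positive power of u is left. *)
    have [D DE] : exists D, (N * q.+1 = nu * q.+1 + `|mu| + D.+1)%N.
      exact: exponent_gap muN.
    have -> : (q%:R / (absv pi * v)) ^+ (nu * q.+1) * ((M * (rho * v) ^+ N) ^+ q.+1 * v ^- `|mu|) =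
       K * v ^+ D.+1.
      rewrite /K invfM mulrA !exprMn -!exprM DE !exprD !exprVn.
      have v1 : v ^+ (nu * q.+1) != 0 by rewrite expf_neq0.
      have v2 : v ^+ `|mu| != 0 by rewrite expf_neq0.
      have v3 : absv pi ^+ (nu * q.+1) != 0 by rewrite expf_neq0 ?gt_eqF.
      move: v1 v2 v3; move: (v ^+ (nu * q.+1)) (v ^+ `|mu|) (v ^+ D.+1) (absv pi ^+ _) => a b e p a0 b0 p1.
      by field; rewrite a0 b0 p1.
    rewrite ler_wpM2l// exprS ler_piMr ?(ltW u0)// exprn_ile1 ?ltW//.
  have [n naff] := Fd_affinoid pi_period c0.
  have [B B0 PB] := rigid_bounded n Prig.
  pose BB := Num.max K ((q%:R / (absv pi * c)) ^+ (nu * q.+1) * B).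
  have Pc : forall w w', Phi w = Phi w'.
    apply: (rigid_const (M := BB) Prig) => d w dd du wF.
    apply: le_trans (gbound d w dd wF) _; rewrite /BB le_max.
    have [uc|uc] := ltP (absv (u (val w))) c; apply/orP; [left|right].
      apply: le_trans (cuspb _ wF uc) _; rewrite ler_piMr//.
      by move: uc; rewrite !lt_min => /and3P[_ /ltW].
    apply: ler_pM; rewrite ?absv_ge0 ?exprn_ge0 ?mulr_ge0 ?absv_ge0 ?(ltW q0)//; last by apply: PB; exact: naff.
    rewrite (absv_eA pi_period) lerXn2r ?nnegrE ?mulr_ge0 ?invr_ge0 ?mulr_ge0 ?absv_ge0 ?(ltW q0) ?(ltW c0)//.
    by rewrite ler_wpM2l ?(ltW q0)// lef_pV2 ?posrE ?mulr_gt0 ?(absv_u_gt0 pi_period)// ler_wpM2l ?absv_ge0.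
  have P0 : Phi z = 0.
    apply/eqP; rewrite -absv_eq0 eq_le absv_ge0 andbT; apply/ler_addgt0Pl => e e0; rewrite addr0.
    have K1 : 0 < K + 1 by rewrite ltr_wpDl.
    have ce : 0 < Num.min c (e / (K + 1)) by rewrite lt_min c0 divr_gt0.
    have [w [wF]] := cusp_small pi_period ce; rewrite lt_min => /andP[uc ue].
    rewrite (Pc z w); apply: le_trans (_ : (q%:R * absv (eA (val w))) ^+ (nu * q.+1) * absv (Phi w) <= _).
      rewrite ler_peMl ?absv_ge0// exprn_ege1// mulr_ege1 ?qR_ge1//; exact: eA_Fd_ge1.
    apply: le_trans (cuspb _ wF uc) _; apply/ltW.
    move: ue; rewrite ltr_pdivlMr// mulrC; apply: le_lt_trans.
    by rewrite ler_wpM2r ?absv_ge0// lerDl.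
  move/eqP: P0; rewrite /Phi mulf_eq0 expf_eq0 /= => /orP[/eqP //|].
  by rewrite (negbTE (expfz_neq0 _ (h_neq0 pi_period h_def z))).
move=> z; have /TposP[M2 [r2 [M20 r20 fb]]] : Tpos (f z) by exists r1 => // t; exact: fc.
apply: (fps_identity r20 fb) => e e0.
have [|t /andP[t0 te]] := @small_elt R F S (Num.min e (Num.min (Num.min r1 e1) (Num.min 1 rho^-1))).
  by rewrite !lt_min e0 r10 e10 ltr01 invr_gt0.
move: te; rewrite !lt_min => /andP[te /andP[/andP[tr1 te1] /andP[t1 tr]]].
exists t; split=> //; apply: main => //.
by rewrite -ler_pdivlMl// mulr1 ltW.
Qed.

(* Multiplying by a power of s_2, which has no zeros, reduces to nu >= 0. *)
Lemma vanishing (mu nu : int) f (M rho : R) k N : slform mu nu f -> gexp pi M rho f k ->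
  (forall n m, (m < N)%N -> k n m = 0) -> (`|mu| + `|nu| < N)%N -> forall z, f z = 0.
Proof.
case: nu => nu; first exact: vanishing_nat.
rewrite NegzE => fs fk kN muN z.
pose s z' : fps C := s_2 (val z') ^+ nu.+1.
have ss : slform (- nu.+1%:Z) nu.+1%:Z s.
  have sX n : slform (- n%:Z) n%:Z (fun z' => s_2 (val z') ^+ n).
    elim: n => [|n IH].
      by rewrite (_ : (fun _ => _) = cst 1); [rewrite oppr0; exact: slform_cst (Tpos1 S)|apply/funext => z'; rewrite expr0].
    have := slformM slform_s2 IH; rewrite -opprD -intS; congr slform.
    by apply/funext => z'; rewrite exprS.
  exact: sX.
have fs2 := slformM fs ss; rewrite addNr in fs2.
have [sr _] := ss; have [_ _ _ [M' [rho' [k' sk]]]] := (regularE pi_period s).1 sr.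
have [h1 h2] := gexp_unify fk sk.
have E := vanishing_nat fs2 (gexpMul h1 h2) (N := N) _ _ z.
have {E} : f z * s z = 0.
  apply: E => [n m mN|]; last by move: muN; lia.
  rewrite fps_sum big1// => i _; rewrite fpsM big1// => j _.
  by rewrite kN ?mul0r//; apply: leq_ltn_trans mN; rewrite -ltnS.
have su : s z \is a GRing.unit by rewrite unitrX// s2u.
by move=> E; apply: (mulIr su); rewrite E mul0r.
Qed.

End Vanishing.

(** * Algebraic independence of g, h, s_2, E and bold E *)

Lemma seq_minn (T : eqType) (s : seq T) (f : T -> nat) x0 : x0 \in s ->
  exists2 x, x \in s & forall y, y \in s -> (f x <= f y)%N.
Proof.
move=> xs; have ex : exists n, has (fun x => f x == n) s.
  by exists (f x0); apply/hasP; exists x0.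
have [n /hasP[x xin /eqP fx] nmin] := ex_minnP ex; exists x => // y ys.
by rewrite fx; apply: nmin; apply/hasP; exists y.
Qed.

Lemma seq_maxn (T : eqType) (s : seq T) (f : T -> nat) x0 : x0 \in s ->
  exists2 x, x \in s & forall y, y \in s -> (f y <= f x)%N.
Proof.
elim: s x0 => // a s IH x0; case: s IH => [_ _|b s IH _].
  by exists a; rewrite ?mem_head// => y; rewrite inE => /eqP ->.
have [x xs H] := IH b (mem_head _ _); case: (leqP (f a) (f x)) => h.
  exists x; first by rewrite inE xs orbT.
  by move=> y; rewrite inE => /orP[/eqP ->//|/H].
exists a; rewrite ?mem_head// => y; rewrite inE => /orP[/eqP ->//|/H fy].
exact: leq_trans fy (ltnW h).
Qed.

Lemma coef_shift_lin (K : comNzRingType) (a b : K) p i n : (n <= p)%N ->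
  ('X^p * (a%:P * 'X + b%:P) ^+ i)`_n = if n == p then b ^+ i else 0.
Proof.
move=> np; rewrite coefXnM; case: ltngtP np => // -> _.
rewrite subnn -horner_coef0 horner_exp hornerD hornerM !hornerC hornerX mulr0 add0r.
by [].
Qed.

Lemma coef_shift_top (K : comNzRingType) (a b : K) p i n : (i <= n)%N ->
  ('X^p * (a%:P * 'X + b%:P) ^+ i)`_(p + n) = if n == i then a ^+ i else 0.
Proof. by move=> ni; rewrite coefXnM ltnNge leq_addr /= addKn coef_linX. Qed.

Lemma weight_alg (K : comUnitRingType) (B B' w e j : nat) (J Ji bJ V k c g s X Y : K) :
  J * Ji = 1 -> bJ * V = k -> (w <= B)%N -> (e + j <= B')%N ->
  Ji ^+ B * V ^+ B' * (c * (J ^+ w * g * (Ji ^+ e * (bJ ^+ e * s)) * X * (bJ ^+ j * Y))) =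
  c * (g * s) * k ^+ (e + j) * (Ji ^+ (B - w + e) * X) * (V ^+ (B' - (e + j)) * Y).
Proof.
move=> J1 bV wB eB.
have EB : Ji ^+ B = Ji ^+ w * Ji ^+ (B - w) by rewrite -exprD subnKC.
have EB' : V ^+ B' = V ^+ (e + j) * V ^+ (B' - (e + j)) by rewrite -exprD subnKC.
rewrite EB EB' -bV exprMn [Ji ^+ (B - w + e)]exprD [bJ ^+ (e + j)]exprD.
have J2 : J ^+ w * Ji ^+ w = 1 by rewrite -exprMn J1 expr1n.
move: J2; move: (J ^+ w) (Ji ^+ w) (Ji ^+ (B - w)) (Ji ^+ e) (bJ ^+ e) (bJ ^+ j) (V ^+ (e + j)) (V ^+ (B' - (e + j))).
move=> a a' b d x y v v' J2; transitivity ((a * a') * (c * (g * s) * (x * y * v) * (b * d * X) * (v' * Y))); first by ring.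
by rewrite J2 mul1r.
Qed.

Lemma monom_alg (K : comNzRingType) (jc ji gg hh bj ss e y : K) q1 q2 q3 a b i j k :
  (jc ^+ q1 * gg) ^+ a * (jc ^+ q2 * hh) ^+ b * (ji * bj * ss) ^+ k * (jc ^+ q3 * e) ^+ i * (jc * bj * y) ^+ j =
  jc ^+ (q1 * a + q2 * b + q3 * i + j) * (gg ^+ a * hh ^+ b) * (ji ^+ k * (bj ^+ k * ss ^+ k)) * e ^+ i * (bj ^+ j * y ^+ j).
Proof. by rewrite !exprMn -!exprM !exprD; ring. Qed.

Lemma sub_cancel B w1 w2 e : (w1 <= B -> w2 <= B -> B - w1 + e = B - w2 + e -> w1 = w2)%N.
Proof. lia. Qed.

Section Independence.
Variables (R : realType) (F : finFieldType) (S : setting R F) (pi : Cinf S).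
Variables g Delta h : Omega S -> Cinf S.
Hypothesis pi_period : carlitz_period pi.
Hypothesis g_Delta : drinfeld_coeffs pi g Delta.
Hypothesis h_def : is_h pi h.
Notation C := (Cinf S).
Notation q := #|F|.
Notation A := {poly F}.
Notation kL := (kL pi_period h_def).
Implicit Types (z : Omega S).

Let E z : fps C := fps_const (false_eisenstein pi z).
Let b z := bE pi h Delta z.
Let sg z : fps C := fps_const (g z).
Let sh z : fps C := fps_const (h z).
Let s2 z : fps C := s_2 (val z).

Definition monom (m : nat * nat * nat * nat * nat) z : fps C :=
  let: (ma, mb, me, mi, mj) := m in sg z ^+ ma * sh z ^+ mb * s2 z ^+ me * E z ^+ mi * b z ^+ mj.

Variables (T : eqType) (ma mb me mi mj : T -> nat).
Hypothesis minj : forall x y, ma x = ma y -> mb x = mb y -> me x = me y -> mi x = mi y -> mj x = mj y -> x = y.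

Let X x z := monom (ma x, mb x, me x, mi x, mj x) z.
Let w x := (q.-1 * ma x + q.+1 * mb x + 2 * mi x + mj x)%N.
Let G x z := sg z ^+ ma x * sh z ^+ mb x * s2 z ^+ me x.
Let lam : fps C := fps_const (- pi^-1).
(** The product of bold J and bold L for every test matrix [gam n]; being independent of n, it
    allows trading powers of bold J for powers of bold L. *)
Let kap z := (tht S * s2 z)^-1.

Let kapu z : kap z \is a GRing.unit.
Proof. by rewrite unitrV unitrM tht_unit s2u. Qed.

Let gam_bJ n z : bJ (gam F n) (val z) * bL (gam F n) (val z) = kap z.
Proof.
have Nu := N_unit z (gam_unit F n); have tu := tht_unit S; have su := s2u z.
rewrite gam_bL bJN /kap /s2 (invrM tu Nu) (invrM tu su).
move: (mulrV Nu); move: (Nm _ _) (Nm _ _)^-1 (tht S)^-1 (s_2 _)^-1 => N N' t v NN.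
by transitivity ((N * N') * (v * t)); [ring|rewrite NN mul1r].
Qed.

Let gam_det n : detC S (gam F n) = 1.
Proof. by rewrite /detC det_mx22E !mat2E mul0r mulN1r opprK add0r ev1. Qed.

Let monom_gam n x z : X x (mobius (gam F n) z) =
  let Jc : fps C := fps_const (J (gam F n) (val z)) in let Ji := fps_const (L (gam F n) (val z)) in
  let bj := bJ (gam F n) (val z) in let V := bL (gam F n) (val z) in
  Jc ^+ w x * (sg z ^+ ma x * sh z ^+ mb x) * (Ji ^+ me x * (bj ^+ me x * s2 z ^+ me x)) *
  (lam * Ji + E z) ^+ mi x * (bj ^+ mj x * (kL * V + b z) ^+ mj x).
Proof.
have gu := gam_unit F n; have J0 := Jn0 z gu.
have LJ : L (gam F n) (val z) = (J (gam F n) (val z))^-1 by rewrite gam_L gam_J.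
rewrite /X /monom /sg /sh /s2 /E /b.
rewrite (g_mobius pi_period g_Delta h_def z gu) (h_mobius h_def z gu) (s2_mob z gu).
rewrite (E_mobius pi_period z gu) (bE_mobius pi_period g_Delta h_def z gu) (gam_det n) invr1 mulr1 !mul1r LJ /=.
move: (J (gam F n) (val z)) J0 => j j0; rewrite /lam.
have -> : false_eisenstein pi z - j^-1 / pi = (- pi^-1) * j^-1 + false_eisenstein pi z by rewrite mulNr addrC mulrC.
rewrite ![fps_const (_ * _)]fps_constM !fps_constX fps_constD fps_constM.
have JJ : (fps_const j : fps C) * fps_const j^-1 = 1 by rewrite -fps_constM mulfV.
rewrite /w.
move: JJ; move: (fps_const j) (fps_const j^-1) (fps_const (g z)) (fps_const (h z)) (bJ _ _) (s_2 _) => jc ji gg hh bj ss JJ.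
move: (fps_const (- pi^-1) * ji + _) (bL _ _) (bE _ _ _ _) => e v bb.
rewrite [bb + _]addrC; move: (kL * v + bb) => y.
rewrite -[jc * jc]/(jc ^+ 2).
exact: monom_alg.
Qed.

(** Evaluate the relation at gamma z and multiply by L^B times the B'-th power of bold L, with B and
    B' large enough to clear J and bold J. The result is polynomial in L and bold L, so by density
    all its coefficients vanish. *)
Lemma monom_rel (s : seq T) (c : T -> fps C) B B' :
  (forall x, x \in s -> (w x <= B)%N) -> (forall x, x \in s -> (me x + mj x <= B')%N) ->
  (forall z, \sum_(x <- s) c x * X x z = 0) -> forall z P Q,
  \sum_(x <- s) c x * G x z * kap z ^+ (me x + mj x) *
     ('X^(B - w x + me x) * (lam%:P * 'X + (E z)%:P) ^+ mi x)`_P *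
     ('X^(B' - (me x + mj x)) * (kL%:P * 'X + (b z)%:P) ^+ mj x)`_Q = 0.
Proof.
move=> wB eB rel z P Q.
pose Qp : {poly {poly fps C}} := \sum_(x <- s)
  ((c x * G x z * kap z ^+ (me x + mj x))%:P * ('X^(B - w x + me x) * (lam%:P * 'X + (E z)%:P) ^+ mi x))%:P *
  map_poly polyC ('X^(B' - (me x + mj x)) * (kL%:P * 'X + (b z)%:P) ^+ mj x).
have Q0 : Qp = 0.
  apply: (gam_density (z := z)) => n; have gu := gam_unit F n.
  have JJ : fps_const (J (gam F n) (val z)) * fps_const (L (gam F n) (val z)) = 1 :> fps C.
    by rewrite -fps_constM gam_L gam_J mulfV// -gam_J Jn0.
  have := rel (mobius (gam F n) z).
  move=> /(congr1 (fun y => fps_const (L (gam F n) (val z)) ^+ B * bL (gam F n) (val z) ^+ B' * y)).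
  rewrite mulr0 mulr_sumr => {}rel; rewrite -[RHS]rel /Qp !horner_sum.
  rewrite big_seq [RHS]big_seq; apply: eq_bigr => x xs.
  rewrite monom_gam /= (weight_alg _ _ _ _ _ JJ (gam_bJ n z) (wB x xs) (eB x xs)).
  have -> (p : {poly fps C}) (r : {poly fps C}) v : (p%:P * map_poly polyC r).[v%:P] = p * (r.[v])%:P.
    by rewrite hornerM hornerC horner_map.
  have lin (a1 b1 v : fps C) : (a1%:P * 'X + b1%:P).[v] = a1 * v + b1.
    by rewrite hornerD hornerM !hornerC hornerX.
  by rewrite !hornerM !hornerC !horner_exp !lin !hornerX /G !mulrA.
have := congr1 (fun p : {poly {poly fps C}} => p`_Q`_P) Q0; rewrite !coef0 => QP.
rewrite -[RHS]QP /Qp !coef_sum; apply: eq_bigr => x _.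
by rewrite coefCM coef_map /= coefMC coefCM.
Qed.

(* First the lowest exponents of U = 1/J and V = bL isolate one weight, then the
   highest ones isolate one monomial in E and bE; the remaining monomials in g and h
   are separated by their order of vanishing at the cusp. *)
Lemma monom_dep (s : seq T) (c : T -> fps C) x0 : uniq s -> x0 \in s ->
  (forall z, \sum_(x <- s) c x * X x z = 0) -> exists2 x, x \in s & c x = 0.
Proof.
move=> us x0s rel.
have [xB _ HB] := seq_maxn w x0s; have [xB' _ HB'] := seq_maxn (fun x => me x + mj x)%N x0s.
set B := w xB in HB; set B' := (me xB' + mj xB')%N in HB'.
have rel1 := monom_rel HB HB' rel.
pose p x := (B - w x + me x)%N; pose r x := (B' - (me x + mj x))%N.
have [x1 x1s p1] := seq_minn p x0s.
have x1s' : x1 \in [seq x <- s | p x == p x1] by rewrite mem_filter eqxx.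
have [x2 x2s r2] := seq_minn r x1s'.
move: x2s; rewrite mem_filter => /andP[/eqP px2 x2s].
pose s1 := [seq x <- s | (p x == p x1) && (r x == r x2)].
have s1s x : x \in s1 -> x \in s by rewrite mem_filter => /andP[].
have s1p x : x \in s1 -> p x = p x1 by rewrite mem_filter => /andP[/andP[/eqP]].
have s1r x : x \in s1 -> r x = r x2 by rewrite mem_filter => /andP[/andP[_ /eqP]].
have x2s1 : x2 \in s1 by rewrite mem_filter px2 !eqxx x2s.
have s1nu x : x \in s1 -> (me x + mj x = me x2 + mj x2)%N.
  by move=> xs; have := s1r x xs; have := HB' x (s1s _ xs); have := HB' x2 x2s; rewrite /r; lia.
(* At the lowest exponents only the constant terms E^mi and b^mj of the affine powers contribute, so
   the sub-sum is again a relation among the original monomials. *)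
have rel2 z : \sum_(x <- s1) c x * X x z = 0.
  have ku : kap z ^+ (me x2 + mj x2) \is a GRing.unit by rewrite unitrX ?kapu.
  apply: (mulIr ku); rewrite mul0r mulr_suml -[RHS](rel1 z (p x1) (r x2)).
  rewrite /s1 big_filter big_mkcond big_seq [RHS]big_seq; apply: eq_bigr => x xs.
  rewrite coef_shift_lin ?p1// -/(p x) eq_sym; have [px|px] := eqVneq (p x) (p x1); last by rewrite mulr0 mul0r.
  rewrite coef_shift_lin -/(r x); last by apply: r2; rewrite mem_filter px eqxx.
  rewrite eq_sym; have [rx|rx] := eqVneq (r x) (r x2); last by rewrite /= mulr0.
  have xs1 : x \in s1 by rewrite mem_filter px rx !eqxx.
  by rewrite -(s1nu x xs1) /= /X /monom /G; move: (kap z ^+ _) (_ ^+ _) (_ ^+ _) (_ ^+ _) (E z ^+ _) (b z ^+ _) => k' a1 a2 a3 a4 a5; ring.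
have rel3 := monom_rel (fun x xs => HB x (s1s x xs)) (fun x xs => HB' x (s1s x xs)) rel2.
have [y1 y1s i1] := seq_maxn mi x2s1.
have y1s' : y1 \in [seq x <- s1 | mi x == mi y1] by rewrite mem_filter eqxx.
have [y2 y2s j2] := seq_maxn mj y1s'.
move: y2s; rewrite mem_filter => /andP[/eqP iy2 y2s].
pose s3 := [seq x <- s1 | (mi x == mi y1) && (mj x == mj y2)].
have s3s x : x \in s3 -> x \in s1 by rewrite mem_filter => /andP[].
have s3i x : x \in s3 -> mi x = mi y1 by rewrite mem_filter => /andP[/andP[/eqP]].
have s3j x : x \in s3 -> mj x = mj y2 by rewrite mem_filter => /andP[/andP[_ /eqP]].
have y2s3 : y2 \in s3 by rewrite mem_filter iy2 !eqxx y2s.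
have s3e x : x \in s3 -> me x = me y2.
  move=> xs; apply/eqP; rewrite -(eqn_add2r (mj y2)); apply/eqP.
  by rewrite -{1}(s3j x xs) (s1nu x (s3s x xs)) (s1nu y2 y2s).
have lamu : lam \is a GRing.unit by rewrite fps_unitE /= oppr_eq0 invr_eq0 (pi_neq0 pi_period).
have kLu : kL \is a GRing.unit by rewrite fps_unitE kL0.
(* At the highest exponents the affine powers contribute their leading coefficients, powers of the
   units [lam] and [kL], and E and b disappear. *)
have rel4 z : \sum_(x <- s3) c x * (sg z ^+ ma x * sh z ^+ mb x) = 0.
  have ku : s2 z ^+ me y2 * (kap z ^+ (me x2 + mj x2) * (lam ^+ mi y1 * kL ^+ mj y2)) \is a GRing.unit.
    by rewrite !unitrM !unitrX ?kapu// s2u.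
  apply: (mulIr ku); rewrite mul0r mulr_suml -[RHS](rel3 z (p x1 + mi y1)%N (r x2 + mj y2)%N).
  rewrite /s3 big_filter big_mkcond big_seq [RHS]big_seq; apply: eq_bigr => x xs.
  rewrite -/(p x) -/(r x) (s1p x xs) (s1r x xs) (s1nu x xs) coef_shift_top ?i1// eq_sym.
  have [ix|ix] := eqVneq (mi x) (mi y1); last by rewrite mulr0 mul0r.
  rewrite coef_shift_top; last by apply: j2; rewrite mem_filter ix eqxx.
  rewrite eq_sym; have [jx|jx] := eqVneq (mj x) (mj y2); last by rewrite /= mulr0.
  have xs3 : x \in s3 by rewrite mem_filter ix jx !eqxx.
  rewrite /= /G (s3e x xs3) ix jx.
  by move: (kap z ^+ _) (_ ^+ _) (_ ^+ _) (_ ^+ _) (lam ^+ _) (kL ^+ _) => k' a1 a2 a3 a4 a5; ring.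
have s3w x : x \in s3 -> (q.-1 * ma x + q.+1 * mb x = q.-1 * ma y2 + q.+1 * mb y2)%N.
  move=> xs; have := s1p x (s3s _ xs); rewrite -(s1p y2 y2s) /p (s3e x xs).
  move=> /(sub_cancel (HB x (s1s _ (s3s _ xs))) (HB y2 (s1s _ y2s))).
  by rewrite /w (s3i x xs) (s3j x xs) iy2 => /addIn/addIn.
(* Dividing by the smallest power of h, which has no zeros, leaves one term alive at the cusp: there
   h tends to 0 and g does not. Equality of weights makes that term unique. *)
have [t0 t0s b0] := seq_minn mb y2s3.
exists t0; first exact/s1s/s3s.
apply: fpsP => n; rewrite fps0.
have h0 z : h z != 0 by exact: h_neq0 pi_period h_def z.
have rel5 z : \sum_(x <- s3) c x n * (g z ^+ ma x * h z ^+ (mb x - mb t0)) = 0.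
  apply: (mulIf (expf_neq0 (mb t0) (h0 z))); rewrite mul0r mulr_suml.
  have := congr1 (fun f : fps C => f n) (rel4 z); rewrite fps0 fps_sum => {}rel4; rewrite -[RHS]rel4.
  rewrite big_seq [RHS]big_seq; apply: eq_bigr => x xs.
  rewrite /sg /sh -!fps_constX -fps_constM fpsMC -!mulrA -exprD subnK// ?b0//.
have [kh [uh kh0 _]] := h_uex pi_period h_def; have [kg [ug kg0]] := g_uex pi_period g_Delta h_def.
have [k [uk k0]] : exists k, uex pi (fun z => \sum_(x <- s3) c x n * (g z ^+ ma x * h z ^+ (mb x - mb t0))) k /\
    k 0%N = \sum_(x <- s3) c x n * (kg 0%N ^+ ma x * kh 0%N ^+ (mb x - mb t0)).
  elim: (s3) => [|x s' [k [uk k0]]].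
    exists (fps_const 0); split; last by rewrite big_nil.
    by apply: uex_ext (uexC pi 0) => z; rewrite big_nil.
  exists (fps_const (c x n) * (kg ^+ ma x * kh ^+ (mb x - mb t0)) + k); split.
    apply: uex_ext (uexD (uexM (uexC pi (c x n)) (uexM (uexX (ma x) ug) (uexX (mb x - mb t0) uh))) uk) => z.
    by rewrite big_cons.
  by rewrite fpsD fpsCM fpsM0 !fpsX0 k0 big_cons.
have k00 : k 0%N = 0.
  apply/eqP; rewrite -absv_eq0 eq_le absv_ge0 andbT; apply/ler_addgt0Pl => e e0; rewrite addr0.
  have [M [rho ukk]] := uk; have [c1 c10 H] := uexp_lims ukk e0.
  have [z [_ uz]] := cusp_small pi_period c10.
  by have := H z uz; rewrite rel5 sub0r absvN => /ltW.
have us3 : uniq s3 by rewrite !filter_uniq.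
move: k0; rewrite k00 (bigD1_seq t0)//= subnn expr0 mulr1 big_seq_cond big1 ?addr0.
  by move=> /esym/eqP; rewrite mulf_eq0 expf_eq0 (negbTE kg0) andbF orbF => /eqP.
move=> x /andP[xs xt]; rewrite kh0 expr0n; case: eqP => [bx|_]; last by rewrite mulr0 mulr0.
exfalso; move/eqP: xt; apply.
have bb : mb x = mb t0 by apply/eqP; rewrite eqn_leq (b0 x xs) andbT -subn_eq0 bx.
apply: minj => //; last by rewrite (s3j x xs) (s3j t0 t0s).
- have := s3w x xs; have := s3w t0 t0s; rewrite bb => <- /eqP; rewrite eqn_add2r eqn_pmul2l ?q1_gt0//.
  by move/eqP.
- by rewrite (s3e x xs) (s3e t0 t0s).
- by rewrite (s3i x xs) (s3i t0 t0s).
Qed.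

Lemma monom_indep (s : seq T) (c : T -> fps C) : uniq s ->
  (forall z, \sum_(x <- s) c x * X x z = 0) -> forall x, x \in s -> c x = 0.
Proof.
move=> us rel x xs; apply/eqP; apply: contrapT => /negP cx.
have [|||y] := @monom_dep [seq y <- s | c y != 0] c x.
- exact: filter_uniq.
- by rewrite mem_filter cx.
- move=> z; rewrite big_filter -[RHS](rel z) big_mkcond; apply: eq_bigr => y _.
  by case: eqP => // ->; rewrite mul0r.
by rewrite mem_filter => /andP[/eqP].
Qed.

End Independence.

(** Fewer equations than unknowns. Elimination is carried out without division, so the solution
    stays in the subring described by the predicate [T], here T_{>0} inside C[[t]]. *)
Lemma siegel (K : idomainType) (T : K -> Prop) (I : eqType) (J : Type) (e : J -> I -> K) (r : seq J) (s : seq I) :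
  T 0 -> T 1 -> (forall x y, T x -> T y -> T (x + y)) -> (forall x y, T x -> T y -> T (x * y)) ->
  (forall x, T x -> T (- x)) -> (forall j x, T (e j x)) -> uniq s -> (size r < size s)%N ->
  exists v : I -> K, [/\ forall x, T (v x), exists2 x, x \in s & v x != 0
    & List.Forall (fun j => \sum_(x <- s) e j x * v x = 0) r].
Proof.
move=> T0 T1 TD TM TN; elim: r e s => [|j r IH] e s Te us rs.
  exists (fun => 1); split=> //; case: s us rs => // a s _ _.
  by exists a; rewrite ?mem_head ?oner_eq0.
have [z|/allPn[x0 x0s px0]] := altP (@allP _ (fun x => e j x == 0) s).
  have [v [Tv [x xs vx] H]] := IH e s Te us (ltnW rs).
  exists v; split=> //; first by exists x.
  by constructor=> //; rewrite big_seq big1// => y /z /eqP ->; rewrite mul0r.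
pose s' := rem x0 s; pose p := e j x0.
have us' : uniq s' by rewrite rem_uniq.
have x0s' : x0 \notin s' by rewrite /s' mem_rem_uniq// !inE eqxx.
have rs' : (size r < size s')%N by rewrite /s' size_rem// -ltnS (leq_trans rs)// leqSpred.
(* Cross-multiplication with the pivot [p] eliminates [x0]; the pivot being nonzero in a domain
   keeps the extended solution nonzero. *)
pose e' i x := p * e i x + - (e i x0 * e j x).
have Te' i x : T (e' i x) by exact: (TD _ _ (TM _ _ (Te _ _) (Te _ _)) (TN _ (TM _ _ (Te _ _) (Te _ _)))).
have [v [Tv [x xs vx] H]] := IH e' s' Te' us' rs'.
have TS : T (\sum_(y <- s') e j y * v y).
  by elim: (s') => [|y t IHt]; rewrite ?big_nil ?big_cons//; apply: TD IHt; exact: TM.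
pose w y := if y == x0 then - (\sum_(y <- s') e j y * v y) else p * v y.
have wE i : \sum_(y <- s) e i y * w y = \sum_(y <- s') e' i y * v y.
  transitivity (\sum_(y <- s') e i y * w y + e i x0 * w x0).
    by rewrite (perm_big _ (perm_to_rem x0s)) big_cons addrC.
  have w0 : w x0 = - (\sum_(y <- s') e j y * v y) by rewrite /w eqxx.
  have ws y : y \in s' -> w y = p * v y.
    by move=> ys; rewrite /w (_ : (y == x0) = false)//; apply: contraNF x0s' => /eqP <-.
  rewrite w0 mulrN mulr_sumr -sumrN -big_split big_seq [RHS]big_seq; apply: eq_bigr => y ys /=.
  by rewrite ws// /e'; ring.
exists w; split.
- by move=> y; rewrite /w; case: ifP => _; [exact: (TN _ TS)|exact: (TM _ _ (Te j x0) (Tv y))].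
- exists x; first exact: mem_rem xs.
  rewrite /w (_ : (x == x0) = false) ?mulf_neq0//.
  by apply: contraNF x0s' => /eqP <-.
- constructor.
    by rewrite wE big1// => y _; rewrite /e' /p; ring.
  by elim: H => [|i r' Hi _ IHr]; constructor=> //; rewrite wE.
Qed.

Lemma count_le n T B : (0 < T)%N -> (2 * (n * (T * B)) + 1 <= T * (2 * (n * B) + 1))%N.
Proof. nia. Qed.

Lemma count_leD n T D : (0 < T)%N -> (n * (T * D) + 1 <= T * (n * D + 1))%N.
Proof. nia. Qed.

(** Number of pairs of weights, times pairs of exponents of E and bold E, times the 2B + 1
    coefficients in u that determine a form of weights at most B. *)
Definition box_count B D := ((2 * B + 1) * (2 * B + 1) * (D + 1) * (D + 1) * (2 * B + 1))%N.

(** With c = a^3 d^2 the number of conditions at scale T is at most c T^5, and T = c + 1 makes this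
    smaller than T^6 <= T^n. If D = 0 then d = 1 and exponents 3 and 4 replace 5 and 6. *)
Lemma count_lt n B D : ((if D == 0 then 3 else 5) < n)%N ->
  exists T, (box_count (n * (T * B)) (n * (T * D)) < T ^ n)%N.
Proof.
move=> kn; pose a := (2 * (n * B) + 1)%N; pose d := (n * D + 1)%N.
pose c := (a * a * d * d * a)%N; exists c.+1.
have Ha := count_le n B (ltn0Sn c); rewrite -/a in Ha.
have Hd := count_leD n D (ltn0Sn c); rewrite -/d in Hd.
have [D0|D0] := eqVneq D 0%N.
  rewrite D0 /= in kn; rewrite D0 !muln0 /box_count.
  apply: (@leq_ltn_trans (c * c.+1 ^ 3)); last first.
    apply: leq_trans (leq_pexp2l (ltn0Sn c) kn); rewrite expnS ltn_pmul2r ?ltnSn// expn_gt0//.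
  have -> : (c * c.+1 ^ 3 = (c.+1 * a) * (c.+1 * a) * (0 + 1) * (0 + 1) * (c.+1 * a))%N.
    by rewrite {1}/c /d D0 muln0; ring.
  by rewrite !leq_mul.
rewrite (negbTE D0) in kn; rewrite /box_count.
apply: (@leq_ltn_trans (c * c.+1 ^ 5)); last first.
  apply: leq_trans (leq_pexp2l (ltn0Sn c) kn); rewrite [(_ ^ 6)%N]expnS ltn_pmul2r ?ltnSn// expn_gt0//.
have -> : (c * c.+1 ^ 5 = (c.+1 * a) * (c.+1 * a) * (c.+1 * d) * (c.+1 * d) * (c.+1 * a))%N.
  by rewrite {1}/c; ring.
by rewrite !leq_mul.
Qed.

(** * Dimension bounds *)

Section UpperBound.
Variables (R : realType) (F : finFieldType) (S : setting R F) (pi : Cinf S).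
Variables h : Omega S -> Cinf S.
Hypothesis pi_period : carlitz_period pi.
Hypothesis h_def : is_h pi h.
Variables E b : Omega S -> fps (Cinf S).
Notation C := (Cinf S).
Notation slform := (slform pi).
Notation gexp := (gexp pi).
Implicit Types (z : Omega S) (f : Omega S -> fps C).

(** A filtration compatible with products, B bounding the weights and D the exponents; [E] and [b]
    may be any functions, since only their coefficients are forced to vanish. *)
Inductive span (B D : nat) : (Omega S -> fps C) -> Prop :=
| span_mon (mu nu : int) i j phi : slform mu nu phi -> (`|mu| <= B)%N -> (`|nu| <= B)%N ->
    (i <= D)%N -> (j <= D)%N -> span B D (fun z => phi z * (E z ^+ i * b z ^+ j))
| span_add f f' : span B D f -> span B D f' -> span B D (f + f').

Lemma span_ext B D f f' : f =1 f' -> span B D f -> span B D f'.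
Proof. by move=> /funext ->. Qed.

Lemma span_mono B D B' D' f : (B <= B')%N -> (D <= D')%N -> span B D f -> span B' D' f.
Proof.
move=> BB DD; elim=> [mu nu i j phi sp m n i1 j1|f1 f2 _ h1 _ h2]; last exact: span_add.
by apply: (span_mon sp); [apply: leq_trans BB|apply: leq_trans BB|apply: leq_trans DD|apply: leq_trans DD].
Qed.

Lemma span_mul B D B' D' f f' : span B D f -> span B' D' f' -> span (B + B') (D + D') (f * f').
Proof.
move=> H H'; elim: H => [mu nu i j phi sp m n i1 j1|f1 f2 _ h1 _ h2]; last by rewrite mulrDl; exact: span_add.
elim: H' => [mu' nu' i' j' phi' sp' m' n' i1' j1'|f1 f2 _ h1 _ h2]; last by rewrite mulrDr; exact: span_add.
apply: span_ext (@span_mon _ _ (mu + mu') (nu + nu') (i + i') (j + j') _ (slformM pi_period sp sp') _ _ _ _).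
- move=> z; rewrite -[RHS]/(phi z * _ * (phi' z * _)) -[(phi * phi') z]/(phi z * phi' z) !exprD.
  by move: (phi z) (phi' z) (E z ^+ i) (E z ^+ i') (b z ^+ j) (b z ^+ j') => *; ring.
- by move: m m'; clear; lia.
- by move: n n'; clear; lia.
- exact: leq_add.
- exact: leq_add.
Qed.

Lemma span_slform mu nu f : slform mu nu f -> span (`|mu| + `|nu|) 0 f.
Proof.
move=> fs; apply: span_ext (span_mon fs (leq_addr _ _) (leq_addl _ _) (leqnn 0) (leqnn 0)) => z.
by rewrite !expr0 !mulr1.
Qed.

Lemma span_cst c : Tpos c -> span 0 0 (cst c).
Proof. by move=> cT; exact: (span_slform (slform_cst pi_period cT)). Qed.

Lemma span_exp B D f n : span B D f -> span (n * B) (n * D) (fun z => f z ^+ n).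
Proof.
move=> H; elim: n => [|n IH].
  by apply: span_ext (span_cst (Tpos1 S)) => z; rewrite expr0.
by rewrite !mulSn; apply: span_ext (span_mul H IH) => z; rewrite exprS.
Qed.

Lemma span_prod B D T n (x : 'I_n -> Omega S -> fps C) (m : 'I_n -> nat) :
  (forall i, span B D (x i)) -> (forall i, (m i <= T)%N) ->
  span (n * (T * B)) (n * (T * D)) (fun z => \prod_(i < n) x i z ^+ m i).
Proof.
move=> H; elim: n x m H => [|n IH] x m H mT.
  by apply: span_ext (span_cst (Tpos1 S)) => z; rewrite big_ord0.
rewrite !mulSn; apply: (@span_ext _ _ ((fun z => x ord0 z ^+ m ord0) *
    (fun z => \prod_(i < n) x (lift ord0 i) z ^+ m (lift ord0 i)))).
  by move=> z; rewrite big_ord_recl.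
apply: span_mul; last by apply: IH => i; [exact: H|exact: mT].
apply: span_mono (span_exp (m ord0) (H ord0)); rewrite leq_mul2r mT orbT//.
Qed.

Lemma slform0 mu nu : slform mu nu (cst 0).
Proof.
split; first exact: (regular_cst pi_period (Tpos0 S)).
by move=> d z _; rewrite /= mulr0.
Qed.

Lemma slformZ c mu nu f : Tpos c -> slform mu nu f -> slform mu nu (fun z => c * f z).
Proof. by move=> cT fs; have := slformM pi_period (slform_cst pi_period cT) fs; rewrite !add0r. Qed.

Lemma slform_sum (I : Type) (s : seq I) (f : I -> Omega S -> fps C) mu nu :
  (forall i, slform mu nu (f i)) -> slform mu nu (fun z => \sum_(i <- s) f i z).
Proof.
move=> H; elim: s => [|i s IH].
  rewrite (_ : (fun _ => _) = cst 0); first exact: slform0.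
  by apply/funext => z; rewrite big_nil.
rewrite (_ : (fun _ => _) = f i + (fun z => \sum_(i <- s) f i z)); first exact: (slformD pi_period).
by apply/funext => z; rewrite big_cons.
Qed.

Lemma gexp_cst c : Tpos c -> exists M rho, gexp M rho (cst c) (fun n => fps_const (c n)).
Proof.
move=> /TposP[M [rho [M0 r0 H]]]; exists M, rho => n; apply: uexpW (uexpC pi _ r0) => //; exact: H.
Qed.

(** The expansion is read transposed: for fixed u-order m, the coefficients in t form one series,
    and these series depend linearly on [v] over T_{>0}. *)
Lemma gexp_lin (I : Type) (s : seq I) (v : I -> fps C) (f : I -> Omega S -> fps C) (k : I -> nat -> fps C) :
  (forall x, Tpos (v x)) -> (forall x, exists M rho, gexp M rho (f x) (k x)) ->
  exists M rho k', gexp M rho (fun z => \sum_(x <- s) v x * f x z) k' /\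
    forall n m, k' n m = (\sum_(x <- s) Fps (fun n => k x n m) * v x) n.
Proof.
move=> vT fk; elim: s => [|x s [M [rho [k' [H kE]]]]].
  have [M [rho H]] := gexp_cst (Tpos0 S); exists M, rho, (fun n => fps_const 0); split.
    have -> : (fun z : Omega S => \sum_(x <- [::]) v x * f x z) = cst 0 by apply/funext => z; rewrite big_nil.
    have -> : (fun=> fps_const 0) = (fun n => fps_const ((0 : fps C) n)).
      by apply/funext => n; rewrite fps0.
    exact: H.
  by move=> n m; rewrite big_nil !fps0.
have [M1 [r1 H1]] := gexp_cst (vT x); have [M2 [r2 H2]] := fk x.
have [H1' H2'] := gexp_unify H1 H2; have HM := gexpMul H1' H2'.
have [H' HM'] := gexp_unify H HM; have HD := gexpD HM' H'.
pose k2 n := \sum_(i < n.+1) fps_const (v x i) * k x (n - i)%N + k' n.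
eexists; eexists; exists k2; split.
  have -> : (fun z => \sum_(y <- x :: s) v y * f y z) = cst (v x) * f x + (fun z => \sum_(y <- s) v y * f y z).
    by apply/funext => z; rewrite big_cons.
  exact: HD.
move=> n m; rewrite /k2 big_cons !fpsD kE; congr (_ + _).
rewrite mulrC fpsM fps_sum; apply: eq_bigr => i _; rewrite fpsCM//.
Qed.

Definition box B D : finType := ('I_(2 * B + 1) * 'I_(2 * B + 1) * 'I_(D + 1) * 'I_(D + 1))%type.
Definition wt1 B D (p : box B D) : int := p.1.1.1%:Z - B%:Z.
Definition wt2 B D (p : box B D) : int := p.1.1.2%:Z - B%:Z.

Lemma wt_le B D (p : box B D) : (`|wt1 p| + `|wt2 p| < 2 * B + 1)%N.
Proof.
by rewrite /wt1 /wt2; case: p => [[[a c] i] j] /=; move: (ltn_ord a) (ltn_ord c); lia.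
Qed.

Lemma box_ord B (mu : int) : (`|mu| <= B)%N -> exists a : 'I_(2 * B + 1), a%:Z - B%:Z = mu.
Proof.
move=> mB; have lt : (`|(mu + B%:Z)%R| < 2 * B + 1)%N by lia.
by exists (Ordinal lt) => /=; lia.
Qed.

Lemma span_coef B D f : span B D f -> exists c : box B D -> Omega S -> fps C,
  (forall p, slform (wt1 p) (wt2 p) (c p)) /\
  forall z, f z = \sum_p c p z * (E z ^+ p.1.2 * b z ^+ p.2).
Proof.
elim=> [mu nu i j phi sp mB nB iD jD|f1 f2 _ [c1 [s1 e1]] _ [c2 [s2 e2]]].
  have [a aE] := box_ord mB; have [c cE] := box_ord nB.
  have iD' : (i < D + 1)%N by rewrite addn1 ltnS.
  have jD' : (j < D + 1)%N by rewrite addn1 ltnS.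
  pose p0 : box B D := (a, c, Ordinal iD', Ordinal jD').
  exists (fun p => if p == p0 then phi else cst 0); split.
    by move=> p; case: eqP => [->|_]; [rewrite /wt1 /wt2 /= aE cE|exact: slform0].
  move=> z; rewrite (bigD1 p0)//= eqxx big1 ?addr0// => p /negbTE ->; exact: mul0r.
exists (fun p => c1 p + c2 p); split; first by move=> p; exact: (slformD pi_period).
move=> z; rewrite -[LHS]/(f1 z + f2 z) e1 e2 -big_split; apply: eq_bigr => p _.
by rewrite -[(c1 p + c2 p) z]/(c1 p z + c2 p z) mulrDl.
Qed.

(* By [vanishing], a combination is zero once finitely many coefficients of each of its
   components are. *)
Lemma span_dep B D (I : eqType) (s : seq I) (f : I -> Omega S -> fps C) : uniq s ->
  (box_count B D < size s)%N -> (forall x, span B D (f x)) ->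
  exists v : I -> fps C, [/\ forall x, Tpos (v x), exists2 x, x \in s & v x != 0
    & forall z, \sum_(x <- s) v x * f x z = 0].
Proof.
move=> us sz fs.
have [c Hc] := choice (fun x => span_coef (fs x)).
have /choice[k Hk] : forall xp : I * box B D, exists k, exists M rho, gexp M rho (c xp.1 xp.2) k.
  move=> [x p].
  have [cr _] := (Hc x).1 p; have [_ _ _ [M [rho [k gk]]]] := (regularE pi_period _).1 cr.
  by exists k, M, rho.
(* One equation over T_{>0} for each component and each u-order at most 2B, since a component has
   |mu| + |nu| <= 2B. *)
pose e (j : box B D * 'I_(2 * B + 1)) x : fps C := Fps (fun n => k (x, j.1) n j.2).
have Te j x : Tpos (e j x).
  have [M [rho gk]] := Hk (x, j.1); have r0 := gexp_rho gk; have M0 := gexp_M gk.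
  apply: (@Tpos_bd _ _ S _ (M * rho ^+ j.2) rho) => //; first by rewrite mulr_ge0// exprn_ge0// ltW.
  by move=> n; have [_ kb _] := gk n; have := kb j.2; rewrite mulrAC.
have sz' : (size (enum {: box B D * 'I_(2 * B + 1)}) < size s)%N.
  by rewrite -cardE !card_prod !card_ord.
have [v [Tv v0 /List.Forall_forall H]] := siegel (Tpos0 S) (Tpos1 S) (@TposD _ _ S) (@TposM _ _ S) (@TposN _ _ S) Te us sz'.
exists v; split=> // z.
have vp p z' : \sum_(x <- s) v x * c x p z' = 0.
  have [M [rho [k' [gk kE]]]] := gexp_lin s Tv (fun x => Hk (x, p)).
  have sl : slform (wt1 p) (wt2 p) (fun z' => \sum_(x <- s) v x * c x p z').
    by apply: slform_sum => x; apply: slformZ => //; exact: (Hc x).1.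
  apply: (vanishing pi_period h_def sl gk (N := (2 * B + 1)%N)) (wt_le p) z' => n m mN.
  rewrite kE; have := H (p, Ordinal mN); rewrite /e /= => ->; first by rewrite fps0.
  have : (p, Ordinal mN) \in enum {: box B D * 'I_(2 * B + 1)} by rewrite mem_enum.
  by elim: (enum _) => // j l IH; rewrite inE => /orP[/eqP ->|/IH]; [left|right].
rewrite (eq_bigr (fun x => \sum_p v x * c x p z * (E z ^+ p.1.2 * b z ^+ p.2))); last first.
  by move=> x _; rewrite (Hc x).2 mulr_sumr; apply: eq_bigr => p _; rewrite mulrA.
by rewrite exchange_big big1// => p _; rewrite -mulr_suml vp mul0r.
Qed.

(** The T^n monomials with all exponents below T lie in the piece of the filtration with bounds nTB
    and nTD; a linear dependence among them is an algebraic relation among the [x i]. *)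
Lemma span_dim B D n (x : 'I_n -> Omega S -> fps C) : (forall i, span B D (x i)) ->
  alg_indep x -> (n <= if D == 0 then 3 else 5)%N.
Proof.
move=> xs indep; rewrite leqNgt; apply/negP => /(count_lt B)[T Tn].
pose f (m : {ffun 'I_n -> 'I_T}) z := \prod_(i < n) x i z ^+ m i.
have [||v [Tv [m0 _ vm0] rel]] := @span_dep (n * (T * B)) (n * (T * D)) _ (enum {ffun 'I_n -> 'I_T}) f (enum_uniq _).
- by rewrite -cardE card_ffun !card_ord.
- by move=> m; apply: span_prod => // i; exact: ltnW.
pose mm (m : {ffun 'I_n -> 'I_T}) : mpoly.multinom n := mpoly.Multinom [tuple m i : nat | i < n].
have mmE m i : mpoly.fun_of_multinom (mm m) i = m i by exact: mpoly.mnmE.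
pose P : mpoly.mpoly n (fps C) := \sum_(m <- enum {ffun 'I_n -> 'I_T}) v m *: (mpoly.mpolyX (fps C) (mm m) : mpoly.mpoly n (fps C)).
have PE k : mpoly.mcoeff k P = \sum_(m <- enum {ffun 'I_n -> 'I_T}) v m * (mm m == k)%:R.
  by rewrite raddf_sum; apply: eq_bigr => m _; rewrite /= mpoly.mcoeffZ mpoly.mcoeffX.
have P0 : P = 0.
  apply: indep => [k|z].
    by rewrite PE; apply: Tpos_sum => m _; apply: TposM => //; case: eqP => _; [exact: Tpos1|exact: Tpos0].
  rewrite raddf_sum -[RHS](rel z); apply: eq_bigr => m _; rewrite /= mpoly.mevalZ mpoly.mevalX /f.
  by congr (_ * _); apply: eq_bigr => i _; rewrite mmE.
have := PE (mm m0); rewrite P0 mpoly.mcoeff0 (bigD1_seq m0) ?mem_enum ?enum_uniq//= eqxx mulr1 big1 ?addr0.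
  by move=> E0; move: vm0; rewrite -E0 eqxx.
move=> m mm0; case: eqP => [em|_]; last by rewrite mulr0.
case/negP: mm0; apply/eqP/ffunP => i; apply: val_inj.
by rewrite /= -!mmE em.
Qed.

End UpperBound.

Section Main.
Variables (R : realType) (F : finFieldType) (S : setting R F) (pi : Cinf S).
Variables g Delta h : Omega S -> Cinf S.
Hypothesis pi_period : carlitz_period pi.
Hypothesis g_Delta : drinfeld_coeffs pi g Delta.
Hypothesis h_def : is_h pi h.
Notation C := (Cinf S).
Notation q := #|F|.
Implicit Types (z : Omega S).

Let E z : fps C := fps_const (false_eisenstein pi z).
Let b := bE pi h Delta.
Let sg z : fps C := fps_const (g z).
Let sh z : fps C := fps_const (h z).
Let s2 z : fps C := s_2 (val z).

Lemma Malg_g : Malg pi sg.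
Proof.
apply: Talg_gen; exists q.-1%:Z, 0, 0; apply/(aqm0P pi_period); split.
  exact: (regular_g pi_period g_Delta h_def).
move=> d z du; rewrite /sg (g_mobius pi_period g_Delta h_def z du) /Wt oppr0 !expr0z mul1r mulr1.
exact: fps_constM.
Qed.

Lemma Malg_h : Malg pi sh.
Proof.
apply: Talg_gen; exists q.+1%:Z, 0, 1; apply/(aqm0P pi_period); split.
  exact: (regular_h pi_period h_def).
move=> d z du; rewrite /sh (h_mobius h_def z du) /Wt expr0z mulr1 exprN1 fps_constM.
by rewrite [X in fps_const X * _]mulrC.
Qed.

Lemma Malg_s2 : Malg pi s2.
Proof.
apply: Talg_gen; exists (-1), 1, 0; apply/(aqm0P pi_period); split; first exact: regular_s2.
by move=> d z du; rewrite /s2 (s2_mob z du) /Wt oppr0 expr0z mul1r expr1z exprN1.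
Qed.

Lemma Malg_span f : Malg pi f -> exists B, span pi E b B 0 f.
Proof.
apply: (@Talg_min _ _ S _ [set f | exists B, span pi E b B 0 f]).
  split=> [c cT|f1 f2 [B1 H1] [B2 H2]|f1 f2 [B1 H1] [B2 H2]].
  - by exists 0%N; exact: span_cst.
  - exists (maxn B1 B2); apply: span_add; [apply: span_mono H1|apply: span_mono H2];
      by rewrite ?leq_maxl ?leq_maxr.
  - by exists (B1 + B2)%N; rewrite -[0%N]/(0 + 0)%N; exact: (span_mul pi_period).
move=> f1 [mu [nu [m Hf]]]; exists (`|mu| + `|nu|)%N.
exact: (span_slform E b (aqm0_slform pi_period Hf)).
Qed.

Lemma Mtilde_span f : Mtilde_alg pi f -> exists B D, span pi E b B D f.
Proof.
rewrite (Mtilde_structure pi_period g_Delta h_def).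
apply: (@Talg_min _ _ S _ [set f | exists B D, span pi E b B D f]).
  split=> [c cT|f1 f2 [B1 [D1 H1]] [B2 [D2 H2]]|f1 f2 [B1 [D1 H1]] [B2 [D2 H2]]].
  - by exists 0%N, 0%N; exact: span_cst.
  - exists (maxn B1 B2), (maxn D1 D2); apply: span_add; [apply: span_mono H1|apply: span_mono H2];
      by rewrite ?leq_maxl ?leq_maxr.
  - by exists (B1 + B2)%N, (D1 + D2)%N; exact: (span_mul pi_period).
have s1 := slform_cst pi_period (Tpos1 S).
move=> f1 [/Malg_span[B H]|[->|->]]; first by exists B, 0%N.
  exists 0%N, 1%N; apply: span_ext (@span_mon _ _ _ _ E b 0 1 0 0 1 0 _ s1 _ _ _ _) => // z.
  by rewrite expr0 mulr1 expr1 mul1r.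
exists 0%N, 1%N; apply: span_ext (@span_mon _ _ _ _ E b 0 1 0 0 0 1 _ s1 _ _ _ _) => // z.
by rewrite expr0 expr1 !mul1r.
Qed.

Lemma Malg_Mtilde : Malg pi `<=` Mtilde_alg pi.
Proof.
rewrite (Mtilde_structure pi_period g_Delta h_def) => f Mf; apply: Talg_gen; by left.
Qed.

(** The exponent maps let one lemma serve both algebras: for M the exponents of E and bold E are
    constantly 0. *)
Lemma indep_of_monoms n (x : 'I_n -> Omega S -> fps C) (ma mb me mi mj : mpoly.multinom n -> nat) :
  (forall m m', ma m = ma m' -> mb m = mb m' -> me m = me m' -> mi m = mi m' -> mj m = mj m' -> m = m') ->
  (forall m z, \prod_i x i z ^+ mpoly.fun_of_multinom m i =
     monom pi g Delta h (ma m, mb m, me m, mi m, mj m) z) ->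
  alg_indep x.
Proof.
move=> minj xE P _ P0; apply/mpoly.mpolyP => m; rewrite mpoly.mcoeff0.
have [ms|/negbTE ms] := boolP (m \in mpoly.msupp P); last by move: ms; rewrite mpoly.mcoeff_msupp => /eqP.
apply: (monom_indep pi_period g_Delta h_def minj (c := fun m => mpoly.mcoeff m P) (mpoly.msupp_uniq P) _ ms) => z.
by rewrite -[RHS](P0 z) mpoly.mevalE; apply: eq_bigr => k _; rewrite xE.
Qed.

Lemma Malg_dim : has_dim (Malg pi) 3.
Proof.
split.
  exists (fun i : 'I_3 => nth sg [:: sg; sh; s2] i); split.
    by case=> [[|[|[|//]]] lt]; [exact: Malg_g|exact: Malg_h|exact: Malg_s2].
  apply: (@indep_of_monoms 3 _ (fun m => mpoly.fun_of_multinom m (inord 0)) (fun m => mpoly.fun_of_multinom m (inord 1))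
    (fun m => mpoly.fun_of_multinom m (inord 2)) (fun=> 0%N) (fun=> 0%N)).
    move=> m m' e0 e1 e2 _ _; apply/mpoly.mnmP => i; rewrite -[i]inord_val.
    by case: i => [[|[|[|//]]] lt].
  move=> m z; rewrite /monom !expr0 !mulr1 !big_ord_recl big_ord0 mulr1 !mulrA /=.
  do ![congr (_ * _)]; congr (_ ^+ _); congr mpoly.fun_of_multinom; apply: val_inj; rewrite /= inordK//.
move=> n x xM indep; have /choice[B HB] := fun i => Malg_span (xM i).
have xs i : span pi E b (\max_j B j) 0 (x i) by apply: span_mono (HB i) => //; exact: leq_bigmax.
exact: (span_dim pi_period h_def xs indep).
Qed.

Lemma Mtilde_dim : has_dim (Mtilde_alg pi) 5.
Proof.
split.
  exists (fun i : 'I_5 => nth sg [:: sg; sh; s2; E; b] i); split.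
    case=> [[|[|[|[|[|//]]]]] lt]; [apply: Malg_Mtilde; exact: Malg_g|apply: Malg_Mtilde; exact: Malg_h|
      apply: Malg_Mtilde; exact: Malg_s2| |]; apply: Talg_gen.
    - by exists 2, 0, 1, 1%N; exact: (aqm_E pi_period).
    - by exists 1, 1, 1, 1%N; exact: (aqm_bE pi_period g_Delta h_def).
  apply: (@indep_of_monoms 5 _ (fun m => mpoly.fun_of_multinom m (inord 0)) (fun m => mpoly.fun_of_multinom m (inord 1))
    (fun m => mpoly.fun_of_multinom m (inord 2)) (fun m => mpoly.fun_of_multinom m (inord 3)) (fun m => mpoly.fun_of_multinom m (inord 4))).
    move=> m m' e0 e1 e2 e3 e4; apply/mpoly.mnmP => i; rewrite -[i]inord_val.
    by case: i => [[|[|[|[|[|//]]]]] lt].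
  move=> m z; rewrite /monom !big_ord_recl big_ord0 mulr1 !mulrA /=.
  do ![congr (_ * _)]; congr (_ ^+ _); congr mpoly.fun_of_multinom; apply: val_inj; rewrite /= inordK//.
move=> n x xM indep; have /choice[B /choice[D HB]] := fun i => Mtilde_span (xM i).
have xs i : span pi E b (\max_j B j) (\max_j D j) (x i) by apply: span_mono (HB i) => //; exact: leq_bigmax.
by apply: leq_trans (span_dim pi_period h_def xs indep) _; case: ifP.
Qed.

End Main.

Theorem theorem1p3 (R : realType) (F : finFieldType) (S : setting R F)
    (pi : Cinf S) (g Delta h : Omega S -> Cinf S)
    (pi_period : carlitz_period pi)
    (g_Delta : drinfeld_coeffs pi g Delta)
    (h_def : is_h pi h) :
  let E := fun z : Omega S => fps_const (false_eisenstein pi z) in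
  [/\ has_dim (Malg pi) 3,
      has_dim (Mtilde_alg pi) 5
    & Mtilde_alg pi = Talg (Malg pi `|` [set E; bE pi h Delta])].
Proof.
move=> E; split; [exact: (Malg_dim pi_period g_Delta h_def)|exact: (Mtilde_dim pi_period g_Delta h_def)|].
exact: (Mtilde_structure pi_period g_Delta h_def).
Qed.
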